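(* Let $M$ be a closed manifold of dimension $n$, $\pi:\tilde M\to M$ a principal $G$-covering where $G$ is a discrete group, $(h,X)$ a Morse–Smale pair on $M$, and $\{\mathcal O^-_v\mid v\in\mathrm{Crit}(h)\}$ a collection of orientations of the unstable manifolds $\{W^-_v\mid v\in\mathrm{Crit}(h)\}$ of the vector field $X$. Let $E$ be a finite dimensional $k$-vector space ($k=\mathbb R$ or $\mathbb C$) and $\rho:G\to GL(E)$ a representation of $G$. Then $\tilde{\mathcal C}^\bullet=(\tilde{\mathcal C}^q_E,\tilde\delta^q)$ is a cochain complex of $G$-representations, and $\mathcal C^\bullet_\rho=(\mathcal C^q_\rho,\delta^q)$ is a finite dimensional subcomplex.
   Context: **Morse–Smale pair.** $h:M\to\mathbb R$ is a smooth Morse function with indices $i(v)$, $v\in\mathrm{Crit}(h)$. A smooth vector field $X$ is gradient-like if (GL1) $X(h)<0$ on $M\setminus\mathrm{Crit}(h)$ and (GL2) near each $v\in\mathrm{Crit}(h)$ there are coordinates $x_1,\dots,x_n$ (centred at $v$, on a ball) in which $h=h(v)-\frac12\sum_{j\le i(v)}x_j^2+\frac12\sum_{j>i(v)}x_j^2$ and $X=\sum_{j\le i(v)}x_j\partial_{x_j}-\sum_{j>i(v)}x_j\partial_{x_j}$. With $\Phi_t$ the flow of $X$, $W^\pm_v=\{x:\lim_{t\to\pm\infty}\Phi_t(x)=v\}$. $(h,X)$ is Morse–Smale if $X$ is gradient-like and all $W^-_v$, $W^+_w$ intersect transversally. $\mathcal T(v,w)=(W^-_v\cap W^+_w)/\mathbb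 R$ ($v\neq w$), a manifold of dimension $i(v)-i(w)-1$ if nonempty; it is a finite set when $i(v)-i(w)=1$. The unstable manifold $W^-_v$ is the interior of the compact manifold with corners $\hat W^-_v=\bigsqcup_{w\le v}\mathcal B(v,w)\times W^-_w$ of (possibly broken) trajectories starting at $v$ (here $w<v$ iff $i(w)<i(v)$ and $h(w)<h(v)$; $\mathcal B(v,w)$ is the union over chains $w<v_\ell<\dots<v_1<v$ of $\mathcal T(v,v_1)\times\dots\times\mathcal T(v_\ell,w)$ and $\mathcal B(v,v)=\{v\}$), whose codimension one boundary stratum is $\partial_1\hat W^-_v=\bigsqcup_{w<v}\mathcal T(v,w)\times W^-_w$. **Covering.** $G$ is a countable group acting freely and properly discontinuously by diffeomorphisms on $\tilde M$, and $\pi$ identifies $\tilde M/G$ with $M$. Put $\tilde h=h\circ\pi$, $\tilde X=\pi^*X$ (the lift of $X$), and define $W^\pm_{\tilde v}$ and $\mathcal T(\tilde v,\tilde w)=(W^-_{\tilde v}\cap W^+_{\tilde w})/\mathbb R$ for $\tilde v,\tilde w\in\mathrm{Crit}(\tilde h)$ using $\tilde X$. $\mathcal X_q$ and $\tilde{\mathcal X}_q=\pi^{-1}(\mathcal X_q)$ denote the sets of critical points of index $q$ of $h$ and $\tilde h$. **Incidence numbers.** For $v\in\mathcal X_q$, $w\in\mathcal X_{q-1}$, $\gamma\in\mathcal T(v,w)$, let $\varepsilon(\gamma)\in\{\pm1\}$ be $+1$ iff the orientation of $\{\gamma\}\times W^-_w\subset\partial_1\hat W^-_v$ induced from $\mathcal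 O^-_v$ (outward normal first) agrees with $\mathcal O^-_w$ under $\{\gamma\}\times W^-_w\cong W^-_w$. For $(\tilde v,\tilde w)\in\tilde{\mathcal X}_q\times\tilde{\mathcal X}_{q-1}$ put $\tilde I_q(\tilde v,\tilde w)=\sum_{\tilde\gamma\in\mathcal T(\tilde v,\tilde w)}\varepsilon(\pi\circ\tilde\gamma)$; for fixed $\tilde v$ only finitely many $\tilde w$ give a nonzero value. **Complexes.** $\tilde{\mathcal C}^q_E$ ($0\le q\le n$) is the $k$-vector space of all maps $\tilde{\mathcal X}_q\to E$, with $G$-action $(g\cdot f)(\tilde v)=\rho(g)f(g^{-1}\tilde v)$. $\tilde\delta^q:\tilde{\mathcal C}^q_E\to\tilde{\mathcal C}^{q+1}_E$ is $\tilde\delta^q(f)(\tilde v)=\sum_{\tilde w\in\tilde{\mathcal X}_q}\tilde I_{q+1}(\tilde v,\tilde w)f(\tilde w)$. $\mathcal C^q_\rho\subset\tilde{\mathcal C}^q_E$ is the subspace of $G$-invariant maps and $\delta^q$ is the restriction of $\tilde\delta^q$ to $\mathcal C_\rho^q$. ''Cochain complex of $G$-representations'' means $\tilde\delta^{q+1}\circ\tilde\delta^q=0$ and each $\tilde\delta^q$ commutes with the $G$-action. *)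

(* Defs.v *)
From HB Require Import structures.
From mathcomp Require Import all_boot all_order all_algebra.
From mathcomp Require Import all_classical all_reals all_analysis.
From mathcomp Require Import complex.

Set Implicit Arguments.
Unset Strict Implicit.
Unset Printing Implicit Defensive.

Import Order.TTheory GRing.Theory Num.Theory.
Import numFieldNormedType.Exports.

Local Open Scope classical_set_scope.
Local Open Scope ring_scope.

Fixpoint Ck (R : realType) (V W : normedModType R) (k : nat)
    (U : set V) (f : V -> W) : Prop :=
  match k with
  | 0%N => forall p, U p -> {for p, continuous f}
  | k'.+1 => (forall p, U p -> differentiable f p) /\
             (forall u, Ck k' U (fun p => 'D_u f p))
  end.

Definition smooth_on (R : realType) (V W : normedModType R)
    (U : set V) (f : V -> W) : Prop := forall k, Ck k U f.

Definition smooth_at (R : realType) (V W : normedModType R)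
    (f : V -> W) (p : V) : Prop :=
  exists U : set V, [/\ open U, U p & smooth_on U f].

Record chart (R : realType) (n : nat) (T : topologicalType) := Chart {
  dom : set T;
  coord :> T -> 'rV[R]_n;
  param : 'rV[R]_n -> T;
  dom_open : open dom;
  img_open : open (coord @` dom);
  coordK : forall x, dom x -> param (coord x) = x;
  coord_continuous : forall x, dom x -> {for x, continuous coord};
  param_continuous :
    forall p, (coord @` dom) p -> {for p, continuous param} }.

Definition transition_smooth (R : realType) (n : nat) (T : topologicalType)
    (c c' : chart R n T) : Prop :=
  smooth_on (c @` (dom c `&` dom c')) (c' \o param c).

(** The atlas is indexed by the points of the manifold.  The tangent space
    at [x] is ['rV[R]_n], read in the coordinates [chart_at x]. *)
Record manifold (R : realType) (n : nat) := Manifold {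
  carrier :> topologicalType;
  chart_at : carrier -> chart R n carrier;
  chart_at_dom : forall x, dom (chart_at x) x;
  chart_at_compat : forall x y, transition_smooth (chart_at x) (chart_at y);
  manifold_hausdorff : hausdorff_space carrier;
  manifold_second_countable : @second_countable carrier }.

Definition closed_manifold (R : realType) (n : nat) (M : manifold R n) : Prop :=
  compact [set: M].

(** Membership in the maximal atlas. *)
Definition smooth_chart (R : realType) (n : nat) (M : manifold R n)
    (c : chart R n M) : Prop :=
  forall x : M, transition_smooth c (chart_at x) /\
                transition_smooth (chart_at x) c.

(** Maps from a normed space to a manifold, their Jacobian matrices (whose rows
    are the partial derivatives, as tangent vectors at the image point), and the
    velocity of a curve. *)
Definition smooth_into (R : realType) (n : nat) (V : normedModType R)
    (M : manifold R n) (f : V -> M) (p : V) : Prop :=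
  {for p, continuous f} /\ smooth_at (chart_at (f p) \o f) p.

Definition jac (R : realType) (n d : nat) (M : manifold R n)
    (f : 'rV[R]_d -> M) (p : 'rV[R]_d) : 'M[R]_(d, n) :=
  'J (chart_at (f p) \o f) p.

Definition velocity (R : realType) (n : nat) (M : manifold R n)
    (c : R -> M) (t : R) : 'rV[R]_n :=
  derive1 (chart_at (c t) \o c) t.

Definition smooth_map (R : realType) (m n : nat)
    (N : manifold R m) (M : manifold R n) (f : N -> M) : Prop :=
  forall x, smooth_into (f \o param (chart_at x)) (chart_at x x).

(** [u *m tangent_mx f x] is the image of the tangent vector [u] under the
    differential of [f] at [x]. *)
Definition tangent_mx (R : realType) (m n : nat)
    (N : manifold R m) (M : manifold R n) (f : N -> M) (x : N) : 'M[R]_(m, n) :=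
  'J (chart_at (f x) \o f \o param (chart_at x)) (chart_at x x).

Definition local_diffeo (R : realType) (n : nat) (N M : manifold R n)
    (f : N -> M) : Prop :=
  smooth_map f /\
  forall x, exists (U : set N) (s : M -> N),
    [/\ open U, U x, open (f @` U),
        (forall y, U y -> s (f y) = y) &
        (forall z, (f @` U) z ->
           smooth_into (s \o param (chart_at z)) (chart_at z z))].

Definition smooth_fun (R : realType) (n : nat) (M : manifold R n)
    (h : M -> R) : Prop :=
  forall x, smooth_at (h \o param (chart_at x)) (chart_at x x).

Definition dfun (R : realType) (n : nat) (M : manifold R n)
    (h : M -> R) (x : M) (u : 'rV[R]_n) : R :=
  'D_u (h \o param (chart_at x)) (chart_at x x).

Definition crit (R : realType) (n : nat) (M : manifold R n)
    (h : M -> R) : set M :=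
  [set x | forall u, dfun h x u = 0].

(** The matrix of second derivatives in the chart [chart_at x]; it represents
    the Hessian when [x] is a critical point. *)
Definition hessian (R : realType) (n : nat) (M : manifold R n)
    (h : M -> R) (x : M) : 'M[R]_n :=
  \matrix_(i < n, j < n)
    'D_(delta_mx 0 i)
      (fun p => 'D_(delta_mx 0 j) (h \o param (chart_at x)) p) (chart_at x x).

(** The largest dimension of a subspace on which the Hessian is negative
    definite. *)
Definition morse_index (R : realType) (n : nat) (M : manifold R n)
    (h : M -> R) (x : M) : nat :=
  \max_(r < n.+1 | `[< exists A : 'M[R]_(r, n), row_free A /\
      forall u : 'rV[R]_r, u != 0 ->
        ((u *m A) *m hessian h x *m (u *m A)^T) 0 0 < 0 >]) r.

Definition morse_function (R : realType) (n : nat) (M : manifold R n)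
    (h : M -> R) : Prop :=
  smooth_fun h /\ forall x, crit h x -> hessian h x \in unitmx.

Definition crit_index (R : realType) (n : nat) (M : manifold R n)
    (h : M -> R) (q : nat) : set M :=
  [set x | crit h x /\ morse_index h x = q].

Definition vector_field (R : realType) (n : nat) (M : manifold R n) : Type :=
  M -> 'rV[R]_n.

(** The components of [u], a tangent vector at [x], in the coordinates [c]. *)
Definition chart_vec (R : realType) (n : nat) (M : manifold R n)
    (c : chart R n M) (x : M) (u : 'rV[R]_n) : 'rV[R]_n :=
  'D_u (c \o param (chart_at x)) (chart_at x x).

Definition smooth_vector_field (R : realType) (n : nat) (M : manifold R n)
    (X : vector_field M) : Prop :=
  forall x, smooth_at
    (fun p => let y := param (chart_at x) p in chart_vec (chart_at x) y (X y))
    (chart_at x x).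

Definition gradient_like (R : realType) (n : nat) (M : manifold R n)
    (h : M -> R) (X : vector_field M) : Prop :=
  (forall x, ~ crit h x -> dfun h x (X x) < 0) /\
  (forall v, crit h v -> exists (c : chart R n M) (r : R),
    [/\ smooth_chart c, dom c v, c v = 0,
        0 < r /\ c @` dom c = [set p | \sum_(j < n) p 0 j ^+ 2 < r ^+ 2] &
        forall x, dom c x ->
          h x = h v - 2^-1 * (\sum_(j < n | (j < morse_index h v)%N) c x 0 j ^+ 2)
                    + 2^-1 * (\sum_(j < n | (morse_index h v <= j)%N) c x 0 j ^+ 2) /\
          chart_vec c x (X x) =
            \row_(j < n) (if (j < morse_index h v)%N then c x 0 j else - c x 0 j)]).

Definition is_flow (R : realType) (n : nat) (M : manifold R n)
    (X : vector_field M) (Phi : R -> M -> M) : Prop :=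
  [/\ (forall x, Phi 0 x = x),
      (forall (t : R) (x : M), smooth_into
         (fun p : R * 'rV[R]_n => Phi p.1 (param (chart_at x) p.2))
         (t, chart_at x x)) &
      (forall t x, velocity (Phi^~ x) t = X (Phi t x))].

Definition Wminus (R : realType) (n : nat) (M : manifold R n)
    (Phi : R -> M -> M) (v : M) : set M :=
  [set x | Phi t x @[t --> -oo%R] --> v].

Definition Wplus (R : realType) (n : nat) (M : manifold R n)
    (Phi : R -> M -> M) (v : M) : set M :=
  [set x | Phi t x @[t --> +oo%R] --> v].

Definition flow_orbit (R : realType) (n : nat) (M : manifold R n)
    (Phi : R -> M -> M) (x : M) : set M := range (Phi^~ x).

(** For [v <> w]: an element of the quotient by the flow is the orbit itself,
    as a subset of [M]. *)
Definition trajectories (R : realType) (n : nat) (M : manifold R n)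
    (Phi : R -> M -> M) (v w : M) : set (set M) :=
  flow_orbit Phi @` (Wminus Phi v `&` Wplus Phi w).

(** Velocities at [x] of the curves of [M] contained in [W]; this is the tangent
    space when [W] is an embedded submanifold. *)
Definition tangent (R : realType) (n : nat) (M : manifold R n)
    (W : set M) (x : M) : set 'rV[R]_n :=
  [set u | exists c : R -> M,
     [/\ c 0 = x, smooth_into c 0, (\forall t \near (0 : R), W (c t)) &
         velocity c 0 = u]].

Definition transverse (R : realType) (n : nat) (M : manifold R n)
    (W W' : set M) : Prop :=
  forall x, W x -> W' x -> forall u, exists a b,
    [/\ tangent W x a, tangent W' x b & u = a + b].

Record morse_smale (R : realType) (n : nat) (M : manifold R n)
    (h : M -> R) (X : vector_field M) (Phi : R -> M -> M) : Prop := MorseSmale {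
  ms_morse : morse_function h;
  ms_smooth : smooth_vector_field X;
  ms_flow : is_flow X Phi;
  ms_gradient_like : gradient_like h X;
  ms_transversal : forall v w, crit h v -> crit h w ->
    transverse (Wminus Phi v) (Wplus Phi w) }.

(** [o x B] tells whether the basis of the tangent space of [W] at [x] given by
    the rows of [B] is positive.  For [r = 0], it is the sign of the point. *)
Definition is_orientation (R : realType) (n r : nat) (M : manifold R n)
    (W : set M) (o : M -> 'M[R]_(r, n) -> bool) : Prop :=
  (forall x B P, W x -> row_free B -> (forall i, tangent W x (row i B)) ->
     P \in unitmx -> o x (P *m B) = o x B (+) (\det P < 0)) /\
  (forall (f : 'rV[R]_r -> M) p, smooth_into f p ->
     (\forall q \near p, W (f q)) -> row_free (jac f p) ->
     \forall q \near p, o (f q) (jac f q) = o (f p) (jac f p)).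

Definition unstable_orientations (R : realType) (n : nat) (M : manifold R n)
    (h : M -> R) (Phi : R -> M -> M)
    (O : forall v : M, M -> 'M[R]_(morse_index h v, n) -> bool) : Prop :=
  forall v, crit h v -> is_orientation (Wminus Phi v) (O v).

Fixpoint broken (R : realType) (n : nat) (M : manifold R n)
    (h : M -> R) (Phi : R -> M -> M) (v w : M) (s : seq (set M)) : Prop :=
  match s with
  | [::] => v = w
  | gamma :: s' => exists v1,
      [/\ crit h v1, (morse_index h v1 < morse_index h v)%N /\ h v1 < h v,
          trajectories Phi v v1 gamma & broken h Phi v1 w s']
  end.

(** A point [(s, x)] is the trajectory from [v] to [x] made of the full orbits
    listed in [s] followed by the backward half orbit of [x]. *)
Definition hatW (R : realType) (n : nat) (M : manifold R n)
    (h : M -> R) (Phi : R -> M -> M) (v : M) : set (seq (set M) * M) :=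
  [set y | exists w,
     [/\ crit h w, broken h Phi v w y.1 & Wminus Phi w y.2]].

Definition track (R : realType) (n : nat) (M : manifold R n)
    (Phi : R -> M -> M) (y : seq (set M) * M) : set M :=
  foldr setU [set Phi t y.2 | t in [set t : R | t <= 0]] y.1.

Definition corner (R : realType) (l d : nat) (a : R) : set 'rV[R]_d :=
  [set p | (forall j, `|p 0 j| < a) /\
           (forall j : 'I_d, (j < l)%N -> 0 <= p 0 j)].

(** Near [p0], [e] is a smooth extension of the map sending a corner point [p] to
    the point at level [c] of the broken trajectory [F p]. *)
Definition level_map (R : realType) (n : nat) (M : manifold R n)
    (h : M -> R) (Phi : R -> M -> M) (d : nat) (D : set 'rV[R]_d)
    (F : 'rV[R]_d -> seq (set M) * M) (c : R) (p0 : 'rV[R]_d)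
    (e : 'rV[R]_d -> M) : Prop :=
  smooth_into e p0 /\
  \forall p \near p0, D p -> track Phi (F p) (e p) /\ h (e p) = c.

Definition regular_level (R : realType) (n : nat) (M : manifold R n)
    (h : M -> R) (v : M) (y : seq (set M) * M) : set R :=
  [set c | h y.2 < c < h v /\ forall x, crit h x -> h x != c].

(** [F] is a chart with [l] corner coordinates of the manifold with corners
    [hatW h Phi v].  The smooth structure is the one for which the end point and
    the intersections with the noncritical levels of [h] depend smoothly on the
    broken trajectory and together form an immersion; [e] extends the end point
    smoothly across the boundary.  The codimension of the stratum of [(s, x)] is
    the length of [s]. *)
Definition corner_chart (R : realType) (n : nat) (M : manifold R n)
    (h : M -> R) (Phi : R -> M -> M) (v : M) (d l : nat) (a : R)
    (F : 'rV[R]_d -> seq (set M) * M) (e : 'rV[R]_d -> M) : Prop :=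
  [/\ d = morse_index h v /\ 0 < a,
      (forall p, corner l a p -> hatW h Phi v (F p) /\
         size (F p).1 = #|[set j : 'I_d | (j < l)%N & p 0 j == 0]|),
      (forall p p', corner l a p -> corner l a p' -> F p = F p' -> p = p'),
      (forall p, corner l a p -> smooth_into e p /\ e p = (F p).2) &
      (forall p0, corner l a p0 ->
         (forall c, regular_level h v (F p0) c ->
            exists f, level_map h Phi (corner l a) F c p0 f) /\
         (forall u : 'rV[R]_d, u != 0 -> u *m jac e p0 != 0 \/
            exists c f, [/\ regular_level h v (F p0) c,
              level_map h Phi (corner l a) F c p0 f & u *m jac f p0 != 0]))].

(** On a half space whose first coordinate is nonnegative in the interior, the
    outward normal is minus the first coordinate vector. *)
Definition outward_first (R : realType) (r n : nat)
    (B : 'M[R]_(r.+1, n)) : 'M[R]_(r.+1, n) :=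
  \matrix_(i, j) (if i == ord0 then - B i j else B i j).

(** The orientation of the boundary component [{gamma} x W^-_w] of
    [hatW h Phi v] induced by [O v] (outward normal first) is [O w].  It is
    tested in a boundary chart around points of that component: the sign of
    [O v] on the frame (outward normal, boundary directions) at the interior
    points of the chart is that of [O w] on the boundary frame. *)
Definition boundary_agrees (R : realType) (n : nat) (M : manifold R n)
    (h : M -> R) (Phi : R -> M -> M)
    (O : forall v : M, M -> 'M[R]_(morse_index h v, n) -> bool)
    (v w : M) (gamma : set M) : Prop :=
  exists (E : (morse_index h w).+1 = morse_index h v) (a : R)
         (F : 'rV[R]_(morse_index h w).+1 -> seq (set M) * M)
         (e : 'rV[R]_(morse_index h w).+1 -> M),
    [/\ corner_chart h Phi v 1 a F e,
        (forall p, corner 1 a p -> p 0 0 = 0 -> (F p).1 = [:: gamma]) &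
        (forall p p', corner 1 a p -> 0 < p 0 0 ->
                      corner 1 a p' -> p' 0 0 = 0 ->
           O v (e p) (castmx (E, erefl n) (outward_first (jac e p))) =
           O w (e p') (row' 0 (jac e p')))].

Definition epsilon (R : realType) (n : nat) (M : manifold R n)
    (h : M -> R) (Phi : R -> M -> M)
    (O : forall v : M, M -> 'M[R]_(morse_index h v, n) -> bool)
    (v w : M) (gamma : set M) : int :=
  if `[< boundary_agrees Phi O v w gamma >] then 1 else -1.

Record covering (G : groupType) (R : realType) (n : nat)
    (Mt M : manifold R n) := Covering {
  deck : G -> Mt -> Mt;
  proj :> Mt -> M;
  deck1 : forall x, deck 1%g x = x;
  deckM : forall g g' x, deck (g * g')%g x = deck g (deck g' x);
  deck_smooth : forall g, smooth_map (deck g);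
  deck_free : forall g x, deck g x = x -> g = 1%g;
  deck_properly_discontinuous : forall K : set Mt, compact K ->
    finite_set [set g | (deck g @` K) `&` K !=set0];
  proj_local_diffeo : local_diffeo proj;
  proj_surj : forall y, exists x, proj x = y;
  proj_fiber : forall x y, proj x = proj y <-> exists g, y = deck g x }.

(** The vector field on the covering which the differential of [pi] maps
    to [X]. *)
Definition lift_vector_field (G : groupType) (R : realType) (n : nat)
    (Mt M : manifold R n) (pi : covering G Mt M) (X : vector_field M) :
    vector_field Mt :=
  fun x => X (pi x) *m invmx (tangent_mx pi x).

Inductive scalars := RealScalars | ComplexScalars.

Definition base_field (R : realType) (k : scalars) : fieldType :=
  match k with RealScalars => R : fieldType | ComplexScalars => R[i] end.

Record representation (G : groupType) (K : fieldType) (E : vectType K) :=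
  Representation {
  rep_fun :> G -> 'End(E);
  rep1 : rep_fun 1%g = \1%VF;
  repM : forall g g', rep_fun (g * g')%g = (rep_fun g \o rep_fun g')%VF }.

Definition cov_crit (G : groupType) (R : realType) (n : nat)
    (Mt M : manifold R n) (pi : covering G Mt M) (h : M -> R) (q : nat) :
    set Mt :=
  pi @^-1` crit_index h q.

(** Meaningful for critical points [v], [w] of consecutive indices; the sum is
    over a finite set in that case. *)
Definition incidence (G : groupType) (R : realType) (n : nat)
    (Mt M : manifold R n) (pi : covering G Mt M) (h : M -> R)
    (Phi : R -> M -> M) (Phit : R -> Mt -> Mt)
    (O : forall v : M, M -> 'M[R]_(morse_index h v, n) -> bool) (v w : Mt) : int :=
  \sum_(gamma \in trajectories Phit v w)
     epsilon Phi O (pi v) (pi w) (pi @` gamma).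

Definition cochain (G : groupType) (R : realType) (n : nat)
    (Mt M : manifold R n) (pi : covering G Mt M) (h : M -> R)
    (K : fieldType) (E : vectType K) (q : nat) : lmodType K :=
  (cov_crit pi h q -> E) : lmodType K.

Definition coboundary (G : groupType) (R : realType) (n : nat)
    (Mt M : manifold R n) (pi : covering G Mt M) (h : M -> R)
    (Phi : R -> M -> M) (Phit : R -> Mt -> Mt)
    (O : forall v : M, M -> 'M[R]_(morse_index h v, n) -> bool)
    (K : fieldType) (E : vectType K) (q : nat) (f : cochain pi h E q) :
    cochain pi h E q.+1 :=
  fun v => \sum_(w \in [set: cov_crit pi h q])
             f w *~ incidence pi Phi Phit O (val v) (val w).

Lemma deck_cov_crit (G : groupType) (R : realType) (n : nat)
    (Mt M : manifold R n) (pi : covering G Mt M) (h : M -> R) (q : nat)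
    (g : G) (v : cov_crit pi h q) : deck pi g (val v) \in cov_crit pi h q.
Proof.
have /set_mem := valP v; rewrite /cov_crit /= => vq; apply/mem_set => /=.
suff <- : pi (val v) = pi (deck pi g (val v)) by [].
by apply/(proj_fiber pi); exists g.
Qed.

Definition deck_crit (G : groupType) (R : realType) (n : nat)
    (Mt M : manifold R n) (pi : covering G Mt M) (h : M -> R) (q : nat)
    (g : G) (v : cov_crit pi h q) : cov_crit pi h q :=
  exist _ (deck pi g (val v)) (deck_cov_crit g v).

Definition cochain_act (G : groupType) (R : realType) (n : nat)
    (Mt M : manifold R n) (pi : covering G Mt M) (h : M -> R)
    (K : fieldType) (E : vectType K) (rho : representation G E) (q : nat)
    (g : G) (f : cochain pi h E q) : cochain pi h E q :=
  fun v => rho g (f (deck_crit g^-1%g v)).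

Definition invariant_cochain (G : groupType) (R : realType) (n : nat)
    (Mt M : manifold R n) (pi : covering G Mt M) (h : M -> R)
    (K : fieldType) (E : vectType K) (rho : representation G E) (q : nat) :
    set (cochain pi h E q) :=
  [set f | forall g, cochain_act rho g f = f].

Definition cochain_complex_of_reps (G : groupType) (K : fieldType)
    (C : nat -> lmodType K) (act : forall q, G -> C q -> C q)
    (delta : forall q, C q -> C q.+1) : Prop :=
  [/\ forall q, linear (delta q),
      forall q f, delta q.+1 (delta q f) = 0,
      forall q g, linear (act q g),
      forall q, (forall f, act q 1%g f = f) /\
        (forall g g' f, act q (g * g')%g f = act q g (act q g' f)) &
      forall q g f, delta q (act q g f) = act q.+1 g (delta q f)].

Definition finite_dim_subcomplex (K : fieldType)
    (C : nat -> lmodType K) (delta : forall q, C q -> C q.+1)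
    (S : forall q, set (C q)) : Prop :=
  forall q,
    [/\ S q 0,
        (forall (a : K) f f', S q f -> S q f' -> S q (a *: f + f')),
        (forall f, S q f -> S q.+1 (delta q f)) &
        exists (d : nat) (b : 'I_d -> C q), (forall i, S q (b i)) /\
          forall f, S q f -> exists a : 'I_d -> K, f = \sum_(i < d) a i *: b i].

(* Main.v *)
(* The only deep point is that the square of the coboundary vanishes, that is, for critical points
   [v], [u] of indices [q + 2], [q], that the broken orbits from [v] to [u] cancel in pairs.

   The unstable manifold of [v] is parametrized by a map [ph] defined on a vector space and
   conjugating the flow to [x |-> e^t x]; near a stable manifold the expanding coordinates of the
   chart, pulled back by the flow, give a map [st] whose zero set is that stable manifold.  Orbits
   from [v] to [u] are then the points of the unit sphere in the zero set [N] of [st \o ph], a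
   one-dimensional manifold with an orientation.  Near a broken orbit [N] is one arc, obtained from
   the linear flow through the intermediate point, and [N] is compact up to these arcs; counting
   the ends of the arcs of an oriented one-dimensional manifold with sign gives zero.  The sign of
   an end is the product of two determinants [adet], one for each half of the broken orbit.

   The same determinant computes [epsilon]: in any boundary chart of the compactified unstable
   manifold the position on the intermediate level, together with the passage parameter, is a
   regular coordinate system, so that orientations are compared through the Jacobian determinant
   of [(s, x) |-> s^-1 sigma (s x)], where [sigma] is a section of [st \o ph].

   On the covering space, orbits are lifted uniquely; the end point of the lift is locally constant
   on [N] and along the arcs, so the count may be restricted to prescribed lifts of [v] and [u]. *)

(* Two obstacles shape the proof. First, a broken orbit is not a point of [N]. The passage near the
   intermediate point [w] is described by [(s, x)]: [- ln s] is the time after which the orbit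
   leaves a neighbourhood of [w], and [x] is the expanding part of its exit point. Since the flow is
   exactly linear in the chart, the exit point extends smoothly across [s = 0], and the implicit
   function theorem there replaces a gluing analysis; the same coordinates yield a boundary chart.
   Secondly, [epsilon] is 1 when some boundary chart agrees and -1 otherwise, so its value requires
   both that all charts give one sign and that a chart exists. The function [st] depends on a time
   [T], but its germ along the stable manifold does not, so its Jacobian is globally defined on [N].
   Indices drop strictly along orbits and in closures of stable manifolds; hence the limit points
   missing from [N] are broken exactly once. The orientation at [w] enters both halves of a broken
   orbit and cancels. Compactness is available on [M] only, so the covering enters the count through
   locally constant labels on [N]. *)
Require Import Defs.
From HB Require Import structures.
From mathcomp Require Import all_boot all_order all_algebra.
From mathcomp Require Import all_classical all_reals all_analysis.
From mathcomp Require Import complex.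
From mathcomp Require Import ring lra zify.
Set Implicit Arguments.
Unset Strict Implicit.
Unset Printing Implicit Defensive.
Import Order.TTheory GRing.Theory Num.Theory.
Import numFieldNormedType.Exports.
Local Open Scope classical_set_scope.
Local Open Scope ring_scope.

(** * Calculus of [Ck] and smooth maps between normed spaces *)

Section DiffEps.
Variables (R : realType) (V W : normedModType R).

Lemma diff_eps (f : V -> W) (x : V) : differentiable f x ->
  forall e : R, 0 < e ->
    \forall h \near (0 : V), `|f (h + x) - (f x + 'd f x h)| <= e * `|h|.
Proof. by move=> /diff_locally /eqaddoP H e e0; exact: H. Qed.

Lemma is_diff_eps (f : V -> W) (x : V) (df : {linear V -> W}) :
  continuous df ->
  (forall e : R, 0 < e ->
    \forall h \near (0 : V), `|f (h + x) - (f x + df h)| <= e * `|h|) ->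
  differentiable f x /\ 'd f x = df :> (V -> W).
Proof.
move=> cdf H.
have E : f \o shift x = cst (f x) + df +o_ 0 id by apply/eqaddoP.
have D := diff_unique cdf E; split=> //.
apply/diff_locallyP; rewrite D; split=> //.
Qed.

Lemma near_differentiable (f g : V -> W) (x : V) :
  (\forall y \near x, f y = g y) -> differentiable f x -> differentiable g x.
Proof.
move=> E df; have Ex : f x = g x by exact: (nbhs_singleton E).
apply: (proj1 (@is_diff_eps g x ('d f x) _ _)).
  exact: diff_continuous.
move=> e e0; have := diff_eps df e0.
have : \forall h \near (0 : V), f (h + x) = g (h + x).
  rewrite (near_shift x) sub0r; apply: filterS E => y.
  by rewrite /= subrK.
by apply: filterS2 => h ->; rewrite Ex.
Qed.

End DiffEps.

Section CkBasic.
Variables (R : realType) (V : normedModType R).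
Implicit Types (U : set V) (k : nat).

(** [Ck] is recursive in derivatives along fixed directions, and the formula for the derivative of a
    combined map holds only at points of [U]. The closure properties below are inductions in which
    that formula is substituted through this lemma. Openness is needed because a derivative at [p]
    sees a neighbourhood of [p]. *)
Lemma Ck_ext (W : normedModType R) k U (f g : V -> W) : open U ->
  (forall p, U p -> f p = g p) -> Ck k U f -> Ck k U g.
Proof.
move=> oU; elim: k f g => [|k IH] f g E /=.
  move=> H p Up; have Np : \forall y \near p, f y = g y.
    by apply: filterS (open_nbhs_nbhs (conj oU Up)) => y; exact: E.
  rewrite /prop_for /continuous_at -(E _ Up); apply: cvg_trans (H p Up).
  exact: near_eq_cvg.
move=> [H1 H2]; split=> [p Up|u].
  apply: near_differentiable (H1 p Up).
  by apply: filterS (open_nbhs_nbhs (conj oU Up)) => y; exact: E.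
apply: IH (H2 u) => p Up; apply: near_eq_derive.
by apply: filterS (open_nbhs_nbhs (conj oU Up)) => y; exact: E.
Qed.

Lemma Ck_sub (W : normedModType R) k U U' (f : V -> W) : U' `<=` U ->
  Ck k U f -> Ck k U' f.
Proof.
move=> sU; elim: k f => [|k IH] f /= => [H p /sU|[H1 H2]]; first exact: H.
by split=> [p /sU|u]; [exact: H1|apply: IH].
Qed.

Lemma Ck_S (W : normedModType R) k U (f : V -> W) : Ck k.+1 U f -> Ck k U f.
Proof.
elim: k f => [|k IH] f [H1 H2].
  by move=> p Up; apply: differentiable_continuous; exact: H1.
by split=> [//|u]; apply: IH; exact: H2.
Qed.

Lemma Ck_cst (W : normedModType R) k U (a : W) : Ck k U (cst a).
Proof.
elim: k a => [|k IH] a /=; first by move=> p _; exact: cst_continuous.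
split=> [p _|u]; first exact: differentiable_cst.
suff -> : 'D_u (cst a : V -> W) = cst 0 by exact: IH.
by apply/funext => p; rewrite derive_cst.
Qed.

Lemma Ck_add (W : normedModType R) k U (f g : V -> W) : open U ->
  Ck k U f -> Ck k U g -> Ck k U (fun x => f x + g x).
Proof.
move=> oU; elim: k f g => [|k IH] f g /=.
  by move=> H1 H2 p Up; apply: continuousD; [exact: H1|exact: H2].
move=> [f1 f2] [g1 g2]; split=> [p Up|u].
  by apply: differentiableD; [exact: f1|exact: g1].
apply: Ck_ext (IH _ _ (f2 u) (g2 u)) => // p Up /=.
by rewrite -deriveD //; apply: diff_derivable; [exact: f1|exact: g1].
Qed.

Lemma Ck_lin (W Z : normedModType R) k U (L : {linear W -> Z}) (f : V -> W) :
  continuous L -> open U -> Ck k U f -> Ck k U (fun x => L (f x)).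
Proof.
move=> cL oU; elim: k f => [|k IH] f /=.
  by move=> H p Up; apply: continuous_comp; [exact: H|exact: cL].
have dL x : differentiable L x by exact: linear_differentiable.
move=> [f1 f2]; split=> [p Up|u].
  by apply: differentiable_comp => //; exact: f1.
apply: Ck_ext (IH _ (f2 u)) => // p Up /=.
have fp := f1 _ Up.
rewrite [RHS]deriveE; last exact: differentiable_comp.
by rewrite diff_comp //= diff_lin // deriveE.
Qed.

Lemma Ck_mul k U (f g : V -> R) : open U ->
  Ck k U f -> Ck k U g -> Ck k U (fun x => f x * g x).
Proof.
move=> oU; elim: k f g => [|k IH] f g.
  by move=> H1 H2 p Up; apply: continuousM; [exact: H1|exact: H2].
move=> Cf Cg; have [Cf' Cg'] := (Ck_S Cf, Ck_S Cg).
case: Cf Cg => [f1 f2] [g1 g2]; split=> [p Up|u].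
  by apply: differentiableM; [exact: f1|exact: g1].
apply: Ck_ext (Ck_add oU (IH _ _ Cf' (g2 u)) (IH _ _ Cg' (f2 u))) => // p Up /=.
by rewrite -deriveM //; apply: diff_derivable; [exact: f1|exact: g1].
Qed.

Lemma Ck_inv k U (f : V -> R) : open U -> (forall p, U p -> f p != 0) ->
  Ck k U f -> Ck k U (fun x => (f x)^-1).
Proof.
move=> oU n0; elim: k => [|k IH] Cf.
  by move=> p Up; apply: continuousV; [exact: n0|exact: Cf].
have {}IH := IH (Ck_S Cf); case: Cf => [f1 f2]; split=> [p Up|u].
  by apply: differentiableV; [exact: f1|exact: n0].
apply: Ck_ext (Ck_mul oU (@Ck_cst R^o k U (-1)) (Ck_mul oU (f2 u) (Ck_mul oU IH IH))) => //.
move=> p Up /=; rewrite deriveV ?n0 //; last by apply: diff_derivable; exact: f1.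
by rewrite mulN1r scaleNr /GRing.scale /= -invfM -expr2 mulrC.
Qed.

Lemma Ck_sum (W : normedModType R) k U (I : Type) (r : seq I) (P : pred I)
    (f : I -> V -> W) : open U ->
  (forall i, P i -> Ck k U (f i)) -> Ck k U (fun x => \sum_(i <- r | P i) f i x).
Proof.
move=> oU H; elim: r => [|i r IH].
  by under eq_fun do rewrite big_nil; exact: Ck_cst.
under eq_fun do rewrite big_cons.
by case Pi: (P i) => //; apply: Ck_add => //; exact: H.
Qed.

End CkBasic.

(** Finite dimension in the form that the chain rule needs: the derivative of [g \o f] along [u] has
    the moving direction ['D_u f], whereas [Ck] knows only fixed ones. Expanding ['D_u f] on [b]
    with the coordinate forms [l] gives scalar functions times the derivatives of [g] along the
    [b i]. *)
Definition findim (R : realType) (W : normedModType R) : Prop :=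
  exists m (b : 'I_m -> W) (l : 'I_m -> {linear W -> R^o}),
    (forall i, continuous (l i)) /\ (forall w, w = \sum_i l i w *: b i).

Lemma findim_R (R : realType) : findim (R : normedModType R).
Proof.
exists 1%N, (fun=> 1 : R), (fun=> (idfun : {linear R^o -> R^o})); split=> [i x|w].
  exact: cvg_id.
by rewrite big_ord1 /= /GRing.scale /= mulr1.
Qed.

Definition mxcoef (R : realType) m n (i : 'I_m) (j : 'I_n) (A : 'M[R]_(m, n)) : R^o := A i j.

Lemma mxcoef_linear (R : realType) m n i j : linear (@mxcoef R m n i j).
Proof. by move=> a A B; rewrite /mxcoef !mxE. Qed.
HB.instance Definition _ (R : realType) m n i j :=
  GRing.isLinear.Build R 'M[R]_(m, n) R^o _ (@mxcoef R m n i j) (@mxcoef_linear R m n i j).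

Lemma mxcoef_continuous (R : realType) m n i j : continuous (@mxcoef R m n i j).
Proof. exact: coord_continuous. Qed.

Lemma findim_rV (R : realType) m : findim ('rV[R]_m : normedModType R).
Proof.
exists m, (fun i => delta_mx 0 i), (fun i => @mxcoef R 1 m 0 i); split=> [i|w].
  exact: mxcoef_continuous.
exact: row_sum_delta.
Qed.

Lemma findim_prod (R : realType) (W Z : normedModType R) :
  findim W -> findim Z -> findim (W * Z)%type.
Proof.
move=> [m [b [l [cl E]]]] [m' [b' [l' [cl' E']]]].
pose L (i : 'I_(m + m')) : {linear (W * Z)%type -> R^o} :=
  match fintype.split i with
  | inl i => l i \o fst : {linear (W * Z)%type -> R^o}
  | inr i => l' i \o snd : {linear (W * Z)%type -> R^o} end.
pose B (i : 'I_(m + m')) : W * Z :=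
  match fintype.split i with inl i => (b i, 0) | inr i => (0, b' i) end.
exists (m + m')%N, B, L; split=> [i|[w z]].
  rewrite /L; case: fintype.split => j p.
    by apply: continuous_comp; [exact: cvg_fst|exact: cl].
  by apply: continuous_comp; [exact: cvg_snd|exact: cl'].
rewrite big_split_ord /=.
under eq_bigr => i _ do rewrite /L /B (unsplitK (inl i)) /=.
under [X in _ = _ + X]eq_bigr => i _ do rewrite /L /B (unsplitK (inr i)) /=.
apply: injective_projections; rewrite raddfD !raddf_sum /=.
  by rewrite -E [X in _ = _ + X]big1 ?addr0 // => i _; rewrite scaler0.
by rewrite -E' [X in _ = X + _]big1 ?add0r // => i _; rewrite scaler0.
Qed.

Section CkComp.
Variables (R : realType) (V : normedModType R).
Implicit Types (U : set V) (k : nat).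

Lemma Ck_scalel (Z : normedModType R) k U (f : V -> R) (z : Z) : open U ->
  Ck k U f -> Ck k U (fun x => f x *: z).
Proof.
move=> oU; elim: k f => [|k IH] f /=.
  by move=> H p Up; apply: continuousZl; exact: H.
move=> [f1 f2]; split=> [p Up|u]; first by apply: differentiableZl; exact: f1.
apply: Ck_ext (IH _ (f2 u)) => // p Up /=.
rewrite [RHS]deriveE; last by apply: differentiableZl; exact: f1.
by rewrite diffZl ?deriveE //; exact: f1.
Qed.

Lemma Ck_scale (Z : normedModType R) k U (a : V -> R) (f : V -> Z) : findim Z ->
  open U -> Ck k U a -> Ck k U f -> Ck k U (fun x => a x *: f x).
Proof.
move=> [m [b [l [cl E]]]] oU Ca Cf.
apply: (@Ck_ext _ _ _ k U (fun x => \sum_i (a x * l i (f x)) *: b i)) => //.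
  move=> p Up; rewrite {2}(E (f p)) scaler_sumr.
  by apply: eq_bigr => i _; rewrite scalerA.
apply: Ck_sum => // i _; apply: Ck_scalel => //.
by apply: Ck_mul => //; exact: Ck_lin.
Qed.

Lemma Ck_comp (W Z : normedModType R) k U (U' : set W) (f : V -> W) (g : W -> Z) :
  findim W -> findim Z -> open U -> open U' -> (forall p, U p -> U' (f p)) ->
  Ck k U f -> Ck k U' g -> Ck k U (g \o f).
Proof.
move=> fW fZ oU oU' fUU'; elim: k g => [|k IH] g.
  move=> Cf Cg p Up; apply: continuous_comp; first exact: Cf.
  by apply: Cg; exact: fUU'.
move=> Cf [g1 g2]; have Cf' := Ck_S Cf; case: Cf => f1 f2; split=> [p Up|u].
  by apply: differentiable_comp; [exact: f1|apply/g1/fUU'].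
case: (fW) => m [b [l [cl E]]].
apply: (@Ck_ext _ _ _ k U
   (fun x => \sum_i l i ('D_u f x) *: ('D_(b i) g \o f) x)) => //.
  move=> p Up; have fp := f1 _ Up; have gp := g1 _ (fUU' _ Up).
  rewrite [RHS]deriveE; last exact: differentiable_comp.
  rewrite diff_comp //= -(deriveE u fp) [in RHS](E ('D_u f p)) linear_sum.
  by apply: eq_bigr => i _; rewrite [RHS]linearZ /= (deriveE (b i) gp).
apply: Ck_sum => // i _; apply: Ck_scale => //; last exact: (IH _ Cf' (g2 _)).
exact: Ck_lin (f2 u).
Qed.

End CkComp.

Section SmoothAt.
Variables (R : realType) (V : normedModType R).
Implicit Types (W Z : normedModType R) (p : V).

Lemma smooth_near_eq W (f g : V -> W) p :
  (\forall q \near p, f q = g q) -> smooth_at f p -> smooth_at g p.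
Proof.
rewrite -nbhs_nearE nbhsE => -[B [oB Bp] sB] [U [oU Up Uf]].
exists (U `&` B); split; [exact: openI|by []|move=> k].
apply: (@Ck_ext _ _ _ k _ f) => //; first exact: openI.
  by move=> q [_ /sB].
by apply: Ck_sub (Uf k) => q [].
Qed.

Lemma smooth_near W (f : V -> W) p :
  smooth_at f p -> \forall q \near p, smooth_at f q.
Proof.
move=> [U [oU Up Uf]]; apply: filterS (open_nbhs_nbhs (conj oU Up)) => q Uq.
by exists U.
Qed.

Lemma smooth_diff W (f : V -> W) p : smooth_at f p -> differentiable f p.
Proof. by move=> [U [oU Up /(_ 1%N) [H _]]]; exact: H. Qed.

Lemma smooth_cont W (f : V -> W) p : smooth_at f p -> {for p, continuous f}.
Proof. by move=> [U [oU Up /(_ 0%N) H]]; exact: H. Qed.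

Lemma smooth_derive W (f : V -> W) p u : smooth_at f p -> smooth_at ('D_u f) p.
Proof. by move=> [U [oU Up Uf]]; exists U; split=> // k; have [_] := Uf k.+1; apply. Qed.

Lemma smooth_cst W (a : W) p : smooth_at (cst a) p.
Proof. by exists setT; split=> //; [exact: openT|move=> k; exact: Ck_cst]. Qed.

Lemma smooth_add W (f g : V -> W) p : smooth_at f p -> smooth_at g p ->
  smooth_at (fun x => f x + g x) p.
Proof.
move=> [U [oU Up Uf]] [U' [oU' Up' Uf']]; exists (U `&` U'); split=> [|//|k].
  exact: openI.
apply: Ck_add; first exact: openI.
  by apply: Ck_sub (Uf k) => q [].
by apply: Ck_sub (Uf' k) => q [].
Qed.

Lemma smooth_lin W Z (L : {linear W -> Z}) (f : V -> W) p :
  continuous L -> smooth_at f p -> smooth_at (fun x => L (f x)) p.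
Proof. by move=> cL [U [oU Up Uf]]; exists U; split=> // k; exact: Ck_lin. Qed.

Lemma smooth_linear W (L : {linear V -> W}) p : continuous L -> smooth_at L p.
Proof.
move=> cL; exists setT; split=> [|//|[|k]]; [exact: openT|by move=> q _; exact: cL|].
split=> [q _|u]; first exact: linear_differentiable.
suff -> : 'D_u L = cst (L u) by exact: Ck_cst.
by apply/funext => q; rewrite deriveE ?diff_lin //; exact: linear_differentiable.
Qed.

Lemma smooth_id p : smooth_at id p.
Proof. by apply: (@smooth_linear V idfun) => x; exact: cvg_id. Qed.

Lemma smooth_mul (f g : V -> R) p : smooth_at f p -> smooth_at g p ->
  smooth_at (fun x => f x * g x) p.
Proof.
move=> [U [oU Up Uf]] [U' [oU' Up' Uf']]; exists (U `&` U'); split=> [|//|k].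
  exact: openI.
apply: Ck_mul; first exact: openI.
  by apply: Ck_sub (Uf k) => q [].
by apply: Ck_sub (Uf' k) => q [].
Qed.

Lemma smooth_scale W (a : V -> R) (f : V -> W) p : findim W ->
  smooth_at a p -> smooth_at f p -> smooth_at (fun x => a x *: f x) p.
Proof.
move=> fW [U [oU Up Uf]] [U' [oU' Up' Uf']]; exists (U `&` U'); split=> [|//|k].
  exact: openI.
apply: Ck_scale => //; first exact: openI.
  by apply: Ck_sub (Uf k) => q [].
by apply: Ck_sub (Uf' k) => q [].
Qed.

Lemma near_neq0 (f : V -> R) p : {for p, continuous f} -> f p != 0 ->
  \forall q \near p, f q != 0.
Proof.
move=> cf fp; apply: (cf [set y | y != 0]); apply: open_nbhs_nbhs; split=> //.
Qed.

Lemma open_nonzero (f : V -> R) U : open U -> (forall q, U q -> {for q, continuous f}) ->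
  open [set q | U q /\ f q != 0].
Proof.
move=> oU cf; rewrite openE => q [Uq fq]; rewrite /interior.
apply: filterI; first exact: open_nbhs_nbhs.
by apply: near_neq0 => //; exact: cf.
Qed.

Lemma smooth_inv (f : V -> R) p : f p != 0 -> smooth_at f p ->
  smooth_at (fun x => (f x)^-1) p.
Proof.
move=> n0 [U [oU Up Uf]]; exists [set q | U q /\ f q != 0].
have oU' : open [set q | U q /\ f q != 0] by apply: open_nonzero => //; exact: Uf 0%N.
split=> // k; apply: Ck_inv => //; first by move=> q [].
by apply: Ck_sub (Uf k) => q [].
Qed.

Lemma smooth_sum W (I : Type) (r : seq I) (P : pred I) (f : I -> V -> W) p :
  (forall i, P i -> smooth_at (f i) p) ->
  smooth_at (fun x => \sum_(i <- r | P i) f i x) p.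
Proof.
move=> H; elim: r => [|i r IH].
  by under eq_fun do rewrite big_nil; exact: smooth_cst.
under eq_fun do rewrite big_cons.
by case Pi: (P i) => //; apply: smooth_add => //; exact: H.
Qed.

Lemma smooth_prod (I : Type) (r : seq I) (P : pred I) (f : I -> V -> R) p :
  (forall i, P i -> smooth_at (f i) p) ->
  smooth_at (fun x => \prod_(i <- r | P i) f i x) p.
Proof.
move=> H; elim: r => [|i r IH].
  by under eq_fun do rewrite big_nil; exact: smooth_cst.
under eq_fun do rewrite big_cons.
by case Pi: (P i) => //; apply: smooth_mul => //; exact: H.
Qed.

Lemma smooth_comp W Z (f : V -> W) (g : W -> Z) p : findim W -> findim Z ->
  smooth_at f p -> smooth_at g (f p) -> smooth_at (g \o f) p.
Proof.
move=> fW fZ [U [oU Up Uf]] [U' [oU' Up' Ug]].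
have oU2 : open (U `&` f @^-1` U').
  rewrite openE => q [Uq fq]; apply: filterI; first exact: open_nbhs_nbhs.
  by apply: (Uf 0%N q Uq); exact: open_nbhs_nbhs.
exists (U `&` f @^-1` U'); split=> // k.
apply: (@Ck_comp _ _ W Z k _ U') => //; first by move=> q [].
by apply: Ck_sub (Uf k) => q [].
Qed.

Lemma Ck_pair W Z k (U : set V) (f : V -> W) (g : V -> Z) : open U ->
  Ck k U f -> Ck k U g -> Ck k U (fun x => (f x, g x)).
Proof.
move=> oU; elim: k f g => [|k IH] f g /=.
  by move=> H1 H2 q Uq; apply: cvg_pair; [exact: H1|exact: H2].
move=> [f1 f2] [g1 g2]; split=> [q Uq|u].
  by apply: differentiable_pair; [exact: f1|exact: g1].
apply: Ck_ext (IH _ _ (f2 u) (g2 u)) => // q Uq /=.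
have fq := f1 _ Uq; have gq := g1 _ Uq.
rewrite [RHS]deriveE; last exact: differentiable_pair.
by rewrite diff_pair //= !deriveE.
Qed.

Lemma smooth_pair W Z (f : V -> W) (g : V -> Z) p : smooth_at f p ->
  smooth_at g p -> smooth_at (fun x => (f x, g x)) p.
Proof.
move=> [U [oU Up Uf]] [U' [oU' Up' Uf']]; exists (U `&` U'); split=> [|//|k].
  exact: openI.
apply: Ck_pair; first exact: openI.
  by apply: Ck_sub (Uf k) => q [].
by apply: Ck_sub (Uf' k) => q [].
Qed.

Lemma smooth_coef m n (f : V -> 'M[R]_(m, n)) i j p :
  smooth_at f p -> smooth_at (fun x => f x i j) p.
Proof.
by move=> Hf; apply: (@smooth_lin _ _ (@mxcoef R m n i j) f) => //; exact: mxcoef_continuous.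
Qed.

Lemma smooth_rV m (f : V -> 'rV[R]_m) p :
  (forall j, smooth_at (fun x => f x 0 j) p) -> smooth_at f p.
Proof.
move=> H; apply: (@smooth_near_eq _ (fun x => \sum_j f x 0 j *: delta_mx 0 j)).
  by apply: nearW => q; rewrite -row_sum_delta.
apply: smooth_sum => j _; apply: smooth_scale => //; first exact: findim_rV.
exact: smooth_cst.
Qed.

Lemma smooth_det m (A : V -> 'M[R]_m) p :
  (forall i j, smooth_at (fun x => A x i j) p) -> smooth_at (fun x => \det (A x)) p.
Proof.
move=> H; rewrite /determinant; apply: smooth_sum => s _.
apply: smooth_mul; first exact: smooth_cst.
by apply: smooth_prod => i _; exact: H.
Qed.

Lemma smooth_invmx m (A : V -> 'M[R]_m) p : A p \in unitmx ->
  (forall i j, smooth_at (fun x => A x i j) p) ->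
  forall i j, smooth_at (fun x => invmx (A x) i j) p.
Proof.
rewrite unitmxE unitfE => uA H i j.
have cd := smooth_cont (smooth_det H).
(* On singular matrices [invmx] is the identity map, so the cofactor formula is used only near [p],
   where the determinant stays nonzero. *)
apply: (@smooth_near_eq _
  (fun x => (\det (A x))^-1 * ((-1) ^+ (j + i) * \det (row' j (col' i (A x)))))).
  have := near_neq0 cd uA.
  apply: filterS => q dq; rewrite /invmx unitmxE unitfE dq !mxE //.
apply: smooth_mul; first by apply: smooth_inv => //; exact: smooth_det.
apply: smooth_mul; first exact: smooth_cst.
apply: smooth_det => k l; under eq_fun do rewrite !mxE.
exact: H.
Qed.

Lemma smooth_mulmx m n q (A : V -> 'M[R]_(m, n)) (B : V -> 'M[R]_(n, q)) p :
  (forall i j, smooth_at (fun x => A x i j) p) ->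
  (forall i j, smooth_at (fun x => B x i j) p) ->
  forall i j, smooth_at (fun x => (A x *m B x) i j) p.
Proof.
move=> H1 H2 i j; under eq_fun do rewrite mxE.
by apply: smooth_sum => k _; apply: smooth_mul.
Qed.

Lemma smooth_mulmxr m n (f : V -> 'rV[R]_m) (B : 'M[R]_(m, n)) p :
  smooth_at f p -> smooth_at (fun x => f x *m B) p.
Proof.
move=> Hf; apply: smooth_rV => j.
apply: (@smooth_mulmx 1 m n f (fun=> B)) => [i k|i k]; last exact: smooth_cst.
exact: smooth_coef.
Qed.

End SmoothAt.

Lemma mulmx_inj (R : pzRingType) m n (A B : 'M[R]_(m, n)) :
  (forall u : 'rV_m, u *m A = u *m B) -> A = B.
Proof. by move=> H; apply/row_matrixP => i; rewrite rowE [RHS]rowE. Qed.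

(** * Jacobian matrices, norms of row vectors and a mean value inequality *)

Section Jacobian.
Variables (R : realType).

Lemma jacE m n (f : 'rV[R]_m -> 'rV[R]_n) p i j : differentiable f p ->
  ('J f p) i j = ('D_(delta_mx 0 i) f p) 0 j.
Proof. by move=> df; rewrite deriveE // /jacobian mxE. Qed.

Lemma smooth_jac m n (f : 'rV[R]_m -> 'rV[R]_n) p : smooth_at f p ->
  forall i j, smooth_at (fun x => ('J f x) i j) p.
Proof.
move=> Hf i j; apply: (@smooth_near_eq _ _ _ (fun x => ('D_(delta_mx 0 i) f x) 0 j)).
  apply: filterS (smooth_near Hf) => q /smooth_diff Hq.
  by rewrite jacE.
by apply: smooth_coef; exact: smooth_derive.
Qed.

Lemma jac_comp m n l (f : 'rV[R]_m -> 'rV[R]_n) (g : 'rV[R]_n -> 'rV[R]_l) p :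
  differentiable f p -> differentiable g (f p) ->
  'J (g \o f) p = 'J f p *m 'J g (f p).
Proof.
move=> df dg; have dgf := differentiable_comp df dg.
apply/row_matrixP => i; rewrite row_mul !rowE.
rewrite -(deriveEjacobian _ dgf) -(deriveEjacobian _ df) -(deriveEjacobian _ dg).
by rewrite (deriveE _ dgf) (deriveE _ df) (deriveE _ dg) (diff_comp df dg).
Qed.

Lemma near_eq_jac m n (f g : 'rV[R]_m -> 'rV[R]_n) (p : 'rV[R]_m) :
  (\forall q \near p, f q = g q) -> differentiable f p -> 'J f p = 'J g p.
Proof.
move=> E df; have dg := near_differentiable E df.
apply: mulmx_inj => u.
exact: (etrans (esym (deriveEjacobian u df))
         (etrans (near_eq_derive u E) (deriveEjacobian u dg))).
Qed.

End Jacobian.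

Opaque jacobian derive diff.

Lemma near_and (T : topologicalType) (p : T) (P Q : T -> Prop) :
  (\forall x \near p, P x) -> (\forall x \near p, Q x) ->
  \forall x \near p, P x /\ Q x.
Proof. by move=> HP HQ; apply: filterS2 HP HQ. Qed.

Lemma near_ball (R : realType) (V : normedModType R) (p : V) (P : V -> Prop) :
  (\forall x \near p, P x) -> exists2 r : R, 0 < r & forall x, ball p r x -> P x.
Proof. by move=> /nbhs_ballP[r /= r0 H]; exists r. Qed.

Section NormRow.
Variables (R : realType).

Lemma normrV_le m (x : 'rV[R]_m) (c : R) : 0 <= c ->
  (forall j, `|x 0 j| <= c) -> `|x| <= c.
Proof.
move=> c0 H; rewrite /Num.norm /= mx_normrE; apply: bigmax_le => // -[i j] _ /=.
by rewrite ord1.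
Qed.

Lemma normrV_coef m (x : 'rV[R]_m) j : `|x 0 j| <= `|x|.
Proof.
rewrite {2}/Num.norm /= mx_normrE.
exact: (@le_bigmax _ _ _ 0 (fun i : 'I_1 * 'I_m => `|x i.1 i.2|) (0, j)).
Qed.

Lemma norm_mulmx_le m n (x : 'rV[R]_m) (A : 'M[R]_(m, n)) (c : R) : 0 <= c ->
  (forall i j, `|A i j| <= c) -> `|x *m A| <= m%:R * c * `|x|.
Proof.
move=> c0 H; apply: normrV_le; first by rewrite !mulr_ge0.
move=> j; rewrite mxE (le_trans (ler_norm_sum _ _ _)) //.
have -> : m%:R * c * `|x| = \sum_(i < m) c * `|x|.
  by rewrite sumr_const card_ord -[RHS]mulr_natl mulrA.
by apply: ler_sum => i _; rewrite normrM mulrC ler_pM // normrV_coef.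
Qed.

Lemma norm_mulmx_bound m n (A : 'M[R]_(m, n)) :
  exists2 C : R, 0 < C & forall x : 'rV[R]_m, `|x *m A| <= C * `|x|.
Proof.
pose c := \sum_i \sum_j `|A i j|.
have c0 : 0 <= c by apply: sumr_ge0 => i _; apply: sumr_ge0.
exists (m%:R * c + 1); first by rewrite ltr_wpDl // mulr_ge0.
move=> x; apply: (@le_trans _ _ (m%:R * c * `|x|)).
  apply: norm_mulmx_le => // i j.
  rewrite /c (bigD1 i) //= (bigD1 j) //= -addrA lerDl addr_ge0 ?sumr_ge0 // => k _.
  exact: sumr_ge0.
by rewrite ler_wpM2r // lerDl.
Qed.

Lemma mulmxr_continuous m n (A : 'M[R]_(m, n)) : continuous (fun x : 'rV[R]_m => x *m A).
Proof.
move=> x; apply: smooth_cont; apply: smooth_mulmxr; exact: smooth_id.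
Qed.

Lemma ball_rVE m (p : 'rV[R]_m) (r : R) x : ball p r x <-> `|p - x| < r.
Proof. by rewrite -ball_normE. Qed.

Lemma segment_ball (V : normedModType R) (p x y : V) (r t : R) : ball p r x -> ball p r y ->
  0 <= t <= 1 -> ball p r (x + t *: (y - x)).
Proof.
rewrite -ball_normE /= => px py /andP[t0 t1].
have -> : p - (x + t *: (y - x)) = (1 - t) *: (p - x) + t *: (p - y).
  transitivity ((p - x) + t *: ((p - y) - (p - x))).
    rewrite opprD addrA; congr (_ + _); rewrite -scalerN; congr (_ *: _).
    by rewrite !opprB [RHS]addrC subrKA.
  by rewrite scalerBl scale1r scalerBr [X in _ + X]addrC addrA.
apply: le_lt_trans (ler_normD _ _) _.
rewrite !normrZ (ger0_norm t0) ger0_norm ?subr_ge0 //.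
have [->|tn0] := eqVneq t 0; first by rewrite mul0r addr0 subr0 mul1r.
have tp : 0 < t by rewrite lt_neqAle eq_sym tn0.
have : (1 - t) * `|p - x| <= (1 - t) * r by rewrite ler_wpM2l ?subr_ge0 // ltW.
have : t * `|p - y| < t * r by rewrite ltr_pM2l.
by nra.
Qed.

Lemma diff_line (V : normedModType R) (x v : V) (t : R) :
  differentiable (fun t : R => x + t *: v) t /\
  'd (fun t : R => x + t *: v) t 1 = v.
Proof.
have D : is_diff t (cst x + ( *:%R ^~ v)) (0 + ( *:%R ^~ v)) by exact: is_diffD.
have E : (fun t : R => x + t *: v) = cst x + ( *:%R ^~ v) by [].
rewrite E; split; first exact: ex_diff.
by rewrite diff_val /GRing.add /= scale1r add0r.
Qed.

(* Coordinatewise mean value theorem: the sup norm avoids any integral. *)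
Lemma mean_value_ball m n (f : 'rV[R]_m -> 'rV[R]_n) p (r c : R) : 0 <= c ->
  (forall x, ball p r x -> differentiable f x /\ forall i j, `|('J f x) i j| <= c) ->
  forall x y, ball p r x -> ball p r y -> `|f y - f x| <= m%:R * c * `|y - x|.
Proof.
move=> c0 H x y px py; apply: normrV_le => [|j]; first by rewrite !mulr_ge0.
pose g (t : R) := f (x + t *: (y - x)) 0 j.
pose dg (t : R) := ((y - x) *m 'J f (x + t *: (y - x))) 0 j.
have dgE (t : R) : 0 <= t <= 1 -> is_derive t 1 g (dg t).
  move=> t01; have [df _] := H _ (segment_ball px py t01).
  have da : differentiable (fun t : R => x + t *: (y - x)) t.
    exact: (diff_line x (y - x) t).1.
  have dc : differentiable (fun M : 'rV[R]_n => M 0 j) (f (x + t *: (y - x))).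
    exact: differentiable_coord.
  have dfa := differentiable_comp da df.
  have dgt : differentiable g t by exact: (differentiable_comp dfa dc).
  apply: DeriveDef; first exact: diff_derivable.
  rewrite deriveE // /g.
  have -> : 'd g t = (fun M : 'rV[R]_n => M 0 j) \o 'd (f \o (fun t : R => x + t *: (y - x))) t :> (R -> R).
    have := @diff_comp R R^o _ R^o _ _ t dfa dc.
    rewrite (_ : 'd (fun M : 'rV[R]_n => M 0 j) _ = mxcoef 0 j :> ('rV[R]_n -> R)) //.
    apply: (@diff_lin _ _ _ (@mxcoef R 1 n 0 j)); exact: mxcoef_continuous.
  rewrite /= (diff_comp da df) /= /dg -deriveEjacobian // deriveE //; congr (_ _ 0 j); congr (_ _).
  exact: (diff_line x (y - x) t).2.
have [t t01 E] : exists2 t, t \in `[0, 1]%R & g 1 - g 0 = dg t * (1 - 0).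
  apply: MVT_segment => //.
    by move=> t; rewrite in_itv /= => /andP[t0 t1]; apply: dgE; rewrite !ltW.
  apply: derivable_within_continuous => t; rewrite in_itv /= => t01.
  by have [] := dgE _ t01.
have -> : (f y - f x) 0 j = g 1 - g 0.
  by rewrite /g scale1r scale0r addr0 [x + _]addrC subrK !mxE.
rewrite E subr0 mulr1; apply: le_trans (normrV_coef _ _) _.
by apply: norm_mulmx_le => //; apply: (H _ (segment_ball px py _)).2.
Qed.

End NormRow.

Lemma differentiable_mulmxr (R : realType) (V : normedModType R) m n
    (f : V -> 'rV[R]_m) (B : 'M[R]_(m, n)) p :
  differentiable f p -> differentiable (fun x => f x *m B) p.
Proof.
move=> df; apply: (@differentiable_comp _ _ _ _ f (mulmxr B)) => //.
by apply: linear_differentiable; exact: mulmxr_continuous.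
Qed.

Lemma derive_mulmxr (R : realType) (V : normedModType R) m n
    (f : V -> 'rV[R]_m) (B : 'M[R]_(m, n)) p u :
  differentiable f p -> 'D_u (fun x => f x *m B) p = 'D_u f p *m B.
Proof.
move=> df; have dB : differentiable (mulmxr B : 'rV[R]_m -> 'rV[R]_n) (f p).
  by apply: linear_differentiable; exact: mulmxr_continuous.
rewrite (deriveE _ (differentiable_mulmxr B df)) (deriveE _ df).
have -> : 'd (fun x => f x *m B) p = 'd (mulmxr B) (f p) \o 'd f p :> (V -> 'rV[R]_n).
  exact: (diff_comp df dB).
by rewrite /= diff_lin //; exact: mulmxr_continuous.
Qed.

Lemma jac_mulmxr (R : realType) l m n
    (f : 'rV[R]_l -> 'rV[R]_m) (B : 'M[R]_(m, n)) (p : 'rV[R]_l) :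
  differentiable f p -> 'J (fun x => f x *m B) p = 'J f p *m B.
Proof.
move=> df; apply: mulmx_inj => u; rewrite mulmxA.
have <- := deriveEjacobian u (differentiable_mulmxr B df).
by rewrite derive_mulmxr // (deriveEjacobian u df).
Qed.

(** * The inverse function theorem *)

Section InverseFunction.
Variables (R : realType) (m : nat).
Implicit Types (f g : 'rV[R]_m -> 'rV[R]_m) (p : 'rV[R]_m).

Lemma smooth_on_at (V W : normedModType R) (U : set V) (f : V -> W) : open U ->
  (forall q, U q -> smooth_at f q) -> smooth_on U f.
Proof.
move=> oU + k; elim: k f => [|k IH] f H /=.
  by move=> q Up; apply: smooth_cont; exact: H.
split=> [q Up|u]; first by apply: smooth_diff; exact: H.
by apply: IH => q Up; apply: smooth_derive; exact: H.
Qed.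

Lemma near_jac_bound l (f : 'rV[R]_m -> 'rV[R]_l) p (c : R) : smooth_at f p ->
  (forall i j, `|('J f p) i j| < c) ->
  \forall x \near p, differentiable f x /\ forall i j, `|('J f x) i j| <= c.
Proof.
move=> Hf H; apply: filterI.
  by apply: filterS (smooth_near Hf) => x; exact: smooth_diff.
apply: (@filter_forall _ _ (fun i x => forall j, `|('J f x) i j| <= c) (nbhs p) _) => i.
apply: (@filter_forall _ _ (fun j x => `|('J f x) i j| <= c) (nbhs p) _) => j.
have := smooth_cont (smooth_jac Hf i j).
move/cvgr_norm_lt => /(_ _ (H i j)).
by apply: filterS => x; exact: ltW.
Qed.

Lemma norm_sub_continuous (V W : normedModType R) (f g : V -> W) x :
  {for x, continuous f} -> {for x, continuous g} ->
  {for x, continuous (fun x => `|f x - g x|)}.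
Proof.
move=> cf cg; apply: (@continuous_comp _ _ _ (fun x => f x - g x) (@Num.norm _ _)).
  exact: continuousB.
exact: norm_continuous.
Qed.

Lemma closed_ball_rV_compact p (r : R) : compact [set x | `|p - x| <= r].
Proof.
apply: bounded_closed_compact.
  exists (`|p| + r); split; first exact: num_real.
  move=> M HM x /= px; apply: le_trans (ltW HM).
  by rewrite -[x](subKr p) (le_trans (ler_normB _ _)) // lerD2l.
rewrite (_ : [set _ | _] = (fun x => `|p - x|) @^-1` [set t | t <= r]) //.
apply: closed_comp; last exact: closed_le.
move=> x _; apply: (@norm_sub_continuous _ _ (cst p) id); [exact: cst_continuous|exact: cvg_id].
Qed.

(* A strict contraction of a compact ball has a fixed point: minimise the displacement. *)
Lemma contraction_fixpoint p (r q : R) g : 0 <= r -> q < 1 ->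
  (forall x, `|p - x| <= r -> {for x, continuous g}) ->
  (forall x, `|p - x| <= r -> `|p - g x| <= r) ->
  (forall x y, `|p - x| <= r -> `|p - y| <= r -> `|g y - g x| <= q * `|y - x|) ->
  exists2 x, `|p - x| <= r & g x = x.
Proof.
move=> r0 q1 gc gB gC; pose B := [set x | `|p - x| <= r].
have cg : {within B, continuous (fun x => `|x - g x|)}.
  apply: continuous_in_subspaceT => x; rewrite inE => Bx.
  by apply: (@norm_sub_continuous _ _ id g); [exact: cvg_id|exact: gc].
have B0 : B !=set0 by exists p; rewrite /B /= subrr normr0.
have [c] := EVT_min_rV B0 (@closed_ball_rV_compact p r) cg.
rewrite inE => Bc cmin; exists c => //.
have := cmin (g c); rewrite inE => /(_ (gB _ Bc)) cm.
have : `|g c - g (g c)| <= q * `|c - g c|.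
  by rewrite (le_trans (gC _ _ (gB _ Bc) Bc)).
move=> /(le_trans cm) H; apply/eqP; rewrite -subr_eq0 -normr_eq0 distrC.
rewrite eq_le normr_ge0 andbT; nra.
Qed.

(** With [d = g (y + h) - g y], the relation [f \o g = id] gives [h = d *m 'J f + o(d)], and the
    Lipschitz bound turns [o(d)] into [o(h)]. Multiplication by [B] then shows that
    [d = h *m B + o(h)]. *)
Lemma inverse_differentiable f g (B : 'M[R]_m) (C : R) y :
  differentiable f (g y) -> 'J f (g y) *m B = 1%:M ->
  (\forall z \near y, f (g z) = z) ->
  0 < C -> (\forall z \near y, `|g z - g y| <= C * `|z - y|) ->
  differentiable g y /\ forall u, 'D_u g y = u *m B.
Proof.
move=> df JB fg C0 gC; have [C' C'0 HB] := norm_mulmx_bound B.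
have cB : continuous (mulmxr B : 'rV[R]_m -> 'rV[R]_m) by exact: mulmxr_continuous.
have nearD (P : 'rV[R]_m -> Prop) : (\forall z \near y, P z) -> \forall h \near (0 : 'rV[R]_m), P (h + y).
  by move=> HP; rewrite (near_shift y) sub0r; apply: filterS HP => z; rewrite /= subrK.
have fgy : f (g y) = y by exact: (nbhs_singleton fg).
have [dg Dg] : differentiable g y /\ 'd g y = (mulmxr B : 'rV[R]_m -> 'rV[R]_m) :> ('rV[R]_m -> 'rV[R]_m).
  apply: (@is_diff_eps _ _ _ g y (mulmxr B)) => // e e0.
  have e'0 : 0 < e / (C' * C) by rewrite divr_gt0 // mulr_gt0.
  have := diff_eps df e'0; move: {gC fg} (nearD _ gC) (nearD _ fg) => gC fg.
  move=> /nbhs_ballP[e1 /= e10 He1].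
  have : \forall h \near (0 : 'rV[R]_m), `|h| < e1 / C.
    by apply: nbhs0_lt; rewrite divr_gt0.
  apply: filterS3 gC fg => h H1 H2 H3 /=; rewrite addrK in H1.
  have {}H3 : ball 0 e1 (g (h + y) - g y).
    rewrite -ball_normE /= sub0r normrN (le_lt_trans H1) // mulrC.
    by rewrite -ltr_pdivlMr.
  move: (He1 _ H3) => /=.
  rewrite subrK H2 fgy; set d := g (h + y) - g y in H1 *.
  rewrite -(deriveE d df) deriveEjacobian // opprD addrA addrK => {}H3.
  have -> : g (h + y) - (g y + h *m B) = - ((h - d *m 'J f (g y)) *m B).
    by rewrite mulmxBl -mulmxA JB mulmx1 opprB opprD addrA.
  rewrite normrN (le_trans (HB _)) // (le_trans (ler_wpM2l (ltW C'0) H3)) //.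
  rewrite (le_trans (ler_wpM2l (ltW C'0) (ler_wpM2l (ltW e'0) H1))) //.
  rewrite !mulrA ler_wpM2r //.
  by rewrite le_eqVlt; apply/orP; left; apply/eqP; field; rewrite !gt_eqF.
by split=> // u; rewrite deriveE // Dg.
Qed.

(** The map [k x = x - f x *m A], with [A] the inverse Jacobian at [p], has zero Jacobian at [p], so
    it is 1/2-Lipschitz on a small ball. Solving [f x = y] means finding a fixed point of
    [x |-> k x + y *m A], and the same contraction bound makes the solution unique and Lipschitz in
    [y]. *)
Theorem inverse_function f p : smooth_at f p -> 'J f p \in unitmx ->
  exists g (U V : set 'rV[R]_m), [/\ open U, U p, open V & V (f p)] /\
    [/\ forall x, U x -> V (f x) /\ g (f x) = x,
        forall y, V y -> U (g y) /\ f (g y) = y &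
        forall y, V y -> smooth_at g y].
Proof.
move=> Hf uJ; set A := invmx ('J f p).
have [C C0 HA] := norm_mulmx_bound A.
pose k x := x - f x *m A.
have Hk : smooth_at k p.
  apply: smooth_add; first exact: smooth_id.
  rewrite (_ : (fun x => _) = (fun x => f x *m - A)); last first.
    by apply/funext => x; rewrite mulmxN.
  exact: smooth_mulmxr.
have df := smooth_diff Hf; have dk := smooth_diff Hk.
have Jk : 'J k p = 0.
  apply: mulmx_inj => u; rewrite mulmx0 -deriveEjacobian //.
  have Dk : 'D_u k p = 'D_u id p - 'D_u (fun x => f x *m A) p.
    apply: (@deriveB _ _ _ id (fun x => f x *m A)); apply: diff_derivable => //.
    exact: differentiable_mulmxr.
  rewrite Dk derive_id derive_mulmxr // (deriveEjacobian _ df).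
  by rewrite -mulmxA mulmxV // mulmx1 subrr.
(* The mean value inequality in the sup norm costs a factor [m]; this bound on the entries leaves
   the Lipschitz constant 1/2, and [m.+1] keeps it meaningful for [m = 0]. *)
pose c : R := (2 * m.+1%:R)^-1.
have c0 : 0 < c by rewrite invr_gt0 mulr_gt0.
have cm : m%:R * c <= 1 / 2.
  by rewrite /c invfM mulrCA mul1r ler_piMr // ler_pdivrMr // mul1r ler_nat.
have : forall i j, `|('J k p) i j| < c by move=> i j; rewrite Jk mxE normr0.
move=> /(near_jac_bound Hk) nk.
have nf : \forall x \near p, smooth_at f x /\ 'J f x \in unitmx.
  apply: (filterI (smooth_near Hf)).
  have cd := smooth_cont (smooth_det (smooth_jac Hf)).
  have d0 : \det ('J f p) != 0 by rewrite -unitfE -unitmxE.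
  by apply: filterS (near_neq0 cd d0) => x; rewrite unitmxE unitfE.
have [r2 r20 Hr2] := near_ball (near_and nk nf).
have nk2 x (px : ball p r2 x) := (Hr2 x px).1.
have nf2 x (px : ball p r2 x) := (Hr2 x px).2.
have kL x y : ball p r2 x -> ball p r2 y -> `|k y - k x| <= 1 / 2 * `|y - x|.
  move=> px py; apply: le_trans (mean_value_ball (ltW c0) nk2 px py) _.
  by rewrite ler_wpM2r.
pose r := r2 / 2.
have r0 : 0 < r by rewrite divr_gt0.
have rr2 : r < r2 by rewrite /r ltr_pdivrMr // mulr_natr mulr2n ltrDl.
have Br x : `|p - x| <= r -> ball p r2 x by rewrite ball_rVE => /le_lt_trans; apply.
have pp : `|p - p| <= r by rewrite subrr normr0 ltW.
pose e := r / 2 / C; have e0 : 0 < e by rewrite !divr_gt0.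
pose V := [set y | `|f p - y| < e].
have fA x y : f x = y <-> k x + y *m A = x.
  split=> [<-|]; first by rewrite /k subrK.
  move/eqP; rewrite /k -addrA -subr_eq0 addrAC subrr add0r addrC subr_eq0 => /eqP E.
  by rewrite -[f x](mulmxKV uJ) -[y](mulmxKV uJ) E.
have ex y : V y -> exists2 x, `|p - x| <= r & f x = y.
  move=> Vy; pose T x := k x + y *m A.
  have Tp : `|p - T p| <= r / 2.
    rewrite /T /k opprD opprB addrA addrCA subrr addr0 -mulmxBl.
    by rewrite (le_trans (HA _)) // mulrC -ler_pdivlMr // ltW.
  have [] := @contraction_fixpoint p r (1 / 2) T (ltW r0).
  - by rewrite ltr_pdivrMr // mul1r ltr1n.
  - move=> x /Br px; apply: (@continuousD _ _ _ k (cst (y *m A))); last exact: cst_continuous.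
    exact: differentiable_continuous (nk2 _ px).1.
  - move=> x px; rewrite -(subrK (T p) p) -addrA (le_trans (ler_normD _ _)) //.
    have : `|T p - T x| <= 1 / 2 * `|p - x|.
      have -> : T p - T x = k p - k x by rewrite /T opprD addrACA subrr addr0.
      by apply: kL; apply: Br.
    move=> H; rewrite [leRHS](splitr r) lerD // (le_trans H) // mulrC mul1r.
    by rewrite ler_wpM2r.
  - move=> x z px pz.
    have -> : T z - T x = k z - k x by rewrite /T opprD addrACA subrr addr0.
    by apply: kL; apply: Br.
  by move=> x px /fA; exists x.
pose g y := xget p [set x | `|p - x| <= r /\ f x = y].
have gP y : V y -> `|p - g y| <= r /\ f (g y) = y.
  move=> /ex [x px fx]; rewrite /g; case: xgetP => [z _ //|/(_ x)].
  by case; split.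
have Linv x y : ball p r2 x -> ball p r2 y -> `|y - x| <= 2 * C * `|f y - f x|.
  move=> px py; have E : y - x = (k y - k x) + (f y - f x) *m A.
    rewrite /k mulmxBl; move: (f y *m A) (f x *m A) => a b.
    by apply/rowP => j; rewrite !mxE; ring.
  have : `|y - x| <= 1 / 2 * `|y - x| + C * `|f y - f x|.
    by rewrite {1}E (le_trans (ler_normD _ _)) // lerD // kL.
  by move=> H; lra.
exists g, [set x | ball p r2 x /\ V (f x)], V.
have oV : open V.
  by rewrite (_ : V = ball (f p) e); [exact: ball_open|apply/seteqP; split=> x; rewrite /V /= -ball_normE].
have oU : open [set x | ball p r2 x /\ V (f x)].
  rewrite openE => x [px Vx]; apply: filterI.
    by apply: open_nbhs_nbhs; split=> //; exact: ball_open.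
  apply: (smooth_cont (nf2 _ px).1); exact: open_nbhs_nbhs.
have Vfp : V (f p) by rewrite /V /= subrr normr0.
split; first by split=> //; split=> //; exact: ballxx.
have gU y : V y -> ball p r2 (g y) /\ f (g y) = y.
  by move=> /gP [H ->]; split=> //; exact: Br.
have sg y : V y -> {for y, continuous g} /\ forall u, differentiable g y /\ 'D_u g y = u *m invmx ('J f (g y)).
  move=> Vy; have [gy fgy] := gU _ Vy; have [sf uf] := nf2 _ gy.
  have nV : \forall z \near y, V z by apply: open_nbhs_nbhs.
  have [] := @inverse_differentiable f g (invmx ('J f (g y))) (2 * C) y.
  - exact: smooth_diff.
  - exact: mulmxV.
  - by apply: filterS nV => z /gU [].
  - by rewrite mulr_gt0.
  - apply: filterS nV => z /gU [gz fgz].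
    by have := Linv _ _ gy gz; rewrite fgz fgy.
  by move=> dg Dg; split; [exact: differentiable_continuous|].
split.
- move=> x [px Vx]; split=> //; have [gx fgx] := gU _ Vx.
  have := Linv _ _ px gx; rewrite fgx subrr normr0 mulr0 normr_le0 subr_eq0.
  by move/eqP.
- by move=> y Vy; have [gy fgy] := gU _ Vy; split=> //; split=> //; rewrite fgy.
(* Bootstrap: the derivative of [g] along [u] is the smooth function [u *m invmx ('J f x)] composed
   with [g], so it is as regular as [g] itself. *)
move=> y0 Vy0; exists V; split=> // l; elim: l => [|l IH].
  by move=> y Vy; have [] := sg _ Vy.
split=> [y Vy|u]; first by have [_ /(_ 0) []] := sg _ Vy.
apply: (@Ck_ext _ _ _ l V ((fun x => u *m invmx ('J f x)) \o g)) => //.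
  by move=> y Vy /=; have [_ /(_ u) [_ ->]] := sg _ Vy.
apply: (@Ck_comp _ _ _ _ l V [set x | ball p r2 x /\ V (f x)]) => //.
- exact: findim_rV.
- exact: findim_rV.
- by move=> y Vy; have [gy fgy] := gU _ Vy; split=> //; rewrite fgy.
apply: smooth_on_at => // x [px _]; have [sf uf] := nf2 _ px.
apply: smooth_rV => j; apply: smooth_mulmx => [i' j'|i' j'].
  exact: smooth_cst.
by apply: smooth_invmx => //; exact: smooth_jac.
Qed.

End InverseFunction.

Lemma near_cont (T U : topologicalType) (f : T -> U) (p : T) (P : U -> Prop) :
  {for p, continuous f} -> (\forall y \near f p, P y) -> \forall q \near p, P (f q).
Proof. by move=> cf H; exact: (cf [set y | P y]). Qed.

Lemma near_eq_continuous (T U : topologicalType) (f g : T -> U) (p : T) :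
  (\forall q \near p, f q = g q) -> {for p, continuous f} -> {for p, continuous g}.
Proof.
move=> E cf; have Ep : f p = g p by exact: (nbhs_singleton E).
by rewrite /prop_for /continuous_at -Ep; apply: cvg_trans cf; exact: near_eq_cvg.
Qed.

Lemma jac_id (R : realType) m (p : 'rV[R]_m) : 'J (@id 'rV[R]_m) p = 1%:M.
Proof.
apply: mulmx_inj => u; rewrite mulmx1.
by have <- := deriveEjacobian u (smooth_diff (smooth_id p)); rewrite derive_id.
Qed.

(** * Smooth maps into a manifold and smooth functions on it, in arbitrary smooth charts *)

Section ManifoldMaps.
Variables (R : realType) (n : nat) (M : manifold R n).
Implicit Types (x y : M) (c : chart R n M).

Definition sfun (W : normedModType R) (g : M -> W) x : Prop :=
  smooth_at (g \o param (chart_at x)) (chart_at x x).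

Lemma near_dom c x : dom c x -> \forall y \near x, dom c y.
Proof. by move=> cx; apply: open_nbhs_nbhs; split=> //; exact: dom_open. Qed.

Lemma near_img c x : dom c x -> \forall p \near c x, (c @` dom c) p.
Proof.
by move=> cx; apply: open_nbhs_nbhs; split; [exact: img_open|exists x].
Qed.

Lemma dom_param c p : (c @` dom c) p -> dom c (param c p).
Proof. by move=> [x cx <-]; rewrite coordK. Qed.

Lemma paramK c p : (c @` dom c) p -> c (param c p) = p.
Proof. by move=> [x cx <-]; rewrite coordK. Qed.

Lemma smooth_chart_at x : smooth_chart (chart_at x).
Proof. by move=> y; split; exact: chart_at_compat. Qed.

Lemma transition_smooth_at c c' x : transition_smooth c c' -> dom c x -> dom c' x ->
  smooth_at (c' \o param c) (c x).
Proof.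
move=> H cx c'x; exists (c @` (dom c `&` dom c')); split=> //; last by exists x.
rewrite openE => _ [y [cy c'y] <-].
have H1 := near_img cy.
have : \forall p \near c y, dom c' (param c p).
  apply: (near_cont (f := param c)); first by apply: param_continuous; exists y.
  by rewrite coordK //; exact: near_dom.
apply: filterS2 H1 => p /[dup] pc [z cz E] pc'.
by exists (param c p); [split=> //; exact: dom_param|exact: paramK].
Qed.

Lemma smooth_chart_trans c c' x : smooth_chart c -> smooth_chart c' -> dom c x -> dom c' x ->
  smooth_at (c' \o param c) (c x).
Proof.
move=> sc sc' cx c'x; have ax := chart_at_dom x.
have h1 := transition_smooth_at (sc x).1 cx ax.
have h2 := transition_smooth_at (sc' x).2 ax c'x.
have h : smooth_at ((c' \o param (chart_at x)) \o (chart_at x \o param c)) (c x).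
  apply: smooth_comp h1 _; [exact: findim_rV|exact: findim_rV|].
  by rewrite /= coordK.
apply: smooth_near_eq h.
have : \forall p \near c x, dom (chart_at x) (param c p).
  apply: (near_cont (f := param c)); first by apply: param_continuous; exists x.
  by rewrite coordK //; exact: near_dom.
by apply: filterS => p px /=; rewrite coordK.
Qed.

Lemma smooth_into_chart (V : normedModType R) (f : V -> M) p c : smooth_chart c ->
  dom c (f p) -> smooth_into f p -> smooth_at (c \o f) p.
Proof.
move=> sc cf [cont sf].
have h : smooth_at ((c \o param (chart_at (f p))) \o (chart_at (f p) \o f)) p.
  apply: smooth_comp sf _; [exact: findim_rV|exact: findim_rV|].
  apply: smooth_chart_trans => //; [exact: smooth_chart_at|exact: chart_at_dom].
apply: smooth_near_eq h.
by apply: filterS (near_cont cont (near_dom (chart_at_dom (f p)))) => q qd /=; rewrite coordK.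
Qed.

Lemma smooth_intoP (V : normedModType R) (f : V -> M) p c : smooth_chart c ->
  dom c (f p) -> {for p, continuous f} -> smooth_at (c \o f) p -> smooth_into f p.
Proof.
move=> sc cf cont sf; split=> //.
have h : smooth_at ((chart_at (f p) \o param c) \o (c \o f)) p.
  apply: smooth_comp sf _; [exact: findim_rV|exact: findim_rV|].
  apply: smooth_chart_trans => //; [exact: smooth_chart_at|exact: chart_at_dom].
apply: smooth_near_eq h.
by apply: filterS (near_cont cont (near_dom cf)) => q qd /=; rewrite coordK.
Qed.

Lemma smooth_into_near_eq (V : normedModType R) (f g : V -> M) p :
  (\forall q \near p, f q = g q) -> smooth_into f p -> smooth_into g p.
Proof.
move=> E [cf sf]; have Ep : f p = g p by exact: (nbhs_singleton E).
split; last first.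
  rewrite -Ep; apply: smooth_near_eq sf.
  by apply: filterS E => q /= ->.
exact: near_eq_continuous cf.
Qed.

Lemma smooth_into_comp (V W : normedModType R) (g : V -> W) (f : W -> M) p :
  findim W -> smooth_at g p -> smooth_into f (g p) -> smooth_into (f \o g) p.
Proof.
move=> fW sg [cf sf]; split.
  by apply: continuous_comp => //; exact: smooth_cont.
by apply: (smooth_comp (f := g) fW _ sg sf); exact: findim_rV.
Qed.

Lemma smooth_into_param c p : smooth_chart c -> (c @` dom c) p ->
  smooth_into (param c) p.
Proof.
move=> sc cp; apply: (smooth_intoP sc); first exact: dom_param.
  exact: param_continuous.
apply: smooth_near_eq (smooth_id p).
case: cp => x cx <-; apply: filterS (near_img cx) => q qc /=; by rewrite paramK.
Qed.

Lemma smooth_into_cst (V : normedModType R) (x : M) (p : V) : smooth_into (fun=> x) p.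
Proof. by split; [exact: cst_continuous|exact: smooth_cst]. Qed.

Lemma sfun_comp (V W : normedModType R) (f : V -> M) (g : M -> W) p : findim W ->
  smooth_into f p -> sfun g (f p) -> smooth_at (g \o f) p.
Proof.
move=> fW [cf sf] sg.
have h : smooth_at ((g \o param (chart_at (f p))) \o (chart_at (f p) \o f)) p.
  by apply: (smooth_comp (f := chart_at (f p) \o f) _ fW sf sg); exact: findim_rV.
apply: smooth_near_eq h.
by apply: filterS (near_cont cf (near_dom (chart_at_dom (f p)))) => q qd /=; rewrite coordK.
Qed.

Lemma sfun_chart c x : smooth_chart c -> dom c x -> sfun c x.
Proof.
move=> sc cx; apply: smooth_chart_trans => //; [exact: smooth_chart_at|exact: chart_at_dom].
Qed.

Lemma sfun_continuous (W : normedModType R) (g : M -> W) x : sfun g x ->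
  {for x, continuous g}.
Proof.
move=> sg; have ax := chart_at_dom x.
have cc : {for x, continuous ((g \o param (chart_at x)) \o chart_at x)}.
  by apply: continuous_comp; [exact: Defs.coord_continuous|exact: smooth_cont].
apply: near_eq_continuous cc.
by apply: filterS (near_dom ax) => y yd /=; rewrite coordK.
Qed.

Lemma sfun_post (W Z : normedModType R) (g : M -> W) (k : W -> Z) x :
  findim W -> findim Z -> sfun g x -> smooth_at k (g x) -> sfun (k \o g) x.
Proof.
move=> fW fZ sg sk.
apply: (smooth_comp (f := g \o param (chart_at x)) (g := k)) => //.
by rewrite /= coordK //; exact: chart_at_dom.
Qed.

Definition jacf m (g : M -> 'rV[R]_m) x : 'M[R]_(n, m) :=
  'J (g \o param (chart_at x)) (chart_at x x).

Lemma jac_sfun_comp d m (f : 'rV[R]_d -> M) (g : M -> 'rV[R]_m) p :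
  smooth_into f p -> sfun g (f p) -> 'J (g \o f) p = jac f p *m jacf g (f p).
Proof.
move=> sf sg; have [cf sf'] := sf.
have h1 := smooth_diff sf'; have h2 := smooth_diff sg.
rewrite /jac /jacf -(jac_comp h1 h2); apply: esym; apply: near_eq_jac.
  by apply: filterS (near_cont cf (near_dom (chart_at_dom (f p)))) => q qd /=; rewrite coordK.
exact: differentiable_comp.
Qed.

Lemma derive_sfun_comp (V : normedModType R) m (f : V -> M) (g : M -> 'rV[R]_m) p u :
  smooth_into f p -> sfun g (f p) ->
  'D_u (g \o f) p = 'D_u (chart_at (f p) \o f) p *m jacf g (f p).
Proof.
move=> sf sg; have [cf sf'] := sf.
have h1 := smooth_diff sf'; have h2 := smooth_diff sg.
transitivity ('D_u ((g \o param (chart_at (f p))) \o (chart_at (f p) \o f)) p).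
  apply: near_eq_derive.
  by apply: filterS (near_cont cf (near_dom (chart_at_dom (f p)))) => q qd /=; rewrite coordK.
rewrite (deriveE _ (differentiable_comp h1 h2)) (diff_comp h1 h2) /= /jacf.
by rewrite -(deriveE _ h1) -(deriveE _ h2) (deriveEjacobian _ h2).
Qed.

Lemma velocity_sfun m (f : R -> M) (g : M -> 'rV[R]_m) (t : R) :
  smooth_into f t -> sfun g (f t) ->
  'D_1 (g \o f) t = velocity f t *m jacf g (f t).
Proof. by move=> sf sg; rewrite /velocity derive1E; exact: derive_sfun_comp. Qed.

Lemma chart_vecE c x u : smooth_chart c -> dom c x -> chart_vec c x u = u *m jacf c x.
Proof.
move=> sc cx; rewrite /chart_vec /jacf; apply: deriveEjacobian.
by apply: smooth_diff; exact: sfun_chart.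
Qed.

Lemma jacf_chart_unit c x : smooth_chart c -> dom c x -> jacf c x \in unitmx.
Proof.
move=> sc cx; have ax := chart_at_dom x.
have h1 := smooth_diff (sfun_chart sc cx).
have h2 := smooth_diff (smooth_chart_trans sc (@smooth_chart_at x) cx ax).
have E : 'J ((chart_at x \o param c) \o (c \o param (chart_at x))) (chart_at x x) = 1%:M.
  transitivity ('J (@id 'rV[R]_n) (chart_at x x)).
    apply: esym; apply: near_eq_jac; last by [].
    have cp := @param_continuous _ _ _ (chart_at x) (chart_at x x) (ex_intro2 _ _ x ax erefl).
    have n1 : \forall p \near chart_at x x, dom c (param (chart_at x) p).
      by apply: (near_cont cp); rewrite coordK //; exact: near_dom.
    by apply: filterS2 n1 (near_img ax) => p pd pi /=; rewrite coordK // paramK.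
  exact: jac_id.
have h2' : differentiable (chart_at x \o param c) ((c \o param (chart_at x)) (chart_at x x)).
  by rewrite /= coordK.
move: E; rewrite (jac_comp h1 h2') => /mulmx1_unit[+ _]; exact.
Qed.

End ManifoldMaps.

Lemma pair_continuous (T U U' : topologicalType) (f : T -> U) (g : T -> U') (x : T) :
  {for x, continuous f} -> {for x, continuous g} ->
  {for x, continuous (fun y => (f y, g y))}.
Proof. by move=> cf cg; apply: cvg_pair; [exact: cf|exact: cg]. Qed.

(** * Integral curves: uniqueness and the group law of the flow *)

Section RealODE.
Variables (R : realType).

Lemma real_mean_value (f : R -> R) (a b K : R) :
  (forall x, Num.min a b <= x <= Num.max a b -> derivable f x 1 /\ `|'D_1 f x| <= K) ->
  `|f b - f a| <= K * `|b - a|.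
Proof.
have key (u v : R) : u <= v -> (forall x, u <= x <= v -> derivable f x 1 /\ `|'D_1 f x| <= K) ->
    `|f v - f u| <= K * `|v - u|.
  move=> uv H; have [x xi ->] : exists2 x, x \in `[u, v]%R & f v - f u = 'D_1 f x * (v - u).
    apply: MVT_segment => // [x|].
      rewrite in_itv /= => /andP[ux xv]; have [|df _] := H x; first by rewrite !ltW.
      exact: derivableP.
    apply: derivable_within_continuous => x; rewrite in_itv /= => xuv.
    by have [] := H x xuv.
  have [_ Hx] := H x xi; by rewrite normrM ler_wpM2r.
have [ab|ba] := leP a b; move=> H.
  by apply: key => // x xab; apply: H.
by rewrite distrC [in leRHS]distrC; apply: key => [|x xab]; [exact: ltW|apply: H].
Qed.

Lemma derivable1_continuous (W : normedModType R) (u : R -> W) (t : R) :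
  derivable u t 1 -> {for t, continuous u}.
Proof. by move=> /derivable1_diffP; exact: differentiable_continuous. Qed.

Lemma derive_repar (W : normedModType R) (f : R -> W) (tau : R -> R) (t : R) :
  differentiable tau t -> differentiable f (tau t) ->
  'D_1 (f \o tau) t = 'D_1 tau t *: 'D_1 f (tau t).
Proof.
move=> d1 d2.
have E1 := deriveE (1 : R) (differentiable_comp d1 d2).
have E2 : 'd (f \o tau) t 1 = 'd f (tau t) ('d tau t 1).
  exact: (congr1 (fun k : R -> W => k 1) (diff_comp d1 d2)).
have E3 : 'd tau t 1 = 'D_1 tau t *: (1 : R^o).
  by rewrite /GRing.scale /= mulr1; apply: esym; exact: deriveE.
have E4 : 'd f (tau t) ('D_1 tau t *: (1 : R^o)) = 'D_1 tau t *: 'd f (tau t) 1 by exact: linearZ.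
have E5 := deriveE (1 : R) d2.
exact: (etrans E1 (etrans E2 (etrans (congr1 _ E3) (etrans E4 (congr1 _ (esym E5)))))).
Qed.

Lemma derive_coef m n (V : normedModType R) (f : V -> 'M[R]_(m, n)) t u i j :
  derivable f t u ->
  derivable (fun s => f s i j) t u /\ 'D_u (fun s => f s i j) t = ('D_u f t) i j.
Proof.
by move=> df; split; [have /derivable_mxP := df; exact|rewrite derive_mx // mxE].
Qed.

(** On an interval of half-length [e] with [L * e <= 1/2], the maximum [g s] of the distance between
    the two solutions is at most half of itself, by the mean value inequality from [t0]; hence it is
    zero. *)
Lemma ode_local_unique n (Y : 'rV[R]_n -> 'rV[R]_n) (p : 'rV[R]_n) (r L : R)
    (u1 u2 : R -> 'rV[R]_n) (t0 : R) : 0 < r -> 0 <= L ->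
  (forall x y, ball p r x -> ball p r y -> `|Y y - Y x| <= L * `|y - x|) ->
  u1 t0 = p -> u2 t0 = p ->
  (\forall t \near t0, derivable u1 t 1 /\ 'D_1 u1 t = Y (u1 t)) ->
  (\forall t \near t0, derivable u2 t 1 /\ 'D_1 u2 t = Y (u2 t)) ->
  \forall t \near t0, u1 t = u2 t.
Proof.
move=> r0 L0 HL e1 e2 d1 d2.
have c (u : R -> 'rV[R]_n) : (\forall t \near t0, derivable u t 1 /\ 'D_1 u t = Y (u t)) -> u t0 = p ->
    \forall t \near t0, ball p r (u t).
  move=> /nbhs_singleton[du _] E.
  have cu := derivable1_continuous du.
  by apply: (near_cont cu); rewrite E; exact: nbhsx_ballx.
have [d d0 Hd] := near_ball (near_and (near_and d1 d2) (near_and (c _ d1 e1) (c _ d2 e2))).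
(* The summand 1 keeps the bound finite when [L = 0]. *)
pose e := Num.min (d / 2) (2 * L + 1)^-1.
have L1 : 0 < 2 * L + 1 by rewrite ltr_wpDl // mulr_ge0.
have e0 : 0 < e by rewrite lt_min divr_gt0 //= invr_gt0.
have ed : e < d by rewrite gt_min ltr_pdivrMr // ltr_pMr // ltr1n.
have Le : L * e <= 1 / 2.
  have : e <= (2 * L + 1)^-1 by rewrite ge_min lexx orbT.
  move=> /(ler_wpM2l L0) /le_trans; apply; rewrite ler_pdivrMr //; nra.
have Bt t : t0 - e <= t <= t0 + e -> ball t0 d t.
  by rewrite -ball_normE /= distrC -ler_distl => /le_lt_trans; apply.
pose g t := `|u1 t - u2 t|.
have cg : {within `[t0 - e, t0 + e], continuous g}.
  apply: continuous_in_subspaceT => t; rewrite inE /= in_itv /= => /Bt /Hd[[[h1 _] [h2 _]] _].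
  exact: (norm_sub_continuous (derivable1_continuous h1) (derivable1_continuous h2)).
have [s se smax] : exists2 c, c \in `[t0 - e, t0 + e]%R & forall t, t \in `[t0 - e, t0 + e]%R -> g t <= g c.
  by apply: EVT_max => //; rewrite lerD2l ge0_cp ?ltW.
have gs : g s <= 1 / 2 * g s.
  have gs_ge0 : 0 <= g s by exact: normr_ge0.
  apply: normrV_le => [|j]; first by lra.
  pose f t := (u1 t - u2 t) 0 j.
  have f0 : f t0 = 0 by rewrite /f e1 e2 subrr mxE.
  have -> : (u1 s - u2 s) 0 j = f s - f t0 by rewrite f0 subr0.
  apply: (@le_trans _ _ (L * g s * `|s - t0|)); last first.
    move: se; rewrite in_itv /= -ler_distl => se.
    rewrite mulrAC; apply: ler_wpM2r => //; apply: le_trans Le; exact: ler_wpM2l.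
  apply: real_mean_value => t tb.
  have te : t0 - e <= t <= t0 + e.
    move: tb; rewrite ge_min le_max => /andP[/orP tl /orP tr]; move: se; rewrite in_itv /=.
    by case: tl; case: tr => ? ? /andP[? ?]; apply/andP; split; lra.
  have [[[h1 E1] [h2 E2]] [b1 b2]] := Hd _ (Bt _ te).
  have dd : derivable (fun t => u1 t - u2 t) t 1 by exact: derivableB.
  have [df ->] := derive_coef 0 j dd; split=> //.
  apply: le_trans (normrV_coef _ _) _.
  have -> : 'D_1 (fun t => u1 t - u2 t) t = Y (u1 t) - Y (u2 t).
    by rewrite -E1 -E2; exact: deriveB.
  by apply: le_trans (HL _ _ b2 b1) _; apply: ler_wpM2l => //; exact: smax.
have gs_ge0 : 0 <= g s by exact: normr_ge0.
have gs0 : g s = 0 by lra.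
have : \forall t \near t0, `|t0 - t| < e by exact: nbhsx_ballx.
apply: filterS => t; rewrite distrC => /ltW; rewrite ler_distl => te.
by apply/eqP; rewrite -subr_eq0 -normr_le0 -gs0; apply: smax; rewrite in_itv.
Qed.

(** The form in which connectedness is used: uniqueness of integral curves and of lifts, the
    linearity of the flow in a chart and the constancy of an orientation sign are all reduced to one
    parameter that runs over the whole line. *)
Lemma real_clopen (S : set R) (t0 : R) : S t0 -> open S -> closed S -> forall t, S t.
Proof.
move=> S0 oS cS t; have /connected_intervalP cT : is_interval [set: R] by [].
have : S = setT; last by move=> ->.
by apply: cT; [exists t0|exists S; rewrite ?setTI|exists S; rewrite ?setTI].
Qed.

End RealODE.

Section Flow.
Variables (R : realType) (n : nat) (M : manifold R n).
Variables (X : vector_field M).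

Definition integral_curve (g : R -> M) : Prop :=
  forall t, smooth_into g t /\ velocity g t = X (g t).

Hypothesis sX : smooth_vector_field X.

Lemma integral_curve_near (g1 g2 : R -> M) (t : R) :
  (\forall s \near t, smooth_into g1 s /\ velocity g1 s = X (g1 s)) ->
  (\forall s \near t, smooth_into g2 s /\ velocity g2 s = X (g2 s)) ->
  g1 t = g2 t -> \forall s \near t, g1 s = g2 s.
Proof.
move=> i1 i2 E; set c := chart_at (g1 t).
have sc : smooth_chart c by exact: smooth_chart_at.
pose Y p := let y := param c p in chart_vec c y (X y).
have sY : smooth_at Y (c (g1 t)) by exact: sX.
pose K := \sum_i \sum_j `|('J Y (c (g1 t))) i j| + 1.
have HK : forall i j, `|('J Y (c (g1 t))) i j| < K.
  move=> i j; rewrite /K (bigD1 i) //= (bigD1 j) //= -!addrA ltrDl.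
  by rewrite !ltr_wpDl // sumr_ge0 // => k _; rewrite ?sumr_ge0.
have [r r0 Hr] := near_ball (near_jac_bound sY HK).
have K0 : 0 <= K by rewrite addr_ge0 // sumr_ge0 // => i _; rewrite sumr_ge0.
have LY := mean_value_ball K0 Hr.
have dom_near g : (\forall s \near t, smooth_into g s /\ velocity g s = X (g s)) -> g t = g1 t ->
    \forall s \near t, dom c (g s).
  move=> /nbhs_singleton[[cg _] _] Eg.
  by apply: (near_cont cg); rewrite Eg; apply: near_dom; exact: chart_at_dom.
have dY g : (\forall s \near t, smooth_into g s /\ velocity g s = X (g s)) -> g t = g1 t ->
    \forall s \near t, derivable (c \o g) s 1 /\ 'D_1 (c \o g) s = Y ((c \o g) s).
  move=> ig Eg; apply: filterS2 ig (dom_near _ ig Eg) => s [sg vg] ds; split.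
    by apply: diff_derivable; apply: smooth_diff; exact: smooth_into_chart.
  rewrite (velocity_sfun sg (sfun_chart sc ds)) vg /Y /= coordK // chart_vecE //.
have := @ode_local_unique R n Y (c (g1 t)) r (n%:R * K) (c \o g1) (c \o g2) t r0 _ LY.
rewrite /= E => /(_ (mulr_ge0 (ler0n _ _) K0) erefl erefl (dY _ i1 erefl) (dY _ i2 (esym E))).
apply: filterS3 (dom_near _ i1 erefl) (dom_near _ i2 (esym E)) => s s1 s2 Es /=.
by rewrite -(coordK s1) Es coordK.
Qed.

Lemma integral_curve_unique (g1 g2 : R -> M) (t0 : R) :
  integral_curve g1 -> integral_curve g2 -> g1 t0 = g2 t0 -> g1 = g2.
Proof.
move=> i1 i2 E; apply/funext; apply: (real_clopen (t0 := t0)) => //.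
- rewrite openE => t /= {}E.
  have n1 : \forall s \near t, smooth_into g1 s /\ velocity g1 s = X (g1 s) by apply: filterE => u; exact: i1.
  have n2 : \forall s \near t, smooth_into g2 s /\ velocity g2 s = X (g2 s) by apply: filterE => u; exact: i2.
  exact: (integral_curve_near n1 n2 E).
- have cg : continuous (fun t => (g1 t, g2 t)).
    by move=> t; apply: cvg_pair; [have [[]] := i1 t|have [[]] := i2 t].
  move=> t clt; apply: (@manifold_hausdorff _ _ M) => A B nA nB.
  have [[c1 _] _] := i1 t; have [[c2 _] _] := i2 t.
  have [s [/= Es [As Bs]]] := clt _ (near_and (near_cont c1 nA) (near_cont c2 nB)).
  by exists (g1 s); split=> //; rewrite Es.
Qed.

Lemma integral_curve_shift (g : R -> M) (a : R) :
  integral_curve g -> integral_curve (fun t => g (t + a)).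
Proof.
move=> ig t; have [sg vg] := ig (t + a).
have sa : smooth_at (fun t => t + a) t.
  by apply: smooth_add; [exact: smooth_id|exact: smooth_cst].
split.
  by apply: (smooth_into_comp (g := fun t => t + a)) => //; exact: findim_R.
rewrite -vg /velocity !derive1E.
have d1 : differentiable (chart_at (g (t + a)) \o g) (t + a).
  by apply: smooth_diff; exact: sg.2.
have d2 := smooth_diff sa.
have := derive_repar d2 d1.
have -> : 'D_1 (fun s => s + a) t = 1.
  by rewrite -derive1E derive1E deriveD // derive_id derive_cst addr0.
by rewrite scale1r.
Qed.

Variable Phi : R -> M -> M.
Hypothesis fPhi : is_flow X Phi.

Lemma flow0 x : Phi 0 x = x. Proof. by case: fPhi. Qed.

Lemma smooth_into_flow (V : normedModType R) (tau : V -> R) (f : V -> M) p : findim V ->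
  smooth_at tau p -> smooth_into f p -> smooth_into (fun q => Phi (tau q) (f q)) p.
Proof.
move=> fV st sf; have [_ sP _] := fPhi; set x := f p; set c := chart_at x.
have scf : smooth_at (c \o f) p by case: sf.
have sg : smooth_at (fun q => (tau q, c (f q))) p by exact: smooth_pair.
have h : smooth_into ((fun p : R * 'rV[R]_n => Phi p.1 (param c p.2)) \o
    (fun q => (tau q, c (f q)))) p.
  apply: smooth_into_comp => //; last exact: sP.
  by apply: findim_prod; [exact: findim_R|exact: findim_rV].
apply: smooth_into_near_eq h.
have [cf _] := sf.
by apply: filterS (near_cont cf (near_dom (chart_at_dom x))) => q qd /=; rewrite coordK.
Qed.

Lemma flow_integral_curve x : integral_curve (Phi^~ x).
Proof.
move=> t; have [_ _ vP] := fPhi; split=> //.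
by apply: (@smooth_into_flow _ id (fun=> x)) => //;
  [exact: findim_R|exact: smooth_id|exact: smooth_into_cst].
Qed.

(** [is_flow] does not contain the group law. Both sides are integral curves in [s] that agree at
    [s = 0]. *)
Lemma flowD s t x : Phi (s + t) x = Phi s (Phi t x).
Proof.
suff E : (fun s => Phi (s + t) x) = (Phi^~ (Phi t x)) by exact: (congr1 (fun f => f s) E).
apply: (integral_curve_unique (t0 := 0)); last by rewrite add0r flow0.
  exact: (integral_curve_shift t (flow_integral_curve x)).
exact: flow_integral_curve.
Qed.

Lemma flowK t x : Phi (- t) (Phi t x) = x.
Proof. by rewrite -flowD addNr flow0. Qed.

Lemma flow_continuous : continuous (fun p : R * M => Phi p.1 p.2).
Proof.
move=> [t x]; have [_ sP _] := fPhi; have [cP _] := sP t x; set c := chart_at x in cP *.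
have cc : {for (t, x), continuous (fun p : R * M => (p.1, c p.2))}.
  apply: (pair_continuous (f := fst)); first exact: cvg_fst.
  apply: (@continuous_comp _ _ _ snd c (t, x)); first exact: cvg_snd.
  by apply: Defs.coord_continuous; exact: chart_at_dom.
have h := @continuous_comp _ _ _ (fun p : R * M => (p.1, c p.2))
  (fun p : R * 'rV[R]_n => Phi p.1 (param c p.2)) (t, x) cc cP.
apply: near_eq_continuous h.
have : \forall p \near (t, x), dom c p.2.
  by apply: (near_cont (f := snd)); [exact: cvg_snd|apply: near_dom; exact: chart_at_dom].
by apply: filterS => p pd /=; rewrite coordK.
Qed.

End Flow.

(** Compactness as an induction on sets, which extracts uniform constants and finite families from
    local ones. The filter [F] consists of the families that contain every sufficiently large set
    with [P]; the near covering property then yields one set with [P] that contains [K]. *)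
Lemma compact_ind (T : topologicalType) (K : set T) (P : set T -> Prop) : compact K ->
  P set0 -> (forall A B, P A -> P B -> P (A `|` B)) ->
  (forall A B, A `<=` B -> P B -> P A) ->
  (forall x, K x -> exists2 U, nbhs x U & P U) -> P K.
Proof.
move=> /compact_near_coveringP cK P0 PU PS Pl.
pose F : set_system (set T) := [set Q | exists2 A, P A & forall B, P B -> A `<=` B -> Q B].
have FF : Filter F.
  split.
  - by exists set0.
  - move=> Q Q' [A PA HA] [A' PA' HA']; exists (A `|` A'); first exact: PU.
    move=> B PB sB; split; [apply: HA|apply: HA'] => // z Az; apply: sB; by [left|right].
  - by move=> Q Q' sQ [A PA HA]; exists A => // B PB sB; apply: sQ; exact: HA.
have := cK _ F (fun B x => B x) FF.
case=> [x Kx|A PA HA].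
  have [U nU PU'] := Pl _ Kx.
  exists (U, [set B | U `<=` B]); last by move=> [y B] /= [Uy]; exact.
  by split => //=; exists U.
exact: PS (HA A PA (fun _ => id)) PA.
Qed.

(** * The exponential and the linear hyperbolic flow *)

Section Exponential.
Variable R : realType.

Lemma D_expR (x : R) : 'D_1 expR x = expR x.
Proof. exact: (congr1 (fun f => f x) (derive_expR R)). Qed.

Lemma smooth_expR (t : R) : smooth_at (expR : R -> R) t.
Proof.
exists setT; split=> [|//|]; first exact: openT.
have D u (x : R) : 'D_u expR x = u * expR x.
  have d : differentiable (expR : R -> R) x by apply/derivable1_diffP; exact: derivable_expR.
  have E : 'd expR x (u *: (1 : R^o)) = u *: 'd expR x 1 by exact: linearZ.
  have E1 := deriveE (1 : R) d; have E2 := deriveE u d.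
  have E3 : u *: (1 : R^o) = u by rewrite /GRing.scale /= mulr1.
  rewrite E3 in E; rewrite E2 E -E1 /GRing.scale /=.
  by rewrite D_expR.
elim=> [|k IH]; first by move=> x _; exact: continuous_expR.
split=> [x _|u]; first by apply/derivable1_diffP; exact: derivable_expR.
have -> : 'D_u expR = (fun x => u * expR x) by apply/funext => x; exact: D.
by apply: Ck_mul => //; [exact: openT|exact: (@Ck_cst R R R^o)].
Qed.

Lemma quadratic_between (a b rho x1 x2 w : R) : 0 <= a ->
  a * x1 ^+ 2 - rho * x1 + b < 0 -> a * x2 ^+ 2 - rho * x2 + b < 0 -> x1 <= w <= x2 ->
  a * w ^+ 2 - rho * w + b < 0.
Proof.
move=> a0 q1 q2 /andP[x1w wx2].
have [E|ne] := eqVneq x1 w; first by rewrite -E.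
have lt1 : 0 < w - x1 by rewrite subr_gt0 lt_neqAle ne.
rewrite -(pmulr_rlt0 _ (_ : 0 < x2 - x1)); last by lra.
have -> : (x2 - x1) * (a * w ^+ 2 - rho * w + b) =
  (x2 - w) * (a * x1 ^+ 2 - rho * x1 + b) + (w - x1) * (a * x2 ^+ 2 - rho * x2 + b)
   - a * ((w - x1) * (x2 - w) * (x2 - x1)) by ring.
have h1 : (w - x1) * (a * x2 ^+ 2 - rho * x2 + b) < 0 by rewrite pmulr_rlt0.
have h2 : (x2 - w) * (a * x1 ^+ 2 - rho * x1 + b) <= 0.
  by rewrite mulr_ge0_le0 ?subr_ge0 // ltW.
have h3 : 0 <= a * ((w - x1) * (x2 - w) * (x2 - x1)).
  rewrite mulr_ge0 // mulr_ge0 ?mulr_ge0 //; lra.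
lra.
Qed.

End Exponential.

Section LinearFlow.
Variables (R : realType) (n : nat).
Implicit Types (s : pred 'I_n) (p : 'rV[R]_n) (t : R).

Definition sqn s p : R := \sum_(j < n | s j) p 0 j ^+ 2.

Definition linflow s t p : 'rV[R]_n :=
  \row_j (if s j then expR t * p 0 j else expR (- t) * p 0 j).

Lemma sqn_ge0 s p : 0 <= sqn s p.
Proof. by apply: sumr_ge0 => j _; exact: sqr_ge0. Qed.

Lemma sqn_split s p : \sum_j p 0 j ^+ 2 = sqn s p + sqn (predC s) p.
Proof. by rewrite (bigID s). Qed.

Lemma linflowN s t p : linflow (predC s) t p = linflow s (- t) p.
Proof. by apply/rowP => j; rewrite !mxE /=; case: (s j); rewrite ?opprK. Qed.

Lemma linflow0 s p : linflow s 0 p = p.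
Proof. by apply/rowP => j; rewrite !mxE oppr0 expR0 !mul1r; case: (s j). Qed.

Lemma sqn_linflow s t p : sqn s (linflow s t p) = expR t ^+ 2 * sqn s p.
Proof.
by rewrite /sqn big_distrr /=; apply: eq_bigr => j sj; rewrite mxE sj exprMn.
Qed.

Lemma sqn_linflowC s t p : sqn (predC s) (linflow s t p) = expR (- t) ^+ 2 * sqn (predC s) p.
Proof.
by rewrite /sqn big_distrr /=; apply: eq_bigr => j /negbTE sj; rewrite mxE sj exprMn.
Qed.

Lemma sqn_eq0 s p : (sqn s p == 0) = [forall j, s j ==> (p 0 j == 0)].
Proof.
rewrite /sqn psumr_eq0 => [|j _]; last exact: sqr_ge0.
apply/allP/forallP => H j; first by have := H j (mem_index_enum _); rewrite sqrf_eq0.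
by move=> _; have := H j; rewrite sqrf_eq0.
Qed.

Lemma sqn_eq0P s p j : sqn s p = 0 -> s j -> p 0 j = 0.
Proof. by move=> /eqP; rewrite sqn_eq0 => /forallP/(_ j)/implyP H /H /eqP. Qed.

(** In the variable [w = expR u ^+ 2], being in the ball at time [u] reads [a w^2 - rho w + b < 0]
    with [a >= 0]. This is a convex condition, so an orbit of the linear flow with both ends in the
    ball stays in it between them. *)
Lemma linflow_ball s t tau p (rho : R) : (0 <= tau <= t) \/ (t <= tau <= 0) ->
  \sum_j p 0 j ^+ 2 < rho -> \sum_j linflow s t p 0 j ^+ 2 < rho ->
  \sum_j linflow s tau p 0 j ^+ 2 < rho.
Proof.
move=> tt; rewrite !(sqn_split s) !sqn_linflow !sqn_linflowC.
set a := sqn s p; set b := sqn _ p => h0 ht.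
have a0 : 0 <= a by exact: sqn_ge0.
have key (u : R) : (expR u ^+ 2 * a + expR (- u) ^+ 2 * b < rho) =
    (a * (expR u ^+ 2) ^+ 2 - rho * expR u ^+ 2 + b < 0).
  have eu : 0 < expR u ^+ 2 by rewrite exprn_gt0 // expR_gt0.
  rewrite -subr_lt0 -(pmulr_rlt0 _ eu); congr (_ < 0).
  by rewrite expRN exprVn; field; rewrite gt_eqF // expR_gt0.
rewrite key in ht; rewrite key.
have {}h0 : a * 1 ^+ 2 - rho * 1 + b < 0 by lra.
have mono (x y : R) : x <= y -> expR x ^+ 2 <= expR y ^+ 2.
  by move=> xy; rewrite ler_pXn2r // ?nnegrE ?expR_ge0 // ler_expR.
have e0 : expR 0 ^+ 2 = 1 :> R by rewrite expR0 expr1n.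
case: tt => /andP[h1 h2].
  apply: (quadratic_between a0 h0 ht); apply/andP; split; last exact: mono.
  by rewrite -e0; exact: mono.
apply: (quadratic_between a0 ht h0); apply/andP; split; first exact: mono.
by rewrite -e0; exact: mono.
Qed.

Lemma smooth_linflow (V : normedModType R) s (tau : V -> R) (f : V -> 'rV[R]_n) (x : V) :
  findim V -> smooth_at tau x -> smooth_at f x ->
  smooth_at (fun q => linflow s (tau q) (f q)) x.
Proof.
move=> fV st sf; apply: smooth_rV => j.
have e (g : V -> R) : smooth_at g x -> smooth_at (fun q => expR (g q)) x.
  move=> sg; apply: (smooth_comp (f := g) (g := expR)) => //; [exact: findim_R|exact: findim_R|exact: smooth_expR].
have nt : smooth_at (fun q => - tau q) x.
  have -> : (fun q => - tau q) = (fun q => (-1) * tau q) by apply/funext => q; rewrite mulN1r.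
  by apply: smooth_mul => //; exact: smooth_cst.
under eq_fun do rewrite mxE; case: (s j).
  by apply: smooth_mul; [exact: e|exact: smooth_coef].
by apply: smooth_mul; [exact: e|exact: smooth_coef].
Qed.

Lemma linflow_derive s t p :
  'D_1 (fun t => linflow s t p) t = \row_j (if s j then linflow s t p 0 j else - linflow s t p 0 j).
Proof.
have d : derivable (fun t => linflow s t p) t 1.
  apply: diff_derivable; apply: smooth_diff.
  by apply: smooth_linflow; [exact: findim_R|exact: smooth_id|exact: smooth_cst].
apply/rowP => j; rewrite derive_mx // !mxE; under eq_fun do rewrite mxE.
case sj: (s j).
  have -> : (fun x : R => expR x * p 0 j) = expR * cst (p 0 j) by [].
  rewrite (deriveM (@derivable_expR R t) (derivable_cst _ _ _)) derive_cst D_expR.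
  by rewrite /GRing.scale /= mulr0 add0r mulrC.
have -> : (fun x : R => expR (- x) * p 0 j) = (expR \o -%R) * cst (p 0 j) by [].
have dN : differentiable (-%R : R -> R) t by apply/derivable1_diffP; exact: derivable_opp.
have dE : differentiable (expR : R -> R) (- t) by apply/derivable1_diffP; exact: derivable_expR.
have dNE : derivable (expR \o -%R : R -> R) t 1.
  by apply/derivable1_diffP; exact: differentiable_comp.
have DN : 'D_1 (-%R : R -> R) t = -1 by apply: derive_val.
rewrite (deriveM dNE (derivable_cst _ _ _)) derive_cst (derive_repar dN dE) DN D_expR /GRing.scale /=.
by rewrite mulr0 add0r mulN1r mulrN mulrC.
Qed.

End LinearFlow.

(** * Charts in which the flow is linear, and local stable manifolds *)

Section HyperbolicChart.
Variables (R : realType) (n : nat) (M : manifold R n).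

(** A set of properties that is invariant under [t |-> - t] together with [h |-> - h]. Statements on
    unstable manifolds are thus those on stable manifolds for the reversed flow. *)
Record gflow (h : M -> R) (Phi : R -> M -> M) : Prop := GFlow {
  gf0 : forall x, Phi 0 x = x;
  gfD : forall s t x, Phi (s + t) x = Phi s (Phi t x);
  gf_cont : continuous (fun p : R * M => Phi p.1 p.2);
  gf_smooth : forall m t (f : 'rV[R]_m -> M) p,
    smooth_into f p -> smooth_into (fun q => Phi t (f q)) p;
  gf_h : continuous h;
  gf_dec : forall x t, 0 <= t -> h (Phi t x) <= h x }.

Definition inb (r : R) (p : 'rV[R]_n) : Prop := \sum_j p 0 j ^+ 2 < r ^+ 2.

(** The expanding coordinates form an arbitrary predicate [s], so that time reversal merely replaces
    it by its complement. In [hc_flow] only the two end points have to lie in the ball; convexity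
    takes care of the points between. *)
Record hypchart (h : M -> R) (Phi : R -> M -> M) (v : M) (s : pred 'I_n)
    (c : chart R n M) (r : R) : Prop := HypChart {
  hc_smooth : smooth_chart c;
  hc_dom : dom c v;
  hc_0 : c v = 0;
  hc_r : 0 < r;
  hc_img : forall p, (c @` dom c) p <-> inb r p;
  hc_h : forall p, inb r p ->
    h (param c p) = h v - 2^-1 * sqn s p + 2^-1 * sqn (predC s) p;
  hc_flow : forall t p, inb r p -> inb r (linflow s t p) ->
    Phi t (param c p) = param c (linflow s t p) }.

Lemma sqnCC (s : pred 'I_n) (p : 'rV[R]_n) : sqn (predC (predC s)) p = sqn s p.
Proof. by apply: eq_bigl => j /=; rewrite negbK. Qed.

Lemma hypchart_rev h Phi v s c r : hypchart h Phi v s c r ->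
  hypchart (fun x => - h x) (fun t => Phi (- t)) v (predC s) c r.
Proof.
case=> a1 a2 a3 a4 a5 a6 a7; split=> // [p ip|t p ip it].
  by rewrite a6 // sqnCC; ring.
by rewrite linflowN in it *; exact: a7.
Qed.

Lemma gflow_rev h Phi : gflow h Phi -> gflow (fun x => - h x) (fun t => Phi (- t)).
Proof.
case=> a1 a2 a3 a4 a5 a6; split=> [x|s t x|p|m t f p|x|x t t0].
- by rewrite oppr0.
- by rewrite opprD.
- apply: (@continuous_comp _ _ _ (fun p : R * M => (- p.1, p.2)) (fun p => Phi p.1 p.2)); last exact: a3.
  apply: (pair_continuous (f := fun p => - p.1) (g := snd)); last exact: cvg_snd.
  by apply: (@continuous_comp _ _ _ fst -%R); [exact: cvg_fst|exact: opp_continuous].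
- exact: a4.
- by apply: (@continuous_comp _ _ _ h -%R); [exact: a5|exact: opp_continuous].
- rewrite lerN2; have := a6 (Phi (- t) x) t t0.
  by rewrite -a2 addrN a1.
Qed.

Variables (h : M -> R) (Phi : R -> M -> M).
Hypothesis gf : gflow h Phi.

Lemma gfK t x : Phi (- t) (Phi t x) = x.
Proof. by rewrite -(gfD gf) addNr (gf0 gf). Qed.

Lemma gfKN t x : Phi t (Phi (- t) x) = x.
Proof. by rewrite -(gfD gf) addrN (gf0 gf). Qed.

Lemma gf_contt t : continuous (Phi t).
Proof.
move=> x; apply: (@continuous_comp _ _ _ (fun x => (t, x)) (fun p => Phi p.1 p.2)).
  by apply: (pair_continuous (f := fun=> t) (g := id)); [exact: cst_continuous|exact: cvg_id].
exact: (gf_cont gf).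
Qed.

Lemma gf_h_mono x t t' : t <= t' -> h (Phi t' x) <= h (Phi t x).
Proof.
by move=> tt; rewrite -(subrK t t') (gfD gf); apply: (gf_dec gf); rewrite subr_ge0.
Qed.

Lemma Wplus_flow v x t : Wplus Phi v x -> Wplus Phi v (Phi t x).
Proof.
rewrite /Wplus /= => H; rewrite (_ : (fun s => _) = (fun s => Phi s x) \o (fun s => s + t)).
  apply: cvg_comp H; apply/cvgryPge => A.
  have : \forall s \near +oo%R, A - t <= s by exact: (nbhs_pinfty_ge (num_real _)).
  by apply: filterS => u; rewrite lerBlDr.
by apply/funext => s /=; rewrite (gfD gf).
Qed.

Lemma Wplus_flowP v x t : Wplus Phi v (Phi t x) <-> Wplus Phi v x.
Proof. by split=> [/(Wplus_flow (- t))|]; [rewrite gfK|exact: Wplus_flow]. Qed.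

Lemma Wplus_h_ge v x t : Wplus Phi v x -> h v <= h (Phi t x).
Proof.
move=> Wx; rewrite leNgt; apply/negP => lt.
have n1 : \forall z \near v, h (Phi t x) < h z.
  exact: (cvgr_gt (h v) (gf_h gf (x := v)) _ lt).
have : \forall s \near +oo%R, h (Phi t x) < h (Phi s x) by exact: (Wx _ n1).
move=> n2; have n3 : \forall s \near (+oo%R : set_system R), t <= s by exact: (nbhs_pinfty_ge (num_real _)).
have [s [h1 h2]] := filter_ex (filterI n2 n3).
by have := gf_h_mono x h2; rewrite leNgt h1.
Qed.

Lemma Wplus_unique v w x : Wplus Phi v x -> Wplus Phi w x -> v = w.
Proof. exact: (cvg_unique (@manifold_hausdorff _ _ M)). Qed.

Variables (v : M) (s : pred 'I_n) (c : chart R n M) (r : R).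
Hypothesis hc : hypchart h Phi v s c r.

(** A product neighbourhood inside the ball. Its separate bounds on the two parts ensure that a
    point leaving it along the expanding directions has sunk below the critical level. *)
Definition box (p : 'rV[R]_n) : Prop :=
  sqn s p < r ^+ 2 / 2 /\ sqn (predC s) p < r ^+ 2 / 2.

Lemma box_inb p : box p -> inb r p.
Proof. by case=> h1 h2; rewrite /inb (sqn_split s) [ltRHS]splitr ltrD. Qed.

Lemma inb_dom p : inb r p -> dom c (param c p).
Proof. by move=> /(hc_img hc) ip; exact: dom_param. Qed.

Lemma inb_K p : inb r p -> c (param c p) = p.
Proof. by move=> /(hc_img hc) ip; exact: paramK. Qed.

Lemma dom_inb x : dom c x -> inb r (c x).
Proof. by move=> cx; apply/(hc_img hc); exists x. Qed.

Lemma param0 : param c 0 = v.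
Proof. by rewrite -(hc_0 hc) coordK //; exact: hc_dom hc. Qed.

Lemma sqn_continuous (s' : pred 'I_n) : continuous (sqn s' : 'rV[R]_n -> R).
Proof.
move=> p; apply: smooth_cont; rewrite /sqn.
apply: smooth_sum => j _; under eq_fun do rewrite expr2.
by apply: smooth_mul; apply: smooth_coef; exact: smooth_id.
Qed.

Lemma box_near p : box p -> \forall q \near p, box q.
Proof.
case=> h1 h2; apply: near_and.
  exact: (cvgr_lt (sqn s p) (@sqn_continuous s p) _ h1).
exact: (cvgr_lt (sqn (predC s) p) (@sqn_continuous (predC s) p) _ h2).
Qed.

Lemma inb_near p : inb r p -> \forall q \near p, inb r q.
Proof.
move=> ip; have E q : inb r q = (sqn predT q < r ^+ 2) by [].
by rewrite /inb; exact: (cvgr_lt (sqn predT p) (@sqn_continuous predT p) _ ip).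
Qed.

Lemma sqn0 (s' : pred 'I_n) : sqn s' (0 : 'rV[R]_n) = 0.
Proof. by rewrite /sqn big1 // => j _; rewrite mxE expr0n. Qed.

Lemma r2_gt0 : 0 < r ^+ 2 / 2.
Proof. by rewrite divr_gt0 // exprn_gt0 // (hc_r hc). Qed.

Lemma box0 : box 0.
Proof. by split; rewrite sqn0 r2_gt0. Qed.

(* A point with a nonzero expanding part leaves the box through a point of level below [h v]. *)
Lemma exit_below p : box p -> 0 < sqn s p ->
  exists2 t, 0 <= t & h (Phi t (param c p)) < h v.
Proof.
move=> bp; have [b1 b2] := bp; set a := sqn s p in b1 *; set b := sqn _ p in b2 => a0.
have rho0 := r2_gt0; set rho := r ^+ 2 / 2 in b1 b2 rho0.
(* The time at which the squared expanding part has grown from [a] to [rho]. The contracting part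
   has then shrunk to [a * b / rho], which is below [rho], so the level is below [h v]. *)
pose t := ln (rho / a) / 2.
have et : expR t ^+ 2 = rho / a.
  by rewrite -expRM_natl /t mulrC divfK ?pnatr_eq0 // lnK // posrE divr_gt0.
have eN : expR (- t) ^+ 2 = a / rho by rewrite expRN exprVn et invf_div.
have b0 : 0 <= b by exact: sqn_ge0.
have e1 : sqn s (linflow s t p) = rho.
  by rewrite sqn_linflow et -/a divfK // gt_eqF.
have e2 : sqn (predC s) (linflow s t p) < rho.
  rewrite sqn_linflowC eN -/b mulrAC ltr_pdivrMr //; nra.
have it : inb r (linflow s t p).
  rewrite /inb (sqn_split s) e1 -[ltRHS](divfK (_ : 2 != 0 :> R)) ?pnatr_eq0 // -/rho.
  by rewrite mulr_natr mulr2n ltrD2l.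
exists t.
  by rewrite /t divr_ge0 // ln_ge0 // ler_pdivlMr // mul1r ltW.
rewrite (hc_flow hc) //; last exact: box_inb.
rewrite (hc_h hc) // e1; lra.
Qed.

Lemma stable_h (p : 'rV[R]_n) : box p -> (forall t, 0 <= t -> h v <= h (Phi t (param c p))) -> sqn s p = 0.
Proof.
move=> bp H; apply/eqP; rewrite eq_le sqn_ge0 andbT leNgt; apply/negP => a0.
by have [t t0] := exit_below bp a0; rewrite ltNge H.
Qed.

Lemma linflow_stable t (p : 'rV[R]_n) : sqn s p = 0 -> linflow s t p = expR (- t) *: p.
Proof.
move=> s0; apply/rowP => j; rewrite !mxE; case sj: (s j) => //.
by rewrite (sqn_eq0P s0 sj) !mulr0.
Qed.

Lemma inb_stable t (p : 'rV[R]_n) : inb r p -> sqn s p = 0 -> 0 <= t -> inb r (linflow s t p).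
Proof.
rewrite /inb !(sqn_split s) => ip s0 t0; rewrite sqn_linflow sqn_linflowC s0 mulr0 add0r.
rewrite s0 add0r in ip; apply: le_lt_trans ip.
by rewrite ler_piMl ?sqn_ge0 // exprn_ile1 ?expR_ge0 // expR_le1 oppr_le0.
Qed.

Lemma stable_Wplus p : inb r p -> sqn s p = 0 -> Wplus Phi v (param c p).
Proof.
move=> ip s0.
have cl : (fun t : R => expR (- t) *: p) @ +oo --> (0 : 'rV[R]_n).
  rewrite -(scale0r p); apply: cvgZr_tmp; exact: cvgr_expR.
have cp : {for 0, continuous (param c)}.
  by apply: param_continuous; apply/(hc_img hc); apply: box_inb; exact: box0.
have : param c (expR (- t) *: p) @[t --> +oo] --> param c 0.
  exact: (cvg_comp _ _ cl cp).
rewrite param0; apply: cvg_trans; apply: near_eq_cvg.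
have : \forall t \near +oo%R, 0 <= t :> R by exact: (nbhs_pinfty_ge (num_real _)).
apply: filterS => t t0.
by rewrite (hc_flow hc) //; [rewrite linflow_stable|exact: inb_stable].
Qed.

(** A point of the stable manifold stays at levels at least [h v] forever, whereas a nonzero
    expanding part would bring it below [h v]. Monotonicity of [h] thus excludes excursions out of
    the chart and back. *)
Lemma stable_boxP p : box p -> Wplus Phi v (param c p) <-> sqn s p = 0.
Proof.
move=> bp; split=> [Wp|]; last exact/stable_Wplus/box_inb.
by apply: stable_h => // t _; exact: Wplus_h_ge.
Qed.

Lemma near_box : \forall x \near v, dom c x /\ box (c x).
Proof.
apply: near_and; first exact: near_dom (hc_dom hc).
apply: (near_cont (Defs.coord_continuous (hc_dom hc))).
by rewrite (hc_0 hc); apply: box_near; exact: box0.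
Qed.

Lemma Wplus_box x : Wplus Phi v x -> \forall t \near +oo%R, dom c (Phi t x) /\ box (c (Phi t x)).
Proof. by move=> Wx; exact: (Wx _ near_box). Qed.

End HyperbolicChart.

(** * Consequences of the Morse-Smale hypothesis for the flow *)

Section FromMorseSmale.
Variables (R : realType) (n : nat) (M : manifold R n).
Variables (h : M -> R) (X : vector_field M) (Phi : R -> M -> M).
Hypothesis hMS : morse_smale h X Phi.
Hypothesis cM : closed_manifold M.

Definition idx_pred (q : nat) : pred 'I_n := fun j => (j < q)%N.

Lemma closed_eq_fun (T : topologicalType) (f g : T -> M) :
  continuous f -> continuous g -> closed [set t | f t = g t].
Proof.
move=> cf cg t clt; apply: (@manifold_hausdorff _ _ M) => A B nA nB.
have [s [/= Es [As Bs]]] := clt _ (near_and (near_cont (cf t) nA) (near_cont (cg t) nB)).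
by exists (f s); split=> //; rewrite Es.
Qed.

Let sX := ms_smooth hMS.
Let fl := ms_flow hMS.

Lemma derive_h (f : R -> M) (t : R) : smooth_into f t -> 'D_1 (h \o f) t = dfun h (f t) (velocity f t).
Proof.
move=> sf; have [cf sf'] := sf; have sh : sfun h (f t) by exact: (ms_morse hMS).1.
have h1 := smooth_diff sf'; have h2 := smooth_diff sh.
transitivity ('D_1 ((h \o param (chart_at (f t))) \o (chart_at (f t) \o f)) t).
  apply: near_eq_derive.
  by apply: filterS (near_cont cf (near_dom (chart_at_dom (f t)))) => q qd /=; rewrite coordK.
have E1 := deriveE (1 : R) (differentiable_comp h1 h2).
have E2 := congr1 (fun k : R -> R => k 1) (diff_comp h1 h2).
have E3 := deriveE (1 : R) h1; have E4 := deriveE (velocity f t) h2.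
rewrite E1 E2 /= /dfun E4; congr (_ _); rewrite /velocity derive1E E3 //.
Qed.

Section LocalChart.
Variables (v : M) (c : chart R n M) (r : R).
Hypothesis r0 : 0 < r.
Hypothesis sc : smooth_chart c.
Hypothesis img : c @` dom c = [set p | \sum_(j < n) p 0 j ^+ 2 < r ^+ 2].
Hypothesis HX : forall x, dom c x -> chart_vec c x (X x) =
  \row_(j < n) (if (j < morse_index h v)%N then c x 0 j else - c x 0 j).

Let s := idx_pred (morse_index h v).

Lemma local_flow t p : inb r p -> inb r (linflow s t p) ->
  Phi t (param c p) = param c (linflow s t p).
Proof.
have imgP q : inb r q -> (c @` dom c) q by rewrite img.
(* The reparametrization [t * sin^2] maps the whole line onto the segment between 0 and [t]. The
   linear orbit then stays in the chart for all [u], and the open-closed argument on the line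
   applies; [u = pi / 2] gives the time [t]. *)
move=> ip it; pose sg (u : R) := t * (sin u * sin u).
pose g u := param c (linflow s u p).
have is_ u : inb r (linflow s (sg u) p).
  apply: linflow_ball ip it; rewrite /sg.
  have s0 : 0 <= sin u * sin u by rewrite -expr2 sqr_ge0.
  have s1 : sin u * sin u <= 1 by rewrite -expr2 -(cos2Dsin2 u) lerDr sqr_ge0.
  by have [t0|t0] := leP 0 t; [left|right]; apply/andP; split; nra.
have csg : continuous sg.
  move=> u; apply: (@continuousM _ _ (cst t) (fun u => sin u * sin u)); first exact: cst_continuous.
  by apply: (@continuousM _ _ (@sin R) (@sin R)); exact: continuous_sin.
have slin u : smooth_at (fun u => linflow s u p) u.
  by apply: smooth_linflow; [exact: findim_R|exact: smooth_id|exact: smooth_cst].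
have sm u : inb r (linflow s u p) -> smooth_into g u.
  move=> iu; apply: (smooth_into_comp (g := fun u => linflow s u p)); [exact: findim_rV|exact: slin|].
  by apply: smooth_into_param => //; exact: imgP.
have cP : continuous (Phi^~ (param c p)).
  by move=> u; have [[]] := flow_integral_curve fl (param c p) u.
have nin u : inb r (linflow s u p) -> \forall u' \near u, inb r (linflow s u' p).
  move=> iu; apply: (near_cont (f := fun u => linflow s u p)).
    exact: smooth_cont (slin u).
  exact: inb_near.
suff H : forall u, Phi (sg u) (param c p) = g (sg u).
  by have := H (pi / 2); rewrite /sg sin_pihalf !mulr1.
apply: (@real_clopen _ [set u | Phi (sg u) (param c p) = g (sg u)] 0).
- by rewrite /= /g /sg sin0 !mulr0 (flow0 fl) linflow0.
- rewrite openE => u /= E; rewrite /interior.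
  apply: (@near_cont _ _ sg u (fun u => Phi u (param c p) = g u) (csg u)).
  apply: (integral_curve_near sX _ _ E).
    by apply: filterE => u'; exact: flow_integral_curve.
  have iu := is_ u; have n1 := nin _ iu.
  have n2 : \forall u' \near sg u, \forall u2 \near u', inb r (linflow s u2 p) by exact: near_join.
  apply: filterS2 n1 n2 => u' iu' nu'; split; first exact: sm.
  have gd : dom c (g u') by apply: dom_param; exact: imgP.
  apply: (can_inj (mulmxK (jacf_chart_unit sc gd))).
  rewrite -(chart_vecE (X (g u')) sc gd) HX //.
  have <- := velocity_sfun (sm _ iu') (sfun_chart sc gd).
  rewrite (near_eq_derive _ (_ : \forall u2 \near u', (c \o g) u2 = linflow s u2 p)); last first.
    by apply: filterS nu' => u2 iu2 /=; rewrite paramK //; exact: imgP.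
  by rewrite linflow_derive {1 2}/g paramK //; exact: imgP.
apply: (@closed_eq_fun R (fun u => Phi (sg u) (param c p)) (fun u => g (sg u))).
  by move=> u; apply: (@continuous_comp _ _ _ sg (Phi^~ (param c p))); [exact: csg|exact: cP].
move=> u; apply: (@continuous_comp _ _ _ sg g); first exact: csg.
by have [] := sm _ (is_ u).
Qed.

End LocalChart.

Lemma gl_chart v : crit h v -> exists c r, [/\ smooth_chart c, dom c v, c v = 0, 0 < r &
  [/\ forall p, (c @` dom c) p <-> inb r p,
   forall p, inb r p -> h (param c p) = h v - 2^-1 * sqn (idx_pred (morse_index h v)) p
      + 2^-1 * sqn (predC (idx_pred (morse_index h v))) p &
   forall t p, inb r p -> inb r (linflow (idx_pred (morse_index h v)) t p) ->
    Phi t (param c p) = param c (linflow (idx_pred (morse_index h v)) t p)]].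
Proof.
move=> cv; have [_ /(_ _ cv) [c [r [sc cdv c0 [r0 img] H]]]] := ms_gradient_like hMS.
exists c, r; split=> //.
have imgP p : (c @` dom c) p <-> inb r p by rewrite img.
split=> // [p ip|t p ip it].
  have [-> _] := H _ (dom_param (proj2 (imgP p) ip)).
  rewrite paramK; last exact/imgP.
  congr (_ + _ * _); apply: eq_bigl => j; by rewrite /= /idx_pred -leqNgt.
apply: (@local_flow v c r) => // x /H[_] //.
Qed.

(** The centre of the chart is fixed by the linear flow. *)
Lemma crit_flow v t : crit h v -> Phi t v = v.
Proof.
move=> cv; have [c [r [sc cdv c0 r0 [imgP _ fP]]]] := gl_chart cv.
have i0 : inb r (0 : 'rV[R]_n).
  by rewrite /inb big1 => [|j _]; rewrite ?mxE ?expr0n // exprn_gt0.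
have l0 : linflow (idx_pred (morse_index h v)) t 0 = 0 :> 'rV[R]_n.
  by apply/rowP => j; rewrite !mxE !mulr0 if_same.
have vE : param c 0 = v by rewrite -c0 coordK.
by have := fP t 0 i0; rewrite l0 vE; exact.
Qed.

Lemma noncrit_flow x t : ~ crit h x -> ~ crit h (Phi t x).
Proof.
by move=> nx cx; apply: nx; rewrite -(flowK sX fl t x) crit_flow.
Qed.

Lemma h_flow_derive x t : derivable (fun t => h (Phi t x)) t 1 /\
  'D_1 (fun t => h (Phi t x)) t = dfun h (Phi t x) (X (Phi t x)).
Proof.
have [sf vf] := flow_integral_curve fl x t; split.
  apply: diff_derivable; apply: smooth_diff.
  apply: (sfun_comp (f := Phi^~ x) (g := h)) => //; first exact: findim_R.
  exact: (ms_morse hMS).1.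
by rewrite -vf -derive_h.
Qed.

Lemma h_strict x t : ~ crit h x -> 0 < t -> h (Phi t x) < h x.
Proof.
move=> nx t0; rewrite -{2}(flow0 fl x).
apply: (@ltr0_derive1_decr _ (fun t => h (Phi t x)) 0 t) => //.
- by move=> u _; have [] := h_flow_derive x u.
- move=> u _; rewrite derive1E (h_flow_derive x u).2.
  exact: (ms_gradient_like hMS).1 (noncrit_flow nx).
apply: derivable_within_continuous => u _; by have [] := h_flow_derive x u.
Qed.

Lemma h_continuous : continuous h.
Proof. by move=> x; apply: sfun_continuous; exact: (ms_morse hMS).1. Qed.

Lemma ms_gflow : gflow h Phi.
Proof.
split=> [x|s t x|p|m t f p sf|x|x t t0].
- exact: flow0 fl x.
- exact: (flowD sX fl).
- exact: flow_continuous fl p.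
- by apply: (smooth_into_flow fl (tau := fun=> t)) => //; [exact: findim_rV|exact: smooth_cst].
- exact: h_continuous.
have [cx|nx] := pselect (crit h x); first by rewrite crit_flow.
move: t0; rewrite le_eqVlt => /predU1P[<-|t0]; first by rewrite (flow0 fl).
exact/ltW/h_strict.
Qed.

Lemma ms_hypchart v : crit h v ->
  exists c r, hypchart h Phi v (idx_pred (morse_index h v)) c r.
Proof.
move=> cv; have [c [r [sc cdv c0 r0 [imgP hP fP]]]] := gl_chart cv.
by exists c, r.
Qed.

(** Off the critical points [h] decreases strictly, so criticality becomes an equality of two
    continuous functions. This gives the closedness of [crit h] without any continuity of the
    differential of [h]. *)
Lemma critP x : crit h x <-> h (Phi 1 x) = h x.
Proof.
split=> [cx|E]; first by rewrite crit_flow.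
apply: contrapT => nx; have := h_strict nx ltr01; by rewrite E ltxx.
Qed.

Lemma crit_closed : closed (crit h).
Proof.
have -> : crit h = [set x | h (Phi 1 x) = h x] by apply/seteqP; split=> x /critP.
have cf : continuous (fun x => h (Phi 1 x) - h x).
  move=> x; apply: continuousB; last exact: h_continuous.
  apply: (@continuous_comp _ _ _ (Phi 1) h); last exact: h_continuous.
  exact: (gf_contt ms_gflow (t := 1) (x := x)).
have -> : [set x | h (Phi 1 x) = h x] = (fun x => h (Phi 1 x) - h x) @^-1` [set 0].
  by apply/seteqP; split=> x /= => [->|/eqP]; rewrite ?subrr // subr_eq0 => /eqP.
by apply: closed_comp; [move=> x _; exact: cf|exact: closed_eq].
Qed.

(** A critical point is fixed by the flow, and the linear flow fixes only the origin. The time used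
    is so small that the point is certain to remain in the chart. *)
Lemma crit_isolated v : crit h v -> \forall x \near v, crit h x -> x = v.
Proof.
move=> cv; have [c [r hc]] := ms_hypchart cv; set s := idx_pred _ in hc.
apply: filterS (near_box hc) => x [dx bx] cx.
have ix := dom_inb hc dx.
have nin : \forall t \near (0 : R), inb r (linflow s t (c x)).
  apply: (near_cont (f := fun t => linflow s t (c x))).
    apply: smooth_cont.
    by apply: smooth_linflow; [exact: findim_R|exact: smooth_id|exact: smooth_cst].
  by rewrite linflow0; exact: inb_near.
have [e e0 He] := near_ball nin.
have it : inb r (linflow s (e / 2) (c x)).
  apply: He; rewrite -ball_normE /= sub0r normrN gtr0_norm ?divr_gt0 //.
  by rewrite ltr_pdivrMr // ltr_pMr // ltr1n.
have E : c x = linflow s (e / 2) (c x).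
  rewrite -[RHS](inb_K hc it) -(hc_flow hc ix it) coordK //.
  by rewrite (crit_flow _ cx).
have e20 : 0 < e / 2 by rewrite divr_gt0.
have c0 : c x = 0.
  apply/rowP => j; have := congr1 (fun p : 'rV[R]_n => p 0 j) E; rewrite !mxE.
  case: (s j) => /eqP.
    rewrite -subr_eq0 -{1}[c x 0 j]mul1r -mulrBl mulf_eq0 subr_eq0 => /orP[/eqP e1|/eqP //].
    by have := expR_gt1 (e / 2); rewrite -e1 ltxx e20.
  rewrite -subr_eq0 -{1}[c x 0 j]mul1r -mulrBl mulf_eq0 subr_eq0 => /orP[/eqP e1|/eqP //].
  by have := expR_lt1 (- (e / 2)); rewrite -e1 ltxx oppr_lt0 e20.
by rewrite -(coordK dx) c0; exact: (param0 hc).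
Qed.

Lemma crit_finite : finite_set (crit h).
Proof.
have := @compact_ind M setT (fun A => finite_set (A `&` crit h)) cM.
rewrite setTI; apply.
- by rewrite set0I.
- by move=> A B fA fB; rewrite setIUl finite_setU.
- by move=> A B AB; apply: sub_finite_set; exact: setSI.
move=> x _; have [cx|nx] := pselect (crit h x).
  exists [set y | crit h y -> y = x]; first exact: crit_isolated.
  by apply: (@sub_finite_set _ _ [set x]) => // y [/= Hy cy]; exact: Hy.
exists (~` crit h); last by rewrite setICl.
by apply: open_nbhs_nbhs; split=> //; apply: closed_openC; exact: crit_closed.
Qed.

(** By compactness the orbit has a cluster point [w]. The values of [h] on the orbit stay at least
    [h w], which forces [h (Phi 1 w) = h w], so [w] is critical. The orbit enters the box around [w]
    and never falls below [h w], hence it lies on the local stable manifold there. *)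
Lemma ms_conv x : exists2 w, crit h w & Wplus Phi w x.
Proof.
have [w [_ clw]] := cM (F := Phi^~ x @ +oo%R) _ filterT.
have gf := ms_gflow.
have nr : \forall u \near +oo%R, range (Phi^~ x) (Phi u x) by apply: filterE => u; exists u.
have hlim t : h w <= h (Phi t x).
  rewrite leNgt; apply/negP => lt.
  have n1 : \forall z \near w, h (Phi t x) < h z by exact: (cvgr_gt (h w) (gf_h gf (x := w)) _ lt).
  have n2 : \forall u \near +oo%R, t <= u :> R by exact: (nbhs_pinfty_ge (num_real _)).
  have [z [[u tu <-] /= lz]] : (Phi^~ x @` [set u | t <= u] `&` [set z | h (Phi t x) < h z]) !=set0.
    apply: clw => //; rewrite /fmap /=; apply: filterS n2 => u tu; by exists u.
  by have := gf_h_mono gf x tu; rewrite leNgt lz.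
have cw : crit h w.
  apply: contrapT => nw; have lt := h_strict nw ltr01.
  have n1 : \forall z \near w, h (Phi 1 z) < h w.
    apply: (cvgr_lt (h (Phi 1 w)) _ _ lt).
    by apply: (@continuous_comp _ _ _ (Phi 1) h); [exact: (gf_contt gf (t := 1) (x := w))|exact: h_continuous].
  have [z [[u _ <-] /= lz]] : (range (Phi^~ x) `&` [set z | h (Phi 1 z) < h w]) !=set0.
    exact: (clw _ _ nr n1).
  by have := hlim (1 + u); rewrite (gfD gf) leNgt lz.
exists w => //; have [c [r hc]] := ms_hypchart cw.
have [z [[u _ <-] [/= du bu]]] : (range (Phi^~ x) `&` [set z | dom c z /\ box (idx_pred (morse_index h w)) r (c z)]) !=set0.
  exact: (clw _ _ nr (near_box hc)).
apply/(Wplus_flowP gf w x u); rewrite -(coordK du); apply/(stable_boxP gf hc bu).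
by apply: (stable_h hc bu) => t _; rewrite coordK // -(gfD gf).
Qed.

Lemma morse_index_le v : (morse_index h v <= n)%N.
Proof. by apply/bigmax_leqP => i _; rewrite -ltnS. Qed.

End FromMorseSmale.

(** * Global parametrization of unstable manifolds and local equations of stable manifolds *)

Section Embedding.
Variables (R : realType) (m n : nat).
Hypothesis mn : (m <= n)%N.

Definition em (x : 'rV[R]_m) : 'rV[R]_n := x *m (pid_mx m : 'M[R]_(m, n)).
Definition pm (p : 'rV[R]_n) : 'rV[R]_m := p *m (pid_mx m : 'M[R]_(n, m)).
Definition nsq k (x : 'rV[R]_k) : R := \sum_j x 0 j ^+ 2.

Lemma pmE p i : pm p 0 i = p 0 (widen_ord mn i).
Proof.
rewrite mxE (bigD1 (widen_ord mn i)) //= big1 ?addr0 => [|j ji].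
  by rewrite mxE eqxx /= ltn_ord mulr1.
rewrite mxE (_ : (j == i :> nat) = false) ?mulr0 //.
by apply/negbTE; apply: contra ji => /eqP ji; apply/eqP/val_inj.
Qed.

Lemma emE x i : em x 0 (widen_ord mn i) = x 0 i.
Proof.
rewrite mxE (bigD1 i) //= big1 ?addr0 => [|j ji].
  by rewrite mxE eqxx /= ltn_ord mulr1.
rewrite mxE (_ : (j == i :> nat) = false) ?mulr0 //.
by apply/negbTE; apply: contra ji => /eqP ji; apply/eqP/val_inj.
Qed.

Lemma emE0 x (j : 'I_n) : (m <= j)%N -> em x 0 j = 0.
Proof.
move=> mj; rewrite mxE big1 // => i _; rewrite mxE (_ : (i == j :> nat) = false) ?mulr0 //.
by apply/negbTE; rewrite neq_ltn (leq_trans (ltn_ord i) mj).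
Qed.

Lemma emK x : pm (em x) = x.
Proof. by apply/rowP => i; rewrite pmE emE. Qed.

Let s := @idx_pred n m.

Lemma sqn_pm p : sqn s p = nsq (pm p).
Proof.
rewrite /sqn /nsq (big_ord_narrow mn); apply: eq_bigr => i _; by rewrite pmE.
Qed.

Lemma sqn_em x : sqn s (em x) = nsq x.
Proof. by rewrite sqn_pm emK. Qed.

Lemma sqnC_em x : sqn (predC s) (em x) = 0.
Proof.
by rewrite /sqn big1 // => j /=; rewrite -leqNgt => mj; rewrite emE0 // expr0n.
Qed.

Lemma pmK p : sqn (predC s) p = 0 -> em (pm p) = p.
Proof.
move=> s0; apply/rowP => j; have [jm|mj] := ltnP j m; last first.
  by rewrite emE0 // (sqn_eq0P s0) //= -leqNgt.
have -> : j = widen_ord mn (Ordinal jm) by exact/val_inj.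
by rewrite emE pmE.
Qed.

Lemma pm_linflow t p : pm (linflow s t p) = expR t *: pm p.
Proof. by apply/rowP => i; rewrite [RHS]mxE !pmE mxE /s /idx_pred /= ltn_ord. Qed.

Lemma em_linflow t x : linflow s t (em x) = em (expR t *: x).
Proof.
apply/rowP => j; rewrite [LHS]mxE; have [jm|mj] := ltnP j m; last first.
  by rewrite /s /idx_pred ltnNge mj /= !emE0 // mulr0.
have -> : j = widen_ord mn (Ordinal jm) by exact/val_inj.
by rewrite /s /idx_pred /= jm !emE mxE.
Qed.

Lemma nsqZ k (a : R) (x : 'rV[R]_k) : nsq (a *: x) = a ^+ 2 * nsq x.
Proof. by rewrite /nsq mulr_sumr; apply: eq_bigr => j _; rewrite mxE exprMn. Qed.

Lemma nsq_ge0 k (x : 'rV[R]_k) : 0 <= nsq x.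
Proof. by apply: sumr_ge0 => j _; exact: sqr_ge0. Qed.

Lemma nsq_eq0 k (x : 'rV[R]_k) : nsq x = 0 -> x = 0.
Proof.
move=> /eqP; rewrite psumr_eq0 => [/allP H|j _]; last exact: sqr_ge0.
by apply/rowP => j; have := H j (mem_index_enum _); rewrite /= sqrf_eq0 mxE => /eqP.
Qed.

Lemma nsq_smooth k (x : 'rV[R]_k) : smooth_at (@nsq k) x.
Proof.
apply: smooth_sum => j _; under eq_fun do rewrite expr2.
by apply: smooth_mul; apply: smooth_coef; exact: smooth_id.
Qed.

Lemma nsq_continuous k : continuous (@nsq k).
Proof. by move=> x; apply: smooth_cont; exact: nsq_smooth. Qed.

Lemma em_smooth (V : normedModType R) (f : V -> 'rV[R]_m) p :
  smooth_at f p -> smooth_at (fun x => em (f x)) p.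
Proof. exact: smooth_mulmxr. Qed.

Lemma pm_smooth (V : normedModType R) (f : V -> 'rV[R]_n) p :
  smooth_at f p -> smooth_at (fun x => pm (f x)) p.
Proof. exact: smooth_mulmxr. Qed.

Lemma scale_smooth (V : normedModType R) k (a : R) (f : V -> 'rV[R]_k) p :
  smooth_at f p -> smooth_at (fun x => a *: f x) p.
Proof.
by move=> sf; apply: smooth_scale => //; [exact: findim_rV|exact: smooth_cst].
Qed.

End Embedding.

Section InvariantManifolds.
Variables (R : realType) (n : nat) (M : manifold R n).
Variables (h : M -> R) (Phi : R -> M -> M).
Hypothesis gf : gflow h Phi.
Variables (v : M) (m : nat) (c : chart R n M) (r : R).
Hypothesis mn : (m <= n)%N.
Let s := @idx_pred n m.
Hypothesis hc : hypchart h Phi v s c r.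

Lemma sfun_flow (W : normedModType R) (g : M -> W) t x : findim W ->
  sfun g (Phi t x) -> sfun (g \o Phi t) x.
Proof.
move=> fW sg; have ax := chart_at_dom x.
apply: (@sfun_comp R n M _ W (fun p => Phi t (param (chart_at x) p)) g (chart_at x x)) => //.
  apply: (gf_smooth gf); apply: smooth_into_param; last by exists x.
  exact: smooth_chart_at.
by rewrite coordK.
Qed.

(** A backward time that brings [x] into the chart: with [y = 2 * nsq x / r^2], the vector
    [expR (- phiT x) *: x] has squared norm [(r^2 / 2) * y / (1 + y)^2], which is below
    [r^2 / 2]. *)
Definition phiT (x : 'rV[R]_m) : R := ln (1 + 2 * nsq x / r ^+ 2).
Definition phi (x : 'rV[R]_m) : M := Phi (phiT x) (param c (em n (expR (- phiT x) *: x))).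

Lemma inb_em (x : 'rV[R]_m) : inb r (em n x) <-> nsq x < r ^+ 2.
Proof. by rewrite /inb (sqn_split s) (sqn_em mn) (sqnC_em n) addr0. Qed.

Let r20 : 0 < r ^+ 2. Proof. by rewrite exprn_gt0 // (hc_r hc). Qed.

Lemma phiT_small x : nsq (expR (- phiT x) *: x) < r ^+ 2 / 2.
Proof.
rewrite nsqZ; have n0 := nsq_ge0 x; set y := 2 * nsq x / r ^+ 2.
have y0 : 0 <= y by apply: divr_ge0; [apply: mulr_ge0|exact: ltW].
have ny : nsq x = y * (r ^+ 2 / 2) by rewrite /y; field; rewrite gt_eqF // (hc_r hc).
rewrite expRN /phiT -/y lnK ?posrE; last by lra.
have q0 : 0 < r ^+ 2 / 2 by rewrite divr_gt0.
rewrite ny; move: (r ^+ 2 / 2) q0 => q q0.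
rewrite exprVn mulrC ltr_pdivrMr; last by rewrite exprn_gt0 //; lra.
by rewrite mulrC ltr_pM2l //; nra.
Qed.

Lemma nsq_half (x : 'rV[R]_m) : nsq x < r ^+ 2 / 2 -> nsq x < r ^+ 2.
Proof. by move=> H; have H' := r20; lra. Qed.

(** The value of [phi] does not depend on the time used, as long as the contracted vector lies in
    the chart. Freezing [T] near a point gives smoothness; a common [T] for two points gives
    injectivity. *)
Lemma phi_eq T x : nsq (expR (- T) *: x) < r ^+ 2 ->
  phi x = Phi T (param c (em n (expR (- T) *: x))).
Proof.
move=> iT; have i0 := nsq_half (phiT_small x); rewrite /phi; set T0 := phiT x in i0 *.
have E : expR (- T0) *: x = expR (T - T0) *: (expR (- T) *: x).
  by rewrite scalerA -expRD; congr (expR _ *: _); ring.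
rewrite E -(em_linflow mn) -(hc_flow hc); [|exact/inb_em|rewrite (em_linflow mn) -E; exact/inb_em].
by rewrite -(gfD gf); congr (Phi _ _); ring.
Qed.

Lemma phi_small x : nsq x < r ^+ 2 -> phi x = param c (em n x).
Proof.
by move=> ix; rewrite (@phi_eq 0) ?oppr0 ?expR0 ?scale1r // (gf0 gf).
Qed.

Lemma phi0 : phi 0 = v.
Proof.
rewrite phi_small; last by rewrite /nsq big1 // => j _; rewrite mxE expr0n.
by rewrite /em mul0mx (param0 hc).
Qed.

Lemma phi_flow t x : Phi t (phi x) = phi (expR t *: x).
Proof.
have E : expR (- (phiT x + t)) *: (expR t *: x) = expR (- phiT x) *: x.
  by rewrite scalerA -expRD; congr (expR _ *: _); ring.
rewrite (@phi_eq (phiT x + t) (expR t *: x)) E; last exact/nsq_half/phiT_small.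
by rewrite addrC (gfD gf).
Qed.

Lemma smooth_phi x : smooth_into phi x.
Proof.
pose T := phiT x.
have cs : {for x, continuous (fun y : 'rV[R]_m => nsq (expR (- T) *: y))}.
  apply: (@continuous_comp _ _ _ (fun y : 'rV[R]_m => expR (- T) *: y) (@nsq R m)).
    by apply: smooth_cont; apply: scale_smooth; exact: smooth_id.
  exact: nsq_continuous.
have n1 : \forall y \near x, nsq (expR (- T) *: y) < r ^+ 2.
  exact: (cvgr_lt (nsq (expR (- T) *: x)) cs _ (nsq_half (phiT_small x))).
apply: (@smooth_into_near_eq _ _ _ _ (fun y => Phi T (param c (em n (expR (- T) *: y))))).
  by apply: filterS n1 => y iy; rewrite -phi_eq.
apply: (gf_smooth gf).
apply: (smooth_into_comp (g := fun y : 'rV[R]_m => em n (expR (- T) *: y)) (f := param c)).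
- exact: findim_rV.
- by apply: em_smooth; apply: scale_smooth; exact: smooth_id.
apply: smooth_into_param; first exact: (hc_smooth hc).
by apply/(hc_img hc)/inb_em; exact/nsq_half/phiT_small.
Qed.

Lemma phi_inj : injective phi.
Proof.
move=> x y E; pose T := Num.max (phiT x) (phiT y).
have small z : phiT z <= T -> nsq (expR (- T) *: z) < r ^+ 2.
  move=> zT; apply: le_lt_trans (nsq_half (phiT_small z)).
  rewrite !nsqZ ler_wpM2r ?nsq_ge0 // ler_pXn2r ?nnegrE ?expR_ge0 //.
  by rewrite ler_expR lerN2.
have sx : nsq (expR (- T) *: x) < r ^+ 2 by apply: small; rewrite le_max lexx.
have sy : nsq (expR (- T) *: y) < r ^+ 2 by apply: small; rewrite le_max lexx orbT.
move: E; rewrite (phi_eq sx) (phi_eq sy) => /(congr1 (Phi (- T))).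
rewrite !(gfK gf) => /(congr1 c); rewrite !(inb_K hc); [|exact/inb_em|exact/inb_em].
move=> /(congr1 (@pm R m n)); rewrite !(emK mn) => /eqP.
rewrite -subr_eq0 -scalerBr scaler_eq0 gt_eqF ?expR_gt0 //= subr_eq0.
by move/eqP.
Qed.

Let gfr := gflow_rev gf.
Let hcr := hypchart_rev hc.

Lemma WminusE (w z : M) : Wminus Phi w z <-> Wplus (fun t => Phi (- t)) w z.
Proof. exact: cvgNy_compNP. Qed.

Lemma Wminus_flowP (w z : M) t : Wminus Phi w (Phi t z) <-> Wminus Phi w z.
Proof.
have H := Wplus_flowP gfr w z (- t); rewrite opprK in H.
by split=> /WminusE H'; apply/WminusE; [apply/H|apply/H].
Qed.

Lemma box_rev p : box s r p -> box (predC s) r p.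
Proof. by case=> h1 h2; split=> //; rewrite sqnCC. Qed.

Lemma unstable_boxP p : box s r p -> Wminus Phi v (param c p) <-> sqn (predC s) p = 0.
Proof.
move=> bp; have H := stable_boxP gfr hcr (box_rev bp).
by split=> [/WminusE/H|/H/WminusE].
Qed.

Lemma box_em (x : 'rV[R]_m) : nsq x < r ^+ 2 / 2 -> box s r (em n x).
Proof. by move=> ix; split; rewrite ?(sqn_em mn) ?(sqnC_em n) // divr_gt0. Qed.

Lemma Wminus_phi x : Wminus Phi v (phi x).
Proof.
apply/Wminus_flowP; apply/unstable_boxP; first exact/box_em/phiT_small.
exact: sqnC_em.
Qed.

Lemma Wminus_local T z : dom c (Phi (- T) z) -> box s r (c (Phi (- T) z)) ->
  Wminus Phi v z -> phi (expR T *: pm m (c (Phi (- T) z))) = z.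
Proof.
move=> dz bz Wz.
have s0 : sqn (predC s) (c (Phi (- T) z)) = 0.
  by apply/unstable_boxP => //; rewrite coordK //; apply/Wminus_flowP.
have E : expR (- T) *: (expR T *: pm m (c (Phi (- T) z))) = pm m (c (Phi (- T) z)).
  by rewrite scalerA -expRD addNr expR0 scale1r.
rewrite (@phi_eq T) E.
  by rewrite (pmK mn s0) coordK // (gfKN gf).
apply: nsq_half; rewrite -(sqn_pm mn); exact: bz.1.
Qed.

Lemma Wminus_range z : Wminus Phi v z -> exists x, z = phi x.
Proof.
move=> Wz; have Wz' := proj1 (WminusE v z) Wz.
have [t [dt bt]] := filter_ex (Wplus_box hcr Wz').
exists (expR t *: pm m (c (Phi (- t) z))); rewrite Wminus_local //.
by case: bt => h1 h2; split=> //; rewrite sqnCC in h2.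
Qed.

Definition phi_linv T z : 'rV[R]_m := expR T *: pm m (c (Phi (- T) z)).

(** The last clause says that the unstable manifold is embedded: a point of it near [phi x] is
    carried by the same backward time into the box, where only the unstable disc belongs to the
    unstable manifold. *)
Lemma phi_linvP x : exists T, [/\ sfun (phi_linv T) (phi x),
  \forall y \near x, phi_linv T (phi y) = y &
  \forall z \near phi x, Wminus Phi v z -> phi (phi_linv T z) = z].
Proof.
pose T := phiT x; exists T.
have pE : Phi (- T) (phi x) = param c (em n (expR (- T) *: x)) by rewrite /phi (gfK gf).
have ix := nsq_half (phiT_small x); have ix' := proj2 (inb_em _) ix.
have dx : dom c (Phi (- T) (phi x)) by rewrite pE; exact: (inb_dom hc ix').
split.
- apply: (@sfun_post _ _ _ _ _ (c \o Phi (- T)) (fun p => expR T *: pm m p)).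
  + exact: findim_rV.
  + exact: findim_rV.
  + apply: sfun_flow; [exact: findim_rV|apply: sfun_chart => //; exact: hc_smooth hc].
  + by apply: scale_smooth; apply: pm_smooth; exact: smooth_id.
- have cs : {for x, continuous (fun y : 'rV[R]_m => nsq (expR (- T) *: y))}.
    apply: (@continuous_comp _ _ _ (fun y : 'rV[R]_m => expR (- T) *: y) (@nsq R m)).
      by apply: smooth_cont; apply: scale_smooth; exact: smooth_id.
    exact: nsq_continuous.
  have n1 : \forall y \near x, nsq (expR (- T) *: y) < r ^+ 2.
    exact: (cvgr_lt (nsq (expR (- T) *: x)) cs _ ix).
  apply: filterS n1 => y iy; rewrite /phi_linv (phi_eq iy) (gfK gf).
  rewrite (inb_K hc); last exact/inb_em.
  by rewrite (emK mn) scalerA -expRD addrN expR0 scale1r.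
have cT : {for phi x, continuous (Phi (- T))} by apply: (gf_contt gf).
have bx : box s r (c (Phi (- T) (phi x))).
  by rewrite pE (inb_K hc) //; apply: box_em; exact: phiT_small.
have n1 : \forall z \near phi x, dom c (Phi (- T) z) by apply: (near_cont cT); exact: near_dom.
have cc : {for phi x, continuous (c \o Phi (- T))}.
  by apply: continuous_comp => //; exact: Defs.coord_continuous.
have n2 : \forall z \near phi x, box s r (c (Phi (- T) z)).
  by apply: (near_cont (f := c \o Phi (- T)) cc); exact: box_near.
by apply: filterS2 n1 n2 => z dz bz Wz; exact: Wminus_local.
Qed.

(** The factor [expR (- T)] compensates for the expansion during the time [T], so that the germ of
    [stab T] along the stable manifold does not depend on [T], and so that the flow multiplies it by
    an exponential ([stab_flow]). *)
Definition stab T z : 'rV[R]_m := expR (- T) *: pm m (c (Phi T z)).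
Definition good T z : Prop := dom c (Phi T z) /\ box s r (c (Phi T z)).

Lemma good_near T z : good T z -> \forall y \near z, good T y.
Proof.
move=> [dz bz]; have cT : {for z, continuous (Phi T)} by apply: (gf_contt gf).
apply: near_and; first by apply: (near_cont cT); exact: near_dom.
apply: (near_cont (f := c \o Phi T) (P := fun p => box s r p)); last exact: box_near.
by apply: continuous_comp => //; exact: Defs.coord_continuous.
Qed.

Lemma stab_sfun T z : dom c (Phi T z) -> sfun (stab T) z.
Proof.
move=> dz; apply: (@sfun_post _ _ _ _ _ (c \o Phi T) (fun p => expR (- T) *: pm m p)).
- exact: findim_rV.
- exact: findim_rV.
- apply: sfun_flow; [exact: findim_rV|apply: sfun_chart => //; exact: hc_smooth hc].
- by apply: scale_smooth; apply: pm_smooth; exact: smooth_id.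
Qed.

Lemma stab_eq0 T z : good T z -> stab T z = 0 <-> Wplus Phi v z.
Proof.
move=> [dz bz]; have H := stable_boxP gf hc bz; rewrite coordK // in H.
split=> [/eqP|/(Wplus_flow gf T)/H s0].
  rewrite scaler_eq0 gt_eqF ?expR_gt0 //= => /eqP p0.
  apply/(Wplus_flowP gf v z T)/H; rewrite (sqn_pm mn) p0.
  by rewrite /nsq big1 // => j _; rewrite mxE expr0n.
by rewrite /stab (nsq_eq0 (_ : nsq (pm m _) = 0)) ?scaler0 // -(sqn_pm mn).
Qed.

Lemma stab_flow T t z : stab (T - t) (Phi t z) = expR t *: stab T z.
Proof.
rewrite /stab -(gfD gf) subrK scalerA -expRD; congr (expR _ *: _); ring.
Qed.

Lemma good_ex z : Wplus Phi v z -> \forall T \near +oo%R, good T z.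
Proof. exact: (Wplus_box hc). Qed.

(** From a point of the stable manifold inside the box the linear orbit never leaves the ball. Hence
    for [y] near [z] the chart coordinates at the two times are related by the linear flow, and the
    two scalings differ by the same exponential. *)
Lemma stab_indep T T' z : Wplus Phi v z -> good T z -> good T' z ->
  \forall y \near z, stab T y = stab T' y.
Proof.
move=> Wz; wlog TT : T T' / T <= T' => [H gT gT'|[dT bT] [dT' bT']].
  have [h1|/ltW h1] := leP T T'; first exact: H.
  by apply: filterS (H _ _ h1 gT' gT) => y ->.
have iT : inb r (c (Phi T z)) by exact: (dom_inb hc dT).
have s0 : sqn s (c (Phi T z)) = 0.
  by apply/(stable_boxP gf hc bT); rewrite coordK //; exact: (Wplus_flow gf T Wz).
have TT0 : 0 <= T' - T by rewrite subr_ge0.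
have iTT := inb_stable iT s0 TT0.
have cT : {for z, continuous (Phi T)} by apply: (gf_contt gf).
have n1 : \forall y \near z, dom c (Phi T y) by apply: (near_cont cT); exact: near_dom.
have n2 : \forall y \near z, inb r (linflow s (T' - T) (c (Phi T y))).
  apply: (near_cont (f := fun y => linflow s (T' - T) (c (Phi T y))) (P := inb r)); last exact: (inb_near iTT).
  apply: (@continuous_comp _ _ _ (c \o Phi T) (linflow s (T' - T))).
    by apply: continuous_comp => //; exact: Defs.coord_continuous.
  apply: smooth_cont; apply: smooth_linflow; [exact: findim_rV|exact: smooth_cst|exact: smooth_id].
apply: filterS2 n1 n2 => y dy iy; rewrite /stab.
have -> : Phi T' y = param c (linflow s (T' - T) (c (Phi T y))).
  rewrite -(hc_flow hc) ?coordK //; last exact: (dom_inb hc dy).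
  by rewrite -(gfD gf) subrK.
rewrite (inb_K hc) // (pm_linflow mn) scalerA -expRD; congr (expR _ *: _); ring.
Qed.

Lemma stab_submersion T z : dom c (Phi T z) -> exists B : 'M[R]_(m, n), B *m jacf (stab T) z = 1%:M.
Proof.
move=> dz; pose p := c (Phi T z).
pose g (y : 'rV[R]_m) := Phi (- T) (param c (p + em n (expR T *: y))).
have ip : inb r p by exact: (dom_inb hc dz).
have e0 : p + em n (expR T *: (0 : 'rV[R]_m)) = p by rewrite scaler0 /em mul0mx addr0.
have sa : smooth_at (fun y : 'rV[R]_m => p + em n (expR T *: y)) 0.
  apply: smooth_add; first exact: smooth_cst.
  by apply: em_smooth; apply: scale_smooth; exact: smooth_id.
have g0 : g 0 = z by rewrite /g e0 /p coordK // (gfK gf).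
have sg : smooth_into g 0.
  apply: (gf_smooth gf); apply: (smooth_into_comp (f := param c) _ sa); first exact: findim_rV.
  apply: smooth_into_param; first exact: hc_smooth hc.
  by rewrite e0; apply/(hc_img hc).
exists (jac g 0); rewrite -g0 -jac_sfun_comp //; last by rewrite g0; exact: stab_sfun.
have n1 : \forall y \near (0 : 'rV[R]_m), inb r (p + em n (expR T *: y)).
  apply: (near_cont (smooth_cont sa)); rewrite e0; exact: inb_near.
transitivity ('J (fun y : 'rV[R]_m => y + cst (expR (- T) *: pm m p) y) 0).
  apply: near_eq_jac.
    apply: filterS n1 => y iy; rewrite /= /stab /g (gfKN gf) (inb_K hc) //.
    rewrite /pm mulmxDl -/(pm m _) -/(pm m _) (emK mn) scalerDr scalerA -expRD addNr expR0 scale1r.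
    exact: addrC.
  apply: smooth_diff; apply: (sfun_comp _ sg); first exact: findim_rV.
  by rewrite g0; exact: stab_sfun.
apply: mulmx_inj => u; rewrite mulmx1.
have d : differentiable (fun y : 'rV[R]_m => y + cst (expR (- T) *: pm m p) y) 0.
  apply: smooth_diff; apply: smooth_add; [exact: smooth_id|exact: smooth_cst].
have <- := deriveEjacobian u d.
have -> : 'D_u (fun y : 'rV[R]_m => y + cst (expR (- T) *: pm m p) y) 0 = 'D_u id 0 + 'D_u (cst (expR (- T) *: pm m p)) 0.
  by apply: (@deriveD _ _ _ id (cst _)); [exact: derivable_id|exact: derivable_cst].
by rewrite derive_id derive_cst addr0.
Qed.

End InvariantManifolds.

(** * Transversality as a rank condition *)

Section MorseSmaleData.
Variables (R : realType) (n : nat) (M : manifold R n).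
Variables (h : M -> R) (X : vector_field M) (Phi : R -> M -> M).
Hypothesis hMS : morse_smale h X Phi.
Hypothesis cM : closed_manifold M.

(** The index is a free variable tied by an equation. Row vectors of size [m] thus need no casts
    along equalities of indices. *)
Definition cip (v : M) (m : nat) : Prop := crit h v /\ morse_index h v = m.

Definition hyp_data (v : M) : chart R n M * R :=
  match pselect (exists cr : chart R n M * R,
    hypchart h Phi v (idx_pred (morse_index h v)) cr.1 cr.2) with
  | left e => sval (cid e)
  | right _ => (chart_at v, 1)
  end.

Definition cc v := (hyp_data v).1.
Definition rr v := (hyp_data v).2.
Definition ph v m : 'rV[R]_m -> M := @phi R n M Phi m (cc v) (rr v).
Definition st v m (T : R) : M -> 'rV[R]_m := @stab R n M Phi m (cc v) T.
Definition gd v m (T : R) (z : M) : Prop := @good R n M Phi m (cc v) (rr v) T z.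

Lemma cip_hyp v m : cip v m -> hypchart h Phi v (idx_pred m) (cc v) (rr v).
Proof.
move=> [cv <-]; have [c [r hc]] := ms_hypchart hMS cv.
rewrite /cc /rr /hyp_data; case: pselect => [e|[]]; first exact: (svalP (cid e)).
by exists (c, r).
Qed.

Lemma cip_le v m : cip v m -> (m <= n)%N.
Proof. by move=> [_ <-]; exact: morse_index_le. Qed.

Let gf := ms_gflow hMS.

Section OnePair.
Variables (v w : M) (m k : nat).
Hypotheses (cv : cip v m) (cw : cip w k).
Let hv := cip_hyp cv.
Let hw := cip_hyp cw.
Let mn := cip_le cv.
Let kn := cip_le cw.

Lemma ph_noncrit (x : 'rV[R]_m) : x != 0 -> ~ crit h (ph v x).
Proof.
move=> x0 cx; have := crit_flow hMS 1 cx.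
rewrite /ph (phi_flow gf mn hv) => /(phi_inj gf mn hv) /eqP.
rewrite -subr_eq0 -{2}[x]scale1r -scalerBl scaler_eq0 (negbTE x0) orbF subr_eq0.
by move=> /eqP e1; have := expR_gt1 (1 : R); rewrite e1 ltxx ltr01.
Qed.

Lemma ph_h_lt (x : 'rV[R]_m) : x != 0 -> h (ph v x) < h v.
Proof.
move=> x0; have nc := ph_noncrit x0.
have nc' : ~ crit h (Phi (-1) (ph v x)) by exact: (noncrit_flow hMS nc).
have := h_strict hMS nc' ltr01; rewrite (gfKN gf) => /lt_le_trans; apply.
have := Wplus_h_ge (gflow_rev gf) 1 (proj1 (WminusE Phi v (ph v x)) (Wminus_phi gf mn hv x)).
by rewrite lerN2.
Qed.

Lemma ph_Wplus_h (x : 'rV[R]_m) : x != 0 -> Wplus Phi w (ph v x) -> h w < h v.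
Proof.
move=> x0 Wx; apply: le_lt_trans (ph_h_lt x0).
by have := Wplus_h_ge gf 0 Wx; rewrite (gf0 gf).
Qed.

Lemma st_near T z : gd w k T z -> \forall y \near z, st w k T y = 0 <-> Wplus Phi w y.
Proof. by move=> gz; apply: filterS (good_near gf gz) => y; exact: (stab_eq0 gf kn hw). Qed.

Lemma st_ph_smooth T (x : 'rV[R]_m) : dom (cc w) (Phi T (ph v x)) ->
  smooth_at (st w k T \o ph v (m := m)) x.
Proof.
move=> gz; apply: sfun_comp; [exact: findim_rV|exact: (smooth_phi gf mn hv)|].
exact: (stab_sfun gf hw).
Qed.

Definition Jst T x : 'M[R]_(m, k) := 'J (st w k T \o ph v (m := m)) x.

(** The curve [expR t *: x] parametrizes the orbit of [ph v x], on which [st] vanishes; its velocity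
    at [t = 0] is [x]. *)
Lemma Jst_ray T (x : 'rV[R]_m) : gd w k T (ph v x) -> Wplus Phi w (ph v x) -> x *m Jst T x = 0.
Proof.
move=> gx Wx; have sF := st_ph_smooth gx.1.
pose e (t : R) := expR t *: x.
have se : smooth_at e 0.
  apply: smooth_scale; [exact: findim_rV|exact: smooth_expR|exact: smooth_cst].
have e0 : e 0 = x by rewrite /e expR0 scale1r.
have De : 'D_1 e 0 = x.
  have d : differentiable (expR : R -> R) 0 by apply: smooth_diff; exact: smooth_expR.
  have E1 := deriveE (1 : R) (smooth_diff se).
  have E2 := diffZl x d.
  have E3 := congr1 (fun k : R -> 'rV[R]_m => k 1) E2.
  have E4 := deriveE (1 : R) d.
  by rewrite E1 E3 /= -E4 D_expR expR0 scale1r.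
have dF : differentiable (st w k T \o ph v (m := m)) (e 0).
  by rewrite e0; exact: smooth_diff.
have de := smooth_diff se.
have E1 := deriveE (1 : R) (differentiable_comp de dF).
have E2 := congr1 (fun k : R -> 'rV[R]_k => k 1) (diff_comp de dF).
have E3 := deriveE (1 : R) de.
have E4 := deriveE x dF; rewrite /= -E3 De -E4 e0 (deriveEjacobian _ (smooth_diff sF)) in E2.
rewrite /Jst -E2 -E1.
transitivity ('D_1 (cst (0 : 'rV[R]_k)) (0 : R)); last exact: derive_cst.
apply: near_eq_derive.
have ce : {for 0, continuous (ph v (m := m) \o e)}.
  apply: continuous_comp; first exact: smooth_cont.
  by have [] := smooth_phi gf mn hv (e 0).
have n1 : \forall t \near (0 : R), st w k T (ph v (e t)) = 0 <-> Wplus Phi w (ph v (e t)).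
  apply: (near_cont (f := ph v (m := m) \o e) (P := fun y => st w k T y = 0 <-> Wplus Phi w y) ce).
  by rewrite /= e0; exact: st_near.
apply: filterS n1 => t [_ H] /=; apply: H; rewrite /e /ph -(phi_flow gf mn hv).
exact: (Wplus_flow gf t Wx).
Qed.

(** A covector value [u0] is lifted to a tangent vector by the right inverse [B] and split by
    transversality. The part tangent to the stable manifold is killed by [st]. The part tangent to
    the unstable manifold is the velocity of a curve that [phi_linv] pulls back to the parameter
    space. *)
Lemma Jst_full T (x : 'rV[R]_m) : gd w k T (ph v x) -> Wplus Phi w (ph v x) -> row_full (Jst T x).
Proof.
move=> gx Wx; set z := ph v x in gx Wx *; have sF := st_ph_smooth gx.1.
suff H (u0 : 'rV[R]_k) : exists y : 'rV[R]_m, u0 = y *m Jst T x.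
  by rewrite -sub1mx; apply/row_subP => i; apply/submxP; exact: H.
have [B EB] := stab_submersion gf kn hw gx.1.
have sst : sfun (st w k T) z by exact: (stab_sfun gf hw gx.1).
have Wz : Wminus Phi v z by exact: (Wminus_phi gf mn hv).
have [a [b [[ca [ca0 sca Wca va]] [cb [cb0 scb Wcb vb]] uab]]] :=
  ms_transversal hMS cv.1 cw.1 Wz Wx (u0 *m B).
have b0 : b *m jacf (st w k T) z = 0.
  rewrite -vb -cb0 -velocity_sfun //; last by rewrite cb0.
  transitivity ('D_1 (cst (0 : 'rV[R]_k)) (0 : R)); last exact: derive_cst.
  apply: near_eq_derive; have [ccb _] := scb.
  have n1 : \forall t \near (0 : R), st w k T (cb t) = 0 <-> Wplus Phi w (cb t).
    by apply: (near_cont (P := fun y => st w k T y = 0 <-> Wplus Phi w y) ccb); rewrite cb0; exact: st_near.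
  by apply: filterS2 n1 Wcb => t [_ H] /H.
have [T' [sl linv rinv]] := phi_linvP gf mn hv x.
rewrite -/(ph v x) -/z in sl linv rinv; set L := phi_linv Phi m (cc v) T' in sl linv rinv.
pose zt := L \o ca.
have szt : smooth_at zt 0.
  by apply: sfun_comp; [exact: findim_rV|exact: sca|rewrite ca0].
have zt0 : zt 0 = x by rewrite /zt /= ca0; exact: (nbhs_singleton linv).
have [cca _] := sca.
have n2 : \forall t \near (0 : R), ph v (zt t) = ca t.
  have : \forall t \near (0 : R), Wminus Phi v (ca t) -> ph v (L (ca t)) = ca t.
    by apply: (near_cont (P := fun y => Wminus Phi v y -> ph v (L y) = y) cca); rewrite ca0.
  by move=> n3; apply: filterS2 n3 Wca => t H /H.
exists ('D_1 zt 0).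
have -> : u0 = a *m jacf (st w k T) z.
  rewrite -[LHS]mulmx1 -EB mulmxA uab mulmxDl -/(st w k T).
  by rewrite [X in _ + X]b0 addr0.
rewrite -va -ca0 -velocity_sfun //; last by rewrite ca0.
transitivity ('D_1 ((st w k T \o ph v (m := m)) \o zt) 0).
  by apply: near_eq_derive; apply: filterS n2 => t /= ->.
have dF : differentiable (st w k T \o ph v (m := m)) (zt 0).
  by rewrite zt0; exact: smooth_diff.
have dz := smooth_diff szt.
have E1 := deriveE (1 : R) (differentiable_comp dz dF).
have E2 := congr1 (fun k : R -> 'rV[R]_k => k 1) (diff_comp dz dF).
have E3 := deriveE (1 : R) dz.
have E4 := deriveE ('D_1 zt 0) dF; rewrite /= -E3 -E4 zt0 (deriveEjacobian _ (smooth_diff sF)) in E2.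
by rewrite E1 E2.
Qed.

(** The Jacobian has [m] rows and full column rank [k], and the nonzero row [x] lies in its kernel;
    hence [1 + k <= m]. *)
Lemma index_drop (x : 'rV[R]_m) : x != 0 -> Wplus Phi w (ph v x) -> (k < m)%N.
Proof.
move=> x0 Wx; have [T gT] := filter_ex (good_ex hw Wx).
have full := Jst_full gT Wx; have ray := Jst_ray gT Wx.
have : (\rank x + \rank (Jst T x) <= m)%N by apply: mulmx0_rank_max.
by rewrite (eqP full) rank_rV x0.
Qed.

End OnePair.
End MorseSmaleData.

(** * Augmented determinants and local sections on level sets *)

Section AugmentedDet.
Variable R : realType.

Lemma dotr_gt0 k (x : 'rV[R]_k) : x != 0 -> 0 < (x *m x^T) 0 0.
Proof.
move=> x0; have -> : (x *m x^T) 0 0 = nsq x.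
  by rewrite mxE; apply: eq_bigr => j _; rewrite mxE -expr2.
rewrite lt_neqAle nsq_ge0 andbT eq_sym; apply: contra x0 => /eqP.
by move=> /nsq_eq0 ->.
Qed.

(** When [x] spans the kernel of [J], the sign tells whether [J], restricted to the orthogonal
    complement of [x], preserves orientation, [x] being counted as the first vector. With [x] an
    orbit direction this is the sign of an orbit between consecutive indices. *)
Definition adet k (x : 'rV[R]_k.+1) (J : 'M[R]_(k.+1, k)) : R := \det (row_mx x^T J : 'M[R]_(1 + k)).

(** A vector killed by the augmented matrix lies in the kernel of [J], which is the line of [x] by
    the rank, and is orthogonal to [x]. *)
Lemma adet_neq0 k (x : 'rV[R]_k.+1) (J : 'M[R]_(k.+1, k)) : row_full J -> x != 0 ->
  x *m J = 0 -> adet x J != 0.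
Proof.
move=> fJ x0 xJ; rewrite -unitfE -unitmxE -row_free_unit; apply/row_freeP.
suff : row_free (row_mx x^T J : 'M[R]_(1 + k)) by move/row_freeP.
rewrite -kermx_eq0; apply/eqP/row_matrixP => i; rewrite row0.
set u := row i _; have : u *m (row_mx x^T J : 'M[R]_(1 + k)) = 0.
  by apply/sub_kermxP; exact: row_sub.
rewrite mul_mx_row -[0 in RHS](row_mx0) => /eq_row_mx[ux uJ].
have sx : (x <= kermx J)%MS by apply/sub_kermxP.
have rk : \rank (kermx J) = \rank x.
  by rewrite mxrank_ker (eqP fJ) subSnn rank_rV x0.
have : (u <= x)%MS.
  apply: (@submx_trans _ _ _ _ _ _ (kermx J)); first exact/sub_kermxP.
  by have [_ ] := mxrank_leqif_sup sx; rewrite rk eqxx => /esym.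
move=> /sub_rVP[a ua]; have := congr1 (fun A : 'M[R]_1 => A 0 0) ux.
rewrite ua -scalemxAl mxE => H; have {H} : a * (x *m x^T) 0 0 = 0 by rewrite H mxE.
move=> /eqP; rewrite mulf_eq0 => /orP[/eqP ->|].
  by rewrite scale0r.
by rewrite gt_eqF // dotr_gt0.
Qed.

End AugmentedDet.

Section JacobianBlocks.
Variable R : realType.

Lemma smooth_row_mx (V : normedModType R) a b (f : V -> 'rV[R]_a) (g : V -> 'rV[R]_b) p :
  smooth_at f p -> smooth_at g p -> smooth_at (fun y => row_mx (f y) (g y)) p.
Proof.
move=> sf sg; apply: smooth_rV => j; case: (split_ordP j) => i ->.
  by under eq_fun do rewrite row_mxEl; exact: smooth_coef.
by under eq_fun do rewrite row_mxEr; exact: smooth_coef.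
Qed.

Lemma smooth_scalar (V : normedModType R) (a : V -> R) p :
  smooth_at a p -> smooth_at (fun y => (a y)%:M : 'rV[R]_1) p.
Proof.
move=> sa; apply: smooth_rV => j; rewrite (ord1 j).
by under eq_fun do rewrite mxE eqxx mulr1n.
Qed.

Lemma derive_rV (V : normedModType R) a (f : V -> 'rV[R]_a) p u j : smooth_at f p ->
  ('D_u f p) 0 j = 'D_u (fun y => f y 0 j) p.
Proof.
move=> sf; have d : derivable f p u by apply: diff_derivable; exact: smooth_diff.
by have [_ ->] := derive_coef 0 j d.
Qed.

Lemma jac_row_mx d a b (f : 'rV[R]_d -> 'rV[R]_a) (g : 'rV[R]_d -> 'rV[R]_b) (p : 'rV[R]_d) :
  smooth_at f p -> smooth_at g p ->
  'J (fun y => row_mx (f y) (g y)) p = row_mx ('J f p) ('J g p).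
Proof.
move=> sf sg; have sfg := smooth_row_mx sf sg; apply: mulmx_inj => u.
rewrite mul_mx_row.
have <- := deriveEjacobian u (smooth_diff sfg).
have <- := deriveEjacobian u (smooth_diff sf).
have <- := deriveEjacobian u (smooth_diff sg).
apply/rowP => j; rewrite derive_rV //; case: (split_ordP j) => i ->.
  by under eq_fun do rewrite row_mxEl; rewrite row_mxEl (derive_rV _ _ sf).
by under eq_fun do rewrite row_mxEr; rewrite row_mxEr (derive_rV _ _ sg).
Qed.

Lemma derive_nsq k (x u : 'rV[R]_k) : 'D_u (@nsq R k) x = 2 * (u *m x^T) 0 0.
Proof.
have sc j (y : 'rV[R]_k) : smooth_at (fun y : 'rV[R]_k => y 0 j) y.
  by apply: smooth_coef; exact: smooth_id.
have -> : @nsq R k = \sum_(j < k) (fun y : 'rV[R]_k => y 0 j) * (fun y => y 0 j).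
  by apply/funext => y; rewrite /nsq fct_sumE; apply: eq_bigr => j _; rewrite expr2.
have dc j : derivable (fun y : 'rV[R]_k => y 0 j) x u.
  by apply: diff_derivable; apply: smooth_diff; exact: sc.
rewrite derive_sum; last by move=> j; exact: derivableM.
rewrite mxE mulr_sumr; apply: eq_bigr => j _; rewrite deriveM // mxE.
have -> : 'D_u (fun y : 'rV[R]_k => y 0 j) x = u 0 j.
  by rewrite -(@derive_rV _ _ id) ?derive_id //; exact: smooth_id.
by rewrite /GRing.scale /=; ring.
Qed.

Lemma jac_scalar k (a : 'rV[R]_k -> R) (x : 'rV[R]_k) (c : 'rV[R]_k) : smooth_at a x ->
  (forall u, 'D_u a x = (u *m c^T) 0 0) ->
  'J (fun y => (a y)%:M : 'rV[R]_1) x = c^T.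
Proof.
move=> sa H; have ss := smooth_scalar sa; apply: mulmx_inj => u.
have <- := deriveEjacobian u (smooth_diff ss).
apply/rowP => j; rewrite (ord1 j); apply: etrans (derive_rV u 0 ss) _.
have -> : (fun y => ((a y)%:M : 'rV[R]_1) 0 0) = a.
  by apply/funext => y; rewrite mxE eqxx mulr1n.
exact: H.
Qed.

Lemma jac_nsq k (x : 'rV[R]_k) : 'J (fun y => (nsq y)%:M : 'rV[R]_1) x = (2 *: x)^T.
Proof.
apply: jac_scalar; first exact: nsq_smooth.
move=> u; rewrite derive_nsq [(2 *: x)^T]linearZ /= -scalemxAr [RHS]mxE //.
Qed.

(* The inverse function theorem in the form used throughout: [f] restricted to a level set of
   [a] has a local smooth inverse [sg]. *)
Lemma level_section k (a : 'rV[R]_k.+1 -> R) (f : 'rV[R]_k.+1 -> 'rV[R]_k) (x : 'rV[R]_k.+1) :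
  smooth_at a x -> smooth_at f x -> f x = 0 ->
  \det (row_mx ('J (fun y => (a y)%:M : 'rV[R]_1) x) ('J f x) : 'M[R]_(1 + k)) != 0 ->
  exists sg : 'rV[R]_k -> 'rV[R]_k.+1, [/\ sg 0 = x,
    \forall xi \near (0 : 'rV[R]_k), [/\ smooth_at sg xi, a (sg xi) = a x & f (sg xi) = xi] &
    \forall y \near x, a y = a x -> sg (f y) = y].
Proof.
move=> sa sf fx0 dJ.
pose Psi (y : 'rV[R]_(1 + k)) : 'rV[R]_(1 + k) := row_mx ((a y)%:M) (f y).
have sP : smooth_at Psi x by apply: smooth_row_mx => //; exact: smooth_scalar.
have uJ : 'J Psi x \in unitmx.
  by rewrite /Psi jac_row_mx //; [rewrite unitmxE unitfE|exact: smooth_scalar].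
have [g [U [V [[oU Ux oV VPx] [HU HV sg]]]]] := inverse_function sP uJ.
pose j (xi : 'rV[R]_k) : 'rV[R]_(1 + k) := row_mx ((a x)%:M) xi.
have sj xi : smooth_at j xi.
  by apply: smooth_row_mx; [exact: smooth_cst|exact: smooth_id].
have j0 : j 0 = Psi x by rewrite /Psi fx0.
have nV : \forall xi \near (0 : 'rV[R]_k), V (j xi).
  apply: (near_cont (smooth_cont (sj 0))); rewrite j0.
  exact: open_nbhs_nbhs.
exists (fun xi => g (j xi)); split.
- by rewrite j0; have [_ ->] := HU _ Ux.
- apply: filterS nV => xi Vj; have [_ PE] := HV _ Vj.
  have [E1 E2] := eq_row_mx PE; split => //.
    apply: (smooth_comp (f := j) (g := g)); [exact: findim_rV|exact: findim_rV|exact: sj|].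
    exact: sg.
  by have := congr1 (fun A : 'M[R]_1 => A 0 0) E1; rewrite !mxE eqxx !mulr1n.
have nU : \forall y \near x, U y by exact: open_nbhs_nbhs.
apply: filterS nU => y Uy ay; have [_ gE] := HU _ Uy.
by rewrite /j -ay -/(Psi y) gE.
Qed.

End JacobianBlocks.

(** * Closures of stable manifolds; finiteness of orbits between consecutive indices *)

Section Closure.
Variables (R : realType) (n : nat) (M : manifold R n).
Variables (h : M -> R) (X : vector_field M) (Phi : R -> M -> M).
Hypothesis hMS : morse_smale h X Phi.
Hypothesis cM : closed_manifold M.
Let gf := ms_gflow hMS.

Lemma sphere_compact k (a : R) : compact [set x : 'rV[R]_k | nsq x = a].
Proof.
apply: bounded_closed_compact.
  exists (a + 1); split; first exact: num_real.
  move=> C aC x /= nx; apply: le_trans (ltW aC).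
  have a0 : 0 <= a by rewrite -nx nsq_ge0.
  apply: normrV_le => [|j]; first by lra.
  have xa : `|x 0 j| ^+ 2 <= a.
    by rewrite -nx /nsq (bigD1 j) //= real_normK ?num_real // lerDl sumr_ge0 // => i _; exact: sqr_ge0.
  have := normr_ge0 (x 0 j); nra.
have -> : [set x : 'rV[R]_k | nsq x = a] = @nsq R k @^-1` [set a] by [].
by apply: closed_comp; [move=> x _; exact: nsq_continuous|exact: closed_eq].
Qed.

Lemma near_em m (x : 'rV[R]_m) (P : 'rV[R]_n -> Prop) : (m <= n)%N ->
  (\forall p \near em n x, P p) -> exists2 e : R, 0 < e &
  forall p, `|x - pm m p| < e -> sqn (predC (idx_pred m)) p < e ^+ 2 -> P p.
Proof.
move=> mn /near_ball[e e0 He]; exists (e / 2); first by rewrite divr_gt0.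
move=> p px sp; apply: He; rewrite -ball_normE /=.
apply: (@le_lt_trans _ _ (e / 2)); last by rewrite ltr_pdivrMr // ltr_pMr // ltr1n.
apply: normrV_le => [|j]; first by rewrite ltW // divr_gt0.
rewrite !mxE -/(em n x); have [jm|mj] := ltnP j m.
  have jE : j = widen_ord mn (Ordinal jm) by exact/val_inj.
  have := normrV_coef (x - pm m p) (Ordinal jm).
  rewrite !mxE -/(pm m p) => H.
  have E1 := emE mn x (Ordinal jm); have E2 := pmE mn p (Ordinal jm).
  rewrite -jE in E1 E2; rewrite mxE in E1; rewrite mxE in E2; rewrite E1 -E2.
  exact: (le_trans H (ltW px)).
have E1 := emE0 x mj; rewrite mxE in E1; rewrite E1 sub0r normrN.
have h1 : `|p 0 j| ^+ 2 <= sqn (predC (idx_pred m)) p.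
  rewrite /sqn (bigD1 j) //=; last by rewrite -leqNgt.
  by rewrite real_normK ?num_real // lerDl sumr_ge0 // => i _; exact: sqr_ge0.
have h2 := normr_ge0 (p 0 j); have h3 : 0 < e / 2 by rewrite divr_gt0.
rewrite leNgt; apply/negP => h4.
have : (e / 2) ^+ 2 < `|p 0 j| ^+ 2 by rewrite ltr_pXn2r // nnegrE ltW.
by move=> h5; have := lt_le_trans (lt_trans sp h5) h1; rewrite ltxx.
Qed.

(* Points of [A] close to the stable manifold of [w] leave a neighbourhood of [w] close to the
   unstable sphere, which is compact. *)
Lemma exit_closure w k (A : set M) m : cip h w k ->
  (forall z t, A z -> A (Phi t z)) -> (forall z, A z -> ~ Wplus Phi w z) ->
  closure A m -> Wplus Phi w m ->
  exists x : 'rV[R]_k, nsq x = rr h Phi w ^+ 2 / 4 /\ closure A (ph h Phi w x).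
Proof.
move=> cw iA AW clA Wm; have hc := cip_hyp hMS cw; have kn := cip_le cw.
set c := cc h Phi w in hc; set r := rr h Phi w in hc *.
apply: contrapT => Hno.
have r0 : 0 < r ^+ 2 by rewrite exprn_gt0 // (hc_r hc).
pose S := [set x : 'rV[R]_k | nsq x = r ^+ 2 / 4].
(* If no point of the unstable sphere were in the closure of [A], compactness would give a uniform
   thickness [eta] of a neighbourhood of the sphere that avoids [A]. *)
have [eta eta0 Heta] : exists2 e : R, 0 < e & forall p, S (pm k p) -> inb r p ->
    sqn (predC (idx_pred k)) p < e -> ~ A (param c p).
  apply: (@compact_ind _ S (fun U => exists2 e : R, 0 < e & forall p, U (pm k p) -> inb r p ->
    sqn (predC (idx_pred k)) p < e -> ~ A (param c p))).
  - exact: sphere_compact.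
  - by exists 1.
  - move=> U U' [e e0 He] [e' e'0 He']; exists (Num.min e e'); first by rewrite lt_min e0.
    by move=> p [Up|Up] ip; rewrite lt_min => /andP[h1 h2]; [exact: He|exact: He'].
  - by move=> U U' sU [e e0 He]; exists e => // p /sU; exact: He.
  move=> x Sx; have ix : nsq x < r ^+ 2 by rewrite (Sx : nsq x = _); lra.
  have iex : inb r (em n x) by exact/(inb_em _ kn).
  have phE : ph h Phi w x = param c (em n x) by exact: (phi_small gf kn hc).
  have nA : \forall z \near ph h Phi w x, ~ A z.
    have : ~ closure A (ph h Phi w x) by move=> clx; apply: Hno; exists x.
    move=> ncl; apply: contrapT => nn; apply: ncl => B nB.
    apply: contrapT => AB; apply: nn; apply: filterS nB => z Bz Az; apply: AB.
    by exists z.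
  have cp : {for em n x, continuous (param c)} by apply: param_continuous; exact/(hc_img hc).
  have nA' : \forall p \near em n x, ~ A (param c p) by apply: (near_cont (P := fun z => ~ A z) cp); rewrite -phE.
  have [e e0 He] := near_em kn nA'.
  exists [set y | `|x - y| < e].
    by apply: open_nbhs_nbhs; split; [have := ball_open x e; rewrite -ball_normE; apply|rewrite /= subrr normr0].
  by exists (e ^+ 2); [rewrite exprn_gt0|move=> p Up _; exact: He].
have [T gT] := filter_ex (good_ex hc Wm).
have st0 : stab Phi k c T m = 0 by apply/(stab_eq0 gf kn hc gT).
have s0 : sqn (idx_pred k) (c (Phi T m)) = 0.
  by apply/(stable_boxP gf hc gT.2); rewrite coordK; [exact: (Wplus_flow gf)|exact: gT.1].
have cT : {for m, continuous (Phi T)} by apply: (gf_contt gf).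
have cs : {for m, continuous (fun z => sqn (idx_pred k) (c (Phi T z)))}.
  apply: (@continuous_comp _ _ _ (c \o Phi T) (sqn (idx_pred k))); last exact: sqn_continuous.
  by apply: continuous_comp => //; apply: Defs.coord_continuous; exact: gT.1.
(* When the expanding part has grown to [r^2 / 4], the contracting part is [a * b / (r^2 / 4)],
   below [2 * a] since [b < r^2 / 2]. The bound [a < r^2 / 4] keeps the exit point in the ball, and
   [a < eta / 2] places it in the forbidden neighbourhood. *)
pose d := Num.min (r ^+ 2 / 4) (eta / 2).
have d0 : 0 < d by rewrite lt_min !divr_gt0.
have n1 : \forall z \near m, sqn (idx_pred k) (c (Phi T z)) < d.
  by apply: (cvgr_lt (sqn (idx_pred k) (c (Phi T m))) cs); rewrite s0.
have [z [Az [gz az]]] := clA _ (near_and (good_near gf gT) n1).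
set p := c (Phi T z) in az.
have bp : box (idx_pred k) r p := gz.2.
set a := sqn _ p in az; set b := sqn (predC (idx_pred k)) p.
have zE : Phi T z = param c p by rewrite /p coordK //; exact: gz.1.
have b0 : 0 <= b by exact: sqn_ge0.
have a0 : 0 < a.
  rewrite lt_neqAle sqn_ge0 andbT eq_sym; apply/negP => /eqP aE.
  apply: (AW (Phi T z)); first exact: iA.
  by rewrite zE; apply/(stable_boxP gf hc bp).
have [ad ae] : a < r ^+ 2 / 4 /\ a < eta / 2 by move: az; rewrite lt_min => /andP.
have bb : b < r ^+ 2 / 2 := bp.2.
pose t := ln (r ^+ 2 / 4 / a) / 2.
have r40 : 0 < r ^+ 2 / 4 by rewrite divr_gt0.
have et : expR t ^+ 2 = r ^+ 2 / 4 / a.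
  by rewrite -expRM_natl /t mulrC divfK ?pnatr_eq0 // lnK // posrE divr_gt0.
have eN : expR (- t) ^+ 2 = a / (r ^+ 2 / 4) by rewrite expRN exprVn et invf_div.
have e1 : sqn (idx_pred k) (linflow (idx_pred k) t p) = r ^+ 2 / 4.
  by rewrite sqn_linflow et -/a divfK // gt_eqF.
have e2 : sqn (predC (idx_pred k)) (linflow (idx_pred k) t p) = a * b / (r ^+ 2 / 4).
  by rewrite sqn_linflowC eN -/b mulrAC.
have e3 : a * b / (r ^+ 2 / 4) < 2 * a by rewrite ltr_pdivrMr //; nra.
have it : inb r (linflow (idx_pred k) t p).
  by rewrite /inb (sqn_split (idx_pred k)) e1 e2; lra.
apply: (Heta (linflow (idx_pred k) t p)) => //.
- by rewrite /S /= -(sqn_pm kn).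
- rewrite e2; lra.
have <- := hc_flow hc (t := t) (box_inb bp) it.
by rewrite -zE; exact: (iA _ _ (iA _ _ Az)).
Qed.

(** Induction on the index of [w]. The closure reaches a point of the unstable sphere of [w], which
    flows to some [w'] of smaller index. If [w'] is [u] the claim follows, and otherwise the
    induction hypothesis applies to [w']. *)
Lemma closure_index w k u l m : cip h w k -> cip h u l ->
  closure (Wplus Phi u) m -> Wplus Phi w m -> w <> u -> (l < k)%N.
Proof.
move=> + cu; have [N] := ubnP k; elim: N w k m => // N IH w k m kN cw clm Wm wu.
have [x [nx clx]] : exists x : 'rV[R]_k, nsq x = rr h Phi w ^+ 2 / 4 /\ closure (Wplus Phi u) (ph h Phi w x).
  apply: (exit_closure cw _ _ clm Wm).
    by move=> z t Wz; exact: (Wplus_flow gf t Wz).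
  by move=> z Wz Wz'; apply: wu; exact: (Wplus_unique Wz' Wz).
have x0 : x != 0.
  apply/eqP => xE; have r0 : 0 < rr h Phi w ^+ 2 / 4.
    by rewrite divr_gt0 // exprn_gt0 // (hc_r (cip_hyp hMS cw)).
  by move: r0; rewrite -nx xE /nsq big1 ?ltxx // => j _; rewrite mxE expr0n.
have [w' cw' Ww'] := ms_conv hMS cM (ph h Phi w x).
have ciw' : cip h w' (morse_index h w') by [].
have k'k := index_drop hMS cw ciw' x0 Ww'.
have [wE|wu'] := pselect (w' = u).
  by move: k'k; rewrite wE cu.2.
have k'N : (morse_index h w' < N)%N by apply: leq_trans k'k _; rewrite -ltnS.
exact: (ltn_trans (IH w' _ (ph h Phi w x) k'N ciw' clx Ww' wu') k'k).
Qed.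

Section Consecutive.
Variables (v w : M) (k : nat).
Hypotheses (cv : cip h v k.+1) (cw : cip h w k).
Let hv := cip_hyp hMS cv.
Let hw := cip_hyp hMS cw.
Let mn := cip_le cv.
Let kn := cip_le cw.

Lemma ph_section T (x : 'rV[R]_k.+1) : nsq x = 1 -> gd h Phi w k T (ph h Phi v x) ->
  Wplus Phi w (ph h Phi v x) ->
  exists sg : 'rV[R]_k -> 'rV[R]_k.+1, [/\ sg 0 = x,
    \forall xi \near (0 : 'rV[R]_k), [/\ smooth_at sg xi, nsq (sg xi) = 1 &
        st h Phi w k T (ph h Phi v (sg xi)) = xi] &
    \forall y \near x, nsq y = 1 -> sg (st h Phi w k T (ph h Phi v y)) = y].
Proof.
move=> nx gx Wx.
have x0 : x != 0.
  apply/eqP => xE; move: nx; rewrite xE /nsq big1 => [|j _]; last by rewrite mxE expr0n.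
  by move/eqP; rewrite eq_sym oner_eq0.
have [] := @level_section R k (@nsq R k.+1) (st h Phi w k T \o ph h Phi v (m := k.+1)) x.
- exact: nsq_smooth.
- exact: (st_ph_smooth hMS cv cw gx.1).
- by apply/(stab_eq0 gf kn hw gx).
- rewrite jac_nsq; apply: (@adet_neq0 _ _ (2 *: x)).
  + exact: (Jst_full hMS cv cw gx Wx).
  + by rewrite scaler_eq0 negb_or x0 pnatr_eq0.
  + by rewrite -scalemxAl (Jst_ray hMS cv cw gx Wx) scaler0.
move=> sg [s0 s1 s2]; exists sg; split=> //.
  by apply: filterS s1 => xi [h1 h2 h3]; split=> //; rewrite h2.
by apply: filterS s2 => y Hy ny; apply: Hy; rewrite nx.
Qed.

Lemma nsq1_neq0 l (x : 'rV[R]_l) : nsq x = 1 -> x != 0.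
Proof.
move=> nx; apply/eqP => xE; move: nx; rewrite xE /nsq big1 => [|j _]; last by rewrite mxE expr0n.
by move/eqP; rewrite eq_sym oner_eq0.
Qed.

Lemma ph_continuous : continuous (ph h Phi v (m := k.+1)).
Proof. by move=> x; have [] := smooth_phi gf mn hv x. Qed.

(** If [x] flowed to another point [w'], its index would be greater than [k] by [closure_index] and
    less than [k.+1] by [index_drop]. *)
Lemma traj_closed (x : 'rV[R]_k.+1) : x != 0 -> closure (Wplus Phi w) (ph h Phi v x) ->
  Wplus Phi w (ph h Phi v x).
Proof.
move=> x0 clx; have [w' cw' Ww'] := ms_conv hMS cM (ph h Phi v x).
have [<- //|ww] := pselect (w' = w).
have ciw' : cip h w' (morse_index h w') by [].
have h1 := index_drop hMS cv ciw' x0 Ww'.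
have h2 := closure_index ciw' cw clx Ww' ww.
by have := leq_trans h2 (ltnSE h1); rewrite ltnn.
Qed.

(** On the compact unit sphere these points are isolated, by the local section, and their set is
    closed, by [traj_closed]. *)
Lemma traj_finite : finite_set [set x : 'rV[R]_k.+1 | nsq x = 1 /\ Wplus Phi w (ph h Phi v x)].
Proof.
set Z := [set x | _]; pose S := [set x : 'rV[R]_k.+1 | nsq x = 1].
have ZS : S `&` Z = Z by apply/seteqP; split=> x; [case|move=> Zx; split=> //; exact: Zx.1].
rewrite -ZS.
apply: (@compact_ind _ S (fun A => finite_set (A `&` Z))).
- exact: sphere_compact.
- by rewrite set0I.
- by move=> A B fA fB; rewrite setIUl finite_setU.
- by move=> A B AB; apply: sub_finite_set; exact: setSI.
move=> x Sx; have x0 := nsq1_neq0 Sx.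
have [Wx|nW] := pselect (Wplus Phi w (ph h Phi v x)).
  have [T gT] := filter_ex (good_ex hw Wx).
  have [sg [s0 s1 s2]] := ph_section Sx gT Wx.
  exists [set y | (nsq y = 1 -> sg (st h Phi w k T (ph h Phi v y)) = y) /\
                  (st h Phi w k T (ph h Phi v y) = 0 <-> Wplus Phi w (ph h Phi v y))].
    apply: (near_and s2).
    exact: (near_cont (P := fun z => st h Phi w k T z = 0 <-> Wplus Phi w z) (@ph_continuous x) (st_near hMS cw gT)).
  apply: (@sub_finite_set _ _ [set x]) => // y [[H1 H2] [ny Wy]] /=.
  by rewrite -(H1 ny) (proj2 H2 Wy) s0.
have ncl : ~ closure (Wplus Phi w) (ph h Phi v x) by move=> /(traj_closed x0).
have nA : \forall z \near ph h Phi v x, ~ Wplus Phi w z.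
  apply: contrapT => nn; apply: ncl => B nB.
  apply: contrapT => AB; apply: nn; apply: filterS nB => z Bz Az; apply: AB.
  by exists z.
exists [set y | ~ Wplus Phi w (ph h Phi v y)].
  exact: (near_cont (P := fun z => ~ Wplus Phi w z) (@ph_continuous x) nA).
by apply: (@sub_finite_set _ _ set0) => // y [ny [_ /ny]].
Qed.

End Consecutive.
End Closure.

(** * Counting the ends of an oriented one-dimensional space covered by arcs *)

Section ArcCounting.
Variables (R : realType) (T : ptopologicalType).

(* Each [c i] parametrizes an open arc of [N] by the interval from [a i] to [b i]; the cores, from
   [lo i] to [hi i], cover [N].  The arc has an end on the left when [a i = lo i], and on the right
   when [hi i = b i]. *)
Record arcs (N : set T) (I : finType) (c : I -> R -> T) (a lo hi b : I -> R) : Prop := Arcs {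
  arc_bounds : forall i, a i <= lo i /\ lo i < hi i /\ hi i <= b i;
  arc_in : forall i t, a i < t < b i -> N (c i t);
  arc_inj : forall i t u, a i < t < b i -> a i < u < b i -> c i t = c i u -> t = u;
  arc_cont : forall i t, a i < t < b i -> {for t, continuous (c i)};
  arc_open : forall i t e, a i < t < b i -> 0 < e -> \forall y \near c i t, N y ->
    exists u, [/\ a i < u < b i, `|u - t| < e & c i u = y];
  arc_orient : forall i j t t', a i < t < b i -> a j < t' < b j -> c i t = c j t' ->
    exists2 e : R, 0 < e & forall u w, a i < u < b i -> a j < w < b j ->
      `|u - t| < e -> `|w - t'| < e -> c i u = c j w -> (u < t) = (w < t');
  arc_cover : forall y, N y -> exists i t, lo i < t < hi i /\ c i t = y;
  arc_lend : forall i y, a i = lo i -> N y -> exists2 e : R, 0 < e &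
    \forall z \near y, forall t, a i < t < a i + e -> c i t <> z;
  arc_rend : forall i y, hi i = b i -> N y -> exists2 e : R, 0 < e &
    \forall z \near y, forall t, b i - e < t < b i -> c i t <> z;
  arc_ldisj : forall i j t u, a i = lo i -> a j = lo j ->
    a i < t < b i -> a j < u < b j -> c i t = c j u -> i = j;
  arc_rdisj : forall i j t u, hi i = b i -> hi j = b j ->
    a i < t < b i -> a j < u < b j -> c i t = c j u -> i = j;
  arc_oneend : forall i, ~ (a i = lo i /\ hi i = b i) }.

Lemma itvN (x y z : R) : (- y < z < - x) = (x < - z < y).
Proof. by rewrite ltrNl [- z < y]ltrNl [x < - z]ltrNr andbC [z < - x]ltrNr andbC. Qed.

(** All arcs are reversed at once, so [arc_orient] survives while left and right ends are exchanged.
    Each statement below is therefore proved in the forward direction only. *)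
Lemma arcs_rev N I c a lo hi b : arcs N c a lo hi b ->
  @arcs N I (fun i t => c i (- t)) (fun i => - b i) (fun i => - hi i) (fun i => - lo i) (fun i => - a i).
Proof.
move=> H; have nE (x y : R) : `|- x - y| = `|x - - y| by rewrite -opprD normrN opprK.
split.
- by move=> i; have [h1 [h2 h3]] := arc_bounds H i; rewrite !lerN2 ltrN2.
- by move=> i t; rewrite itvN; exact: arc_in H i (- t).
- move=> i t u; rewrite !itvN => ht hu /(arc_inj H ht hu) /eqP; rewrite eqr_opp => /eqP //.
- move=> i t; rewrite itvN => ht; apply: (@continuous_comp _ _ _ -%R (c i)).
    exact: opp_continuous.
  exact: arc_cont H i _ ht.
- move=> i t e; rewrite itvN => ht e0; apply: filterS (arc_open H ht e0) => y Hy /Hy[u [h1 h2 h3]].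
  by exists (- u); split; [rewrite itvN opprK|rewrite nE|rewrite opprK].
- move=> i j t t'; rewrite !itvN => ht ht' E; have [e e0 He] := arc_orient H ht ht' E.
  exists e => // u w; rewrite !itvN => hu hw ut wt cE.
  have nE' (x y : R) : `|- x - - y| = `|x - y| by rewrite opprK addrC distrC.
  have {}He := He _ _ hu hw; rewrite !nE' in He; have {}He := He ut wt cE.
  rewrite !ltrN2 in He.
  have Heq : u = t <-> w = t'.
    split=> E2.
      by apply: oppr_inj; apply: (arc_inj H hw ht'); rewrite -cE E2.
    by apply: oppr_inj; apply: (arc_inj H hu ht); rewrite cE E2.
  rewrite !ltNge !le_eqVlt He; congr (~~ (_ || _)).
  by apply/eqP/eqP => /esym/Heq.
- move=> y Ny; have [i [t [ht E]]] := arc_cover H Ny.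
  by exists i, (- t); rewrite opprK itvN !opprK; split.
- move=> i y /oppr_inj E Ny; have [e e0 He] := arc_rend H (esym E) Ny; exists e => //.
  apply: filterS He => z Hz t /andP[? ?]; apply: Hz; apply/andP; split; lra.
- move=> i y /oppr_inj E Ny; have [e e0 He] := arc_lend H (esym E) Ny; exists e => //.
  apply: filterS He => z Hz t /andP[? ?]; apply: Hz; apply/andP; split; lra.
- move=> i j t u /oppr_inj E1 /oppr_inj E2; rewrite !itvN; exact: (arc_rdisj H (esym E1) (esym E2)).
- move=> i j t u /oppr_inj E1 /oppr_inj E2; rewrite !itvN; exact: (arc_ldisj H (esym E1) (esym E2)).
- by move=> i [/oppr_inj E1 /oppr_inj E2]; exact: (arc_oneend H (conj (esym E2) (esym E1))).
Qed.

Section Forward.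
Variables (N : set T) (I : finType) (c : I -> R -> T) (a lo hi b : I -> R).
Hypothesis hT : hausdorff_space T.
Hypothesis H : arcs N c a lo hi b.

(** The overlapping arcs are not made disjoint. Cutting them at these finitely many points turns the
    space into a directed graph in which each node has exactly one successor. *)
Definition vtx (y : T) : Prop :=
  exists i, (a i < lo i /\ y = c i (lo i)) \/ (hi i < b i /\ y = c i (hi i)).

Definition novtx i s t : Prop := forall u, s < u < t -> ~ vtx (c i u).
(** A node [inl p] is a vertex; a node [inr l] stands for the missing end of the arc [l], which is
    not a point of the space. *)
Definition src i s (x : T + I) : Prop :=
  match x with inl p => [/\ a i < s, c i s = p & vtx p] | inr l => [/\ l = i, s = a i & a i = lo i] end.
Definition tgt i t (x : T + I) : Prop :=
  match x with inl p => [/\ t < b i, c i t = p & vtx p] | inr l => [/\ l = i, t = b i & hi i = b i] end.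
Definition seg i s t : Prop := [/\ a i <= s, s < t, t <= b i & novtx i s t].

Let in_seg i s t u : seg i s t -> s < u < t -> a i < u < b i.
Proof. by case=> h1 _ h2 _ /andP[h3 h4]; rewrite (le_lt_trans h1 h3) (lt_le_trans h4 h2). Qed.

Lemma closed_itv_cluster (F : set_system R) (x y : R) : ProperFilter F -> F [set u | x < u < y] ->
  exists2 w, x <= w <= y & cluster F w.
Proof.
move=> FF Fxy; have := @segment_compact R x y F FF.
case=> [|w [wxy clw]].
  by apply: filterS Fxy => u /andP[h1 h2]; rewrite /= in_itv /= !ltW.
by exists w => //; move: wxy; rewrite /= in_itv.
Qed.

(** A limit parameter [w] exists by compactness of the closed interval. It cannot be a missing end
    of the arc [j], because near a point of [N] the arc does not return arbitrarily late or early
    ([arc_lend], [arc_rend]). Then continuity and separation identify [c j w] with [c i u0]. *)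
Lemma arc_limit j s' t' (xj xj' : T + I) i u0 (G : R -> Prop) :
  seg j s' t' -> src j s' xj -> tgt j t' xj' -> a i < u0 < b i ->
  (forall e : R, 0 < e -> exists2 u, (G u /\ `|u - u0| < e) /\ a i < u < b i &
      exists2 w, s' < w < t' & c j w = c i u) ->
  exists w, [/\ s' <= w <= t', a j < w < b j, c j w = c i u0 &
    forall e : R, 0 < e -> exists u w', [/\ G u, a i < u < b i, `|u - u0| < e, `|w' - w| < e & s' < w' < t' /\ c j w' = c i u]].
Proof.
move=> sg sx tx hu0 HG; have [h1 h2 h3 h4] := sg.
pose B (e : R) := [set w | s' < w < t' /\ exists u, [/\ G u, `|u - u0| < e, a i < u < b i & c j w = c i u]].
pose F : set_system R := [set Q | exists2 e, 0 < e & B e `<=` Q].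
have FF : ProperFilter F.
  apply: Build_ProperFilter_ex.
    move=> Q [e e0 sQ]; have [u [[Gu ue] hu] [w hw E]] := HG e e0.
    by exists w; apply: sQ; split=> //; exists u.
  split.
  - by exists 1.
  - move=> Q Q' [e e0 sQ] [e' e'0 sQ']; exists (Num.min e e'); first by rewrite lt_min e0.
    move=> w [hw [u [Gu ue hu E]]]; move: ue; rewrite lt_min => /andP[ue ue'].
    by split; [apply: sQ|apply: sQ']; split=> //; exists u.
  - by move=> Q Q' sQ [e e0 sB]; exists e => // w /sB /sQ.
have [|w wst clw] := @closed_itv_cluster F s' t' FF.
  by exists 1 => // w [].
have key (e : R) : 0 < e -> exists u w', [/\ G u, a i < u < b i, `|u - u0| < e, `|w' - w| < e & s' < w' < t' /\ c j w' = c i u].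
  move=> e0; have FB : F (B e) by exists e.
  have [w' [[hw' [u [Gu ue hu E]]] we]] := clw _ _ FB (nbhsx_ballx w e e0).
  exists u, w'; split=> //.
  by move: we; rewrite -ball_normE /= distrC.
have Nu0 : N (c i u0) by exact: (arc_in H hu0).
have cu0 := arc_cont H hu0.
have near_u0 (P : T -> Prop) : (\forall z \near c i u0, P z) -> exists2 e, 0 < e & forall u, `|u - u0| < e -> P (c i u).
  move=> nP; have [e e0 He] := near_ball (near_cont cu0 nP).
  by exists e => // u ue; apply: He; rewrite -ball_normE /= distrC.
have aw : a j < w.
  rewrite lt_neqAle; have [ws _] := andP wst; rewrite (le_trans h1 ws) andbT; apply/eqP => wE.
  have s'E : s' = a j by apply/eqP; rewrite eq_le h1 andbT wE.
  have lE : a j = lo j.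
    by case: xj sx => [p [h5 _ _]|l []//]; move: h5; rewrite s'E ltxx.
  have [e e0 He] := arc_lend H lE Nu0; have [e' e'0 He'] := near_u0 _ He.
  have m0 : 0 < Num.min e e' by rewrite lt_min e0.
  have [u [w' [Gu hu ue we [hw E]]]] := key _ m0.
  move: ue we; rewrite !lt_min -wE => /andP[_ ue] /andP[we _].
  apply: (He' _ ue w'); last exact: E.
  rewrite -s'E (andP hw).1 /= s'E; have := ler_norm (w' - a j); lra.
have wb : w < b j.
  rewrite lt_neqAle; have [_ ws] := andP wst; rewrite (le_trans ws h3) andbT; apply/eqP => wE.
  have t'E : t' = b j by apply/eqP; rewrite eq_le h3 -wE.
  have lE : hi j = b j.
    by case: xj' tx => [p [h5 _ _]|l []//]; move: h5; rewrite t'E ltxx.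
  have [e e0 He] := arc_rend H lE Nu0; have [e' e'0 He'] := near_u0 _ He.
  have m0 : 0 < Num.min e e' by rewrite lt_min e0.
  have [u [w' [Gu hu ue we [hw E]]]] := key _ m0.
  move: ue we; rewrite !lt_min wE => /andP[_ ue] /andP[we _].
  apply: (He' _ ue w'); last exact: E.
  rewrite -t'E (andP hw).2 andbT t'E; have := ler_norm (b j - w'); rewrite distrC; lra.
have hw0 : a j < w < b j by rewrite aw.
exists w; split=> //.
apply: hT => A A' nA nA'.
have [e e0 He] := near_ball (near_cont (arc_cont H hw0) nA).
have [e' e'0 He'] := near_u0 _ nA'.
have m0 : 0 < Num.min e e' by rewrite lt_min e0.
  have [u [w' [Gu hu ue we [hw E]]]] := key _ m0.
move: ue we; rewrite !lt_min => /andP[_ ue] /andP[we _].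
exists (c i u); split; last exact: He'.
by rewrite -E; apply: He; rewrite -ball_normE /= distrC.
Qed.

Lemma seg_inner j s' t' xj xj' w : seg j s' t' -> src j s' xj -> tgt j t' xj' ->
  s' <= w <= t' -> a j < w < b j -> ~ vtx (c j w) -> s' < w < t'.
Proof.
move=> [h1 h2 h3 h4] sx tx /andP[sw wt] /andP[aw wb] nv.
rewrite !lt_neqAle sw wt !andbT; apply/andP; split; apply/eqP => E.
  by case: xj sx => [p [_ <- h5]|l [_ h5 _]]; [apply: nv; rewrite -E|move: aw; rewrite -E h5 ltxx].
by case: xj' tx => [p [_ <- h5]|l [_ h5 _]]; [apply: nv; rewrite E|move: wb; rewrite E h5 ltxx].
Qed.

Lemma seg_sub i s t j s' t' x y y' : seg i s t -> src i s x -> tgt i t y ->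
  seg j s' t' -> src j s' x -> tgt j t' y' ->
  forall u, s < u < t -> exists2 w, s' < w < t' & c j w = c i u.
Proof.
move=> sg sx ty sg' sx' ty'; have [h1 h2 h3 h4] := sg; have [h1' h2' h3' h4'] := sg'.
pose B u := exists2 w, s' < w < t' & c j w = c i u.
have oB u : s < u < t -> B u -> exists2 e, 0 < e & forall u', `|u' - u| < e -> s < u' < t -> B u'.
  move=> hu [w hw E]; have hw' := in_seg sg' hw.
  pose d := Num.min (w - s') (t' - w).
  have d0 : 0 < d by rewrite lt_min !subr_gt0.
  have no := arc_open H hw' d0; rewrite E in no.
  have [e e0 He] := near_ball (near_cont (arc_cont H (in_seg sg hu)) no).
  exists e => // u' ue hu'.
  have [|w' [hw1 hw2 hw3]] := He u' _ (arc_in H (in_seg sg hu')).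
    by rewrite -ball_normE /= distrC.
  exists w' => //; move: hw2; rewrite lt_min ltr_norml => /andP[/andP[? ?] /= ?].
  have := ler_norm (w' - w); have := ler_norm (w - w'); rewrite (distrC w w') => ? ?.
  by apply/andP; split; lra.
(* At a common vertex, [arc_orient] forces both segments to leave in the same direction. At a common
   missing end the two arcs are the same one. *)
have B0 : exists2 e, 0 < e & forall u, s < u < s + e -> s < u < t -> B u.
  case: x sx sx' => [p [as_ E vp] [as' E' _]|l [li sE lE] [lj s'E lE']].
    have hs : a i < s < b i by rewrite as_ (lt_le_trans h2 h3).
    have hs' : a j < s' < b j by rewrite as' (lt_le_trans h2' h3').
    have EE : c i s = c j s' by rewrite E E'.
    have [e e0 He] := arc_orient H hs hs' EE.
    pose d := Num.min e (t' - s').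
    have d0 : 0 < d by rewrite lt_min e0 subr_gt0.
    have no := arc_open H hs' d0; rewrite -EE in no.
    have [e1 e10 He1] := near_ball (near_cont (arc_cont H hs) no).
    exists (Num.min e e1); first by rewrite lt_min e0.
    move=> u /andP[su ue] hu; have hu' := in_seg sg hu.
    have us : `|u - s| < Num.min e e1 by rewrite gtr0_norm ?subr_gt0 // ltrBlDr addrC.
    move: us; rewrite lt_min => /andP[us us1].
    have [|w [hw1 hw2 hw3]] := He1 u _ (arc_in H hu').
      by rewrite -ball_normE /= distrC.
    move: hw2; rewrite lt_min => /andP[we wt].
    have := He u w hu' hw1 us we (esym hw3); rewrite ltNge (ltW su) /= => /esym/negbT.
    rewrite -leNgt le_eqVlt => /predU1P[wE|sw].
      have := arc_inj H hs hu' (_ : c i s = c i u); rewrite -hw3 -wE EE => /(_ erefl) uE.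
      by move: su; rewrite uE ltxx.
    exists w => //; rewrite sw /=; have := ler_norm (w - s'); lra.
  exists (t' - s'); first by rewrite subr_gt0.
  have ij : i = j by rewrite -li.
  have ss : s' = s by rewrite s'E sE ij.
  move=> u /andP[su ue] hu; exists u; last by rewrite ij.
  by apply/andP; split; lra.
have [e0' e00 HB0] := B0.
move=> u hu; apply: contrapT => nBu.
pose S := [set u | s < u < t /\ ~ B u].
have Su : S u by [].
have infS : has_inf S by split; [exists u|exists s => v [/andP[/ltW]]].
pose v := inf S.
have sv : s + e0' <= v.
  apply: lb_le_inf; first by exists u.
  move=> x' [/andP[sx1 sx2] nBx]; rewrite leNgt; apply/negP => lt; apply: nBx.
  by apply: HB0; rewrite sx1.
have vu : v <= u by apply: ge_inf => //; case: infS.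
have hv : s < v < t.
  by case/andP: hu => su ut; rewrite (le_lt_trans vu ut) andbT (lt_le_trans _ sv) // ltrDl.
have Blow u' : s < u' < v -> B u'.
  move=> /andP[h5 h6]; apply: contrapT => nB.
  have : v <= u' by apply: ge_inf; [case: infS|split=> //; rewrite h5 (lt_trans h6) //; case/andP: hv].
  by rewrite leNgt h6.
have Bv : B v.
  have [|w [hw1 hw2 hw3 _]] := @arc_limit j s' t' x y' i v (fun u' => s < u' < v) sg' sx' ty' (in_seg sg hv).
    move=> e e1; pose d := Num.min e (v - s); have d0 : 0 < d by rewrite lt_min e1 subr_gt0; case/andP: hv.
    have de : d <= e by rewrite ge_min lexx.
    have dv : d <= v - s by rewrite ge_min lexx orbT.
    have hu' : s < v - d / 2 < v by apply/andP; split; lra.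
    exists (v - d / 2); last by apply: Blow.
    split; first by split=> //; rewrite addrAC subrr add0r normrN gtr0_norm; lra.
    by apply: (in_seg sg); case/andP: hu' => -> /lt_trans -> //; case/andP: hv.
  exists w => //; apply: (seg_inner sg' sx' ty' hw1 hw2); rewrite hw3; exact: h4.
have [e e1 He] := oB v hv Bv.
have [z Sz zv] := inf_adherent e1 infS.
have vz : v <= z by apply: ge_inf; [case: infS|].
case: Sz => hz; apply; apply: He => //.
by rewrite ger0_norm ?subr_ge0 // ltrBlDl.
Qed.

(** The final vertex of the first segment is a limit of points of the second. It is not interior to
    the second, which contains no vertex, and it is not its beginning, by orientation; so it is its
    end. *)
Lemma tgt_vtx i s t j s' t' x p y' : seg i s t -> src i s x -> tgt i t (inl p) ->
  seg j s' t' -> src j s' x -> tgt j t' y' -> y' = inl p.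
Proof.
move=> sg sx ty sg' sx' ty'.
have sub := seg_sub sg sx ty sg' sx' ty'.
have [h1 h2 h3 h4] := sg; have [h1' h2' h3' h4'] := sg'.
have [tb tp vp] := ty.
have ht : a i < t < b i by rewrite (le_lt_trans h1 h2).
have [|w [/andP[sw wt] hw2 hw3 hw4]] := @arc_limit j s' t' x y' i t (fun u' => s < u' < t) sg' sx' ty' ht.
  move=> e e1; pose d := Num.min e (t - s); have d0 : 0 < d by rewrite lt_min e1 subr_gt0.
  have de : d <= e by rewrite ge_min lexx.
  have dv : d <= t - s by rewrite ge_min lexx orbT.
  have hu' : s < t - d / 2 < t by apply/andP; split; lra.
  exists (t - d / 2); last by apply: sub.
  split; first by split=> //; rewrite addrAC subrr add0r normrN gtr0_norm; lra.
  exact: (in_seg sg hu').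
move: wt; rewrite le_eqVlt => /predU1P[wE|wt].
  case: y' ty' {sub} => [p' [_ <- _]|l [_ tE _]]; first by rewrite -wE hw3 tp.
  by case/andP: hw2; rewrite wE tE ltxx.
move: sw; rewrite le_eqVlt => /predU1P[wE|sw]; last first.
  by exfalso; apply: (h4' w); [rewrite sw|rewrite hw3 tp].
have [e e0 He] := arc_orient H ht hw2 (esym hw3).
have [u [w' [/andP[Gu1 Gu2] hu ue we [hw' E]]]] := hw4 e e0.
have := He u w' hu (in_seg sg' hw') ue we (esym E).
by rewrite Gu2 -wE ltNge; case/andP: hw' => /ltW ->.
Qed.

Lemma tgt_unique i s t j s' t' x y y' : seg i s t -> src i s x -> tgt i t y ->
  seg j s' t' -> src j s' x -> tgt j t' y' -> y = y'.
Proof.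
case: y => [p|l] sg sx ty sg' sx' ty'; first by rewrite (tgt_vtx sg sx ty sg' sx' ty').
case: y' ty' => [p'|l'] ty'; first by rewrite (tgt_vtx sg' sx' ty' sg sx ty).
have [_ h2 _ _] := sg.
have hu : s < (s + t) / 2 < t by rewrite midf_lt ?h2 //=; lra.
have [w hw E] := seg_sub sg sx ty sg' sx' ty' hu.
case: ty ty' => -> _ e1 [-> _ e2]; congr inr.
exact: (arc_rdisj H e1 e2 (in_seg sg hu) (in_seg sg' hw) (esym E)).
Qed.

Lemma vtx_finite : finite_set vtx.
Proof.
apply: (@sub_finite_set _ _ ([set c i (lo i) | i in [set: I]] `|` [set c i (hi i) | i in [set: I]])).
  by move=> y [i [[_ ->]|[_ ->]]]; [left|right]; exists i.
by rewrite finite_setU; split; apply: finite_image; exact: finite_finset.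
Qed.

Lemma vtx_N y : vtx y -> N y.
Proof.
by case=> i; have [h1 [h2 h3]] := arc_bounds H i; case=> [[h4 ->]|[h4 ->]]; apply: (arc_in H);
  [rewrite h4 (lt_le_trans h2 h3)|rewrite h4 (le_lt_trans h1 h2)].
Qed.

Lemma finite_min (A : set R) x : finite_set A -> A x -> exists2 m, A m & forall y, A y -> m <= y.
Proof.
move=> /finite_seqP[s ->] /=; elim: s x => [//|z [|z' s] IH] x _.
  by exists z; rewrite ?inE // => y; rewrite inE => /eqP ->.
have [m ms mP] := IH z' (mem_head _ _).
have [zm|mz] := leP z m; [exists z|exists m]; rewrite ?mem_head //.
- by move=> y; rewrite in_cons => /predU1P[->//|/mP]; exact: le_trans.
- by rewrite in_cons ms orbT.
- by move=> y; rewrite in_cons => /predU1P[->|/mP//]; exact: ltW.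
Qed.

Lemma seg_total i s x : src i s x -> s < hi i -> exists t y, [/\ seg i s t, tgt i t y &
  match y with inl p => vtx p | inr l => hi l = b l end].
Proof.
move=> sx sh; have [h1 [h2 h3]] := arc_bounds H i.
have as_ : a i <= s by case: x sx => [p [/ltW]|l [_ ->]].
pose A := [set u | s < u < b i /\ vtx (c i u)].
have inA u : s < u < b i -> a i < u < b i by case/andP=> h4 ->; rewrite (le_lt_trans as_ h4).
have fA : finite_set A.
  apply: (sub_finite_set _ (finite_image (fun p => xget 0 [set u | a i < u < b i /\ c i u = p]) vtx_finite)).
  move=> u [/inA hu vu]; exists (c i u) => //; case: xgetP => [w _ [hw E]|/(_ u)[]//].
  exact: (arc_inj H hw hu E).
have [ex|nex] := pselect (exists u, A u).
  case: ex => u /(finite_min fA)[t [/andP[st tb] vt] mt]; exists t, (inl (c i t)); split=> //.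
  split=> //; first exact: ltW.
  move=> w /andP[sw wt] vw; have := mt w; rewrite /A /= sw (lt_trans wt tb) leNgt wt.
  by move=> /(_ (conj erefl vw)).
(* If the core stopped before the end of the arc, its last point would be a further vertex. *)
have bE : hi i = b i.
  apply/eqP; rewrite eq_le h3 leNgt; apply/negP => lt.
  by apply: nex; exists (hi i); split; [rewrite sh|exists i; right].
exists (b i), (inr i); split=> //; split=> //; first by rewrite -bE.
by move=> u hu vu; apply: nex; exists u.
Qed.

Definition next (x y : T + I) : Prop := exists i s t, [/\ seg i s t, src i s x & tgt i t y].

Lemma next_unique x y y' : next x y -> next x y' -> y = y'.
Proof.
move=> [i [s [t [h1 h2 h3]]]] [j [s' [t' [h4 h5 h6]]]]; exact: tgt_unique h1 h2 h3 h4 h5 h6.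
Qed.

Lemma next_total x : match x with inl p => vtx p | inr l => a l = lo l end ->
  exists2 y, next x y & match y with inl p => vtx p | inr l => hi l = b l end.
Proof.
case: x => [p vp|l al].
  have [i [s [/andP[ls sh] E]]] := arc_cover H (vtx_N vp).
  have sx : src i s (inl p) by split=> //; rewrite (le_lt_trans _ ls) //; case: (arc_bounds H i).
  by have [t [y [h1 h2 h3]]] := seg_total sx sh; exists y => //; exists i, s, t.
have sx : src l (a l) (inr l) by [].
have [|t [y [h1 h2 h3]]] := seg_total sx; last by exists y => //; exists l, (a l), t.
by rewrite al; case: (arc_bounds H l) => _ [].
Qed.
End Forward.

Lemma vtx_rev (I : finType) (c : I -> R -> T) (a lo hi b : I -> R) (y : T) : vtx (fun i t => c i (- t)) (fun i => - b i)
  (fun i => - hi i) (fun i => - lo i) (fun i => - a i) y <-> vtx c a lo hi b y.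
Proof.
by split; case=> i; rewrite /= ?ltrN2 ?opprK; case=> h; exists i; rewrite /= ?ltrN2 ?opprK; [right|left|right|left].
Qed.

Lemma next_rev (I : finType) (c : I -> R -> T) (a lo hi b : I -> R) (x y : T + I) : next c a lo hi b x y ->
  next (fun i t => c i (- t)) (fun i => - b i) (fun i => - hi i) (fun i => - lo i) (fun i => - a i) y x.
Proof.
move=> [i [s [t [[h1 h2 h3 h4] sx ty]]]]; exists i, (- t), (- s); split.
- split; rewrite ?lerN2 ?ltrN2 // => u hu /vtx_rev vu; apply: (h4 (- u)) => //.
  by move: hu; rewrite itvN.
- by case: y ty => [p [e1 e2 e3]|l [e1 e2 e3]]; split; rewrite ?ltrN2 ?opprK ?e2 ?e3 //; apply/vtx_rev.
- by case: x sx => [p [e1 e2 e3]|l [e1 e2 e3]]; split; rewrite ?ltrN2 ?opprK ?e2 ?e3 //; apply/vtx_rev.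
Qed.

Lemma next_inj (N : set T) (I : finType) (c : I -> R -> T) (a lo hi b : I -> R) (x x' y : T + I) : hausdorff_space T -> arcs N c a lo hi b ->
  next c a lo hi b x y -> next c a lo hi b x' y -> x = x'.
Proof. by move=> hT H /next_rev h1 /next_rev h2; exact: (next_unique hT (arcs_rev H) h1 h2). Qed.

(** The successor map is an injection from vertices and left ends to vertices and right ends,
    injectivity being uniqueness of the successor for the reversed arcs. The vertices are the same
    on both sides and cancel. *)
Lemma arcs_ends_le (N : set T) (I : finType) (c : I -> R -> T) (a lo hi b : I -> R) : hausdorff_space T -> arcs N c a lo hi b ->
  (#|[pred i | a i == lo i]| <= #|[pred i | hi i == b i]|)%N.
Proof.
move=> hT H; have [vs vsE] := (finite_seqP _).1 (vtx_finite c a lo hi b).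
have vsP p : p \in vs <-> vtx c a lo hi b p.
  by split=> [pv|vp]; [rewrite vsE|have : [set` vs] p by rewrite -vsE].
pose S : finType := (seq_sub vs + {i | a i == lo i})%type.
pose S' : finType := (seq_sub vs + {i | hi i == b i})%type.
pose e (x : S) : T + I := match x with inl p => inl (val p) | inr i => inr (val i) end.
pose e' (x : S') : T + I := match x with inl p => inl (val p) | inr i => inr (val i) end.
have ex x : exists y, next c a lo hi b (e x) (e' y).
  have [|y hy Py] := @next_total N I c a lo hi b H (e x).
    by case: x => [p|[i li]] /=; [apply/vsP; exact: valP|apply/eqP].
  case: y hy Py => [p hy /vsP vp|i hy /eqP hi_]; first by exists (inl (SeqSub vp)).
  by exists (inr (exist _ i hi_)).
have [f fP] := choice ex.
have f_inj : injective f.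
  move=> x x' E; have := next_inj hT H (fP x); rewrite E => /(_ _ (fP x')).
  by case: x x' {E} => [p|i] [p'|i'] //= [] /val_inj ->.
have := leq_card f f_inj; rewrite !card_sum leq_add2l !card_sig; exact.
Qed.

Lemma arcs_ends (N : set T) (I : finType) (c : I -> R -> T) (a lo hi b : I -> R) : hausdorff_space T -> arcs N c a lo hi b ->
  #|[pred i | a i == lo i]| = #|[pred i | hi i == b i]|.
Proof.
move=> hT H; apply/eqP; rewrite eqn_leq (arcs_ends_le hT H) /=.
have := arcs_ends_le hT (arcs_rev H); congr (_ <= _)%N; apply: eq_card => i; rewrite !inE eqr_opp eq_sym //.
Qed.
End ArcCounting.

(** * Oriented arcs in a zero set on the unit sphere *)

Section Curves.
Variable R : realType.

Lemma derive_curve m k (c : R -> 'rV[R]_m) (F : 'rV[R]_m -> 'rV[R]_k) t :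
  smooth_at c t -> smooth_at F (c t) -> 'D_1 (F \o c) t = 'D_1 c t *m 'J F (c t).
Proof.
move=> sc sF; have dc := smooth_diff sc; have dF := smooth_diff sF.
have E1 := deriveE (1 : R) (differentiable_comp dc dF).
have E2 := congr1 (fun k : R -> 'rV[R]_k => k 1) (diff_comp dc dF).
have E3 := deriveE (1 : R) dc.
have E4 := deriveE ('D_1 c t) dF; rewrite /= -E3 -E4 (deriveEjacobian _ dF) in E2.
by rewrite E1 E2.
Qed.

Lemma derive_scale m (a : R -> R) (f : R -> 'rV[R]_m) t : smooth_at a t -> smooth_at f t ->
  'D_1 (fun u => a u *: f u) t = 'D_1 a t *: f t + a t *: 'D_1 f t.
Proof.
move=> sa sf; have saf : smooth_at (fun u => a u *: f u) t by apply: smooth_scale => //; exact: findim_rV.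
apply/rowP => j; rewrite (derive_rV _ _ saf) [RHS]mxE [X in X + _]mxE [X in _ + X]mxE (derive_rV _ _ sf).
have -> : (fun y => (a y *: f y) 0 j) = a * (fun y => f y 0 j) by apply/funext => y; rewrite mxE.
have da : derivable a t 1 by apply: diff_derivable; exact: smooth_diff.
have df : derivable (fun y => f y 0 j) t 1.
  by apply: diff_derivable; apply: smooth_diff; exact: smooth_coef.
apply: etrans (deriveM da df) _; rewrite addrC; congr (_ + _); exact: mulrC.
Qed.

Lemma smooth_pos (V : normedModType R) (f : V -> R) p : smooth_at f p -> 0 < f p ->
  \forall y \near p, 0 < f y.
Proof. by move=> /smooth_cont cf; apply: (cvgr_gt (f p)). Qed.

Lemma derive_pos_mono (f : R -> R) t : derivable f t 1 -> 0 < 'D_1 f t ->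
  \forall u \near t, (f u < f t) = (u < t).
Proof.
move=> df D0; have /(cvgr_gt ('D_1 f t))/(_ _ D0) := df.
rewrite near_withinE => /near_ball[e e0 He].
apply: filterS (nbhsx_ballx t e e0) => u; rewrite -ball_normE /= => ue.
have [->|ut] := eqVneq u t; first by rewrite !ltxx.
have h0 : u - t != 0 by rewrite subr_eq0.
have : ball (0 : R) e (u - t) by rewrite -ball_normE /= sub0r normrN distrC.
move=> /He /(_ h0) /=; rewrite scaler1 subrK /GRing.scale /= => Hp.
have {}Hp : 0 < (f u - f t) * (u - t).
  have h2 : 0 < (u - t) ^+ 2 by rewrite lt_neqAle sqr_ge0 andbT eq_sym expf_eq0 /= h0.
  have -> : (f u - f t) * (u - t) = (u - t)^-1 * (f u - f t) * (u - t) ^+ 2 by field.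
  exact: mulr_gt0.
rewrite -[f u < _]subr_lt0 -[u < t]subr_lt0; move: ut; rewrite neq_lt => /orP[ut|ut].
  have h1 : u - t < 0 by rewrite subr_lt0.
  by rewrite h1; move: Hp; rewrite nmulr_lgt0.
have h1 : 0 < u - t by rewrite subr_gt0.
by move: Hp; rewrite pmulr_lgt0 // => h2; rewrite !ltNge ltW // ltW.
Qed.

(** The frame consists of the normal [x] of the sphere, a tangent [tau] of the curve and the
    differentials of its equations. Its sign orients the curve. *)
Definition mdet q (x tau : 'rV[R]_q.+2) (J : 'M[R]_(q.+2, q)) : R :=
  \det (row_mx x^T (row_mx tau^T J) : 'M[R]_(1 + (1 + q))).

Lemma mul_frame q (x tau z : 'rV[R]_q.+2) (J : 'M[R]_(q.+2, q)) :
  z *m (row_mx x^T (row_mx tau^T J) : 'M[R]_(1 + (1 + q))) =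
  row_mx (z *m x^T) (row_mx (z *m tau^T) (z *m J)).
Proof. by rewrite !mul_mx_row. Qed.

Lemma mdetZ q (x be : 'rV[R]_q.+2) (J : 'M[R]_(q.+2, q)) k : mdet x (k *: be) J = k * mdet x be J.
Proof.
pose D : 'M[R]_(1 + (1 + q)) := block_mx 1%:M 0 0 (block_mx k%:M 0 0 1%:M).
have -> : mdet x (k *: be) J = \det ((row_mx x^T (row_mx be^T J) : 'M[R]_(1 + (1 + q))) *m D).
  congr (\det _); rewrite /D mul_row_block !mulmx1 !mulmx0 addr0 add0r mul_row_block !mulmx0 addr0 add0r mulmx1.
  by rewrite [(k *: be)^T]linearZ /= mul_mx_scalar.
by rewrite det_mulmx /D !det_ublock !det1 det_scalar1 mul1r mulr1 mulrC.
Qed.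

Lemma tangent_proportional q (x al be : 'rV[R]_q.+2) (J : 'M[R]_(q.+2, q)) :
  al *m x^T = 0 -> al *m J = 0 -> 0 < mdet x al J ->
  be *m x^T = 0 -> be *m J = 0 -> 0 < mdet x be J ->
  exists2 k : R, 0 < k & al = k *: be.
Proof.
move=> ax aJ ad bx bJ bd; set P : 'M[R]_(1 + (1 + q)) := row_mx x^T (row_mx be^T J).
have uP : P \in unitmx by rewrite unitmxE unitfE gt_eqF.
pose k := (al *m be^T) 0 0 / (be *m be^T) 0 0.
have be0 : be != 0.
  by apply/eqP => E; move: bd; rewrite E -(scale0r be) mdetZ mul0r ltxx.
have aE : al = k *: be.
  have : al *m P = (k *: be) *m P.
    rewrite -scalemxAl !mul_frame ax aJ bx bJ !scale_row_mx !scaler0; congr (row_mx _ (row_mx _ _)).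
    apply/rowP => j; rewrite (ord1 j) [RHS]mxE /k divfK // gt_eqF //; exact: dotr_gt0.
  by move/(congr1 (mulmx^~ (invmx P))); rewrite /= !mulmxK.
exists k => //; move: ad; rewrite aE mdetZ; by rewrite pmulr_lgt0.
Qed.

Variables (q : nat) (N : set 'rV[R]_q.+2) (K : 'rV[R]_q.+2 -> 'M[R]_(q.+2, q)).

(** The equation [F] is only local, because [st] depends on a time, whereas its Jacobian at points
    of [N] is the globally given matrix [K]. This is what makes the orientations of different arcs
    comparable. *)
Definition loc_def x : Prop := [/\ nsq x = 1, row_full (K x), x *m K x = 0 &
  exists F : 'rV[R]_q.+2 -> 'rV[R]_q, [/\ smooth_at F x,
    \forall y \near x, nsq y = 1 -> (F y = 0 <-> N y) & \forall y \near x, N y -> 'J F y = K y]].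

Hypothesis NP : forall x, N x -> loc_def x.

Record garc (c : R -> 'rV[R]_q.+2) (a b : R) : Prop := Garc {
  garc_in : forall t, a < t < b -> N (c t);
  garc_inj : forall t u, a < t < b -> a < u < b -> c t = c u -> t = u;
  garc_smooth : forall t, a < t < b -> smooth_at c t;
  garc_pos : forall t, a < t < b -> 0 < mdet (c t) ('D_1 c t) (K (c t));
  garc_open : forall t e, a < t < b -> 0 < e -> \forall y \near c t, N y ->
    exists u, [/\ a < u < b, `|u - t| < e & c u = y] }.

Lemma near_itv (a b t : R) : a < t < b -> \forall u \near t, a < u < b.
Proof.
move=> ht; have : \forall u \near t, u \in `]a, b[ by apply: near_in_itvoo; rewrite in_itv.
by apply: filterS => u; rewrite in_itv.
Qed.

Lemma curve_tangent (c : R -> 'rV[R]_q.+2) t : smooth_at c t -> (\forall u \near t, N (c u)) ->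
  'D_1 c t *m (c t)^T = 0 /\ 'D_1 c t *m K (c t) = 0.
Proof.
move=> sc nN; have Nt := nbhs_singleton nN; have [_ _ _ [F [sF nF JF]]] := NP Nt.
have cc := smooth_cont sc.
split.
  have sa : smooth_at (fun y : 'rV[R]_q.+2 => (nsq y)%:M : 'rV[R]_1) (c t).
    by apply: smooth_scalar; exact: nsq_smooth.
  have E := derive_curve sc sa; rewrite jac_nsq in E.
  have E0 : 'D_1 ((fun y : 'rV[R]_q.+2 => (nsq y)%:M : 'rV[R]_1) \o c) t = 0.
    transitivity ('D_1 (cst (1%:M : 'rV[R]_1)) t); last exact: derive_cst.
    by apply: near_eq_derive; apply: filterS nN => u /NP[/= -> _ _ _].
  move: E; rewrite E0 [(2 *: _)^T]linearZ /= -scalemxAr => /esym/eqP.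
  by rewrite scaler_eq0 pnatr_eq0 /= => /eqP.
have E := derive_curve sc sF; rewrite (nbhs_singleton JF Nt) in E; rewrite -E.
transitivity ('D_1 (cst (0 : 'rV[R]_q)) t); last exact: derive_cst.
have nF' := near_cont (P := fun y => nsq y = 1 -> (F y = 0 <-> N y)) cc nF.
apply: near_eq_derive; apply: filterS2 nN nF' => u Nu Hu; apply: (proj2 (Hu _)) => //.
by case: (NP Nu).
Qed.

(** At a common point both velocities are positive multiples of each other, so the scalar product
    with one of them increases along both curves and orders their common points. *)
Lemma garc_orient c a b t c' a' b' t' : garc c a b -> garc c' a' b' ->
  a < t < b -> a' < t' < b' -> c t = c' t' ->
  exists2 e : R, 0 < e & forall u w, a < u < b -> a' < w < b' ->
      `|u - t| < e -> `|w - t'| < e -> c u = c' w -> (u < t) = (w < t').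
Proof.
move=> g g' ht ht' E.
have nN : \forall u \near t, N (c u) by apply: filterS (near_itv ht); exact: (garc_in g).
have nN' : \forall u \near t', N (c' u) by apply: filterS (near_itv ht'); exact: (garc_in g').
have sc := garc_smooth g ht; have sc' := garc_smooth g' ht'.
have [t1 t2] := curve_tangent sc nN; have [t3 t4] := curve_tangent sc' nN'.
have p1 := garc_pos g ht; have p2 := garc_pos g' ht'; rewrite -E in t3 t4 p2.
have [k k0 aE] := tangent_proportional t1 t2 p1 t3 t4 p2.
set be := 'D_1 c' t' in aE.
have be0 : be != 0.
  by apply/eqP => E0; move: p2; rewrite -/be E0 -(scale0r be) mdetZ mul0r ltxx.
pose l (y : 'rV[R]_q.+2) : R := (y *m be^T) 0 0.
have lD (d : R -> 'rV[R]_q.+2) s : smooth_at d s -> derivable (l \o d) s 1 /\ 'D_1 (l \o d) s = ('D_1 d s *m be^T) 0 0.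
  move=> sd; have sm : smooth_at (fun u => d u *m be^T) s by exact: smooth_mulmxr.
  have dd : derivable (fun u => d u *m be^T) s 1.
    by apply: diff_derivable; exact: smooth_diff.
  have [h1 h2] := derive_coef 0 0 dd.
  split; first exact: h1.
  apply: etrans h2 _; congr (fun_of_matrix _ 0 0); apply: derive_mulmxr; exact: smooth_diff.
have [d1 D1] := lD _ _ sc; have [d2 D2] := lD _ _ sc'.
have P2 : 0 < 'D_1 (l \o c') t' by rewrite D2; exact: dotr_gt0.
have P1 : 0 < 'D_1 (l \o c) t.
  by rewrite D1 aE -scalemxAl mxE mulr_gt0 //; exact: dotr_gt0.
have [e1 e10 H1] := near_ball (derive_pos_mono d1 P1).
have [e2 e20 H2] := near_ball (derive_pos_mono d2 P2).
exists (Num.min e1 e2); first by rewrite lt_min e10.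
move=> u w _ _; rewrite !lt_min => /andP[u1 _] /andP[_ w2] cE.
have b1 : ball t e1 u by rewrite -ball_normE /= distrC.
have b2 : ball t' e2 w by rewrite -ball_normE /= distrC.
by rewrite -(H1 _ b1) -(H2 _ b2) /= cE E.
Qed.

Lemma frame_neq0 (x tau : 'rV[R]_q.+2) (J : 'M[R]_(q.+2, q)) : x != 0 -> tau != 0 ->
  tau *m x^T = 0 -> row_full J -> x *m J = 0 -> tau *m J = 0 -> mdet x tau J != 0.
Proof.
move=> x0 t0 tx fJ xJ tJ; rewrite -unitfE -unitmxE -row_free_unit; apply/row_freeP.
suff : row_free (row_mx x^T (row_mx tau^T J) : 'M[R]_(1 + (1 + q))) by move/row_freeP.
rewrite -kermx_eq0; apply/eqP/row_matrixP => i; rewrite row0.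
set u := row i _; have : u *m (row_mx x^T (row_mx tau^T J) : 'M[R]_(1 + (1 + q))) = 0.
  by apply/sub_kermxP; exact: row_sub.
rewrite mul_frame -[0 in RHS](row_mx0) => /eq_row_mx[ux].
rewrite -[0 in RHS](row_mx0) => /eq_row_mx[ut uJ].
pose A : 'M[R]_(1 + 1, q.+2) := col_mx x tau.
have xt : x *m tau^T = 0 by rewrite -[LHS]trmxK trmx_mul trmxK tx trmx0.
have AA : A *m A^T \in unitmx.
  rewrite unitmxE unitfE /A tr_col_mx mul_col_row xt tx det_ublock mulf_neq0 //.
    by rewrite [X in \det X]mx11_scalar det_scalar1 gt_eqF // dotr_gt0.
  by rewrite [X in \det X]mx11_scalar det_scalar1 gt_eqF // dotr_gt0.
have rA : \rank A = 2%N.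
  apply/eqP; rewrite -[_ == _]/(row_free A); apply/row_freeP.
  by exists (A^T *m invmx (A *m A^T)); rewrite mulmxA mulmxV.
have sA : (A <= kermx J)%MS by apply/sub_kermxP; rewrite mul_col_mx xJ tJ col_mx0.
have rk : \rank (kermx J) = \rank A by rewrite mxrank_ker (eqP fJ) rA -addn2 addKn.
have : (u <= A)%MS.
  apply: (@submx_trans _ _ _ _ _ _ (kermx J)); first exact/sub_kermxP.
  by have [_ ] := mxrank_leqif_sup sA; rewrite rk eqxx => /esym.
move=> /submxP[D uD]; have : u *m A^T = 0 by rewrite tr_col_mx mul_mx_row ux ut row_mx0.
rewrite uD -mulmxA => /(congr1 (mulmx^~ (invmx (A *m A^T)))) /=.
by rewrite mulmxK // mul0mx => ->; rewrite mul0mx.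
Qed.

Lemma mdet_smooth (V : normedModType R) (x tau : V -> 'rV[R]_q.+2) (J : V -> 'M[R]_(q.+2, q)) p :
  smooth_at x p -> smooth_at tau p -> (forall i j, smooth_at (fun y => J y i j) p) ->
  smooth_at (fun y => mdet (x y) (tau y) (J y)) p.
Proof.
move=> sx st sJ; apply: smooth_det => i j; case: (split_ordP j) => j' ->.
  under eq_fun do rewrite row_mxEl mxE; exact: smooth_coef.
under eq_fun do rewrite row_mxEr.
case: (@split_ordP 1 q j') => j'' ->.
  under eq_fun do rewrite row_mxEl mxE; exact: smooth_coef.
by under eq_fun do rewrite row_mxEr.
Qed.

(** A tangent vector [tau], with the sign that makes the frame positive, supplies the missing
    coordinate [y |-> y *m tau^T]. Together with [F] it is regular on the sphere, and the arc is the
    section over the first axis. *)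
Lemma local_garc x : N x -> exists c e, [/\ 0 < e, garc c (- e) e & c 0 = x].
Proof.
move=> Nx; have [nx fK xK [F [sF nF JF]]] := NP Nx; have x0 := nsq1_neq0 nx.
have [tau [t0 tx tK tp]] : exists tau : 'rV[R]_q.+2, [/\ tau != 0, tau *m x^T = 0, tau *m K x = 0 &
    0 < mdet x tau (K x)].
  pose B : 'M[R]_(q.+2, 1 + q) := row_mx x^T (K x).
  have : kermx B != 0.
    rewrite -mxrank_eq0 mxrank_ker -lt0n subn_gt0 (leq_ltn_trans (rank_leq_col B)) //.
  move=> /rowV0Pn[t /sub_kermxP]; rewrite mul_mx_row -[0 in X in X -> _](row_mx0) => /eq_row_mx[tx tK] t0.
  have d0 := frame_neq0 x0 t0 tx fK xK tK; move: d0; rewrite neq_lt => /orP[d0|d0]; last by exists t.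
  exists (- t); split; rewrite ?oppr_eq0 // ?mulNmx ?tx ?tK ?oppr0 //.
  by rewrite -scaleN1r mdetZ mulN1r oppr_gt0.
pose f (y : 'rV[R]_q.+2) : 'rV[R]_(1 + q) := row_mx (y *m tau^T) (F y).
have sm (y : 'rV[R]_q.+2) : smooth_at (fun y : 'rV[R]_q.+2 => y *m tau^T) y.
  by apply: smooth_mulmxr; exact: smooth_id.
have sf : smooth_at f x by exact: smooth_row_mx.
have Jf : 'J f x = row_mx tau^T (K x).
  rewrite /f jac_row_mx // (nbhs_singleton JF Nx); congr (row_mx _ _).
  by rewrite (@jac_mulmxr _ _ _ _ id) ?jac_id ?mul1mx.
have fx : f x = 0.
  rewrite /f; have -> : F x = 0 by apply/(nbhs_singleton nF).
  have -> : x *m tau^T = 0 by rewrite -[LHS]trmxK trmx_mul trmxK tx trmx0.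
  exact: row_mx0.
have [|sg [sg0 sg1 sg2]] := @level_section R q.+1 (@nsq R q.+2) f x (nsq_smooth _) sf fx.
  rewrite jac_nsq Jf; apply: (@frame_neq0 (2 *: x)); rewrite ?scaler_eq0 ?pnatr_eq0 //=.
    by rewrite [(2 *: x)^T]linearZ /= -scalemxAr tx scaler0.
  by rewrite -scalemxAl xK scaler0.
pose e0 : 'rV[R]_(1 + q) := row_mx 1%:M 0.
have e00 : e0 != 0.
  by apply/eqP => /rowP/(_ (lshift q 0)); rewrite row_mxEl !mxE => /eqP; rewrite oner_eq0.
pose c (t : R) := sg (t *: e0).
have sce t : smooth_at (fun t : R => t *: e0) t.
  by apply: smooth_scale; [exact: findim_rV|exact: smooth_id|exact: smooth_cst].
have scn t : smooth_at sg (t *: e0) -> smooth_at c t.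
  by move=> h1; apply: (smooth_comp (f := fun t : R => t *: e0) (g := sg)); [exact: findim_rV|exact: findim_rV| |].
pose G y := [/\ smooth_at F y, \forall z \near y, nsq z = 1 -> (F z = 0 <-> N z),
  \forall z \near y, N z -> 'J F z = K z & \forall z \near y, nsq z = nsq x -> sg (f z) = z].
have nG : \forall y \near x, G y.
  apply: filterS2 (near_and (smooth_near sF) (nbhs_interior nF)) (near_and (nbhs_interior JF) (nbhs_interior sg2)).
  by move=> y [h1 h2] [h3 h4].
have c0 : c 0 = x by rewrite /c scale0r.
have n1 : \forall t \near (0 : R), [/\ smooth_at sg (t *: e0), nsq (c t) = nsq x & f (c t) = t *: e0].
  apply: (near_cont (f := fun t : R => t *: e0) (P := fun xi => [/\ smooth_at sg xi, nsq (sg xi) = nsq x & f (sg xi) = xi])).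
    exact: smooth_cont.
  by rewrite scale0r.
have sc0 : smooth_at c 0 by apply: scn; case: (nbhs_singleton n1).
have n2 : \forall t \near (0 : R), G (c t).
  by apply: (near_cont (P := G) (smooth_cont sc0)); rewrite c0.
have cN t : nsq (c t) = nsq x -> f (c t) = t *: e0 -> G (c t) -> N (c t).
  move=> h1 h2 [_ h3 _ _]; apply/(nbhs_singleton h3); first by rewrite h1.
  by move: h2; rewrite /f /e0 scale_row_mx scaler0 => /eq_row_mx[_ ->].
have n3 : \forall t \near (0 : R), N (c t).
  by apply: filterS2 n1 n2 => t [h1 h2 h3] h4; exact: cN.
have [D1 D2] := curve_tangent sc0 n3.
have D3 : 'D_1 c 0 *m tau^T = 1%:M.
  have H := derive_curve sc0 (_ : smooth_at f (c 0)); rewrite c0 Jf mul_mx_row in H.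
  have {H} := H sf; have -> : 'D_1 (f \o c) 0 = e0.
    transitivity ('D_1 (fun t : R => t *: e0) 0).
      by apply: near_eq_derive; apply: filterS n1 => t [].
    rewrite (@derive_scale _ id (cst e0)); [|exact: smooth_id|exact: smooth_cst].
    by rewrite derive_id derive_cst scaler0 addr0 scale1r.
  by move=> /eq_row_mx[<-].
rewrite c0 in D1 D2.
have D0 : 'D_1 c 0 = ((tau *m tau^T) 0 0)^-1 *: tau.
  have uP : (row_mx x^T (row_mx tau^T (K x)) : 'M[R]_(1 + (1 + q))) \in unitmx.
    by rewrite unitmxE unitfE gt_eqF.
  have : 'D_1 c 0 *m (row_mx x^T (row_mx tau^T (K x)) : 'M[R]_(1 + (1 + q))) =
    (((tau *m tau^T) 0 0)^-1 *: tau) *m (row_mx x^T (row_mx tau^T (K x)) : 'M[R]_(1 + (1 + q))).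
    rewrite -scalemxAl !mul_frame D1 D2 D3 tx tK !scale_row_mx !scaler0; congr (row_mx _ (row_mx _ _)).
    have k0 : (tau *m tau^T) 0 0 != 0 by rewrite gt_eqF //; exact: dotr_gt0.
    by apply/rowP => j; rewrite (ord1 j) [RHS]mxE mulVf // mxE eqxx.
  by move/(congr1 (mulmx^~ (invmx (row_mx x^T (row_mx tau^T (K x)))))); rewrite /= !mulmxK.
have p0 : 0 < mdet x ('D_1 c 0) ('J F x).
  by rewrite D0 (nbhs_singleton JF Nx) mdetZ mulr_gt0 // invr_gt0; exact: dotr_gt0.
have n4 : \forall t \near (0 : R), 0 < mdet (c t) ('D_1 c t) ('J F (c t)).
  have sM : smooth_at (fun t => mdet (c t) ('D_1 c t) ('J F (c t))) 0.
    apply: mdet_smooth => //; first exact: smooth_derive.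
    move=> i j; apply: (smooth_comp (f := c) (g := fun y => ('J F y) i j)) => //; first exact: findim_rV.
      exact: findim_R.
    by rewrite c0; exact: smooth_jac.
  by apply: (smooth_pos sM); rewrite c0.
have [e e1 He] := near_ball (near_and (near_and n1 n2) n4).
have {}He t : - e < t < e -> [/\ smooth_at sg (t *: e0), nsq (c t) = nsq x, f (c t) = t *: e0, G (c t) &
    0 < mdet (c t) ('D_1 c t) ('J F (c t))].
  move=> ht; have [|[[h1 h2 h3] h4] h5] := He t; last by split.
  by rewrite -ball_normE /= sub0r normrN ltr_norml.
exists c, e; split=> //; split.
- by move=> t /He[h1 h2 h3 h4 h5]; exact: cN.
- move=> t u /He[_ _ h1 _ _] /He[_ _ h2 _ _] E; apply/eqP; rewrite -subr_eq0.
  have /eqP : (t - u) *: e0 = 0 by rewrite scalerBl -h1 -h2 E subrr.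
  by rewrite scaler_eq0 (negbTE e00) orbF.
- by move=> t /He[h1 _ _ _ _]; exact: scn.
- move=> t /He[h1 h2 h3 h4 h5]; have Nt := cN _ h2 h3 h4; case: h4 => _ _ h4 _.
  by rewrite -(nbhs_singleton h4 Nt).
move=> t d ht d0; have [h1 h2 h3 [h4 h5 h6 h7] h8] := He t ht.
have ct : (c t *m tau^T) 0 0 = t.
  move: h3; rewrite /f /e0 scale_row_mx => /eq_row_mx[-> _]; by rewrite !mxE eqxx mulr1.
have n5 : \forall y \near c t, - e < (y *m tau^T) 0 0 < e /\ `|(y *m tau^T) 0 0 - t| < d.
  have cl : {for c t, continuous (fun y : 'rV[R]_q.+2 => (y *m tau^T) 0 0)}.
    by apply: smooth_cont; apply: smooth_coef.
  apply: (near_cont (P := fun u : R => - e < u < e /\ `|u - t| < d) cl); rewrite ct.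
  apply: near_and; first exact: near_itv.
  by apply: filterS (nbhsx_ballx t d d0) => u; rewrite -ball_normE /= distrC.
apply: filterS (near_and n5 (near_and h5 h7)) => y [[i1 i2] [i3 i4]] Ny.
have ny : nsq y = 1 by case: (NP Ny).
exists ((y *m tau^T) 0 0); split=> //.
rewrite -[RHS]i4 ?ny ?nx // /c; congr (sg _).
rewrite /f (proj2 (i3 ny) Ny) /e0 scale_row_mx scaler0.
apply: (congr1 (fun A : 'rV[R]_1 => row_mx A (0 : 'rV[R]_q))).
by apply/rowP => j; rewrite (ord1 j) [LHS]mxE [X in _ * X]mxE eqxx mulr1.
Qed.
End Curves.

(** * Determinant identities for the sign of an end *)

Section EndAlgebra.
Variable R : realType.

(** As a linear form in [p], [adet p K] vanishes when [p] is orthogonal to [w], since [w] is then in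
    the kernel of the augmented matrix. So it is proportional to the scalar product with [w], and
    [p = w] gives the factor. *)
Lemma adet_left_ker k (w p : 'rV[R]_k.+1) (K : 'M[R]_(k.+1, k)) : w *m K = 0 ->
  nsq w * adet p K = (p *m w^T) 0 0 * adet w K.
Proof.
move=> wK; have nE (x : 'rV[R]_k.+1) : (x *m x^T) 0 0 = nsq x.
  by rewrite mxE; apply: eq_bigr => j _; rewrite mxE -expr2.
have [-> |w0] := eqVneq w 0.
  by rewrite trmx0 mulmx0 mxE mul0r /nsq big1 ?mul0r // => j _; rewrite mxE expr0n.
have n0 : nsq w != 0 by rewrite -nE gt_eqF // dotr_gt0.
pose c := (p *m w^T) 0 0 / nsq w; pose p' := p - c *: w.
have aT (x : 'rV[R]_k.+1) : adet x K = \det (col_mx x K^T : 'M[R]_(1 + k)).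
  by rewrite /adet -det_tr tr_row_mx trmxK.
have row'E (x y : 'rV[R]_k.+1) : row' (lshift k 0) (col_mx x K^T : 'M[R]_(1 + k)) =
    row' (lshift k 0) (col_mx y K^T : 'M[R]_(1 + k)).
  apply/matrixP => i j; rewrite !mxE.
  have -> : lift (lshift k (0 : 'I_1)) i = rshift 1 i by apply/val_inj.
  by case: splitP => // j'; rewrite (ord1 j').
have d' : adet p' K = 0.
  apply/eqP; rewrite -[_ == 0]negbK -unitfE -unitmxE; apply/negP => uP.
  have : w *m (row_mx p'^T K : 'M[R]_(1 + k)) = 0.
    rewrite mul_mx_row wK -[0 in RHS](row_mx0); congr (row_mx _ _).
    apply/rowP => j; rewrite (ord1 j) /p' linearB /= linearZ /= mulmxBr -scalemxAr.
    rewrite [LHS]mxE [X in _ + X]mxE [X in - X]mxE nE /c divfK // [X in _ - X](_ : _ = (w *m p^T) 0 0).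
      by rewrite subrr mxE.
    by rewrite -[in LHS](trmxK p) -trmx_mul mxE.
  move/(congr1 (mulmx^~ (invmx (row_mx p'^T K)))); rewrite /= mulmxK // mul0mx => /eqP.
  by rewrite (negbTE w0).
have -> : adet p K = c * adet w K + 1 * adet p' K.
  rewrite !aT; apply: (@determinant_multilinear _ _ _ _ _ (lshift k 0)); rewrite ?(row'E _ p) //.
  by rewrite !rowKu !row_id scale1r /p' addrC subrK.
by rewrite d' mulr0 addr0 /c mulrA mulrCA divff // mulr1 mulrC.
Qed.
Lemma nsq_dot k (x : 'rV[R]_k) : (x *m x^T) 0 0 = nsq x.
Proof. by rewrite mxE; apply: eq_bigr => j _; rewrite mxE -expr2. Qed.

(** The identity that splits the sign of an end into the signs of its two halves. Multiplication by
    the frame [C] of [y] and [A], whose determinant is inverse to [adet y J1], reduces the left side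
    to a determinant of size [q.+1], and [adet_left_ker] evaluates it. *)
Lemma frame_sign q (y a' : 'rV[R]_q.+2) (A : 'M[R]_(q.+1, q.+2)) (J1 : 'M[R]_(q.+2, q.+1))
    (J2 : 'M[R]_(q.+2, q)) (w : 'rV[R]_q.+1) :
  nsq y = 1 -> A *m y^T = 0 -> A *m J1 = 1%:M -> a' = w *m A -> y *m J2 = 0 ->
  w *m (A *m J2) = 0 ->
  mdet y a' J2 * nsq w = adet y J1 * nsq a' * adet w (A *m J2).
Proof.
move=> ny Ay AJ aE yJ wK.
have yy : y *m y^T = 1%:M.
  by apply/matrixP => i j; rewrite (ord1 i) (ord1 j) nsq_dot ny mxE eqxx.
pose C : 'M[R]_(1 + q.+1) := col_mx y A.
have d1 : \det C * adet y J1 = 1.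
  rewrite /adet -det_mulmx /C mul_col_row yy Ay AJ det_ublock !det1 mulr1 //.
have d2 : \det C * mdet y a' J2 = adet (a' *m A^T) (A *m J2).
  have ya : y *m a'^T = 0 by rewrite aE trmx_mul mulmxA -[y *m A^T]trmxK trmx_mul trmxK Ay trmx0 mul0mx.
  have E1 : y *m (row_mx a'^T J2 : 'M[R]_(q.+2, 1 + q)) = 0 by rewrite mul_mx_row yJ ya row_mx0.
  have E2 : A *m (row_mx a'^T J2 : 'M[R]_(q.+2, 1 + q)) = row_mx (a' *m A^T)^T (A *m J2).
    by rewrite mul_mx_row trmx_mul trmxK.
  rewrite /mdet -det_mulmx /C; transitivity (\det (block_mx 1%:M 0 0 (row_mx (a' *m A^T)^T (A *m J2) : 'M[R]_(1 + q)) : 'M[R]_(1 + (1 + q)))).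
    by congr (\det _); rewrite -E1 -E2 -Ay -yy; exact: mul_col_row.
  by rewrite det_lblock det1 mul1r.
have d3 := adet_left_ker (a' *m A^T) wK.
have nE : (a' *m A^T *m w^T) 0 0 = nsq a' by rewrite -mulmxA -trmx_mul -aE nsq_dot.
rewrite nE -d2 in d3; apply: (etrans (y := adet y J1 * (nsq w * (\det C * mdet y a' J2)))).
  by rewrite -[LHS]mul1r -d1; ring.
by rewrite d3 mulrA.
Qed.
End EndAlgebra.

Lemma jac_cst (R : realType) m k (a : 'rV[R]_k) (p : 'rV[R]_m) : 'J (fun _ : 'rV[R]_m => a) p = 0.
Proof.
apply: mulmx_inj => u; rewrite mulmx0.
have <- := deriveEjacobian u (smooth_diff (smooth_cst a p)).
exact: derive_cst.
Qed.

Lemma adet_smooth (R : realType) (V : normedModType R) k (x : V -> 'rV[R]_k.+1) (J : V -> 'M[R]_(k.+1, k)) p :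
  smooth_at x p -> (forall i j, smooth_at (fun y => J y i j) p) ->
  smooth_at (fun y => adet (x y) (J y)) p.
Proof.
move=> sx sJ; apply: smooth_det => i j; case: (@split_ordP 1 k j) => j' ->.
  under eq_fun do rewrite row_mxEl mxE; exact: smooth_coef.
by under eq_fun do rewrite row_mxEr.
Qed.

Lemma adet0 (R : realType) k (K : 'M[R]_(k.+1, k)) : adet 0 K = 0.
Proof.
rewrite /adet -det_tr tr_row_mx trmxK; apply/eqP/det0P; exists (row_mx 1%:M 0 : 'rV[R]_(1 + k)).
  by apply/eqP => /rowP/(_ (lshift k 0)); rewrite row_mxEl !mxE => /eqP; rewrite oner_eq0.
by rewrite mul_row_col mulmx0 mul0mx addr0.
Qed.

Lemma mulr5_gt0 (R : realType) (a b c d e : R) : 0 < a * d -> 0 < b -> 0 < c * e ->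
  0 < a * b * c * (d * e).
Proof.
move=> h1 h2 h3; have -> : a * b * c * (d * e) = (a * d) * b * (c * e) by ring.
by apply: mulr_gt0 => //; apply: mulr_gt0.
Qed.

Section SplitRow.
Variables (R : realType) (V : normedModType R) (a b : nat).

Lemma smooth_lsubmx (f : V -> 'rV[R]_(a + b)) p : smooth_at f p -> smooth_at (fun z => lsubmx (f z)) p.
Proof. by move=> sf; apply: smooth_rV => j; under eq_fun do rewrite mxE; exact: smooth_coef. Qed.

Lemma smooth_rsubmx (f : V -> 'rV[R]_(a + b)) p : smooth_at f p -> smooth_at (fun z => rsubmx (f z)) p.
Proof. by move=> sf; apply: smooth_rV => j; under eq_fun do rewrite mxE; exact: smooth_coef. Qed.
End SplitRow.

(** * The arc of [N] near a broken orbit *)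

Section Weights.
Variables (R : realType) (n : nat) (M : manifold R n).
Variables (h : M -> R) (X : vector_field M) (Phi : R -> M -> M).
Hypothesis hMS : morse_smale h X Phi.
Let gf := ms_gflow hMS.

(** A chosen good time, with default 0. By [JwE] the matrix [Jw] does not depend on the choice. *)
Definition gT w k z : R := xget 0 [set T | gd h Phi w k T z].
Definition Jw v w m k (x : 'rV[R]_m) : 'M[R]_(m, k) := Jst h Phi v w k (gT w k (ph h Phi v x)) x.

Section Pair.
Variables (v w : M) (m k : nat).
Hypotheses (cv : cip h v m) (cw : cip h w k).
Let hv := cip_hyp hMS cv.
Let hw := cip_hyp hMS cw.
Let mn := cip_le cv.
Let kn := cip_le cw.

Lemma gTP z : Wplus Phi w z -> gd h Phi w k (gT w k z) z.
Proof.
move=> Wz; have [T gT0] := filter_ex (good_ex hw Wz).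
by rewrite /gT; case: xgetP => [T' _ //|/(_ T)].
Qed.

Lemma phc (x : 'rV[R]_m) : {for x, continuous (ph h Phi v (m := m))}.
Proof. by have [] := smooth_phi gf mn hv x. Qed.

Lemma JwE T (x : 'rV[R]_m) : gd h Phi w k T (ph h Phi v x) -> Wplus Phi w (ph h Phi v x) ->
  Jw v w k x = Jst h Phi v w k T x.
Proof.
move=> gx Wx; have gx' := gTP Wx; apply: near_eq_jac.
  exact: (near_cont (P := fun z => st h Phi w k _ z = st h Phi w k T z) (@phc x) (stab_indep gf kn hw Wx gx' gx)).
by apply: smooth_diff; apply: (st_ph_smooth hMS cv cw); case: gx'.
Qed.

Lemma near_gd T z : gd h Phi w k T z -> \forall y \near z, gd h Phi w k T y.
Proof. exact: (good_near gf). Qed.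

Lemma near_ph (x : 'rV[R]_m) (P : M -> Prop) :
  (\forall z \near ph h Phi v x, P z) -> \forall y \near x, P (ph h Phi v y).
Proof. exact: (near_cont (@phc x)). Qed.
End Pair.

Section FirstMfd.
Variables (v u : M) (q : nat).
Hypotheses (cv : cip h v q.+2) (cu : cip h u q).
Let hv := cip_hyp hMS cv.
Let hu := cip_hyp hMS cu.

Definition N0 : set 'rV[R]_q.+2 := [set x | nsq x = 1 /\ Wplus Phi u (ph h Phi v x)].

Lemma N0_loc (lab : 'rV[R]_q.+2 -> Prop) x : (\forall y \near x, N0 y -> (lab y <-> lab x)) ->
  N0 x -> lab x -> loc_def [set x | N0 x /\ lab x] (@Jw v u q.+2 q) x.
Proof.
move=> nl [nx Wx] lx; have gx := gTP cu Wx; set T := gT u q _ in gx.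
split=> //; first exact: (Jst_full hMS cv cu).
  exact: (Jst_ray hMS cv cu).
exists (st h Phi u q T \o ph h Phi v (m := q.+2)); split.
- by apply: (st_ph_smooth hMS cv cu); case: gx.
- apply: filterS2 nl (near_ph cv (st_near hMS cu gx)) => y H1 H2 ny /=; rewrite H2.
  split=> [Wy|[[]]//]; split; first by split.
  by apply/H1.
have n1 := near_ph (P := gd h Phi u q T) cv (near_gd gx).
apply: filterS n1 => y gy [[_ Wy] _].
by rewrite (JwE cv cu gy Wy).
Qed.
End FirstMfd.

Section Exit.
Variables (w : M) (k : nat).
Hypothesis cw : cip h w k.
Let hw := cip_hyp hMS cw.
Let kn := cip_le cw.

Lemma linflow_split t (p : 'rV[R]_n) :
  linflow (idx_pred k) t p = em n (expR t *: pm k p) + expR (- t) *: (p - em n (pm k p)).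
Proof.
apply/rowP => j; rewrite !mxE -/(em n _) /idx_pred; have [jk|kj] := ltnP j k.
  have jE : j = widen_ord kn (Ordinal jk) by exact/val_inj.
  have E (x : 'rV[R]_k) := emE kn x (Ordinal jk); rewrite -jE in E.
  have E1 := E (expR t *: pm k p); have E2 := E (pm k p); rewrite mxE in E1; rewrite mxE in E2.
  have E3 := pmE kn p (Ordinal jk); rewrite -jE in E3.
  by rewrite E1 E2 mxE E3 subrr mulr0 addr0.
have E1 := emE0 (expR t *: pm k p) kj; have E2 := emE0 (pm k p) kj.
by rewrite mxE in E1; rewrite mxE in E2; rewrite E1 E2 add0r subr0.
Qed.

(* For [st z = s *: x] with [s > 0], flowing for the time [- ln s] brings [z] to the point whose
   expanding part is [x]; the other part is of order [s]. *)
Definition exitpt T (s : R) (x : 'rV[R]_k) (p : 'rV[R]_n) : 'rV[R]_n :=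
  em n x + (s * expR T) *: (p - em n (pm k p)).

Lemma exit_flow T s x z : 0 < s -> dom (cc h Phi w) (Phi T z) -> st h Phi w k T z = s *: x ->
  inb (rr h Phi w) (exitpt T s x (cc h Phi w (Phi T z))) ->
  Phi (- ln s) z = param (cc h Phi w) (exitpt T s x (cc h Phi w (Phi T z))).
Proof.
move=> s0 dz sE; set p := cc h Phi w (Phi T z) => ip.
have pE : pm k p = (s * expR T) *: x.
  rewrite mulrC -scalerA -sE /st /stab scalerA -expRD subrr expR0 scale1r //.
pose t := - ln s - T.
have et : expR t * (s * expR T) = 1.
  by rewrite /t expRD expRN lnK ?posrE // expRN mulrACA mulVf ?mulVf ?mul1r ?gt_eqF ?expR_gt0.
have eN : expR (- t) = s * expR T.
  by rewrite expRN -[LHS]mulr1 -et mulKf // gt_eqF // expR_gt0.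
have lE : linflow (idx_pred k) t p = exitpt T s x p.
  by rewrite linflow_split pE scalerA et scale1r -pE eN.
have -> : Phi (- ln s) z = Phi t (Phi T z) by rewrite -(gfD gf) /t subrK.
rewrite -lE -(hc_flow hw) ?lE //; first by rewrite /p coordK.
exact: (dom_inb hw).
Qed.
End Exit.

Section EndArc.
Variables (v w u : M) (q : nat).
Hypotheses (cv : cip h v q.+2) (cw : cip h w q.+1) (cu : cip h u q).
Variables (x1 : 'rV[R]_q.+2) (y1 : 'rV[R]_q.+1) (rho : R).
Hypotheses (nx1 : nsq x1 = 1) (Wx1 : Wplus Phi w (ph h Phi v x1)).
Hypotheses (rho0 : 0 < rho) (rhor : rho ^+ 2 <= rr h Phi w ^+ 2 / 4).
Hypotheses (ny1 : nsq y1 = rho ^+ 2) (Wy1 : Wplus Phi u (ph h Phi w y1)).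
Let hv := cip_hyp hMS cv.
Let hw := cip_hyp hMS cw.
Let hu := cip_hyp hMS cu.
Let wn := cip_le cw.
Let T1 := gT w q.+1 (ph h Phi v x1).
Let T2 := gT u q (ph h Phi w y1).
Let st1 y := st h Phi w q.+1 T1 (ph h Phi v (m := q.+2) y).
Let pt1 y := cc h Phi w (Phi T1 (ph h Phi v (m := q.+2) y)).
Let g1 : gd h Phi w q.+1 T1 (ph h Phi v x1) := gTP cw Wx1.
Let g2 : gd h Phi u q T2 (ph h Phi w y1) := gTP cu Wy1.

Let small_inb (x : 'rV[R]_q.+1) : nsq x = rho ^+ 2 -> inb (rr h Phi w) (em n x).
Proof.
move=> nx; apply/(inb_em _ wn); rewrite nx; apply: le_lt_trans rhor _.
have := exprn_gt0 2 (hc_r hw); lra.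
Qed.

Let y10 : y1 != 0.
Proof.
apply/eqP => E; move: ny1; rewrite E /nsq big1 => [/eqP|j _]; last by rewrite mxE expr0n.
by rewrite eq_sym expf_eq0 /= gt_eqF.
Qed.

Let x10 : x1 != 0. Proof. exact: nsq1_neq0. Qed.

Let pt1_smooth : smooth_at pt1 x1.
Proof.
apply: (@sfun_comp _ _ _ _ _ (ph h Phi v (m := q.+2)) (cc h Phi w \o Phi T1)); first exact: findim_rV.
  exact: (smooth_phi gf (cip_le cv) hv).
apply: (sfun_flow gf); first exact: findim_rV.
by apply: sfun_chart; [exact: hc_smooth hw|case: g1].
Qed.

Section WithSection.
Variable sg : 'rV[R]_q.+1 -> 'rV[R]_q.+2.
Hypothesis sg0 : sg 0 = x1.
Hypothesis sgP : \forall xi \near (0 : 'rV[R]_q.+1),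
  [/\ smooth_at sg xi, nsq (sg xi) = 1 & st1 (sg xi) = xi].
Hypothesis sgK : \forall y \near x1, nsq y = 1 -> sg (st1 y) = y.

(** For [z = (s, x)] with [s > 0], this is the exit point near [w] of the orbit in direction
    [sg (s *: x)], and [G = 0] says that the orbit ends at [u]. Both expressions are smooth across
    [s = 0], where the exit point is [x] on the unstable disc of [w] and [G] becomes the equation of
    orbits from [w] to [u]. *)
Let pos (z : 'rV[R]_(1 + q.+1)) : 'rV[R]_n :=
  exitpt T1 (lsubmx z 0 0) (rsubmx z) (pt1 (sg (lsubmx z 0 0 *: rsubmx z))).
Let G z := st h Phi u q T2 (param (cc h Phi w) (pos z)).
Let z0 : 'rV[R]_(1 + q.+1) := row_mx 0 y1.

Let l0 : lsubmx z0 0 0 = 0. Proof. by rewrite row_mxKl mxE. Qed.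
Let r0 : rsubmx z0 = y1. Proof. exact: row_mxKr. Qed.

Let pos0 (x : 'rV[R]_q.+1) : pos (row_mx 0 x) = em n x.
Proof. by rewrite /pos /exitpt row_mxKl row_mxKr mxE mul0r scale0r addr0. Qed.

Let sg_smooth : smooth_at sg 0.
Proof. by case: (nbhs_singleton sgP). Qed.

Let sgs_smooth : smooth_at (fun z : 'rV[R]_(1 + q.+1) => sg (lsubmx z 0 0 *: rsubmx z)) z0.
Proof.
apply: (@smooth_comp _ _ _ _ (fun z : 'rV[R]_(1 + q.+1) => lsubmx z 0 0 *: rsubmx z) sg); try exact: findim_rV.
  apply: smooth_scale; first exact: findim_rV.
    by apply: smooth_coef; apply: smooth_lsubmx; exact: smooth_id.
  by apply: smooth_rsubmx; exact: smooth_id.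
by rewrite l0 scale0r.
Qed.

Let pos_smooth : smooth_at pos z0.
Proof.
have sp : smooth_at (fun z : 'rV[R]_(1 + q.+1) => pt1 (sg (lsubmx z 0 0 *: rsubmx z))) z0.
  apply: (@smooth_comp _ _ _ _ (fun z : 'rV[R]_(1 + q.+1) => sg (lsubmx z 0 0 *: rsubmx z)) pt1); try exact: findim_rV.
    exact: sgs_smooth.
  by rewrite l0 scale0r sg0.
have sr : smooth_at (fun z : 'rV[R]_(1 + q.+1) => rsubmx z) z0 by apply: smooth_rsubmx; exact: smooth_id.
apply: smooth_add; first exact: em_smooth.
apply: smooth_scale; first exact: findim_rV.
  apply: smooth_mul; last exact: smooth_cst.
  by apply: smooth_coef; apply: smooth_lsubmx; exact: smooth_id.
apply: smooth_add => //; under eq_fun do rewrite -scaleN1r.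
by apply: scale_smooth; apply: em_smooth; exact: pm_smooth.
Qed.

Let e0E : param (cc h Phi w) (pos z0) = ph h Phi w y1.
Proof. by rewrite pos0 /ph (phi_small gf wn hw) //; apply/(inb_em _ wn); exact: small_inb. Qed.

Let epos_smooth : smooth_into (fun z => param (cc h Phi w) (pos z)) z0.
Proof.
apply: (@smooth_into_comp _ _ _ _ _ pos (param (cc h Phi w))); first exact: findim_rV.
  exact: pos_smooth.
apply: smooth_into_param; first exact: hc_smooth hw.
by apply/(hc_img hw); rewrite pos0; exact: small_inb.
Qed.

Let G_smooth : smooth_at G z0.
Proof.
apply: sfun_comp; [exact: findim_rV|exact: epos_smooth|].
by rewrite e0E; apply: (stab_sfun gf hu); case: g2.
Qed.

Let near_small (x : 'rV[R]_q.+1) : nsq x = rho ^+ 2 -> \forall y \near x, nsq y < rr h Phi w ^+ 2.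
Proof.
move=> nx; apply: (cvgr_lt (nsq x) (@nsq_continuous R _ x)); apply/(inb_em (rr h Phi w) wn); exact: small_inb.
Qed.

Let incl : 'M[R]_(q.+1, 1 + q.+1) := row_mx 0 1%:M.

Let inclE (x : 'rV[R]_q.+1) : x *m incl = row_mx 0 x.
Proof. by rewrite /incl mul_mx_row mulmx0 mulmx1. Qed.

Let G_jac : incl *m 'J G z0 = Jw w u q y1.
Proof.
have si (x : 'rV[R]_q.+1) : smooth_at (fun x : 'rV[R]_q.+1 => x *m incl) x.
  by apply: smooth_mulmxr; exact: smooth_id.
have Ji : 'J (fun x : 'rV[R]_q.+1 => x *m incl) y1 = incl.
  by rewrite (@jac_mulmxr _ _ _ _ id) ?jac_id ?mul1mx.
have zE : y1 *m incl = z0 by rewrite inclE.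
have dG : differentiable G (y1 *m incl) by rewrite zE; exact: smooth_diff.
rewrite (JwE cw cu g2 Wy1) -[in LHS]Ji -[in LHS]zE -(jac_comp (smooth_diff (si y1)) dG).
apply: esym; apply: near_eq_jac; last first.
  by apply: smooth_diff; apply: (st_ph_smooth hMS cw cu); case: g2.
apply: filterS (near_small ny1) => x nx /=.
by rewrite /G inclE pos0 /ph (phi_small gf wn hw).
Qed.

Let e1 : 'rV[R]_(1 + q) := row_mx 1%:M 0.

Lemma end_curve : exists Z : R -> 'rV[R]_(1 + q.+1), [/\ Z 0 = z0, smooth_at Z 0,
  \forall s \near (0 : R), [/\ lsubmx (Z s) 0 0 = s, nsq (rsubmx (Z s)) = rho ^+ 2 & G (Z s) = 0] &
  \forall z \near z0, nsq (rsubmx z) = rho ^+ 2 -> G z = 0 -> z = Z (lsubmx z 0 0)].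
Proof.
pose a (z : 'rV[R]_q.+2) := nsq (rsubmx (z : 'rV[R]_(1 + q.+1))).
pose f (z : 'rV[R]_q.+2) : 'rV[R]_(1 + q) := row_mx (lsubmx (z : 'rV[R]_(1 + q.+1))) (G z).
have sl (z : 'rV[R]_q.+2) : smooth_at (fun z : 'rV[R]_q.+2 => lsubmx (z : 'rV[R]_(1 + q.+1))) z.
  by apply: smooth_lsubmx; exact: smooth_id.
have sr (z : 'rV[R]_q.+2) : smooth_at (fun z : 'rV[R]_q.+2 => rsubmx (z : 'rV[R]_(1 + q.+1))) z.
  by apply: smooth_rsubmx; exact: smooth_id.
have sa : smooth_at a z0.
  apply: (@smooth_comp _ _ _ _ (fun z : 'rV[R]_(1 + q.+1) => rsubmx z) (@nsq R q.+1)); [exact: findim_rV|exact: findim_R|exact: sr|exact: nsq_smooth].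
have sf : smooth_at f z0 by apply: smooth_row_mx; [exact: sl|exact: G_smooth].
have G0 : G z0 = 0 by rewrite /G e0E; apply/(stab_eq0 gf (cip_le cu) hu g2).
have f0 : f z0 = 0 by rewrite /f G0 row_mxKl row_mx0.
pose pl : 'M[R]_(1 + q.+1, 1) := col_mx 1%:M 0.
pose pr : 'M[R]_(1 + q.+1, q.+1) := col_mx 0 1%:M.
have plE (z : 'rV[R]_(1 + q.+1)) : z *m pl = lsubmx z.
  by rewrite -{1}(hsubmxK z) /pl mul_row_col mulmx0 mulmx1 addr0.
have prE (z : 'rV[R]_(1 + q.+1)) : z *m pr = rsubmx z.
  by rewrite -{1}(hsubmxK z) /pr mul_row_col mulmx0 mulmx1 add0r.
have Jl : 'J (fun z : 'rV[R]_(1 + q.+1) => lsubmx z) z0 = pl.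
  have -> : (fun z : 'rV[R]_(1 + q.+1) => lsubmx z) = (fun z => z *m pl) by apply/funext => z; rewrite plE.
  by rewrite (@jac_mulmxr _ _ _ _ id) ?jac_id ?mul1mx.
have Jr : 'J (fun z : 'rV[R]_(1 + q.+1) => rsubmx z) z0 = pr.
  have -> : (fun z : 'rV[R]_(1 + q.+1) => rsubmx z) = (fun z => z *m pr) by apply/funext => z; rewrite prE.
  by rewrite (@jac_mulmxr _ _ _ _ id) ?jac_id ?mul1mx.
have Ja : 'J (fun z : 'rV[R]_q.+2 => (a z)%:M : 'rV[R]_1) z0 = pr *m (2 *: y1)^T.
  have sn : smooth_at (fun y : 'rV[R]_q.+1 => (nsq y)%:M : 'rV[R]_1) (rsubmx z0).
    by apply: smooth_scalar; exact: nsq_smooth.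
  have := jac_comp (smooth_diff (sr z0)) (smooth_diff sn).
  by rewrite Jr jac_nsq r0; apply.
have Jf : 'J f z0 = row_mx pl ('J G z0).
  by rewrite /f (jac_row_mx (sl z0) G_smooth) Jl.
(* A kernel vector has no [s] component, its other part is orthogonal to [y1] and is killed by the
   Jacobian at [y1]; it is zero because the augmented matrix at [y1] is invertible. *)
have d0 : \det (row_mx ('J (fun z : 'rV[R]_q.+2 => (a z)%:M : 'rV[R]_1) z0) ('J f z0) : 'M[R]_(1 + q.+1)) != 0.
  rewrite -unitfE -unitmxE -row_free_unit Ja Jf; apply/row_freeP.
  suff : row_free (row_mx (pr *m (2 *: y1)^T) (row_mx pl ('J G z0)) : 'M[R]_(1 + (1 + q))) by move/row_freeP.
  rewrite -kermx_eq0; apply/eqP/row_matrixP => i; rewrite row0.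
  set t : 'rV[R]_(1 + q.+1) := row i _.
  have : t *m (row_mx (pr *m (2 *: y1)^T) (row_mx pl ('J G z0)) : 'M[R]_(1 + (1 + q))) = 0.
    by apply/sub_kermxP; exact: row_sub.
  rewrite !mul_mx_row mulmxA prE plE -[0 in RHS](row_mx0) => /eq_row_mx[H1].
  rewrite -[0 in RHS](row_mx0) => /eq_row_mx[H2 H3].
  have tE : t = rsubmx t *m incl by rewrite inclE -[LHS](hsubmxK t) H2.
  have H4 : rsubmx t *m Jw w u q y1 = 0 by rewrite -G_jac mulmxA -tE.
  have uP : (row_mx y1^T (Jw w u q y1) : 'M[R]_(1 + q)) \in unitmx.
    rewrite unitmxE unitfE; apply: adet_neq0 => //.
      by rewrite (JwE cw cu g2 Wy1); exact: (Jst_full hMS cw cu).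
    by rewrite (JwE cw cu g2 Wy1); exact: (Jst_ray hMS cw cu).
  have : rsubmx t *m (row_mx y1^T (Jw w u q y1) : 'M[R]_(1 + q)) = 0.
    rewrite mul_mx_row H4 -[0 in RHS](row_mx0); congr (row_mx _ _).
    move: H1; rewrite [(2 *: y1)^T]linearZ /= -scalemxAr => /eqP.
    by rewrite scaler_eq0 pnatr_eq0 /= => /eqP.
  move/(congr1 (mulmx^~ (invmx (row_mx y1^T (Jw w u q y1))))); rewrite /= mulmxK // mul0mx => rt.
  by rewrite tE rt mul0mx.
have [sg2 [s0 s1 s2]] := level_section sa sf f0 d0.
have sse : smooth_at (fun s : R => s *: e1) 0.
  by apply: smooth_scale; [exact: findim_rV|exact: smooth_id|exact: smooth_cst].
have az0 : a z0 = rho ^+ 2 by rewrite /a r0.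
exists (fun s => sg2 (s *: e1)); split.
- by rewrite scale0r.
- apply: (@smooth_comp _ _ _ _ (fun s : R => s *: e1) sg2); try exact: findim_rV; first exact: sse.
  by rewrite scale0r; case: (nbhs_singleton s1).
- have n1 : \forall s \near (0 : R), a (sg2 (s *: e1)) = a z0 /\ f (sg2 (s *: e1)) = s *: e1.
    apply: (near_cont (f := fun s : R => s *: e1) (P := fun xi => a (sg2 xi) = a z0 /\ f (sg2 xi) = xi)).
      exact: smooth_cont.
    by rewrite scale0r; apply: filterS s1 => xi [].
  apply: filterS n1 => s [h1 h2]; rewrite -az0 -h1; move: h2; rewrite /f /e1 scale_row_mx scaler0.
  move=> /eq_row_mx[-> h3]; split=> //; by rewrite !mxE eqxx mulr1.
apply: filterS s2 => z Hz nz Gz; rewrite -[LHS]Hz ?az0 //; congr (sg2 _).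
rewrite /f Gz /e1 scale_row_mx scaler0; apply: (congr1 (fun A : 'rV[R]_1 => row_mx A (0 : 'rV[R]_q))).
by apply/rowP => j; rewrite (ord1 j) [RHS]mxE [X in _ * X]mxE eqxx mulr1.
Qed.

Let near_exit : \forall z \near z0, 0 < lsubmx z 0 0 -> let xi := lsubmx z 0 0 *: rsubmx z in
  [/\ [/\ smooth_at sg xi, nsq (sg xi) = 1 & st1 (sg xi) = xi],
      Phi (- ln (lsubmx z 0 0)) (ph h Phi v (sg xi)) = param (cc h Phi w) (pos z),
      gd h Phi u q T2 (param (cc h Phi w) (pos z)), smooth_at G z &
      N0 v u (sg xi) <-> G z = 0].
Proof.
have cxi : {for z0, continuous (fun z : 'rV[R]_(1 + q.+1) => lsubmx z 0 0 *: rsubmx z)}.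
  apply: smooth_cont; apply: smooth_scale; first exact: findim_rV.
    by apply: smooth_coef; apply: smooth_lsubmx; exact: smooth_id.
  by apply: smooth_rsubmx; exact: smooth_id.
have n1 : \forall z \near z0, let xi := lsubmx z 0 0 *: rsubmx z in
    [/\ smooth_at sg xi, nsq (sg xi) = 1 & st1 (sg xi) = xi].
  by apply: (near_cont (P := fun xi => [/\ smooth_at sg xi, nsq (sg xi) = 1 & st1 (sg xi) = xi]) cxi); rewrite l0 scale0r.
have n2 : \forall z \near z0, gd h Phi w q.+1 T1 (ph h Phi v (sg (lsubmx z 0 0 *: rsubmx z))).
  apply: (near_cont (P := fun y => gd h Phi w q.+1 T1 (ph h Phi v y)) (smooth_cont sgs_smooth)).
  by rewrite l0 scale0r sg0; exact: (near_ph (P := gd h Phi w q.+1 T1) cv (near_gd g1)).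
have n3 : \forall z \near z0, inb (rr h Phi w) (pos z).
  apply: (near_cont (P := fun p => inb (rr h Phi w) p) (smooth_cont pos_smooth)).
  by apply: inb_near; rewrite pos0; exact: small_inb.
have n4 : \forall z \near z0, gd h Phi u q T2 (param (cc h Phi w) (pos z)) /\
    (st h Phi u q T2 (param (cc h Phi w) (pos z)) = 0 <-> Wplus Phi u (param (cc h Phi w) (pos z))).
  apply: (near_cont (P := fun y => gd h Phi u q T2 y /\ (st h Phi u q T2 y = 0 <-> Wplus Phi u y)) (epos_smooth).1).
  by rewrite e0E; apply: near_and; [exact: near_gd|exact: (st_near hMS cu)].
apply: filterS2 (near_and n1 n2) (near_and (near_and n3 n4) (smooth_near G_smooth)).
move=> z [/= h1 h2] [[h3 [h4 h5]] h6] s0.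
have E : Phi (- ln (lsubmx z 0 0)) (ph h Phi v (sg (lsubmx z 0 0 *: rsubmx z))) = param (cc h Phi w) (pos z).
  by apply: (exit_flow cw s0) => //; [case: h2|case: h1].
split=> //; rewrite /G h5 -E; have W := Wplus_flowP gf u (ph h Phi v (sg (lsubmx z 0 0 *: rsubmx z))) (- ln (lsubmx z 0 0)).
by split=> [[_ Wz]|/W Wz]; [apply/W|split=> //; case: h1].
Qed.

(** The arc is [s |-> sg (s *: Xc s)], where [(s, Xc s)] is the zero curve of [G] on the sphere of
    radius [rho]. Its orientation follows from [frame_sign]: each of the two [adet] factors at
    parameter [s] has the sign of its limit at [s = 0], by continuity. *)
Lemma end_arc : exists (al : R -> 'rV[R]_q.+2) (Xc : R -> 'rV[R]_q.+1) (d : R), 0 < d /\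
 [/\ smooth_at al 0 /\ al 0 = x1, smooth_at Xc 0 /\ Xc 0 = y1,
  forall s : R, 0 < s < d -> [/\ N0 v u (al s), smooth_at al s, st1 (al s) = s *: Xc s, nsq (Xc s) = rho ^+ 2 &
    0 < mdet (al s) ('D_1 al s) (Jw v u q (al s)) * (adet x1 (Jw v w q.+1 x1) * adet y1 (Jw w u q y1))] &
  forall y (s : R) x, N0 v u y -> `|y - x1| < d -> 0 < s < d -> nsq x = rho ^+ 2 -> `|x - y1| < d ->
    st1 y = s *: x -> y = al s].
Proof.
have [Z [Z0 sZ nZ uZ]] := end_curve.
pose Xc s := rsubmx (Z s); pose al s := sg (s *: Xc s).
have sXc : smooth_at Xc 0 by exact: smooth_rsubmx.
have sXi s : smooth_at Xc s -> smooth_at (fun s0 : R => s0 *: Xc s0) s.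
  by move=> sx; apply: smooth_scale; [exact: findim_rV|exact: smooth_id|].
have sal s : smooth_at Xc s -> smooth_at sg (s *: Xc s) -> smooth_at al s.
  by move=> sx ss; apply: (@smooth_comp _ _ _ _ (fun s0 : R => s0 *: Xc s0) sg) => //; try exact: findim_rV; exact: sXi.
have X0 : Xc 0 = y1 by rewrite /Xc Z0.
have al0 : al 0 = x1 by rewrite /al scale0r.
have sal0 : smooth_at al 0 by apply: sal => //; rewrite scale0r.
(* The velocity of [s |-> s *: Xc s]; at [s = 0] it is [y1]. *)
pose w' s := Xc s + s *: 'D_1 Xc s.
pose K1 s := incl *m 'J G (Z s).
have sst1 : smooth_at (st1 : 'rV[R]_q.+2 -> 'rV[R]_q.+1) x1.
  by apply: (st_ph_smooth hMS cv cw); case: g1.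
have p1 : 0 < adet x1 ('J st1 x1) * adet x1 (Jw v w q.+1 x1).
  rewrite (JwE cv cw g1 Wx1) -expr2 exprn_even_gt0 //=; apply: adet_neq0 => //.
    exact: (Jst_full hMS cv cw).
  exact: (Jst_ray hMS cv cw).
have p2 : 0 < adet y1 (K1 0) * adet y1 (Jw w u q y1).
  rewrite /K1 Z0 G_jac -expr2 exprn_even_gt0 //= (JwE cw cu g2 Wy1); apply: adet_neq0 => //.
    exact: (Jst_full hMS cw cu).
  exact: (Jst_ray hMS cw cu).
have n1 : \forall s \near (0 : R), 0 < adet (al s) ('J st1 (al s)) * adet x1 (Jw v w q.+1 x1).
  apply: (smooth_pos (f := fun s => adet (al s) ('J st1 (al s)) * adet x1 (Jw v w q.+1 x1))); last by rewrite al0.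
  apply: smooth_mul; last exact: smooth_cst.
  apply: adet_smooth => // i j.
  apply: (@smooth_comp _ _ _ _ al (fun y => 'J st1 y i j)) => //; [exact: findim_rV|exact: findim_R|].
  by rewrite al0; exact: smooth_jac.
have n2 : \forall s \near (0 : R), 0 < adet (w' s) (K1 s) * adet y1 (Jw w u q y1).
  apply: (smooth_pos (f := fun s => adet (w' s) (K1 s) * adet y1 (Jw w u q y1))).
    apply: smooth_mul; last exact: smooth_cst.
    apply: adet_smooth => [|i j].
      apply: smooth_add => //; apply: smooth_scale; first exact: findim_rV.
        exact: smooth_id.
      exact: smooth_derive.
    apply: smooth_mulmx => i' j'; first exact: smooth_cst.
    apply: (@smooth_comp _ _ _ _ Z (fun y => 'J G y i' j')) => //; [exact: findim_rV|exact: findim_R|].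
    by rewrite Z0; exact: smooth_jac.
  by rewrite /w' scale0r addr0 X0.
have cZ := smooth_cont sZ.
have n3 := nbhs_interior near_exit; rewrite -[in X in nbhs X _]Z0 in n3.
have {}n3 := near_cont cZ n3.
have csX : {for 0, continuous (fun s0 : R => s0 *: Xc s0)} by apply: smooth_cont; exact: sXi.
have n4 := nbhs_interior sgP; rewrite -[in X in nbhs X _](scale0r (Xc 0)) in n4.
have {}n4 := near_cont csX n4.
have n5 : \forall s \near (0 : R), smooth_at (st1 : 'rV[R]_q.+2 -> 'rV[R]_q.+1) (al s).
  apply: (near_cont (P := fun y => smooth_at (st1 : 'rV[R]_q.+2 -> 'rV[R]_q.+1) y) (smooth_cont sal0)).
  by rewrite al0; exact: smooth_near.
have [d1 d10 Hd] := near_ball (near_and (near_and (near_and n1 n2) (near_and n3 n4)) (near_and n5 (near_and nZ (smooth_near sZ)))).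
have mainN s : 0 < s < d1 -> N0 v u (al s).
  move=> /andP[s0 sd]; have bs : ball 0 d1 s by rewrite -ball_normE /= sub0r normrN gtr0_norm.
  have [[_ [h3 _]] [_ [[h5 h6 h7] _]]] := Hd s bs.
  have := nbhs_singleton h3; rewrite h5 -/(Xc s) -/(al s) => /(_ s0) [_ _ _ _ h15].
  exact/h15.
have main s : 0 < s < d1 -> [/\ N0 v u (al s), smooth_at al s, st1 (al s) = s *: Xc s, nsq (Xc s) = rho ^+ 2 &
    0 < mdet (al s) ('D_1 al s) (Jw v u q (al s)) * (adet x1 (Jw v w q.+1 x1) * adet y1 (Jw w u q y1))].
  move=> hs; have Ns := mainN s hs; case/andP: (hs) => s0 sd.
  have bs : ball 0 d1 s by rewrite -ball_normE /= sub0r normrN gtr0_norm.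
  have [[[h1 h2] [h3 h4]] [sst [[h5 h6 h7] h8]]] := Hd s bs.
  have := nbhs_singleton h3; rewrite h5 -/(Xc s) -/(al s) => /(_ s0) [[h9 h10 h11] h12 h13 h14 h15].
  have sXs : smooth_at Xc s by exact: smooth_rsubmx.
  have sas : smooth_at al s by exact: sal.
  split=> //.
  set xi := s *: Xc s in h9 h10 h11 *.
  pose A := 'J sg xi; pose J1 := 'J st1 (al s); pose J2 := Jw v u q (al s).
  have Ay : A *m (al s)^T = 0.
    have sn : smooth_at (fun y : 'rV[R]_q.+2 => (nsq y)%:M : 'rV[R]_1) (sg xi).
      by apply: smooth_scalar; exact: nsq_smooth.
    have E := jac_comp (smooth_diff h9) (smooth_diff sn).
    have E0 : 'J ((fun y : 'rV[R]_q.+2 => (nsq y)%:M : 'rV[R]_1) \o sg) xi = 0.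
      rewrite -(jac_cst (1%:M : 'rV[R]_1) xi); apply: esym; apply: near_eq_jac.
        by apply: filterS h4 => z [_ /= -> _].
      by apply: smooth_diff; exact: smooth_cst.
    move: E; rewrite E0 jac_nsq [(2 *: _)^T]linearZ /= -scalemxAr => /esym/eqP.
    by rewrite scaler_eq0 pnatr_eq0 /= => /eqP.
  have AJ : A *m J1 = 1%:M.
    rewrite /A /J1 -(jac_comp (smooth_diff h9) (smooth_diff sst)) -(jac_id xi).
    apply: esym; apply: near_eq_jac; first by apply: filterS h4 => z [_ _ /= ->].
    by apply: smooth_diff; exact: smooth_id.
  have aE : 'D_1 al s = w' s *m A.
    have E := derive_curve (sXi _ sXs) h9; apply: etrans E _; congr (_ *m _).
    rewrite (@derive_scale _ _ id Xc) //; last exact: smooth_id.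
    by rewrite derive_id scale1r.
  have yJ : al s *m J2 = 0 by case: Ns => _ Wa; exact: (Jst_ray hMS cv cu (gTP cu Wa) Wa).
  have NP x : [set x | N0 v u x /\ True] x -> loc_def [set x | N0 v u x /\ True] (@Jw v u q.+2 q) x.
    move=> [Nx _]; have nT : \forall y \near x, N0 v u y -> (True <-> True) by apply: filterE.
    exact: (@N0_loc v u q cv cu (fun=> True)).
  have nN : \forall t \near s, [set x | N0 v u x /\ True] (al t).
    by apply: filterS (near_itv hs) => t /mainN.
  have aJ : 'D_1 al s *m J2 = 0 by case: (curve_tangent NP sas nN).
  have wK : w' s *m (A *m J2) = 0 by rewrite mulmxA -aE.
  (* By [stab_flow] the function [st] near the arc is [s *: G (s, s^-1 *: x)]. The factor [s]
     cancels the [s^-1] of the chain rule, so the Jacobian along the section has a limit as [s]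
     tends to 0. *)
  have AK : A *m J2 = K1 s.
    pose T := T2 - ln s.
    have gT' : gd h Phi u q T (ph h Phi v (al s)).
      by rewrite /gd /good /T (gfD gf) h12.
    have sS := st_ph_smooth hMS cv cu gT'.1.
    rewrite /A /J2 (JwE cv cu gT' Ns.2) /Jst.
    rewrite -(jac_comp (smooth_diff h9) (smooth_diff sS)).
    pose aff (x : 'rV[R]_q.+1) : 'rV[R]_(1 + q.+1) := x *m (s^-1 *: incl) + row_mx s%:M 0.
    have sm x : smooth_at (fun x : 'rV[R]_q.+1 => x *m (s^-1 *: incl)) x.
      by apply: smooth_mulmxr; exact: smooth_id.
    have saff x : smooth_at aff x by apply: smooth_add; [exact: sm|exact: smooth_cst].
    have affE x : aff x = row_mx s%:M (s^-1 *: x).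
      by rewrite /aff -scalemxAr inclE scale_row_mx scaler0 add_row_mx add0r addr0.
    have Jaff : 'J aff xi = s^-1 *: incl.
      apply: mulmx_inj => y; have <- := deriveEjacobian y (smooth_diff (saff xi)).
      have E : 'D_y aff xi = 'D_y (fun x : 'rV[R]_q.+1 => x *m (s^-1 *: incl)) xi + 'D_y (cst (row_mx s%:M 0 : 'rV[R]_(1 + q.+1))) xi.
        apply: (@deriveD); apply: diff_derivable; apply: smooth_diff; [exact: sm|exact: smooth_cst].
      rewrite E derive_cst addr0; have E2 := @derive_mulmxr R _ _ _ id (s^-1 *: incl) xi y.
      by apply: etrans (E2 _) _; [apply: smooth_diff; exact: smooth_id|rewrite derive_id].
    have affxi : aff xi = Z s.
      rewrite affE /xi scalerA mulVf ?gt_eqF // scale1r -[RHS]hsubmxK; congr (row_mx _ _).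
      by apply/rowP => j; rewrite (ord1 j) h5 mxE eqxx.
    have dG : differentiable G (aff xi) by rewrite affxi; exact: smooth_diff.
    transitivity ('J (fun x => G (aff x) *m s%:M) xi).
      apply: esym; apply: near_eq_jac; last first.
        by apply: differentiable_mulmxr; exact: differentiable_comp (smooth_diff (saff xi)) dG.
      rewrite -affxi in h3.
      apply: filterS (near_cont (smooth_cont (saff xi)) h3) => x.
      rewrite /= affE row_mxKl row_mxKr mxE eqxx mulr1n scalerA divff ?gt_eqF // scale1r => /(_ s0)[_ Hx _ _ _].
      rewrite mul_mx_scalar /G -Hx; have := stab_flow gf q (cc h Phi u) T (- ln s) (ph h Phi v (sg x)).
      have -> : T - - ln s = T2 by rewrite /T opprK subrK.
      rewrite /st => ->; rewrite expRN lnK ?posrE // scalerA divff ?gt_eqF // scale1r //.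
    rewrite (jac_mulmxr s%:M (differentiable_comp (smooth_diff (saff xi)) dG)).
    rewrite (jac_comp (smooth_diff (saff xi)) dG) Jaff affxi mul_mx_scalar -scalemxAl scalerA.
    by rewrite divff ?gt_eqF // scale1r.
  have FS := frame_sign (J1 := J1) h10 Ay AJ aE yJ wK.
  rewrite AK in FS.
  have w0 : w' s != 0.
    apply/eqP => E; move: h2; rewrite E adet0 mul0r ltxx //.
  have a0 : 'D_1 al s != 0.
    apply/eqP => E; move: w0; rewrite -[w' s]mulmx1 -AJ mulmxA -aE E mul0mx eqxx //.
  have nw : 0 < nsq (w' s) by rewrite -nsq_dot; exact: dotr_gt0.
  have na : 0 < nsq ('D_1 al s) by rewrite -nsq_dot; exact: dotr_gt0.
  rewrite -(pmulr_lgt0 _ nw) mulrAC FS.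
  exact: mulr5_gt0 h1 na h2.
have [d2 d20 Hd2] := near_ball (near_and near_exit uZ).
have [d3 d30 Hd3] := near_ball sgK.
exists al, Xc, (Num.min d1 (Num.min d2 d3)); split; first by rewrite !lt_min d10 d20.
split=> //.
  by move=> s; rewrite !lt_min => /andP[s0 /andP[s1 _]]; apply: main; rewrite s0.
move=> y s x Ny; rewrite !lt_min => /and3P[_ _ yd] /andP[s0 /and3P[sd1 sd2 _]] nx /and3P[_ xd _] yE.
have bz : ball z0 d2 (row_mx s%:M x : 'rV[R]_(1 + q.+1)).
  rewrite -ball_normE /= /z0; apply: (@le_lt_trans _ _ (Num.max s `|x - y1|)); last by rewrite gt_max sd2.
  apply: normrV_le => [|j]; first by rewrite le_max ltW.
  rewrite le_max !mxE; case: split_ordP => j' _.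
    by apply/orP; left; rewrite (ord1 j') !mxE eqxx mulr1n sub0r normrN gtr0_norm // lexx.
  by apply/orP; right; have := normrV_coef (x - y1) j'; rewrite !mxE distrC.
have [h1 h2] := Hd2 _ bz.
rewrite row_mxKl row_mxKr mxE eqxx mulr1n in h1 h2.
have [_ _ _ _ h3] := h1 s0.
have by_ : ball x1 d3 y by rewrite -ball_normE /= distrC.
have yE' := Hd3 _ by_ Ny.1; rewrite yE in yE'; rewrite yE' in h3.
rewrite /al /Xc -(h2 nx (proj1 h3 Ny)) row_mxKr //.
Qed.
End WithSection.

Lemma end_arc_ex : exists (al : R -> 'rV[R]_q.+2) (Xc : R -> 'rV[R]_q.+1) (d : R), 0 < d /\
 [/\ smooth_at al 0 /\ al 0 = x1, smooth_at Xc 0 /\ Xc 0 = y1,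
  forall s : R, 0 < s < d -> [/\ N0 v u (al s), smooth_at al s, st1 (al s) = s *: Xc s, nsq (Xc s) = rho ^+ 2 &
    0 < mdet (al s) ('D_1 al s) (Jw v u q (al s)) * (adet x1 (Jw v w q.+1 x1) * adet y1 (Jw w u q y1))] &
  forall y (s : R) x, N0 v u y -> `|y - x1| < d -> 0 < s < d -> nsq x = rho ^+ 2 -> `|x - y1| < d ->
    st1 y = s *: x -> y = al s].
Proof.
by have [sg [s0 s1 s2]] := ph_section hMS cv cw nx1 g1 Wx1; exact: (end_arc s0 s1 s2).
Qed.
End EndArc.
End Weights.

(** * Parametrized ends as positively oriented arcs *)

Section Polar.
Variables (R : realType) (k : nat) (rho : R).
Hypothesis rho0 : 0 < rho.

Definition radius (xi : 'rV[R]_k) : R := Num.sqrt (nsq xi) / rho.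

Lemma radiusZ s (x : 'rV[R]_k) : 0 < s -> nsq x = rho ^+ 2 -> radius (s *: x) = s.
Proof.
move=> s0 nx; rewrite /radius nsqZ nx -exprMn sqrtr_sqr ger0_norm ?mulr_ge0 ?ltW //.
by rewrite mulfK // gt_eqF.
Qed.

Lemma radius_gt0 (xi : 'rV[R]_k) : xi != 0 -> 0 < radius xi.
Proof. by move=> x0; rewrite divr_gt0 // sqrtr_gt0 -nsq_dot; exact: dotr_gt0. Qed.

Lemma radius_unit (xi : 'rV[R]_k) : xi != 0 -> nsq ((radius xi)^-1 *: xi) = rho ^+ 2.
Proof.
move=> x0; rewrite nsqZ exprVn /radius expr_div_n sqr_sqrtr ?nsq_ge0 // invf_div divfK //.
by rewrite -nsq_dot gt_eqF // dotr_gt0.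
Qed.

Lemma radiusK (xi : 'rV[R]_k) : xi != 0 -> xi = radius xi *: ((radius xi)^-1 *: xi).
Proof. by move=> x0; rewrite scalerA divff ?scale1r // gt_eqF // radius_gt0. Qed.

Lemma radius_continuous : continuous radius.
Proof.
move=> x; have H : {for x, continuous (fun y : 'rV[R]_k => Num.sqrt (nsq y))}.
  apply: (@continuous_comp _ _ _ (@nsq R k) (@Num.sqrt R)); first exact: nsq_continuous.
  exact: sqrt_continuous.
apply: (@continuous_comp _ _ _ (fun y : 'rV[R]_k => Num.sqrt (nsq y)) (fun u : R => u / rho)) => //.
by apply: smooth_cont; apply: smooth_mul; [exact: smooth_id|exact: smooth_cst].
Qed.

Lemma radius0 : radius 0 = 0.
Proof. by rewrite /radius /nsq big1 ?sqrtr0 ?mul0r // => j _; rewrite mxE expr0n. Qed.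
End Polar.

Section PreArc.
Variables (R : realType) (q : nat) (N : set 'rV[R]_q.+2) (K : 'rV[R]_q.+2 -> 'M[R]_(q.+2, q)).
Variables (al : R -> 'rV[R]_q.+2) (Xc : R -> 'rV[R]_q.+1) (f : 'rV[R]_q.+2 -> 'rV[R]_q.+1).
Variables (x1 : 'rV[R]_q.+2) (y1 : 'rV[R]_q.+1) (rho d d' sg : R).
Hypotheses (rho0 : 0 < rho) (dd : d <= d').
Hypothesis alN : forall s : R, 0 < s < d -> [/\ N (al s), smooth_at al s, f (al s) = s *: Xc s,
  nsq (Xc s) = rho ^+ 2 & 0 < mdet (al s) ('D_1 al s) (K (al s)) * sg].
Hypothesis al_near : forall s : R, 0 < s < d ->
  [/\ `|al s - x1| < d', `|Xc s - y1| < d' & {for al s, continuous f}].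
Hypothesis al_cover : forall y (s : R) x, N y -> `|y - x1| < d' -> 0 < s < d' ->
  nsq x = rho ^+ 2 -> `|x - y1| < d' -> f y = s *: x -> y = al s.

Lemma prearc_inj s t : 0 < s < d -> 0 < t < d -> al s = al t -> s = t.
Proof.
move=> hs ht E; have [_ _ fs ns _] := alN hs; have [_ _ ft nt _] := alN ht.
have [s0 _] := andP hs; have [t0 _] := andP ht.
by rewrite -(radiusZ rho0 s0 ns) -fs E ft radiusZ.
Qed.

(** The parameters of a point are recovered from [f y = s *: x] by polar decomposition: [s] is its
    [radius] and [x] its direction. Both are continuous away from 0, so nearby points of [N] satisfy
    the hypotheses of [al_cover]. *)
Lemma prearc_open t e : 0 < t < d -> 0 < e -> \forall y \near al t, N y ->
    exists u, [/\ 0 < u < d, `|u - t| < e & al u = y].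
Proof.
move=> ht e0; have [_ _ ft nt _] := alN ht; have [h1 h2 cf] := al_near ht.
have t0 : 0 < t by case/andP: ht.
have X0 : Xc t != 0.
  apply/eqP => E; move: nt; rewrite E /nsq big1 => [/eqP|j _]; last by rewrite mxE expr0n.
  by rewrite eq_sym expf_eq0 /= gt_eqF.
have rt : radius rho (f (al t)) = t by rewrite ft radiusZ.
have cr : {for al t, continuous (fun y => radius rho (f y))}.
  by apply: (@continuous_comp _ _ _ f (radius rho)) => //; exact: radius_continuous.
have cx : {for al t, continuous (fun y => (radius rho (f y))^-1 *: f y)}.
  have r0 : radius rho (f (al t)) != 0 by rewrite rt gt_eqF.
  exact: (cvgZ (cvgV r0 cr) cf).
have xt : (radius rho (f (al t)))^-1 *: f (al t) = Xc t.
  by rewrite rt ft scalerA mulVf ?scale1r // gt_eqF.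
have n1 : \forall y \near al t, 0 < radius rho (f y) < d /\ `|radius rho (f y) - t| < e.
  apply: (near_cont (P := fun u : R => 0 < u < d /\ `|u - t| < e) cr); rewrite rt.
  apply: near_and; first exact: near_itv.
  by apply: filterS (nbhsx_ballx t e e0) => u; rewrite -ball_normE /= distrC.
have nball (V : normedModType R) (a b : V) : `|a - b| < d' -> \forall y \near a, `|y - b| < d'.
  move=> ab; have /filterS : nbhs b (ball b d') by exact: (nbhsx_ballx b d' (le_lt_trans (normr_ge0 _) ab)).
  move=> _; have := @open_nbhs_nbhs _ a (ball b d'); rewrite /open_nbhs => H.
  have : nbhs a (ball b d') by apply: H; split; [exact: ball_open|rewrite -ball_normE /= distrC].
  by apply: filterS => y; rewrite -ball_normE /= distrC.
have n2 : \forall y \near al t, `|(radius rho (f y))^-1 *: f y - y1| < d'.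
  have H := near_cont (P := fun u : 'rV[R]_q.+1 => `|u - y1| < d') cx.
  by apply: H; rewrite xt; exact: nball.
apply: filterS2 (near_and n1 n2) (nball _ _ _ h1) => y [[/andP[i1 i1'] i2] i3] i4 Ny.
exists (radius rho (f y)); split=> //; first by rewrite i1.
have f0 : f y != 0 by apply/eqP => E; move: i1; rewrite E radius0 ltxx.
apply: esym; apply: (al_cover Ny i4 _ _ i3).
- by rewrite i1 (lt_le_trans i1' dd).
- exact: radius_unit.
- exact: radiusK.
Qed.

Lemma garc_pos_end : 0 < sg -> garc N K al 0 d.
Proof.
move=> sg0; split.
- by move=> t /alN[].
- exact: prearc_inj.
- by move=> t /alN[].
- by move=> t /alN[_ _ _ _]; rewrite pmulr_lgt0.
- exact: prearc_open.
Qed.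

(** An end of negative sign is run backwards to become positively oriented, so its missing point
    lies on the right; for a positive sign it lies on the left. *)
Lemma garc_neg_end : sg < 0 -> garc N K (fun t => al (- t)) (- d) 0.
Proof.
move=> sg0; have iN t : - d < t < 0 -> 0 < - t < d by move=> /andP[? ?]; apply/andP; split; lra.
split.
- by move=> t /iN/alN[].
- by move=> t u /iN ht /iN hu /(prearc_inj ht hu)/oppr_inj.
- move=> t /iN/alN[_ sa _ _ _]; apply: (@smooth_comp _ _ _ _ (fun t : R => - t) al) => //; try exact: findim_R.
    exact: findim_rV.
  by under eq_fun do rewrite -mulN1r; apply: smooth_mul; [exact: smooth_cst|exact: smooth_id].
- move=> t /iN/alN[_ sa _ _]; rewrite nmulr_lgt0 // => md.
  have sN : smooth_at (fun t : R => - t) t.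
    by under eq_fun do rewrite -mulN1r; apply: smooth_mul; [exact: smooth_cst|exact: smooth_id].
  have DN : 'D_1 (fun t : R => - t) t = -1.
    have H : derivable (@id R) t 1 by exact: derivable_id.
    by have := deriveN H; rewrite derive_id; apply.
  have -> : 'D_1 (fun t : R => al (- t)) t = -1 *: 'D_1 al (- t).
    rewrite -DN; exact: (derive_repar (smooth_diff sN) (smooth_diff sa)).
  by rewrite mdetZ mulN1r oppr_gt0.
move=> t e /iN ht e0; apply: filterS (prearc_open ht e0) => y Hy /Hy[u [h1 h2 h3]].
exists (- u); split; last by rewrite opprK.
  by case/andP: h1 => ? ?; apply/andP; split; lra.
by rewrite -[t]opprK -opprD normrN.
Qed.
End PreArc.

Lemma finite_pos (R : realType) (I : finType) (P : I -> R -> Prop) :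
  (forall i, exists2 e : R, 0 < e & P i e) ->
  (forall i (e e' : R), 0 < e' -> e' <= e -> P i e -> P i e') ->
  exists2 e : R, 0 < e & forall i, P i e.
Proof.
move=> ex mono; suff H : forall s : seq I, exists2 e : R, 0 < e & forall i, i \in s -> P i e.
  by have [e e0 He] := H (enum I); exists e => // i; apply: He; rewrite mem_enum.
elim=> [|i s [e e0 He]]; first by exists 1.
have [e' e'0 Pe'] := ex i; exists (Num.min e e'); first by rewrite lt_min e0.
have m0 : 0 < Num.min e e' by rewrite lt_min e0.
move=> j; rewrite in_cons => /predU1P[->|/He Pj].
  by apply: (mono _ e') => //; rewrite ge_min lexx orbT.
by apply: (mono _ e) => //; rewrite ge_min lexx.
Qed.

Lemma card_inl (E J : finType) (P : pred E) (Q : pred (E + J)) :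
  (forall i, Q (inl i) = P i) -> (forall k, Q (inr k) = false) -> #|Q| = #|P|.
Proof.
move=> QE QJ; have injl : injective (@inl E J) by move=> x y [].
rewrite -(fintype.card_image injl P); apply: eq_card => -[i|k].
  by rewrite fintype.mem_image // -!topredE /= QE.
by rewrite [LHS]QJ; apply/esym/fintype.imageP; case.
Qed.

Lemma curves_apart (R : realType) (V : normedModType R) (f g : R -> V) :
  {for 0, continuous f} -> {for 0, continuous g} -> f 0 <> g 0 ->
  exists2 e : R, 0 < e & forall s t : R, `|s| < e -> `|t| < e -> f s <> g t.
Proof.
move=> cf cg fg; pose r := `|f 0 - g 0| / 2.
have r0 : 0 < r by rewrite divr_gt0 // normr_gt0 subr_eq0; exact/eqP.
have [e1 e10 H1] := near_ball (near_cont cf (nbhsx_ballx (f 0) r r0)).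
have [e2 e20 H2] := near_ball (near_cont cg (nbhsx_ballx (g 0) r r0)).
exists (Num.min e1 e2) => [|s t]; first by rewrite lt_min e10.
rewrite !lt_min => /andP[s1 _] /andP[_ t2] E.
have := H1 s; have := H2 t; rewrite -!ball_normE /= !sub0r !normrN => /(_ t2) h2 /(_ s1) h1.
have : `|f 0 - g 0| < r + r.
  apply: le_lt_trans (ltrD h1 h2); rewrite -E [`|g 0 - _|]distrC.
  by apply: le_trans (ler_normD _ _); rewrite addrA subrK.
by rewrite /r; set x := `|_|; lra.
Qed.

(** * The signed count of broken orbits *)

Section Gluing.
Variables (R : realType) (n : nat) (M : manifold R n).
Variables (h : M -> R) (X : vector_field M) (Phi : R -> M -> M).
Hypothesis hMS : morse_smale h X Phi.
Hypothesis cM : closed_manifold M.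
Let gf := ms_gflow hMS.
Variables (v u : M) (q : nat).
Hypotheses (cv : cip h v q.+2) (cu : cip h u q).
Variable rho : M -> R.
Hypothesis rhoP : forall w, cip h w q.+1 -> 0 < rho w /\ rho w ^+ 2 <= rr h Phi w ^+ 2 / 4.

Definition is_end w (x : 'rV[R]_q.+2) (y : 'rV[R]_q.+1) : Prop :=
  [/\ cip h w q.+1, nsq x = 1 /\ Wplus Phi w (ph h Phi v x) &
      nsq y = rho w ^+ 2 /\ Wplus Phi u (ph h Phi w y)].

Definition st1 w (x y : 'rV[R]_q.+2) : 'rV[R]_q.+1 :=
  st h Phi w q.+1 (gT h Phi w q.+1 (ph h Phi v x)) (ph h Phi v y).

(** A locally constant property that selects an open and closed part of the space of orbits; [Lend]
    is the corresponding selection of broken orbits. They serve to prescribe end points in the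
    covering while the compactness arguments take place on [M]. *)
Variable lab : 'rV[R]_q.+2 -> Prop.
Hypothesis labP : forall x, N0 h Phi v u x -> \forall y \near x, N0 h Phi v u y -> (lab y <-> lab x).
Variable Lend : M -> 'rV[R]_q.+2 -> 'rV[R]_q.+1 -> Prop.
Hypothesis labE : forall w x1 y1, is_end w x1 y1 -> exists2 d : R, 0 < d & forall y (s : R) x,
  N0 h Phi v u y -> `|y - x1| < d -> 0 < s < d -> `|x - y1| < d -> st1 w x1 y = s *: x ->
  (lab y <-> Lend w x1 y1).

Variables (E : finType) (ew : E -> M) (ex : E -> 'rV[R]_q.+2) (ey : E -> 'rV[R]_q.+1).
Hypothesis endP : forall i, is_end (ew i) (ex i) (ey i) /\ Lend (ew i) (ex i) (ey i).
Hypothesis end_inj : forall i j, ew i = ew j -> ex i = ex j -> ey i = ey j -> i = j.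
Hypothesis end_surj : forall w x y, is_end w x y -> Lend w x y ->
  exists i, [/\ ew i = w, ex i = x & ey i = y].

Definition end_sign i : R := adet (ex i) (Jw h Phi v (ew i) q.+1 (ex i)) * adet (ey i) (Jw h Phi (ew i) u q (ey i)).

Let N : set 'rV[R]_q.+2 := [set x | N0 h Phi v u x /\ lab x].
Let K : 'rV[R]_q.+2 -> 'M[R]_(q.+2, q) := @Jw R n M h Phi v u q.+2 q.

Let NP x : N x -> loc_def N K x.
Proof. by move=> [Nx lx]; apply: (N0_loc hMS cv cu) => //; exact: labP. Qed.

Definition end_prop i (al : R -> 'rV[R]_q.+2) (Xc : R -> 'rV[R]_q.+1) (d : R) : Prop := 0 < d /\
 [/\ smooth_at al 0 /\ al 0 = ex i, smooth_at Xc 0 /\ Xc 0 = ey i,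
  forall s : R, 0 < s < d -> [/\ N0 h Phi v u (al s), smooth_at al s, st1 (ew i) (ex i) (al s) = s *: Xc s,
    nsq (Xc s) = rho (ew i) ^+ 2 & 0 < mdet (al s) ('D_1 al s) (K (al s)) * end_sign i] &
  forall y (s : R) x, N0 h Phi v u y -> `|y - ex i| < d -> 0 < s < d -> nsq x = rho (ew i) ^+ 2 ->
    `|x - ey i| < d -> st1 (ew i) (ex i) y = s *: x -> y = al s].

Let end_raw i : exists t : (R -> 'rV[R]_q.+2) * (R -> 'rV[R]_q.+1) * R, end_prop i t.1.1 t.1.2 t.2.
Proof.
have [[cw [nx Wx] [ny Wy]] _] := endP i; have [r0 r1] := rhoP cw.
have [al [Xc [d H]]] := end_arc_ex hMS cv cw cu nx Wx r0 r1 ny Wy.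
by exists (al, Xc, d).
Qed.

Definition end_data i := sval (cid (end_raw i)).
Let al i := (end_data i).1.1.
Let Xc i := (end_data i).1.2.
Let d0 i := (end_data i).2.

Let end_dataP i : end_prop i (al i) (Xc i) (d0 i). Proof. exact: (svalP (cid (end_raw i))). Qed.

Let d0_gt0 i : 0 < d0 i. Proof. by have [] := end_dataP i. Qed.

Let al0 i : smooth_at (al i) 0 /\ al i 0 = ex i. Proof. by have [_ []] := end_dataP i. Qed.

Let Xc0 i : smooth_at (Xc i) 0 /\ Xc i 0 = ey i. Proof. by have [_ []] := end_dataP i. Qed.

Let alP i (s : R) : 0 < s < d0 i -> [/\ N0 h Phi v u (al i s), smooth_at (al i) s,
  st1 (ew i) (ex i) (al i s) = s *: Xc i s, nsq (Xc i s) = rho (ew i) ^+ 2 &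
  0 < mdet (al i s) ('D_1 (al i) s) (K (al i s)) * end_sign i].
Proof. by have [_ [_ _ H _]] := end_dataP i; exact: H. Qed.

Let al_cover i y (s : R) x : N0 h Phi v u y -> `|y - ex i| < d0 i -> 0 < s < d0 i ->
  nsq x = rho (ew i) ^+ 2 -> `|x - ey i| < d0 i -> st1 (ew i) (ex i) y = s *: x -> y = al i s.
Proof. by have [_ [_ _ _ H]] := end_dataP i; exact: H. Qed.

(** If the first halves differ, so do the limits of the arcs. If they agree, the intermediate point
    is the same and the parameter is read off as a radius, so that a common point would have equal
    exit directions, whose limits are distinct. *)
Let al_apart i j : i <> j -> exists2 e : R, 0 < e & e <= d0 i /\ e <= d0 j /\
  forall s t : R, 0 < s < e -> 0 < t < e -> al i s <> al j t.
Proof.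
move=> ij; have m0 : 0 < Num.min (d0 i) (d0 j) by rewrite lt_min !d0_gt0.
have fin (e : R) : 0 < e -> (forall s t : R, 0 < s < d0 i -> 0 < t < d0 j -> `|s| < e -> `|t| < e -> al i s <> al j t) ->
    exists2 e : R, 0 < e & e <= d0 i /\ e <= d0 j /\ forall s t : R, 0 < s < e -> 0 < t < e -> al i s <> al j t.
  move=> e0 He; exists (Num.min e (Num.min (d0 i) (d0 j))); first by rewrite lt_min e0.
  rewrite !ge_min !lexx /= !orbT; split=> //; split=> // s t /andP[s0]; rewrite !lt_min => /and3P[s1 s2 s3].
  by move=> /andP[t0 /and3P[t1 t2 t3]]; apply: He; rewrite ?s0 ?t0 ?gtr0_norm.
have [a1 a2] := al0 i; have [a3 a4] := al0 j; have [b1 b2] := Xc0 i; have [b3 b4] := Xc0 j.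
have [xE|xN] := pselect (ex i = ex j); last first.
  have [|e e0 He] := curves_apart (smooth_cont a1) (smooth_cont a3); first by rewrite a2 a4.
  by apply: (fin e) => // s t _ _; exact: He.
have [[cwi [_ Wi] _] _] := endP i; have [[cwj [_ Wj] _] _] := endP j.
have wE : ew i = ew j by move: Wj; rewrite -xE; exact: Wplus_unique.
have yN : ey i <> ey j by move=> yE; exact: ij (end_inj wE xE yE).
have [|e e0 He] := curves_apart (smooth_cont b1) (smooth_cont b3); first by rewrite b2 b4.
apply: (fin e) => // s t hs ht se te AE; have [_ _ fs ns _] := alP hs; have [_ _ ft nt _] := alP ht.
have [r0 _] := rhoP cwi; have s0 : 0 < s by case/andP: hs. have t0 : 0 < t by case/andP: ht.
have fE : s *: Xc i s = t *: Xc j t by rewrite -fs -ft AE wE xE.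
have st_ : s = t by rewrite -(radiusZ r0 s0 ns) fE radiusZ // wE.
apply: (He s t se te); move: fE; rewrite -st_ => /(congr1 ( *:%R s^-1)).
by rewrite !scalerA mulVf ?scale1r // gt_eqF.
Qed.

Let nearD (V : normedModType R) (f : R -> V) (y : V) (d : R) : 0 < d -> smooth_at f 0 -> f 0 = y ->
  exists2 e : R, 0 < e & forall s, 0 < s < e -> `|f s - y| < d.
Proof.
move=> dp sf <-; have [e e0 He] := near_ball (near_cont (smooth_cont sf) (nbhsx_ballx (f 0) d dp)).
exists e => // s /andP[s0 se]; have := He s; rewrite -!ball_normE /= sub0r normrN gtr0_norm // distrC; exact.
Qed.

Let st1_smooth w x : cip h w q.+1 -> Wplus Phi w (ph h Phi v x) -> smooth_at (st1 w x) x.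
Proof. by move=> cw Wx; apply: (st_ph_smooth hMS cv cw); case: (gTP hMS cw Wx). Qed.

Let uniform : exists2 d : R, 0 < d & forall i, d <= d0 i /\ (forall s : R, 0 < s < d ->
  [/\ lab (al i s), `|al i s - ex i| < d0 i, `|Xc i s - ey i| < d0 i & {for al i s, continuous (st1 (ew i) (ex i))}]) /\
  forall j, i <> j -> forall s t : R, 0 < s < d -> 0 < t < d -> al i s <> al j t.
Proof.
apply: finite_pos => [i|i e e' e'0 ee [h1 [h2 h3]]]; last first.
  have sub s : 0 < s < e' -> 0 < s < e by move=> /andP[-> /lt_le_trans ->].
  split; first exact: le_trans ee h1.
  by split=> [s /sub/h2//|j ij s t /sub hs /sub ht]; exact: h3.
have [e1 e10 He1] : exists2 e : R, 0 < e & forall j, i <> j -> forall s t : R, 0 < s < e -> 0 < t < e -> al i s <> al j t.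
  apply: finite_pos => [j|j e e' e'0 ee H ij s t]; last first.
    by move=> /andP[s0 se] /andP[t0 te]; apply: H; rewrite ?s0 ?t0 ?(lt_le_trans se ee) ?(lt_le_trans te ee).
  have [ij|ij] := pselect (i <> j); last by exists 1.
  by have [e e0 [_ [_ H]]] := al_apart ij; exists e.
have [[cw [nx Wx] [ny Wy]] Li] := endP i.
have [d d_gt0 Hd] := labE (endP i).1.
have m0 : 0 < Num.min d (d0 i) by rewrite lt_min d_gt0 d0_gt0.
have [e2 e20 He2] := nearD m0 (al0 i).1 (al0 i).2.
have [e3 e30 He3] := nearD m0 (Xc0 i).1 (Xc0 i).2.
have [e4 e40 He4] : exists2 e : R, 0 < e & forall s, 0 < s < e -> {for al i s, continuous (st1 (ew i) (ex i))}.
  have n1 : \forall y \near al i 0, smooth_at (st1 (ew i) (ex i)) y.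
    by rewrite (al0 i).2; apply: smooth_near; exact: st1_smooth.
  have [e e0 He] := near_ball (near_cont (smooth_cont (al0 i).1) n1).
  exists e; first exact: e0.
  move=> s /andP[s0 se]; have bs : ball 0 e s by rewrite -ball_normE /= sub0r normrN gtr0_norm.
  exact: (smooth_cont (He s bs)).
exists (Num.min (Num.min e1 e2) (Num.min (Num.min e3 e4) (Num.min d (d0 i)))).
  by rewrite !lt_min e10 e20 e30 e40 d_gt0 d0_gt0.
split; first by rewrite !ge_min lexx !orbT.
split=> [s|j ij s t].
  move=> /andP[s0]; rewrite !lt_min => /and3P[/andP[s1 s2] /andP[s3 s4] /andP[s5 s6]].
  have := He2 s; rewrite s0 s2 lt_min => /(_ isT)/andP[h1 h2].
  have := He3 s; rewrite s0 s3 lt_min => /(_ isT)/andP[h3 h4].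
  have hs : 0 < s < d0 i by rewrite s0.
  split; [|exact: h2|exact: h4|by apply: He4; rewrite s0].
  have [a1 _ a3 _ _] := alP hs; have hs' : 0 < s < d by rewrite s0.
  by apply/(Hd _ _ _ a1 h1 hs' h3 a3).
move=> /andP[s0]; rewrite !lt_min => /and3P[/andP[s1 _] _ _] /andP[t0 /and3P[/andP[t1 _] _ _]].
by apply: He1 => //; rewrite ?s0 ?t0.
Qed.

Section Cover.
Variable d : R.
Hypotheses (dpos : 0 < d) (dd0 : forall i, d <= d0 i).

(** The exit point depends continuously on [(y, s, x)] at [(x1, 0, x0)], and near the limit no point
    flows to [u], by [traj_closed]. *)
Let exit_near w (x1 : 'rV[R]_q.+2) (x0 : 'rV[R]_q.+1) : cip h w q.+1 -> Wplus Phi w (ph h Phi v x1) ->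
  nsq x0 = rho w ^+ 2 -> ~ Wplus Phi u (ph h Phi w x0) ->
  exists2 e : R, 0 < e & forall y (s : R) x, N0 h Phi v u y -> `|y - x1| < e -> 0 < s < e -> `|x - x0| < e ->
    st1 w x1 y = s *: x -> False.
Proof.
move=> cw Wx1 nx0 nW; have [r0 r1] := rhoP cw; have hw := cip_hyp hMS cw; have wn := cip_le cw.
have g1 := gTP hMS cw Wx1; set T1 := gT h Phi w q.+1 (ph h Phi v x1) in g1.
have x00 : x0 != 0.
  apply/eqP => E0; move: nx0; rewrite E0 /nsq big1 => [/eqP|j _]; last by rewrite mxE expr0n.
  by rewrite eq_sym expf_eq0 /= gt_eqF.
have ix0 : nsq x0 < rr h Phi w ^+ 2.
  by rewrite nx0; apply: le_lt_trans r1 _; have := exprn_gt0 2 (hc_r hw); lra.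
have nA : \forall z \near ph h Phi w x0, ~ Wplus Phi u z.
  apply: contrapT => nn; apply: nW; apply: (traj_closed hMS cM cw cu x00) => B nB.
  apply: contrapT => AB; apply: nn; apply: filterS nB => z Bz Az; apply: AB.
  by exists z.
pose pt y := cc h Phi w (Phi T1 (ph h Phi v (m := q.+2) y)).
have cpt : {for x1, continuous pt}.
  apply: (@continuous_comp _ _ _ (ph h Phi v (m := q.+2)) (cc h Phi w \o Phi T1)); first exact: (phc hMS cv).
  apply: continuous_comp; first exact: (gf_contt gf).
  by apply: Defs.coord_continuous; case: g1.
pose p0 : 'rV[R]_q.+2 * R * 'rV[R]_q.+1 := (x1, 0, x0).
pose ep (p : 'rV[R]_q.+2 * R * 'rV[R]_q.+1) := exitpt T1 p.1.2 p.2 (pt p.1.1).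
have cep : {for p0, continuous ep}.
  have c3 : {for p0, continuous (fun p : 'rV[R]_q.+2 * R * 'rV[R]_q.+1 => em n p.2)}.
    apply: (@continuous_comp _ _ _ snd (em n)); first exact: cvg_snd.
    by apply: smooth_cont; apply: em_smooth; exact: smooth_id.
  have c2 : {for p0, continuous (fun p : 'rV[R]_q.+2 * R * 'rV[R]_q.+1 => p.1.2 * expR T1)}.
    apply: (@continuous_comp _ _ _ (fun p : 'rV[R]_q.+2 * R * 'rV[R]_q.+1 => p.1.2) (fun s : R => s * expR T1)).
      by apply: (@continuous_comp _ _ _ fst snd); [exact: cvg_fst|exact: cvg_snd].
    by apply: smooth_cont; apply: smooth_mul; [exact: smooth_id|exact: smooth_cst].
  have c1 : {for p0, continuous (fun p : 'rV[R]_q.+2 * R * 'rV[R]_q.+1 => pt p.1.1 - em n (pm q.+1 (pt p.1.1)))}.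
    apply: (@continuous_comp _ _ _ (fun p : 'rV[R]_q.+2 * R * 'rV[R]_q.+1 => pt p.1.1) (fun P => P - em n (pm q.+1 P))).
      apply: (@continuous_comp _ _ _ (fun p : 'rV[R]_q.+2 * R * 'rV[R]_q.+1 => p.1.1) pt); last exact: cpt.
      by apply: (@continuous_comp _ _ _ fst fst); exact: cvg_fst.
    apply: smooth_cont; apply: smooth_add; first exact: smooth_id.
    under eq_fun do rewrite -scaleN1r.
    by apply: scale_smooth; apply: em_smooth; apply: pm_smooth; exact: smooth_id.
  exact: (cvgD c3 (cvgZ c2 c1)).
have ep0 : ep p0 = em n x0 by rewrite /ep /exitpt /= mul0r scale0r addr0.
have iem : inb (rr h Phi w) (em n x0) by apply/(inb_em _ wn).
have n1 : \forall p \near p0, inb (rr h Phi w) (ep p) /\ ~ Wplus Phi u (param (cc h Phi w) (ep p)).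
  apply: (near_cont (P := fun z => inb (rr h Phi w) z /\ ~ Wplus Phi u (param (cc h Phi w) z)) cep); rewrite ep0.
  apply: near_and; first exact: inb_near.
  have cp : {for em n x0, continuous (param (cc h Phi w))} by apply: param_continuous; exact/(hc_img hw).
  by apply: (near_cont (P := fun z => ~ Wplus Phi u z) cp); rewrite -(phi_small gf wn hw ix0).
have n2 : \forall y \near x1, gd h Phi w q.+1 T1 (ph h Phi v y).
  exact: (near_ph hMS (P := gd h Phi w q.+1 T1) cv (near_gd hMS g1)).
have [e1 e10 He1] := near_ball n1; have [e2 e20 He2] := near_ball n2.
exists (Num.min e1 e2); first by rewrite lt_min e10.
move=> y s x [_ Wy]; rewrite !lt_min => /andP[y1 y2] /andP[s0 /andP[s1 s2]] /andP[x1' x2] E0.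
have b1 : ball p0 e1 (y, s, x).
  by rewrite /p0; split; [split|]; rewrite -ball_normE /= ?sub0r ?normrN ?gtr0_norm // distrC.
have [i1 i2] := He1 _ b1.
have b2 : ball x1 e2 y by rewrite -ball_normE /= distrC.
have gy := He2 _ b2.
have EF := exit_flow hMS cw s0 gy.1 E0 i1.
apply: i2; rewrite /ep /= -EF; exact: (Wplus_flow gf).
Qed.

(** A limit point of [N0] outside [N0] flows to some [w] whose index lies strictly between those of
    [u] and [v], hence is [q.+1]. The exit directions fill a compact sphere; near each of them there
    are either no points of [N] or only those of one arc [al i]. *)
Let end_cover (x1 : 'rV[R]_q.+2) : nsq x1 = 1 -> ~ N0 h Phi v u x1 ->
  exists2 U, nbhs x1 U & forall y, U y -> N y -> exists i s, 0 < s < d / 2 /\ al i s = y.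
Proof.
move=> nx1 nN; have x10 := nsq1_neq0 nx1.
have [nn|nn] := pselect (\forall y \near x1, ~ N0 h Phi v u y).
  by exists [set y | ~ N0 h Phi v u y] => // y ny [].
have cl : closure (Wplus Phi u) (ph h Phi v x1).
  move=> B nB; apply: contrapT => AB; apply: nn.
  apply: filterS (near_ph hMS (P := B) cv nB) => y By [_ Wy]; apply: AB; by exists (ph h Phi v y).
have [w cw0 Wx1] := ms_conv hMS cM (ph h Phi v x1).
have ciw : cip h w (morse_index h w) by [].
have wu : w <> u by move=> wE; apply: nN; split=> //; rewrite -wE.
have i1 := closure_index hMS cM ciw cu cl Wx1 wu.
have i2 := index_drop hMS cv ciw x10 Wx1.
have cw : cip h w q.+1 by split=> //; apply/eqP; rewrite eqn_leq i1 andbT -ltnS.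
have [r0 r1] := rhoP cw.
have [dl dl0 Hdl] : exists2 dl : R, 0 < dl & forall y (s : R) x, N y -> `|y - x1| < dl -> 0 < s < dl ->
    nsq x = rho w ^+ 2 -> st1 w x1 y = s *: x -> exists i, y = al i s.
  suff [dl dl0 Hdl] : exists2 dl : R, 0 < dl & forall y (s : R) x, N y -> `|y - x1| < dl -> 0 < s < dl ->
    [set x : 'rV[R]_q.+1 | nsq x = rho w ^+ 2] x -> nsq x = rho w ^+ 2 -> st1 w x1 y = s *: x -> exists i, y = al i s.
    by exists dl => // y s x Ny y1 s1 nx; exact: (Hdl y s x).
  apply: (@compact_ind _ _ (fun U => exists2 dl : R, 0 < dl & forall y (s : R) x, N y -> `|y - x1| < dl -> 0 < s < dl ->
    U x -> nsq x = rho w ^+ 2 -> st1 w x1 y = s *: x -> exists i, y = al i s)).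
  - exact: sphere_compact.
  - by exists 1.
  - move=> A B [e e0 He] [e' e'0 He']; exists (Num.min e e'); first by rewrite lt_min e0.
    move=> y s x Ny; rewrite !lt_min => /andP[y1 y2] /andP[s0 /andP[s1 s2]] [Ax|Bx].
      by apply: He => //; rewrite s0.
    by apply: He' => //; rewrite s0.
  - by move=> A B AB [e e0 He]; exists e => // y s x Ny y1 s1 /AB; exact: He.
  move=> x0 nx0.
  have nb (e : R) : 0 < e -> nbhs x0 [set x | `|x - x0| < e].
    by move=> e0; apply: filterS (nbhsx_ballx x0 e e0) => x; rewrite -ball_normE /= distrC.
  have [Wx0|nW] := pselect (Wplus Phi u (ph h Phi w x0)); last first.
    have [e e0 He] := exit_near cw Wx1 nx0 nW.
    exists [set x | `|x - x0| < e]; first exact: nb.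
    by exists e => // y s x [Ny _] y1 s1 x0e _ E0; case: (He y s x).
  have isE : is_end w x1 x0 by [].
  have [Le|nL] := pselect (Lend w x1 x0).
    have [i [iw ix iy]] := end_surj isE Le.
    exists [set x | `|x - x0| < d0 i]; first exact: nb.
    exists (d0 i) => // y s x [Ny _] y1 s1 x0e nx E0; exists i.
    by apply: (@al_cover i y s x); rewrite ?iw ?ix ?iy.
  have [e e0 He] := labE isE.
  exists [set x | `|x - x0| < e]; first exact: nb.
  exists e => // y s x [Ny ly] y1 s1 x0e nx E0; exfalso; apply: nL.
  by apply/(He y s x Ny y1 s1 x0e E0).
pose m := Num.min dl (d / 2); have m0 : 0 < m by rewrite lt_min dl0 divr_gt0.
have g1 := gTP hMS cw Wx1.
have st0 : st1 w x1 x1 = 0 by apply/(stab_eq0 gf (cip_le cw) (cip_hyp hMS cw) g1).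
have cr : {for x1, continuous (fun y => radius (rho w) (st1 w x1 y))}.
  apply: (@continuous_comp _ _ _ (st1 w x1) (radius (rho w))); last exact: radius_continuous.
  exact: (smooth_cont (st1_smooth cw Wx1)).
have n1 : \forall y \near x1, radius (rho w) (st1 w x1 y) < m.
  by apply: (cvgr_lt (radius (rho w) (st1 w x1 x1)) cr); rewrite st0 radius0.
have n2 := near_ph hMS (P := fun z => st h Phi w q.+1 (gT h Phi w q.+1 (ph h Phi v x1)) z = 0 <-> Wplus Phi w z) cv (st_near hMS cw g1).
exists [set y | [/\ radius (rho w) (st1 w x1 y) < m, st1 w x1 y = 0 <-> Wplus Phi w (ph h Phi v y) & `|y - x1| < dl]].
  have n3 : \forall y \near x1, `|y - x1| < dl.
    by apply: filterS (nbhsx_ballx x1 dl dl0) => y; rewrite -ball_normE /= distrC.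
  by apply: filterS3 n1 n2 n3 => y.
move=> y [y1 y2 y3] Ny; have s0 : st1 w x1 y != 0.
  by apply/eqP => /y2 Wy; apply: wu; case: Ny => -[_ Wy'] _; exact: (Wplus_unique Wy Wy').
set s := radius (rho w) (st1 w x1 y) in y1; have sp : 0 < s by exact: radius_gt0.
move: y1; rewrite lt_min => /andP[s1 s2].
have nsx : nsq (s^-1 *: st1 w x1 y) = rho w ^+ 2 by exact: radius_unit.
have sxE : st1 w x1 y = s *: (s^-1 *: st1 w x1 y) by exact: radiusK.
have [|i yE] := Hdl y s (s^-1 *: st1 w x1 y) Ny y3 _ nsx sxE; first by rewrite sp.
by exists i, s; rewrite sp.
Qed.

Let end_sign_neq0 i : end_sign i != 0.
Proof.
have hs : 0 < d0 i / 2 < d0 i by have := d0_gt0 i => H; apply/andP; split; lra.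
by have [_ _ _ _] := alP hs; apply: contraTneq => ->; rewrite mulr0 ltxx.
Qed.

Let local_cover (x : 'rV[R]_q.+2) : nsq x = 1 -> exists2 U, nbhs x U & exists (J : finType) (c : J -> R -> 'rV[R]_q.+2) (e : J -> R),
  (forall k, 0 < e k /\ garc N K (c k) (- e k) (e k)) /\
  forall y, U y -> N y -> (exists k s, - (e k / 2) < s < e k / 2 /\ c k s = y) \/
    (exists i s, 0 < s < d / 2 /\ al i s = y).
Proof.
move=> nx; have [Nx|nN] := pselect (N0 h Phi v u x); last first.
  have [U nU HU] := end_cover nx nN; exists U => //.
  by exists void, (@of_void _), (@of_void _); split=> [[]|y Uy Ny]; right; exact: HU.
have [lx|nl] := pselect (lab x); last first.
  exists [set y | N0 h Phi v u y -> (lab y <-> lab x)]; first exact: labP.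
  exists void, (@of_void _), (@of_void _); split=> [[]|y Uy [Ny ly]].
  by exfalso; apply: nl; apply/(Uy Ny).
have Nx' : N x by [].
have [c [e [e0 g c0]]] := local_garc NP Nx'.
have h0 : - e < 0 < e by rewrite oppr_lt0 e0.
have e20 : 0 < e / 2 by rewrite divr_gt0.
exists [set y | N y -> exists u, [/\ - e < u < e, `|u - 0| < e / 2 & c u = y]].
  by rewrite -c0; exact: (garc_open g h0 e20).
exists unit, (fun=> c), (fun=> e); split=> // y Uy Ny; left; exists tt.
have [s [_ h2 h3]] := Uy Ny; exists s; split=> //.
by move: h2; rewrite subr0 ltr_norml.
Qed.

Let global_cover : exists (J : finType) (c : J -> R -> 'rV[R]_q.+2) (e : J -> R),
  (forall k, 0 < e k /\ garc N K (c k) (- e k) (e k)) /\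
  forall y, N y -> (exists k s, - (e k / 2) < s < e k / 2 /\ c k s = y) \/
    (exists i s, 0 < s < d / 2 /\ al i s = y).
Proof.
suff [J [c [e [H1 H2]]]] : exists (J : finType) (c : J -> R -> 'rV[R]_q.+2) (e : J -> R),
  (forall k, 0 < e k /\ garc N K (c k) (- e k) (e k)) /\
  forall y, [set y : 'rV[R]_q.+2 | nsq y = 1] y -> N y -> (exists k s, - (e k / 2) < s < e k / 2 /\ c k s = y) \/
    (exists i s, 0 < s < d / 2 /\ al i s = y).
  by exists J, c, e; split=> // y Ny; apply: H2 => //; case: Ny => -[].
apply: (@compact_ind _ _ (fun U => exists (J : finType) (c : J -> R -> 'rV[R]_q.+2) (e : J -> R),
  (forall k, 0 < e k /\ garc N K (c k) (- e k) (e k)) /\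
  forall y, U y -> N y -> (exists k s, - (e k / 2) < s < e k / 2 /\ c k s = y) \/
    (exists i s, 0 < s < d / 2 /\ al i s = y))).
- exact: sphere_compact.
- by exists void, (@of_void _), (@of_void _); split=> [[]|y []].
- move=> A B [J [c [e [H1 H2]]]] [J' [c' [e' [H1' H2']]]].
  exists (J + J')%type, (fun z => match z with inl k => c k | inr k => c' k end),
    (fun z => match z with inl k => e k | inr k => e' k end); split=> [[k|k] //|y [Ay|By] Ny].
    by have [[k H]|H] := H2 y Ay Ny; [left; exists (inl k)|right].
  by have [[k H]|H] := H2' y By Ny; [left; exists (inr k)|right].
- by move=> A B AB [J [c [e [H1 H2]]]]; exists J, c, e; split=> // y /AB; exact: H2.
exact: local_cover.
Qed.

Hypothesis alN : forall i (s : R), 0 < s < d -> [/\ lab (al i s), `|al i s - ex i| < d0 i,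
  `|Xc i s - ey i| < d0 i & {for al i s, continuous (st1 (ew i) (ex i))}].
Hypothesis al_disj : forall i j, i <> j -> forall s t : R, 0 < s < d -> 0 < t < d -> al i s <> al j t.

Let end_garc i : (0 < end_sign i -> garc N K (al i) 0 d) /\
  (end_sign i < 0 -> garc N K (fun t => al i (- t)) (- d) 0).
Proof.
have [[cw _ _] _] := endP i; have [r0 _] := rhoP cw.
have sub s : 0 < s < d -> 0 < s < d0 i by move=> /andP[-> /lt_le_trans ->].
have H1 (s : R) : 0 < s < d -> [/\ N (al i s), smooth_at (al i) s, st1 (ew i) (ex i) (al i s) = s *: Xc i s,
    nsq (Xc i s) = rho (ew i) ^+ 2 & 0 < mdet (al i s) ('D_1 (al i) s) (K (al i s)) * end_sign i].
  move=> hs; have [a1 a2 a3 a4 a5] := alP (sub _ hs); split=> //; split=> //.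
  by have [] := alN i hs.
have H2 (s : R) : 0 < s < d -> [/\ `|al i s - ex i| < d0 i, `|Xc i s - ey i| < d0 i &
    {for al i s, continuous (st1 (ew i) (ex i))}].
  by move=> hs; have [a1 a2 a3 a4] := alN i hs; split.
have H3 y (s : R) x : N y -> `|y - ex i| < d0 i -> 0 < s < d0 i ->
  nsq x = rho (ew i) ^+ 2 -> `|x - ey i| < d0 i -> st1 (ew i) (ex i) y = s *: x -> y = al i s.
  by move=> [Ny _]; exact: al_cover.
by split=> sg0; [exact: (garc_pos_end r0 (dd0 i) H1 H2 H3)|exact: (garc_neg_end r0 (dd0 i) H1 H2 H3)].
Qed.

(** The finitely many arcs around points of [N] together with the ends form a system [arcs]. By the
    choice of parametrization, left ends are the broken orbits of positive sign and right ends those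
    of negative sign. *)
Lemma glue_ends_aux : #|[pred i | 0 < end_sign i]| = #|[pred i | end_sign i < 0]|.
Proof.
have half1 : ~ (- d = - (d / 2)) by have dp := dpos; lra.
have half2 : ~ (d / 2 = d) by have dp := dpos; lra.
have [J [c [e [H1 H2]]]] := global_cover.
pose p i := 0 < end_sign i.
have pN i : ~~ p i -> end_sign i < 0 by rewrite /p -leNgt le_eqVlt (negbTE (end_sign_neq0 i)).
pose C (z : E + J) : R -> 'rV[R]_q.+2 := match z with inl i => if p i then al i else fun t => al i (- t) | inr k => c k end.
pose A (z : E + J) : R := match z with inl i => if p i then 0 else - d | inr k => - e k end.
(* Cores have half the length, except at a missing end, where core and arc have the same bound; this
   equality is what marks an end. *)
pose LO (z : E + J) : R := match z with inl i => if p i then 0 else - (d / 2) | inr k => - (e k / 2) end.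
pose HI (z : E + J) : R := match z with inl i => if p i then d / 2 else 0 | inr k => e k / 2 end.
pose B (z : E + J) : R := match z with inl i => if p i then d else 0 | inr k => e k end.
have G z : garc N K (C z) (A z) (B z).
  case: z => [i|k] /=; last by case: (H1 k).
  by case: ifPn => [|/pN] si; [exact: (end_garc i).1|exact: (end_garc i).2].
(* The limit [ex i] of the arc flows to [ew i] and not to [u], so it is not in [N], and a short
   initial piece of the arc stays away from a neighbourhood of [y]. *)
have sep i y : N y -> exists2 r : R, 0 < r & \forall z \near y, forall t, 0 < t < r -> al i t <> z.
  move=> Ny; have [[cw [_ Wx] _] _] := endP i.
  have xy : al i 0 <> y.
    rewrite (al0 i).2 => xE; case: Ny => -[_ Wy] _; move: Wx; rewrite xE => /(Wplus_unique Wy) uE.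
    by move: cw.2 cu.2; rewrite -uE => -> /eqP; rewrite -[X in _ == X]addn0 -addn1 eqn_add2l.
  pose r := `|al i 0 - y| / 2; have r0 : 0 < r by rewrite divr_gt0 // normr_gt0 subr_eq0; exact/eqP.
  have [e1 e10 He1] := near_ball (near_cont (smooth_cont (al0 i).1) (nbhsx_ballx (al i 0) r r0)).
  exists e1 => //; apply: filterS (nbhsx_ballx y r r0) => z; rewrite -ball_normE /= => zy t /andP[t0 te] E0.
  have := He1 t; rewrite -!ball_normE /= sub0r normrN gtr0_norm // E0 => /(_ te) h1.
  have : `|al i 0 - y| < r + r.
    apply: le_lt_trans (ltrD h1 zy); rewrite [`|y - z|]distrC.
    by apply: le_trans (ler_normD _ _); rewrite addrA subrK.
  by rewrite /r; set x := `|_|; lra.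
have arcsP : arcs N C A LO HI B.
  have dp := dpos.
  have JL i : A (inl i) = LO (inl i) -> p i by rewrite /A /LO; case: ifP => // _ /half1.
  have JR i : HI (inl i) = B (inl i) -> ~~ p i by rewrite /HI /B; case: ifP => // _ /half2.
  have J1 k : ~ (A (inr k) = LO (inr k)) by have [e0 _] := H1 k; rewrite /A /LO; lra.
  have J2 k : ~ (HI (inr k) = B (inr k)) by have [e0 _] := H1 k; rewrite /HI /B; lra.
  split.
  - move=> [i|k] /=; first by case: ifP => _; split; [|split| |split]; lra.
    by have [e0 _] := H1 k; split; [|split]; lra.
  - by move=> z; exact: (garc_in (G z)).
  - by move=> z; exact: (garc_inj (G z)).
  - by move=> z t ht; exact: (smooth_cont (garc_smooth (G z) ht)).
  - by move=> z; exact: (garc_open (G z)).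
  - by move=> z z' t t'; exact: (garc_orient NP (G z) (G z')).
  - move=> y Ny; have [[k [s [hs sE]]]|[i [s [hs sE]]]] := H2 y Ny; first by exists (inr k), s.
    exists (inl i); rewrite /C /LO /HI; case: ifP => _; first by exists s.
    by exists (- s); rewrite opprK; split=> //; case/andP: hs => ? ?; apply/andP; split; lra.
  - move=> [i|k] y /=; last by have [e0 _] := H1 k; lra.
    case: ifPn => pi_; last by lra.
    move=> _ Ny; have [r r0 Hr] := sep i y Ny; exists r => //.
    by apply: filterS Hr => z Hz t; rewrite add0r; exact: Hz.
  - move=> [i|k] y /=; last by have [e0 _] := H1 k; lra.
    case: ifPn => pi_; first by lra.
    move=> _ Ny; have [r r0 Hr] := sep i y Ny; exists r => //.
    apply: filterS Hr => z Hz t /andP[? ?]; apply: Hz; apply/andP; split; lra.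
  - move=> [i|k] z t w; last by move=> /(J1 k).
    case: z => [j|k']; last by move=> _ /(J1 k').
    move=> /JL pi_ /JL pj; rewrite /A /B /C pi_ pj => ht hw E0.
    by have [->//|ij] := pselect (i = j); exfalso; exact: (al_disj ij ht hw E0).
  - move=> [i|k] z t w; last by move=> /(J2 k).
    case: z => [j|k']; last by move=> _ /(J2 k').
    move=> /JR pi_ /JR pj; rewrite /A /B /C (negbTE pi_) (negbTE pj) => ht hw E0.
    have [->//|ij] := pselect (i = j); exfalso.
    have flip (x : R) : - d < x < 0 -> 0 < - x < d by move=> /andP[x1 x2]; rewrite oppr_gt0 x2 ltrNl.
    exact: (al_disj ij (flip _ ht) (flip _ hw) E0).
  - by move=> [i|k] []; [move=> /JL pi_ /JR; rewrite pi_|move=> /J1].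
have := arcs_ends (@norm_hausdorff _ _) arcsP.
have dp := dpos.
rewrite (@card_inl _ _ p) => [|i|k] /=; last 2 first.
- by case: ifP => _; [rewrite eqxx|apply/eqP; lra].
- by have [e0 _] := H1 k; apply/eqP; lra.
rewrite (@card_inl _ _ (fun i => end_sign i < 0)) => [->//|i|k] /=.
- case: ifPn => [pi_|/pN ->]; last by rewrite eqxx.
  have -> : (end_sign i < 0) = false by apply/negbTE; rewrite -leNgt ltW.
  by apply/eqP; exact: half2.
by have [e0 _] := H1 k; apply/eqP; lra.
Qed.
End Cover.

Theorem glue_ends : #|[pred i | 0 < end_sign i]| = #|[pred i | end_sign i < 0]|.
Proof.
have [d d_gt0 Hd] := uniform.
by apply: (glue_ends_aux d_gt0) => [i|i s|i j]; have [h1 [h2 h3]] := Hd i; [exact: h1|exact: h2|exact: h3].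
Qed.
End Gluing.

(** * An orbit that passes near a critical point *)

Section Passage.
Variables (R : realType) (n : nat) (M : manifold R n) (h : M -> R) (Phi : R -> M -> M).
Hypothesis gf : gflow h Phi.
Variables (v : M) (s : pred 'I_n) (c : chart R n M) (r : R).
Hypothesis hc : hypchart h Phi v s c r.

(* An orbit which leaves the chart passes through a level so low that it cannot come back to a
   point with small expanding part. *)
Lemma passage p t : box s r p -> sqn s p < r ^+ 2 / 4 -> 0 <= t ->
  dom c (Phi t (param c p)) -> sqn s (c (Phi t (param c p))) <= r ^+ 2 / 4 ->
  c (Phi t (param c p)) = linflow s t p.
Proof.
move=> bp ap t0 dt at_; have [b1 b2] := bp; have rho0 := r2_gt0 hc.
set a := sqn s p in b1 ap *; set b := sqn _ p in b2; set rho := r ^+ 2 / 2 in b1 b2 rho0.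
have r4 : r ^+ 2 / 4 = rho / 2 by rewrite /rho; field.
rewrite r4 in ap at_.
have ib := box_inb bp; have b0 : 0 <= b by exact: sqn_ge0.
have fin : inb r (linflow s t p) -> c (Phi t (param c p)) = linflow s t p.
  by move=> it; rewrite (hc_flow hc) // (inb_K hc).
have := sqn_ge0 s p; rewrite -/a le_eqVlt => /predU1P[a0|a0].
  by apply: fin; apply: inb_stable => //; rewrite -/a -a0.
(* The time at which the squared expanding part reaches [rho = r^2 / 2]. The level is then below
   [h v - rho / 4], while a point of the chart whose squared expanding part is at most [rho / 2] has
   level at least [h v - rho / 4]; so the time [t] cannot be later. *)
pose t1 := ln (rho / a) / 2.
have et : expR t1 ^+ 2 = rho / a.
  by rewrite -expRM_natl /t1 mulrC divfK ?pnatr_eq0 // lnK // posrE divr_gt0.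
have eN : expR (- t1) ^+ 2 = a / rho by rewrite expRN exprVn et invf_div.
have e1 : sqn s (linflow s t1 p) = rho by rewrite sqn_linflow et -/a divfK // gt_eqF.
have e2 : sqn (predC s) (linflow s t1 p) < rho / 2.
  rewrite sqn_linflowC eN -/b mulrAC ltr_pdivrMr //; nra.
have r2 : r ^+ 2 = rho * 2 by rewrite /rho; field.
have i1 : inb r (linflow s t1 p) by rewrite /inb (sqn_split s) e1 r2; lra.
have [tt|tt] := leP t t1.
  apply: fin; rewrite /inb (sqn_split s) r2 sqn_linflow sqn_linflowC -/a -/b.
  have h1 : expR t ^+ 2 * a <= rho.
    rewrite -(divfK (_ : a != 0) rho) ?gt_eqF // -et ler_pM2r // ler_pXn2r ?nnegrE ?expR_ge0 //.
    by rewrite ler_expR.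
  have h2 : expR (- t) ^+ 2 * b <= b.
    by rewrite ler_piMl // exprn_ile1 ?expR_ge0 // expR_le1 oppr_le0.
  lra.
have h1 := gf_h_mono gf (param c p) (ltW tt).
have h2 : h (Phi t1 (param c p)) < h v - rho / 4 by rewrite (hc_flow hc) // (hc_h hc) // e1; lra.
have ip1 := dom_inb hc dt.
have h3 := hc_h hc ip1; rewrite coordK // in h3.
have h4 := sqn_ge0 (predC s) (c (Phi t (param c p))).
have : h v - rho / 4 <= h (Phi t (param c p)) by rewrite h3; lra.
by move=> h5; have := le_lt_trans (le_trans h5 h1) h2; rewrite ltxx.
Qed.
End Passage.

Lemma smooth_deriveD (R : realType) (V W : normedModType R) (f g : V -> W) p u :
  smooth_at f p -> smooth_at g p -> 'D_u (fun y => f y + g y) p = 'D_u f p + 'D_u g p.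
Proof.
move=> sf sg; apply: (@deriveD); apply: diff_derivable; exact: smooth_diff.
Qed.

(** * Orientations of unstable manifolds *)

Section Orientation.
Variables (R : realType) (n : nat) (M : manifold R n).

Lemma is_orientation_cast r r' (E : r = r') (W : set M) (o : M -> 'M[R]_(r', n) -> bool) :
  is_orientation W o -> is_orientation W (fun x (B : 'M[R]_(r, n)) => o x (castmx (E, erefl n) B)).
Proof. by case: _ / E o. Qed.

Lemma jac_near_eq d (f g : 'rV[R]_d -> M) p : (\forall q \near p, g q = f q) -> smooth_into f p ->
  jac g p = jac f p.
Proof.
move=> gE [_ sf]; rewrite /jac (nbhs_singleton gE).
have dg : differentiable (chart_at (f p) \o f) p by exact: smooth_diff.
have n1 : \forall q \near p, (chart_at (f p) \o f) q = (chart_at (f p) \o g) q.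
  by apply: filterS gE => q /= ->.
exact: (esym (near_eq_jac n1 dg)).
Qed.

Lemma jac_comp_into d m (z : 'rV[R]_m -> 'rV[R]_d) (f : 'rV[R]_d -> M) p :
  smooth_at z p -> smooth_into f (z p) -> jac (f \o z) p = 'J z p *m jac f (z p).
Proof.
move=> sz [_ sf]; rewrite /jac.
exact: (jac_comp (smooth_diff sz) (smooth_diff sf)).
Qed.

Lemma tangent_jac d (W : set M) (f : 'rV[R]_d -> M) p i : smooth_into f p ->
  (\forall q \near p, W (f q)) -> tangent W (f p) (row i (jac f p)).
Proof.
move=> sf nW; pose c (t : R) : 'rV[R]_d := p + t *: delta_mx 0 i.
have sc t : smooth_at c t.
  apply: smooth_add; first exact: smooth_cst.
  by apply: smooth_scale; [exact: findim_rV|exact: smooth_id|exact: smooth_cst].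
have c0 : c 0 = p by rewrite /c scale0r addr0.
have D0 : 'D_1 c 0 = delta_mx 0 i.
  apply: etrans (smooth_deriveD _ _ _) _; first exact: smooth_cst.
    by apply: smooth_scale; [exact: findim_rV|exact: smooth_id|exact: smooth_cst].
  rewrite derive_cst add0r (@derive_scale _ _ id (cst (delta_mx 0 i))); [|exact: smooth_id|exact: smooth_cst].
  by rewrite derive_id derive_cst scaler0 addr0 scale1r.
exists (f \o c); split; first by rewrite /= c0.
- by apply: smooth_into_comp; [exact: findim_rV|exact: sc|rewrite c0].
- have cc := smooth_cont (sc 0); apply: (near_cont (P := fun q => W (f q)) cc).
  by rewrite c0.
have sf' : smooth_at (chart_at (f p) \o f) (c 0) by rewrite c0; case: sf.
have E := derive_curve (sc 0) sf'; rewrite D0 c0 -rowE in E.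
by rewrite /velocity derive1E /= c0; exact: E.
Qed.

Lemma orient_jac d (W : set M) (o : M -> 'M[R]_(d, n) -> bool) (f : 'rV[R]_d -> M)
    (z : 'rV[R]_d -> 'rV[R]_d) (g : 'rV[R]_d -> M) p :
  is_orientation W o -> smooth_into f (z p) -> (\forall q \near z p, W (f q)) ->
  row_free (jac f (z p)) -> smooth_at z p -> 'J z p \in unitmx ->
  (\forall q \near p, g q = f (z q)) ->
  o (g p) (jac g p) = o (f (z p)) (jac f (z p)) (+) (\det ('J z p) < 0).
Proof.
move=> [H _] sf nW fr sz uz gE; have gp : g p = f (z p) := nbhs_singleton gE.
have -> : jac g p = 'J z p *m jac f (z p).
  have E := jac_comp_into sz sf; rewrite -E; exact: (jac_near_eq gE (smooth_into_comp (findim_rV R d) sz sf)).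
rewrite gp; apply: H => //; first exact: (nbhs_singleton nW).
by move=> i; exact: tangent_jac.
Qed.
End Orientation.

Section UnstableOrientation.
Variables (R : realType) (n : nat) (M : manifold R n).
Variables (h : M -> R) (X : vector_field M) (Phi : R -> M -> M).
Hypothesis hMS : morse_smale h X Phi.
Let gf := ms_gflow hMS.
Variables (v : M) (m : nat).
Hypothesis cv : cip h v m.
Let hv := cip_hyp hMS cv.
Let mn := cip_le cv.

Lemma ph_smooth (x : 'rV[R]_m) : smooth_into (ph h Phi v (m := m)) x.
Proof. exact: (smooth_phi gf mn hv). Qed.

Lemma ph_Wminus (x : 'rV[R]_m) : Wminus Phi v (ph h Phi v x).
Proof. exact: (Wminus_phi gf mn hv). Qed.

Lemma jac_ph_free (x : 'rV[R]_m) : row_free (jac (ph h Phi v (m := m)) x).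
Proof.
have [T [sL linv _]] := phi_linvP gf mn hv x.
have E := jac_sfun_comp (ph_smooth x) sL.
apply/row_freeP; exists (jacf (phi_linv Phi m (cc h Phi v) T) (ph h Phi v x)); rewrite -E -(jac_id x).
apply: esym; apply: near_eq_jac; first by apply: filterS linv => y Hy; rewrite /= /ph Hy.
by apply: smooth_diff; exact: smooth_id.
Qed.

Variable o : M -> 'M[R]_(m, n) -> bool.
Hypothesis oP : is_orientation (Wminus Phi v) o.

Definition osign : bool := o (ph h Phi v (0 : 'rV[R]_m)) (jac (ph h Phi v (m := m)) 0).

(** The sign is locally constant along the segment from 0 to [x], by the continuity clause of
    [is_orientation]. One boolean thus describes the whole orientation. *)
Lemma osignE (x : 'rV[R]_m) : o (ph h Phi v x) (jac (ph h Phi v (m := m)) x) = osign.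
Proof.
pose g (t : R) := o (ph h Phi v (t *: x)) (jac (ph h Phi v (m := m)) (t *: x)).
have gn t : \forall u \near t, g u = g t.
  have ct : {for t, continuous (fun t : R => t *: x)}.
    apply: smooth_cont.
    by apply: smooth_scale; [exact: findim_rV|exact: smooth_id|exact: smooth_cst].
  apply: (near_cont (P := fun y => o (ph h Phi v y) (jac (ph h Phi v (m := m)) y) = g t) ct).
  apply: oP.2; [exact: ph_smooth|by apply: filterE => y; exact: ph_Wminus|exact: jac_ph_free].
have op (b : bool) : open [set t | g t = b].
  by rewrite openE => t /= tb; apply: filterS (gn t) => u uE /=; rewrite uE.
have : g 1 = osign.
  apply: (@real_clopen R [set t | g t = osign] 0); [by rewrite /= /g scale0r|exact: op|].
  have -> : [set t | g t = osign] = ~` [set t | g t = ~~ osign].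
    by apply/seteqP; split=> t /=; case: (g t); case: osign.
  by apply: open_closedC; exact: op.
by rewrite /g scale1r.
Qed.

Lemma orient_ph (z : 'rV[R]_m -> 'rV[R]_m) (g : 'rV[R]_m -> M) p :
  smooth_at z p -> 'J z p \in unitmx -> (\forall q \near p, g q = ph h Phi v (z q)) ->
  o (g p) (jac g p) = osign (+) (\det ('J z p) < 0).
Proof.
move=> sz uz gE; rewrite -(osignE (z p)).
by apply: (orient_jac oP) => //; [exact: ph_smooth|apply: filterE => y; exact: ph_Wminus|exact: jac_ph_free].
Qed.
End UnstableOrientation.

Section BlockHelpers.
Variable R : realType.

Lemma mul_rsubmx a b (z : 'rV[R]_(a + b)) : z *m (col_mx 0 1%:M : 'M[R]_(a + b, b)) = rsubmx z.
Proof. by rewrite -{1}(hsubmxK z) mul_row_col mulmx0 mulmx1 add0r. Qed.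

Lemma mul_lsubmx a b (z : 'rV[R]_(a + b)) : z *m (col_mx 1%:M 0 : 'M[R]_(a + b, a)) = lsubmx z.
Proof. by rewrite -{1}(hsubmxK z) mul_row_col mulmx0 mulmx1 addr0. Qed.

Lemma det_row_col n (A : 'M[R]_(1 + n, 1)) :
  \det (row_mx A (col_mx 0 1%:M : 'M[R]_(1 + n, n)) : 'M[R]_(1 + n)) = ((row_mx 1%:M 0 : 'rV[R]_(1 + n)) *m A) 0 0.
Proof.
rewrite -[A](vsubmxK) -block_mxEh det_lblock det1 mulr1 mul_row_col mul1mx mul0mx addr0.
by rewrite [X in \det X]mx11_scalar det_scalar1.
Qed.
End BlockHelpers.

(** * Level maps, half spaces and standard coordinates near the boundary *)

Section LevelMaps.
Variables (R : realType) (n : nat) (M : manifold R n).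
Variables (h : M -> R) (X : vector_field M) (Phi : R -> M -> M).
Hypothesis hMS : morse_smale h X Phi.
Let gf := ms_gflow hMS.
Let fl := ms_flow hMS.
Let sX := ms_smooth hMS.

(** Implicit function theorem: the derivative of [h] along the orbit is negative at a noncritical
    point, so the time of arrival at the level is a smooth function of the starting point. *)
Lemma level_time z0 t0 : ~ crit h (Phi t0 z0) -> exists tau : 'rV[R]_n -> R,
  [/\ smooth_at tau (chart_at z0 z0), tau (chart_at z0 z0) = t0 &
    \forall x \near chart_at z0 z0, h (Phi (tau x) (param (chart_at z0) x)) = h (Phi t0 z0)].
Proof.
move=> nc; set c := chart_at z0; have cz := chart_at_dom z0.
pose pt : 'rV[R]_(1 + n) := row_mx t0%:M (c z0).
pose a (z : 'rV[R]_n.+1) := h (Phi (lsubmx (z : 'rV[R]_(1 + n)) 0 0) (param c (rsubmx (z : 'rV[R]_(1 + n))))).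
pose f (z : 'rV[R]_n.+1) : 'rV[R]_n := rsubmx (z : 'rV[R]_(1 + n)) - c z0.
have l0 : lsubmx pt 0 0 = t0 by rewrite row_mxKl mxE eqxx mulr1n.
have r0 : rsubmx pt = c z0 by rewrite row_mxKr.
have sl : smooth_at (fun z : 'rV[R]_(1 + n) => lsubmx z 0 0) pt.
  by apply: smooth_coef; apply: smooth_lsubmx; exact: smooth_id.
have sr (z : 'rV[R]_(1 + n)) : smooth_at (fun z : 'rV[R]_(1 + n) => rsubmx z) z.
  by apply: smooth_rsubmx; exact: smooth_id.
have sp : smooth_into (fun z : 'rV[R]_(1 + n) => param c (rsubmx z)) pt.
  apply: (@smooth_into_comp _ _ _ _ _ (fun z : 'rV[R]_(1 + n) => rsubmx z) (param c)); first exact: findim_rV.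
    exact: sr.
  by rewrite r0; apply: smooth_into_param; [exact: smooth_chart_at|exists z0].
have sa : smooth_at a pt.
  apply: (@sfun_comp _ _ _ _ _ (fun z : 'rV[R]_(1 + n) => Phi (lsubmx z 0 0) (param c (rsubmx z))) h); first exact: findim_R.
    by apply: (smooth_into_flow fl) => //; exact: findim_rV.
  exact: (ms_morse hMS).1.
have sf : smooth_at f pt by apply: smooth_add; [exact: sr|exact: smooth_cst].
have f0 : f pt = 0 by rewrite /f r0 subrr.
pose e0 : 'rV[R]_(1 + n) := row_mx 1%:M 0.
pose g (t : R) : 'rV[R]_(1 + n) := t *: e0 + row_mx 0 (c z0).
have gE t : g t = row_mx t%:M (c z0).
  rewrite /g scale_row_mx scaler0 add_row_mx addr0 add0r; congr (row_mx _ _).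
  by rewrite scalemx1.
have sg : smooth_at g t0.
  apply: smooth_add; last exact: smooth_cst.
  by apply: smooth_scale; [exact: findim_rV|exact: smooth_id|exact: smooth_cst].
have Dg : 'D_1 g t0 = e0.
  apply: etrans (smooth_deriveD _ _ _) _; last first.
  - rewrite derive_cst addr0 (@derive_scale _ _ id (cst e0)); [|exact: smooth_id|exact: smooth_cst].
    by rewrite derive_id derive_cst scaler0 addr0 scale1r.
  - exact: smooth_cst.
  by apply: smooth_scale; [exact: findim_rV|exact: smooth_id|exact: smooth_cst].
set Ja := 'J (fun y : 'rV[R]_n.+1 => (a y)%:M : 'rV[R]_1) pt.
have ga : (e0 *m Ja) 0 0 < 0.
  have ss : smooth_at (fun y : 'rV[R]_n.+1 => (a y)%:M : 'rV[R]_1) (g t0).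
    by rewrite gE; exact: smooth_scalar.
  have E := derive_curve sg ss; rewrite Dg gE in E; rewrite -/pt -/Ja in E; rewrite -E.
  have saT : smooth_at (a \o g) t0.
    by apply: (@smooth_comp _ _ _ _ g a) => //; [exact: findim_rV|exact: findim_R|rewrite gE].
  have E2 := derive_rV (1 : R) 0 (smooth_scalar saT); rewrite E2.
  have -> : (fun y : R => ((a (g y))%:M : 'rV[R]_1) 0 0) = (fun t => h (Phi t z0)).
    apply/funext => t; rewrite mxE eqxx mulr1n /a gE row_mxKl row_mxKr mxE eqxx mulr1n coordK //.
  by rewrite (h_flow_derive hMS z0 t0).2; exact: (ms_gradient_like hMS).1.
have Jf : 'J f pt = (col_mx 0 1%:M : 'M[R]_(1 + n, n)).
  apply: mulmx_inj => u; have <- := deriveEjacobian u (smooth_diff sf).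
  apply: etrans (smooth_deriveD _ _ _) _; [exact: sr|exact: smooth_cst|].
  have uE : u *m (col_mx 0 1%:M : 'M[R]_(1 + n, n)) = rsubmx (u : 'rV[R]_(1 + n)).
    exact: (@mul_rsubmx R 1 n u).
  rewrite derive_cst addr0 uE.
  apply/rowP => j; rewrite (derive_rV _ _ (sr pt)) mxE.
  have -> : (fun y : 'rV[R]_(1 + n) => rsubmx y 0 j) = (fun y => y 0 (rshift 1 j)) by apply/funext => y; rewrite mxE.
  by rewrite -(@derive_rV _ _ _ id) ?derive_id //; exact: smooth_id.
have d0 : \det (row_mx Ja ('J f pt) : 'M[R]_(1 + n)) != 0.
  rewrite Jf; have -> : \det (row_mx Ja (col_mx 0 1%:M : 'M[R]_(1 + n, n)) : 'M[R]_(1 + n)) = (e0 *m Ja) 0 0.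
    exact: (@det_row_col R n Ja).
  by rewrite lt_eqF.
have [sg1 [s0 s1 s2]] := level_section sa sf f0 d0.
pose tau (x : 'rV[R]_n) := lsubmx (sg1 (x - c z0) : 'rV[R]_(1 + n)) 0 0.
have sx : smooth_at (fun x : 'rV[R]_n => x - c z0) (c z0).
  by apply: smooth_add; [exact: smooth_id|exact: smooth_cst].
exists tau; split.
- apply: smooth_coef; apply: smooth_lsubmx.
  apply: (@smooth_comp _ _ _ _ (fun x : 'rV[R]_n => x - c z0) sg1); try exact: findim_rV; first exact: sx.
  by rewrite subrr; case: (nbhs_singleton s1).
- by rewrite /tau subrr s0.
have cx := smooth_cont sx.
have n1 := near_cont (P := fun xi => [/\ smooth_at sg1 xi, a (sg1 xi) = a pt & f (sg1 xi) = xi]) cx.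
rewrite subrr in n1; apply: filterS (n1 s1) => x [_ h1 h2].
have h3 : rsubmx (sg1 (x - c z0) : 'rV[R]_(1 + n)) = x by apply: (addIr (- c z0)); exact: h2.
by move: h1; rewrite /a h3 l0 r0 coordK.
Qed.

(** The last clause holds because [f] is obtained from [g] by a smooth map. It will show that a
    direction not seen by [g] is not seen by the level map either. *)
Lemma level_map_ex d (g : 'rV[R]_d -> M) p0 t0 : smooth_into g p0 -> ~ crit h (Phi t0 (g p0)) ->
  exists (f : 'rV[R]_d -> M) (tau : 'rV[R]_d -> R), [/\ smooth_into f p0, {for p0, continuous tau} /\ tau p0 = t0,
    \forall p \near p0, f p = Phi (tau p) (g p) /\ h (f p) = h (Phi t0 (g p0)) &
    forall u : 'rV[R]_d, u *m jac g p0 = 0 -> u *m jac f p0 = 0].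
Proof.
move=> sg nc; have [tau [st t_0 nt]] := level_time nc; set c := chart_at (g p0) in st t_0 nt.
have [cg sg'] := sg; have cz := chart_at_dom (g p0).
pose L x := Phi (tau x) (param c x).
have sL : smooth_into L (c (g p0)).
  apply: (smooth_into_flow fl) => //; first exact: findim_rV.
  by apply: smooth_into_param; [exact: smooth_chart_at|exists (g p0)].
have sf : smooth_into (L \o (c \o g)) p0 by apply: (smooth_into_comp (findim_rV R n) sg' sL).
exists (L \o (c \o g)), (tau \o (c \o g)); split.
- exact: sf.
- split; last exact: t_0.
  exact: (continuous_comp (smooth_cont sg') (smooth_cont st)).
- have n1 := near_cont (smooth_cont sg') nt.
  have n2 := near_cont cg (near_dom cz).
  by apply: filterS2 n1 n2 => p h1 h2; rewrite /L /= coordK // in h1 *.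
move=> u ug; have -> := jac_comp_into sg' sL; by rewrite mulmxA -/(jac g p0) ug mul0mx.
Qed.

Lemma same_level_orbit x t t' : ~ crit h x -> h (Phi t x) = h (Phi t' x) -> Phi t x = Phi t' x.
Proof.
move=> nc E; suff -> : t = t' by [].
have key (a b : R) : a < b -> h (Phi a x) = h (Phi b x) -> False.
  move=> ab E'; have := h_strict hMS (noncrit_flow hMS (t := a) nc) (_ : 0 < b - a).
  by rewrite subr_gt0 => /(_ ab); rewrite -(gfD gf) subrK E' ltxx.
by case: (ltgtP t t') => // tt; exfalso; [exact: (key t t')|exact: (key t' t)].
Qed.
End LevelMaps.

Section HalfSpace.
Variables (R : realType) (d : nat).

(** For a direction that points into the half space, the derivative is a one-sided limit and sees
    only common values; the opposite directions follow by linearity. This is needed because the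
    formulas for a corner chart hold only on the corner. *)
Lemma halfspace_derive k (g1 g2 : 'rV[R]_d.+1 -> 'rV[R]_k) : smooth_at g1 0 -> smooth_at g2 0 ->
  (\forall p \near (0 : 'rV[R]_d.+1), 0 <= (p : 'rV[R]_d.+1) 0 0 -> g1 p = g2 p) -> 'J g1 0 = 'J g2 0.
Proof.
move=> s1 s2 nE; apply: mulmx_inj => u.
have d1 := smooth_diff s1; have d2 := smooth_diff s2.
suff key (y : 'rV[R]_d.+1) : 0 <= y 0 0 -> y *m 'J g1 0 = y *m 'J g2 0.
  have [u0|/ltW u0] := leP 0 (u 0 0); first exact: key.
  have n0 : 0 <= (- u) 0 0 by rewrite mxE oppr_ge0.
  move: (key _ n0); move: ('J g1 0) ('J g2 0) => A B.
  by rewrite (mulNmx u A) (mulNmx u B) => /oppr_inj.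
move: y => {}u u0; have E1 := deriveEjacobian u d1; have E2 := deriveEjacobian u d2.
apply: (etrans (esym E1)); apply: (etrans _ E2); clear E1 E2.
pose c (t : R) := t *: u.
have sc : smooth_at c 0 by apply: smooth_scale; [exact: findim_rV|exact: smooth_id|exact: smooth_cst].
have c0 : c 0 = 0 by rewrite /c scale0r.
have nc := near_cont (P := fun p => 0 <= (p : 'rV[R]_d.+1) 0 0 -> g1 p = g2 p) (smooth_cont sc).
rewrite c0 in nc; have [e e0 He] := near_ball (nc nE).
apply/eqP; rewrite -subr_eq0; apply/eqP.
have D1 : derivable g1 0 u by exact: diff_derivable.
have D2 : derivable g2 0 u by exact: diff_derivable.
pose q t := t^-1 *: (g1 (t *: u) - g1 0) - t^-1 *: (g2 (t *: u) - g2 0).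
have cq : q @ (0 : R)^' --> 'D_u g1 0 - 'D_u g2 0.
  have h1 : (fun t : R => t^-1 *: (g1 (t *: u + 0) - g1 0)) @ (0 : R)^' --> 'D_u g1 0 by exact: D1.
  have h2 : (fun t : R => t^-1 *: (g2 (t *: u + 0) - g2 0)) @ (0 : R)^' --> 'D_u g2 0 by exact: D2.
  have -> : q = fun t => t^-1 *: (g1 (t *: u + 0) - g1 0) - t^-1 *: (g2 (t *: u + 0) - g2 0).
    by apply/funext => t; rewrite /q !addr0.
  exact: (cvgB h1 h2).
apply: contrapT => /eqP N0.
have n1 : \forall t \near (0 : R)^', q t != 0 by exact: (cvgr_neq0 _ cq N0).
rewrite near_withinE in n1; have [e' e'0 He'] := near_ball n1.
pose t := Num.min e e' / 2; have m0 : 0 < Num.min e e' by rewrite lt_min e0.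
have t0 : 0 < t by rewrite divr_gt0.
have tm : t < Num.min e e' by rewrite /t; lra.
have := tm; rewrite lt_min => /andP[te te'].
have := He' t; rewrite -ball_normE /= sub0r normrN gtr0_norm // gt_eqF // => /(_ te' isT) /eqP.
apply; rewrite /q; have -> : g1 (t *: u) = g2 (t *: u).
  apply: He; first by rewrite -ball_normE /= sub0r normrN gtr0_norm.
  by rewrite mxE mulr_ge0 // ltW.
have -> : g1 0 = g2 0 by apply: (nbhs_singleton nE); rewrite mxE.
exact: subrr.
Qed.

Lemma halfspace_jac n (M : manifold R n) (g1 g2 : 'rV[R]_d.+1 -> M) : smooth_into g1 0 -> smooth_into g2 0 ->
  (\forall p \near (0 : 'rV[R]_d.+1), 0 <= (p : 'rV[R]_d.+1) 0 0 -> g1 p = g2 p) -> jac g1 0 = jac g2 0.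
Proof.
move=> [_ s1] [_ s2] nE; have E0 : g1 0 = g2 0 by apply: (nbhs_singleton nE); rewrite mxE.
rewrite /jac; apply: halfspace_derive; [exact: s1|exact: s2|].
by apply: filterS nE => p Hp /Hp /= ->; rewrite E0.
Qed.
End HalfSpace.

Lemma avoid_finite (R : realType) (A : set R) (a b : R) : finite_set A -> a < b ->
  exists2 c, a < c < b & ~ A c.
Proof.
move=> /finite_seqP[s ->]; elim: s a b => [|x s IH] a b ab.
  by exists ((a + b) / 2) => //; rewrite !midf_lt.
have [/andP[ax xb]|xN] := boolP (a < x < b).
  have [c /andP[ac cx] cs] := IH a x ax; exists c; first by rewrite ac (lt_trans cx).
  by rewrite /= inE => /predU1P[E|/cs//]; move: cx; rewrite E ltxx.
have [c cab cs] := IH a b ab; exists c => //.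
by rewrite /= inE => /predU1P[E|/cs//]; move: xN; rewrite -E cab.
Qed.

Section StandardCoordinates.
Variable R : realType.

Lemma derive_scaleV (V : normedModType R) m (a : V -> R) (f : V -> 'rV[R]_m) p u : smooth_at a p -> smooth_at f p ->
  'D_u (fun y => a y *: f y) p = 'D_u a p *: f p + a p *: 'D_u f p.
Proof.
move=> sa sf; have saf : smooth_at (fun u => a u *: f u) p by apply: smooth_scale => //; exact: findim_rV.
apply/rowP => j; rewrite (derive_rV _ _ saf) [RHS]mxE [X in X + _]mxE [X in _ + X]mxE (derive_rV _ _ sf).
have -> : (fun y => (a y *: f y) 0 j) = a * (fun y => f y 0 j) by apply/funext => y; rewrite mxE.
have da : derivable a p u by apply: diff_derivable; exact: smooth_diff.
have df : derivable (fun y => f y 0 j) p u.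
  by apply: diff_derivable; apply: smooth_diff; exact: smooth_coef.
apply: etrans (deriveM da df) _; rewrite addrC; congr (_ + _); exact: mulrC.
Qed.

Lemma derive_lsub (a b : nat) (z u : 'rV[R]_(a + b)) : 'D_u (fun y : 'rV[R]_(a + b) => lsubmx y) z = lsubmx u.
Proof.
have sl : smooth_at (fun y : 'rV[R]_(a + b) => lsubmx y) z by apply: smooth_lsubmx; exact: smooth_id.
have -> : (fun y : 'rV[R]_(a + b) => lsubmx y) = (fun y => y *m (col_mx 1%:M 0 : 'M[R]_(a + b, a))).
  by apply/funext => y; rewrite mul_lsubmx.
rewrite -mul_lsubmx; have E := @derive_mulmxr R _ _ _ id (col_mx 1%:M 0 : 'M[R]_(a + b, a)) z u.
by apply: etrans (E _) _; [apply: smooth_diff; exact: smooth_id|rewrite derive_id].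
Qed.

Lemma derive_rsub (a b : nat) (z u : 'rV[R]_(a + b)) : 'D_u (fun y : 'rV[R]_(a + b) => rsubmx y) z = rsubmx u.
Proof.
have -> : (fun y : 'rV[R]_(a + b) => rsubmx y) = (fun y => y *m (col_mx 0 1%:M : 'M[R]_(a + b, b))).
  by apply/funext => y; rewrite mul_rsubmx.
rewrite -mul_rsubmx; have E := @derive_mulmxr R _ _ _ id (col_mx 0 1%:M : 'M[R]_(a + b, b)) z u.
by apply: etrans (E _) _; [apply: smooth_diff; exact: smooth_id|rewrite derive_id].
Qed.

Variables (q : nat) (x1 : 'rV[R]_q.+1) (F : 'rV[R]_q.+1 -> 'rV[R]_q).

(** Directions are normalized by the affine condition [y *m x1^T = 1]. It is reached by dividing by
    a scalar product, and it makes the frame of [sg] and its Jacobian exactly triangular in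
    [zeta_jac_det]. *)
Lemma hyper_section : nsq x1 = 1 -> smooth_at F x1 -> F x1 = 0 -> x1 *m 'J F x1 = 0 -> row_full ('J F x1) ->
  exists sg : 'rV[R]_q -> 'rV[R]_q.+1, [/\ sg 0 = x1,
    \forall xi \near (0 : 'rV[R]_q), [/\ smooth_at sg xi, sg xi *m x1^T = 1%:M & F (sg xi) = xi] &
    \forall y \near x1, y *m x1^T = 1%:M -> sg (F y) = y].
Proof.
move=> nx sF F0 xJ fJ; pose a (y : 'rV[R]_q.+1) := (y *m x1^T) 0 0.
have aM (y : 'rV[R]_q.+1) : (a y)%:M = y *m x1^T by rewrite [RHS]mx11_scalar.
have sm (y : 'rV[R]_q.+1) : smooth_at (fun y : 'rV[R]_q.+1 => y *m x1^T) y.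
  by apply: smooth_mulmxr; exact: smooth_id.
have sa : smooth_at a x1 by apply: smooth_coef; exact: sm.
have Ja : 'J (fun y : 'rV[R]_q.+1 => (a y)%:M : 'rV[R]_1) x1 = x1^T.
  have -> : (fun y : 'rV[R]_q.+1 => (a y)%:M : 'rV[R]_1) = (fun y => y *m x1^T) by apply/funext => y; exact: aM.
  by rewrite (@jac_mulmxr _ _ _ _ id) ?jac_id ?mul1mx.
have ax : a x1 = 1 by rewrite /a nsq_dot.
have [|sg [s0 s1 s2]] := level_section sa sF F0; first by rewrite Ja; apply: adet_neq0 => //; exact: nsq1_neq0.
have aE y : a y = a x1 <-> y *m x1^T = 1%:M.
  by rewrite -aM ax; split=> [->//|E]; have := congr1 (fun A : 'M[R]_1 => A 0 0) E; rewrite !mxE eqxx !mulr1n.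
exists sg; split=> //; first by apply: filterS s1 => xi [h1 /aE h2 h3].
by apply: filterS s2 => y Hy /aE.
Qed.

Variable sg : 'rV[R]_q -> 'rV[R]_q.+1.

(** The orbit in direction [sg (s *: x)] after the time [- ln s], since the flow acts on the
    parameter space by the exponential; this is the exit point in the parameters of the unstable
    manifold of [v]. *)
Definition zeta (z : 'rV[R]_(1 + q)) : 'rV[R]_q.+1 := (lsubmx z 0 0)^-1 *: sg (lsubmx z 0 0 *: rsubmx z).

Let sl (z : 'rV[R]_(1 + q)) : smooth_at (fun z : 'rV[R]_(1 + q) => lsubmx z 0 0) z.
Proof. by apply: smooth_coef; apply: smooth_lsubmx; exact: smooth_id. Qed.

Let sr (z : 'rV[R]_(1 + q)) : smooth_at (fun z : 'rV[R]_(1 + q) => rsubmx z) z.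
Proof. by apply: smooth_rsubmx; exact: smooth_id. Qed.

Let sxi (z : 'rV[R]_(1 + q)) : smooth_at (fun z : 'rV[R]_(1 + q) => lsubmx z 0 0 *: rsubmx z) z.
Proof. by apply: smooth_scale; [exact: findim_rV|exact: sl|exact: sr]. Qed.

Let ssg (z : 'rV[R]_(1 + q)) : smooth_at sg (lsubmx z 0 0 *: rsubmx z) ->
  smooth_at (fun z : 'rV[R]_(1 + q) => sg (lsubmx z 0 0 *: rsubmx z)) z.
Proof.
move=> s; apply: (@smooth_comp _ _ _ _ (fun z : 'rV[R]_(1 + q) => lsubmx z 0 0 *: rsubmx z) sg); try exact: findim_rV.
  exact: sxi.
exact: s.
Qed.

Lemma zeta_smooth (z : 'rV[R]_(1 + q)) : lsubmx z 0 0 != 0 -> smooth_at sg (lsubmx z 0 0 *: rsubmx z) -> smooth_at zeta z.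
Proof.
move=> s0 s; apply: smooth_scale; first exact: findim_rV.
  by apply: smooth_inv => //; exact: sl.
exact: ssg.
Qed.

(** The Jacobian factors as a triangular [L] times the frame [C] of [sg], and the determinant of [C]
    is inverse to the augmented one. The minus sign comes from the derivative of [s^-1]; it will
    cancel that of the outward normal. *)
Lemma zeta_jac_det (z : 'rV[R]_(1 + q)) : let s := lsubmx z 0 0 in let xi := s *: rsubmx z in
  s != 0 -> smooth_at F (sg xi) ->
  (\forall xi \near xi, [/\ smooth_at sg xi, sg xi *m x1^T = 1%:M & F (sg xi) = xi]) ->
  \det ('J zeta z) * \det (row_mx x1^T ('J F (sg xi)) : 'M[R]_(1 + q)) = - s ^- 2.
Proof.
move=> s xi s0 sF nx; have [ss s1 sF1] := nbhs_singleton nx; have sz := zeta_smooth s0 ss.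
set A := 'J sg xi; set x := rsubmx z.
have zE : s *: zeta z = sg xi by rewrite /zeta scalerA divff ?scale1r.
have Dz (u : 'rV[R]_(1 + q)) : u *m 'J zeta z = s^-1 *: ((lsubmx u 0 0 *: x + s *: rsubmx u) *m A - lsubmx u 0 0 *: zeta z).
  have E1 := deriveEjacobian u (smooth_diff sz); rewrite -E1.
  have D1 : 'D_u (fun y : 'rV[R]_(1 + q) => lsubmx y 0 0) z = lsubmx u 0 0.
    rewrite -(derive_lsub z u) (derive_rV _ _ (_ : smooth_at _ z)) //.
    by apply: smooth_lsubmx; exact: smooth_id.
  have E2 := derive_scaleV u (sl z) sz; rewrite D1 -/s in E2.
  have E3 : 'D_u (fun y => lsubmx y 0 0 *: zeta y) z = (lsubmx u 0 0 *: x + s *: rsubmx u) *m A.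
    transitivity ('D_u (fun y : 'rV[R]_(1 + q) => sg (lsubmx y 0 0 *: rsubmx y)) z).
      apply: near_eq_derive; have := near_neq0 (smooth_cont (sl z)) s0.
      by apply: filterS => y y0; rewrite /zeta scalerA divff ?scale1r.
    have E4 := deriveEjacobian u (smooth_diff (ssg ss)).
    have E5 := jac_comp (smooth_diff (sxi z)) (smooth_diff ss).
    apply: (etrans E4); apply: (etrans (congr1 (mulmx u) E5)); rewrite mulmxA; congr (_ *m _).
    have E6 := deriveEjacobian u (smooth_diff (sxi z)); apply: (etrans (esym E6)).
    by apply: (etrans (derive_scaleV u (sl z) (sr z))); rewrite D1 derive_rsub.
  have {E2}E2 := etrans (esym E3) E2.
  by rewrite E2 addrC addKr scalerA mulVf ?scale1r.
pose C : 'M[R]_(1 + q) := col_mx (sg xi) A.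
pose L : 'M[R]_(1 + q) := block_mx (- s ^- 2)%:M (s^-1 *: x) 0 1%:M.
have JE : 'J zeta z = L *m C.
  apply: mulmx_inj => u; rewrite Dz mulmxA; set c := lsubmx u 0 0.
  have uL : u *m L = row_mx (- s ^- 2 * c)%:M ((c * s^-1) *: x + rsubmx u).
    rewrite -[LHS](congr1 (fun y => y *m L) (hsubmxK u)) /L mul_row_block mulmx0 mulmx1 addr0.
    rewrite [lsubmx u]mx11_scalar -/c mul_mx_scalar mul_scalar_mx scalerA; congr (row_mx _ _).
    exact: scale_scalar_mx.
  rewrite uL /C (@mul_row_col _ 1 1 q) mul_scalar_mx -zE !mulmxDl -!scalemxAl.
  move: (x *m A) (rsubmx u *m A) (zeta z) => a b d.
  by apply/rowP => j; rewrite !mxE; field.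
have Ax : A *m x1^T = 0.
  have := jac_mulmxr x1^T (smooth_diff ss); rewrite -/A => <-.
  rewrite -(jac_cst (1%:M : 'rV[R]_1) xi); apply: esym; apply: near_eq_jac.
    by apply: filterS nx => y [_ -> _].
  by apply: smooth_diff; exact: smooth_cst.
have AJ : A *m 'J F (sg xi) = 1%:M.
  rewrite -(jac_comp (smooth_diff ss) (smooth_diff sF)) -(jac_id xi).
  apply: esym; apply: near_eq_jac; first by apply: filterS nx => y [_ _ /= ->].
  by apply: smooth_diff; exact: smooth_id.
rewrite JE -det_mulmx -mulmxA det_mulmx /C mul_col_row s1 Ax AJ [X in _ * X]det_ublock !det1 !mulr1.
by rewrite /L det_ublock det_scalar1 det1 mulr1.
Qed.
End StandardCoordinates.

Section SignHelpers.
Variable R : realType.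

Lemma sign_transfer (b1 b2 b3 b4 b5 : R) : 0 < b1 * b4 -> 0 < b3 * b5 -> b2 * b3 < 0 -> (0 < b1 * b2) = (b4 * b5 < 0).
Proof.
have same (x y z : R) : 0 < x * y -> (0 < x * z) = (0 < y * z).
  have [x0|x0|<-] := ltrgtP 0 x; last by rewrite mul0r ltxx.
    by rewrite pmulr_rgt0 // => y0; rewrite !pmulr_rgt0.
  by rewrite nmulr_rgt0 // => y0; rewrite !nmulr_rgt0.
move=> h1 h2 h3; have h4 : 0 < b2 * - b3 by rewrite mulrN oppr_gt0.
rewrite (same _ _ _ h1) mulrC (same _ _ _ h4) mulNr -mulrN (same _ _ _ h2) mulrN oppr_gt0 mulrC //.
Qed.

Lemma det_row_mx_kernel k (B : 'M[R]_(1 + k, 1)) (C : 'M[R]_(1 + k, k)) :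
  (row_mx 0 1%:M : 'M[R]_(k, 1 + k)) *m B = 0 ->
  \det (row_mx B C : 'M[R]_(1 + k)) = B 0 0 * \det ((row_mx 0 1%:M : 'M[R]_(k, 1 + k)) *m C).
Proof.
rewrite -[B]vsubmxK -[C]vsubmxK !mul_row_col !mul0mx !mul1mx !add0r => ->.
rewrite -block_mxEh det_ublock [usubmx B]mx11_scalar det_scalar1; congr (_ * _).
have <- : lshift k (0 : 'I_1) = 0 by exact/val_inj.
by rewrite [RHS]col_mxEu [RHS]mxE eqxx mulr1n.
Qed.

End SignHelpers.

(** * The sign read in an arbitrary boundary chart *)

Section CornerCharts.
Variables (R : realType) (n : nat) (M : manifold R n).
Variables (h : M -> R) (X : vector_field M) (Phi : R -> M -> M).
Hypothesis hMS : morse_smale h X Phi.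
Hypothesis cM : closed_manifold M.
Let gf := ms_gflow hMS.
Variables (v w : M) (q : nat).
Hypotheses (cv : cip h v q.+1) (cw : cip h w q).
Let hv := cip_hyp hMS cv.
Let hw := cip_hyp hMS cw.
Let mn := cip_le cv.
Let wn := cip_le cw.
Variable x1 : 'rV[R]_q.+1.
Hypotheses (nx1 : nsq x1 = 1) (Wx1 : Wplus Phi w (ph h Phi v x1)).
Let x10 : x1 != 0. Proof. exact: nsq1_neq0. Qed.
Let T1 := gT h Phi w q (ph h Phi v x1).
Let g1 : gd h Phi w q T1 (ph h Phi v x1) := gTP hMS cw Wx1.
Let F0 (y : 'rV[R]_q.+1) := st h Phi w q T1 (ph h Phi v y).
Let pt (y : 'rV[R]_q.+1) := cc h Phi w (Phi T1 (ph h Phi v y)).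
Let hwv : h w < h v := ph_Wplus_h hMS cv x10 Wx1.

Lemma pt_smooth : smooth_at pt x1.
Proof.
apply: (@sfun_comp _ _ _ _ _ (ph h Phi v (m := q.+1)) (cc h Phi w \o Phi T1)); first exact: findim_rV.
  exact: (ph_smooth hMS cv).
apply: (sfun_flow gf); first exact: findim_rV.
by apply: sfun_chart; [exact: hc_smooth hw|case: g1].
Qed.

Lemma F0_smooth : smooth_at F0 x1.
Proof. by apply: (st_ph_smooth hMS cv cw); case: g1. Qed.

Lemma F0_x1 : F0 x1 = 0.
Proof. by apply/(stab_eq0 gf wn hw g1). Qed.

Lemma F0_section : exists sg : 'rV[R]_q -> 'rV[R]_q.+1, [/\ sg 0 = x1,
    \forall xi \near (0 : 'rV[R]_q), [/\ smooth_at sg xi, sg xi *m x1^T = 1%:M & F0 (sg xi) = xi] &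
    \forall y \near x1, y *m x1^T = 1%:M -> sg (F0 y) = y].
Proof.
apply: hyper_section; [exact: nx1|exact: F0_smooth|exact: F0_x1|exact: (Jst_ray hMS cv cw g1 Wx1)|].
exact: (Jst_full hMS cv cw g1 Wx1).
Qed.

Lemma pt_x1 : sqn (idx_pred q) (pt x1) = 0 /\ box (idx_pred q) (rr h Phi w) (pt x1).
Proof.
split; last exact: g1.2.
by apply/(stable_boxP gf hw g1.2); rewrite coordK; [exact: (Wplus_flow gf)|exact: g1.1].
Qed.

Lemma pt_x1_neq0 : pt x1 != 0.
Proof.
apply/eqP => E; apply: (ph_noncrit hMS cv x10); rewrite -(gfK gf T1 (ph h Phi v x1)).
apply: contrapT => nc; apply: (noncrit_flow hMS (t := T1) (x := ph h Phi v x1)).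
  by move: nc; rewrite (gfK gf).
have -> : Phi T1 (ph h Phi v x1) = w.
  by rewrite -(coordK (c := cc h Phi w) g1.1) -/(pt x1) E (param0 hw).
by case: cw.
Qed.

Definition gam : set M := flow_orbit Phi (ph h Phi v x1).

Lemma gam_trajectory w' : trajectories Phi v w' gam -> w' = w.
Proof.
move=> [x' [_ Wx'] E]; have : gam (ph h Phi v x1) by exists 0 => //; rewrite (gf0 gf).
rewrite -E => -[t _ tE]; apply: (Wplus_unique (x := ph h Phi v x1)); last exact: Wx1.
by rewrite -tE; exact: (Wplus_flow gf).
Qed.

Lemma gam_h z : gam z -> h w < h z.
Proof.
move=> [t _ <-]; have Wt := Wplus_flow gf t Wx1.
have nc : ~ crit h (Phi t (ph h Phi v x1)) by apply: (noncrit_flow hMS); exact: (ph_noncrit hMS cv x10).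
apply: le_lt_trans (h_strict hMS nc ltr01); exact: (Wplus_h_ge gf).
Qed.

Lemma Wminus_h_le z t : Wminus Phi w z -> h (Phi t z) <= h w.
Proof.
move=> /WminusE Wz; have := Wplus_h_ge (gflow_rev gf) (- t) Wz; rewrite opprK lerN2; exact.
Qed.

Section OneChart.
Variables (a : R) (F : 'rV[R]_q.+1 -> seq (set M) * M) (e : 'rV[R]_q.+1 -> M).
Hypothesis CC : corner_chart h Phi v 1 a F e.
Hypothesis FB : forall p, corner 1 a p -> p 0 0 = 0 -> (F p).1 = [:: gam].

Lemma chart_bdry p : corner 1 a p -> p 0 0 = 0 -> Wminus Phi w (e p) /\ F p = ([:: gam], e p).
Proof.
case: CC => _ C2 _ C4 _ cp p0; have [[w' [cw' br Ww']] _] := C2 p cp; have [_ eE] := C4 p cp.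
rewrite (FB cp p0) in br; case: br => v1 [cv1 _ tr v1E].
have := gam_trajectory tr; rewrite v1E => wE; rewrite -wE eE; split=> //.
by rewrite -(FB cp p0); case: (F p).
Qed.

(** The number of full orbits in [F p] is that of the vanishing corner coordinates. The only corner
    coordinate is the first, which is positive here. *)
Lemma chart_int p : corner 1 a p -> 0 < p 0 0 -> Wminus Phi v (e p) /\ F p = ([::], e p).
Proof.
case: CC => _ C2 _ C4 _ cp p0; have [[w' [cw' br Ww']] sz] := C2 p cp; have [_ eE] := C4 p cp.
have s0 : (F p).1 = [::].
  apply: size0nil; rewrite sz; apply/eqP; rewrite cards_eq0; apply/eqP/setP => j; rewrite !inE.
  apply/negbTE; rewrite negb_and -leqNgt; have [j0|//] := posnP j.
  have -> : j = 0 by exact/val_inj.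
  by rewrite gt_eqF.
rewrite s0 in br; rewrite br eE; split=> //; by rewrite -s0; case: (F p).
Qed.

Lemma corner0 : corner 1 a (0 : 'rV[R]_q.+1).
Proof. by case: CC => -[_ a0] _ _ _ _; split=> j; rewrite mxE ?normr0. Qed.

Lemma e_smooth : smooth_into e 0.
Proof. by case: CC => _ _ _ C4 _; case: (C4 0 corner0). Qed.

Let e0W : Wminus Phi w (e 0).
Proof. by case: (chart_bdry corner0 (mxE _ _ _ _)). Qed.

Lemma regular_level_ex : exists c, [/\ regular_level h v (F 0) c, h w < c & c < h v].
Proof.
have fA : finite_set (h @` crit h) by apply: finite_image; exact: (crit_finite hMS cM).
have [c /andP[c1 c2] nc] := avoid_finite fA hwv; exists c; split=> //; split.
  rewrite c2 andbT; apply: le_lt_trans c1; have [_ ->] := chart_bdry corner0 (mxE _ _ _ _).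
  by have := Wminus_h_le 0 e0W; rewrite (gf0 gf).
by move=> x cx; apply/eqP => E; apply: nc; exists x.
Qed.

Section WithSection.
Variable sg : 'rV[R]_q -> 'rV[R]_q.+1.
Hypothesis sg0 : sg 0 = x1.
Hypothesis sgP : \forall xi \near (0 : 'rV[R]_q), [/\ smooth_at sg xi, sg xi *m x1^T = 1%:M & F0 (sg xi) = xi].
Hypothesis sgK : \forall y \near x1, y *m x1^T = 1%:M -> sg (F0 y) = y.

Definition nu (p : 'rV[R]_n) := p - em n (pm q p).

(* The level map at a regular level just above [w] gives the direction [y] of the trajectory in
   the unstable manifold of [v]. *)
Lemma direction : exists y : 'rV[R]_q.+1 -> 'rV[R]_q.+1, [/\ smooth_at y 0, y 0 = x1,
  \forall p \near (0 : 'rV[R]_q.+1), y p *m x1^T = 1%:M &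
  \forall p \near (0 : 'rV[R]_q.+1), corner 1 a p ->
    (p 0 0 = 0 -> y p = x1) /\ (0 < p 0 0 -> exists2 mu : R, 0 < mu & e p = ph h Phi v (mu *: y p))].
Proof.
have [c [rc c1 c2]] := regular_level_ex; case: CC => _ _ _ _ /(_ _ corner0)[/(_ c rc)[f [sf nf]] _].
have [tf0 hf0] := nbhs_singleton nf corner0.
have gorb z : gam z -> exists t, z = ph h Phi v (expR t *: x1).
  by move=> [t _ <-]; exists t; rewrite /ph (phi_flow gf mn hv).
(* The half orbit ending at [e p] lies at levels at most [h w], below [c]; so the point at level [c]
   of the broken trajectory is on [gam]. *)
have bdry p : corner 1 a p -> p 0 0 = 0 -> track Phi (F p) (f p) -> h (f p) = c -> gam (f p).
  move=> cp p0; have [We ->] := chart_bdry cp p0; rewrite /track /= => -[//|[t t0 <-]] hE.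
  by have := Wminus_h_le t We; rewrite hE leNgt c1.
have [t0 f0E] := gorb _ (bdry _ corner0 (mxE _ _ _ _) tf0 hf0).
have [T [sL linv rinv]] := phi_linvP gf mn hv (expR t0 *: x1).
rewrite -/(ph h Phi v _) -f0E in sL rinv; set L := phi_linv Phi q.+1 (cc h Phi v) T in sL linv rinv.
pose Y p := L (f p).
have sY : smooth_at Y 0 by apply: (sfun_comp (f := f)) => //; exact: findim_rV.
have Y0 : Y 0 = expR t0 *: x1 by rewrite /Y f0E; exact: (nbhs_singleton linv).
(* Dividing by [b] moves the point along its own orbit in the parameter space to the hyperplane of
   [hyper_section]. *)
pose b p := (Y p *m x1^T) 0 0.
have sb : smooth_at b 0 by apply: smooth_coef; exact: smooth_mulmxr.
have b0 : 0 < b 0 by rewrite /b Y0 -scalemxAl mxE nsq_dot nx1 mulr1 expR_gt0.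
have nb := smooth_pos sb b0.
exists (fun p => (b p)^-1 *: Y p); split.
- by apply: smooth_scale; [exact: findim_rV|apply: smooth_inv => //; rewrite gt_eqF|].
- by rewrite /b Y0 -scalemxAl mxE nsq_dot nx1 mulr1 scalerA mulVf ?scale1r // gt_eqF // expR_gt0.
- by apply: filterS nb => p bp; rewrite -scalemxAl [Y p *m _]mx11_scalar -/(b p) scale_scalar_mx mulVf // gt_eqF.
have nr := near_cont (P := fun z => Wminus Phi v z -> ph h Phi v (L z) = z) (proj1 sf) rinv.
apply: filterS3 nb nf nr => p bp Hp rp cp; have [tp hp] := Hp cp; split=> p0.
  have [t fE] := gorb _ (bdry _ cp p0 tp hp).
  have fpE : f p = f 0.
    have xE (s : R) : ph h Phi v (expR s *: x1) = Phi s (ph h Phi v x1) by rewrite /ph (phi_flow gf mn hv).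
    rewrite fE f0E !xE; apply: (same_level_orbit hMS (ph_noncrit hMS cv x10)).
    by rewrite -!xE -fE -f0E hp hf0.
  have -> : b p = b 0 by rewrite /b /Y fpE.
  rewrite /Y fpE -/(Y 0) /b Y0 -scalemxAl mxE nsq_dot nx1 mulr1 scalerA mulVf ?scale1r // gt_eqF // expR_gt0 //.
have [We FE] := chart_int cp p0; move: tp; rewrite FE /track /= => -[t _ tE].
have Wf : Wminus Phi v (f p) by rewrite -tE; apply/(Wminus_flowP gf).
exists (expR (- t) * b p); first by rewrite mulr_gt0 // expR_gt0.
have -> : (expR (- t) * b p) *: ((b p)^-1 *: Y p) = expR (- t) *: Y p.
  by rewrite scalerA mulfK // gt_eqF.
by rewrite /ph -(phi_flow gf mn hv) -/(ph h Phi v (Y p)) (rp Wf) -tE (gfK gf).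
Qed.
(* Near the boundary of the chart, [m] is the small parameter and [Xh] the boundary coordinate: a
   boundary point is the image of [Xh] in the unstable manifold of [w], and an interior point is the
   end point of an orbit which leaves a neighbourhood of [w] at [Xh], at distance [m] from it. *)
Definition collared (T' : R) (y : 'rV[R]_q.+1 -> 'rV[R]_q.+1) (m : 'rV[R]_q.+1 -> R)
    (Xh : 'rV[R]_q.+1 -> 'rV[R]_q) (P : 'rV[R]_q.+1 -> 'rV[R]_n) (p : 'rV[R]_q.+1) : Prop :=
  [/\ P p = em n (Xh p) + (m p * expR T1) *: nu (pt (y p)), F0 (y p) = m p *: Xh p,
        p 0 0 = 0 -> [/\ m p = 0, y p = x1 & e p = ph h Phi w (expR T' *: Xh p)] &
        0 < p 0 0 -> [/\ 0 < m p, e p = ph h Phi v (expR T' *: zeta sg (row_mx (m p)%:M (Xh p))) &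
                         exists mu : R, e p = ph h Phi v (expR mu *: y p)]].

(** A backward time [T'] brings [e 0] into the box around [w], and the direction [y] reaches that
    box after [T1]. By [passage] the first point is the image of the second under the linear flow,
    so the expanding and the contracting parts of [P] are explicit in terms of [y] and the passage
    time. *)
Lemma collar : exists (T' : R) (y : 'rV[R]_q.+1 -> 'rV[R]_q.+1) (m : 'rV[R]_q.+1 -> R)
    (Xh : 'rV[R]_q.+1 -> 'rV[R]_q) (P : 'rV[R]_q.+1 -> 'rV[R]_n),
  [/\ smooth_at m 0 /\ m 0 = 0, smooth_at Xh 0 /\ smooth_at P 0, smooth_at y 0 /\ y 0 = x1,
    \forall p \near (0 : 'rV[R]_q.+1), [/\ e p = Phi T' (param (cc h Phi w) (P p)), inb (rr h Phi w) (P p)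
       & sg (F0 (y p)) = y p] &
    \forall p \near (0 : 'rV[R]_q.+1), corner 1 a p -> collared T' y m Xh P p].
Proof.
have [y [sy y0 yH yP]] := direction.
set c := cc h Phi w; set r := rr h Phi w; set s := @idx_pred n q.
have r4 : 0 < r ^+ 2 / 4 by rewrite divr_gt0 // exprn_gt0 // (hc_r hw).
have cP p : sqn s p < r ^+ 2 / 4 -> \forall p' \near p, sqn s p' < r ^+ 2 / 4.
  by move=> H; exact: (cvgr_lt (sqn s p) (@sqn_continuous R n s p) _ H).
have nw : \forall z \near w, [/\ dom c z, box s r (c z) & sqn s (c z) < r ^+ 2 / 4].
  have cw0 : {for w, continuous c} by apply: Defs.coord_continuous; exact: hc_dom hw.
  have n1 := near_cont (P := fun p => sqn s p < r ^+ 2 / 4) cw0.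
  rewrite (hc_0 hw) in n1; have n2 := n1 (cP 0 _); rewrite sqn0 in n2.
  by apply: filterS2 (near_box hw) (n2 r4) => z [].
have [T' e0T] : exists T' : R, [/\ dom c (Phi (- T') (e 0)), box s r (c (Phi (- T') (e 0))) &
    sqn s (c (Phi (- T') (e 0))) < r ^+ 2 / 4].
  have W0 : Wplus (fun t => Phi (- t)) w (e 0) by apply/WminusE; exact: e0W.
  have HF : \forall t \near +oo%R, [/\ dom c (Phi (- t) (e 0)), box s r (c (Phi (- t) (e 0))) &
    sqn s (c (Phi (- t) (e 0))) < r ^+ 2 / 4] by exact: (W0 _ nw).
  by have [T' HT] := filter_ex HF; exists T'.
pose P p := c (Phi (- T') (e p)).
have sP : smooth_at P 0.
  apply: (@sfun_comp _ _ _ _ _ e (c \o Phi (- T'))); [exact: findim_rV|exact: e_smooth|].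
  apply: (sfun_flow gf); first exact: findim_rV.
  by apply: sfun_chart; [exact: hc_smooth hw|case: e0T].
have ce : {for 0, continuous (fun p => Phi (- T') (e p))}.
  by apply: (continuous_comp (proj1 e_smooth)); exact: (gf_contt gf).
have n1 : \forall p \near (0 : 'rV[R]_q.+1), [/\ dom c (Phi (- T') (e p)), box s r (P p) & sqn s (P p) < r ^+ 2 / 4].
  have [d0 b0 s0] := e0T.
  have m1 := near_cont (P := fun z => dom c z) ce (near_dom d0).
  have cPc := smooth_cont sP.
  have m2 := near_cont (P := fun z => box s r z) cPc (box_near b0).
  have m3 := near_cont (P := fun z => sqn s z < r ^+ 2 / 4) cPc (cP _ s0).
  by apply: filterS3 m1 m2 m3.
have spy : smooth_at (fun p => pt (y p)) 0.
  by apply: (@smooth_comp _ _ _ _ y pt) => //; try exact: findim_rV; rewrite y0; exact: pt_smooth.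
have cy := smooth_cont sy.
have [s0 b0] := pt_x1.
have n2 : \forall p \near (0 : 'rV[R]_q.+1), [/\ gd h Phi w q T1 (ph h Phi v (y p)), box s r (pt (y p)) & sqn s (pt (y p)) < r ^+ 2 / 4].
  have m1 := near_cont (P := fun y => gd h Phi w q T1 (ph h Phi v y)) cy; rewrite y0 in m1.
  have m3 := near_cont (P := fun z => sqn s z < r ^+ 2 / 4) (smooth_cont spy); rewrite y0 in m3.
  have m1' := m1 (near_ph hMS (P := gd h Phi w q T1) cv (near_gd hMS g1)).
  have m3' := m3 (cP _ _); rewrite s0 in m3'; have {}m3' := m3' r4.
  by apply: filterS2 m1' m3' => p h1 h2; split=> //; exact: h1.2.
(* This comparison of levels will show that the passage time from the second point to the first is
   nonnegative. *)
have n3 : \forall p \near (0 : 'rV[R]_q.+1), h (Phi (- T') (e p)) < h (Phi T1 (ph h Phi v (y p))).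
  have c1 : {for 0, continuous (fun p => h (Phi (- T') (e p)))}.
    by apply: (continuous_comp ce); exact: (gf_h gf).
  have c2 : {for 0, continuous (fun p => h (Phi T1 (ph h Phi v (y p))))}.
    apply: (@continuous_comp _ _ _ (fun p => Phi T1 (ph h Phi v (y p))) h); last exact: (gf_h gf).
    apply: (@continuous_comp _ _ _ (fun p => ph h Phi v (y p)) (Phi T1)); last exact: (gf_contt gf).
    by apply: (continuous_comp cy); exact: (phc hMS cv).
  have h1 : h (Phi (- T') (e 0)) <= h w by exact: (Wminus_h_le (- T') e0W).
  have h2 : h w < h (Phi T1 (ph h Phi v (y 0))) by rewrite y0; apply: gam_h; exists T1.
  pose k := (h w + h (Phi T1 (ph h Phi v (y 0)))) / 2.
  have k1 : h (Phi (- T') (e 0)) < k by rewrite /k; lra.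
  have k2 : k < h (Phi T1 (ph h Phi v (y 0))) by rewrite /k; lra.
  apply: filterS2 (cvgr_lt _ c1 _ k1) (cvgr_gt _ c2 _ k2) => p; exact: lt_trans.
have pm0 : pm q (pt x1) = 0 by apply: nsq_eq0; rewrite -(sqn_pm wn).
have nu1 : nu (pt x1) = pt x1 by rewrite /nu pm0 /em mul0mx subr0.
have [j j0] : exists j, nu (pt (y 0)) 0 j != 0.
  rewrite y0 nu1; apply: contrapT => nj; move/eqP: pt_x1_neq0; apply; apply/rowP => j.
  by rewrite mxE; apply/eqP; apply: contrapT => /negP j0; apply: nj; exists j.
have snu (f : 'rV[R]_q.+1 -> 'rV[R]_n) : smooth_at f 0 -> smooth_at (fun p => nu (f p)) 0.
  move=> sf; apply: smooth_add => //; under eq_fun do rewrite -scaleN1r.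
  by apply: scale_smooth; apply: em_smooth; exact: pm_smooth.
pose d p := nu (pt (y p)) 0 j.
have sd : smooth_at d 0 by apply: smooth_coef; exact: snu.
have nd := near_neq0 (smooth_cont sd) j0.
(* Inside the chart the contracting parts of [P p] and [pt (y p)] differ by the factor
   [m p * expR T1]. A coordinate [j] that is nonzero at the limit recovers [m] as a quotient, which
   is smooth up to the boundary, unlike the passage time. *)
pose m p := nu (P p) 0 j * (expR T1 * d p)^-1.
pose Xh p := pm q (P p).
have sm : smooth_at m 0.
  apply: smooth_mul; first by apply: smooth_coef; exact: snu.
  have k0 : expR T1 * d 0 != 0 by rewrite mulf_neq0 // gt_eqF // expR_gt0.
  have sk : smooth_at (fun p => expR T1 * d p) 0 by apply: smooth_mul; [exact: smooth_cst|exact: sd].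
  by apply: smooth_inv; [exact: k0|exact: sk].
have n4 : \forall p \near (0 : 'rV[R]_q.+1), sg (F0 (y p)) = y p.
  have m1 := near_cont (P := fun y : 'rV[R]_q.+1 => y *m x1^T = 1%:M -> sg (F0 y) = y) cy; rewrite y0 in m1.
  by apply: filterS2 yH (m1 sgK) => p h1; apply.
have main : \forall p \near (0 : 'rV[R]_q.+1), corner 1 a p -> collared T' y m Xh P p.
  apply: filterS3 (near_and n1 n2) (near_and n3 n4) (near_and nd yP) => p [[h1 h2 h3] [h4 h5 h6]] [h7 h8] [h9 h10] cp.
  have {h10}[yb yi] := h10 cp.
  have pE : Phi (- T') (e p) = param c (P p) by rewrite /P coordK.
  have p00 : 0 <= p 0 0 by case: cp => _ /(_ 0 isT).
  move: p00; rewrite le_eqVlt => /predU1P[p0|p0].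
    have [We _] := chart_bdry cp (esym p0).
    have sC : sqn (predC s) (P p) = 0.
      by apply/(unstable_boxP gf hw h2); rewrite -pE; apply/(Wminus_flowP gf).
    have emP := pmK wn sC; have nuP : nu (P p) = 0 by rewrite /nu emP subrr.
    have m0 : m p = 0 by rewrite /m nuP mxE mul0r.
    rewrite /collared m0 !mul0r !scale0r addr0 /Xh emP (yb (esym p0)); split=> //; first exact: F0_x1.
      by move=> _; split=> //; rewrite /ph (Wminus_local gf wn hw h1 h2 We).
    by rewrite -p0 ltxx.
  have [mu mu0 eE] := yi p0.
  pose t := ln mu - T' - T1.
  have ptE : Phi T1 (ph h Phi v (y p)) = param c (pt (y p)) by rewrite /pt coordK //; exact: h4.1.
  have EE : Phi (- T') (e p) = Phi t (param c (pt (y p))).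
    rewrite -ptE -(gfD gf) eE /ph !(phi_flow gf mn hv) scalerA; congr (phi _ _ _ (_ *: _)).
    by rewrite /t subrK addrC expRD lnK ?posrE // mulrC.
  have t0 : 0 <= t.
    rewrite leNgt; apply/negP => tn; move: h7; rewrite EE ptE ltNge.
    by have := gf_h_mono gf (param c (pt (y p))) (ltW tn); rewrite (gf0 gf) => ->.
  have PE : P p = linflow s t (pt (y p)).
    rewrite /P EE; apply: (passage gf hw) => //; first by rewrite -EE.
    by rewrite -EE ltW.
  have XE : Xh p = expR t *: pm q (pt (y p)) by rewrite /Xh PE (pm_linflow wn).
  have nuE : nu (P p) = expR (- t) *: nu (pt (y p)).
    by rewrite {1}/nu -/(Xh p) XE PE (linflow_split cw) addrC addKr.
  have mE : m p = expR (- t) * expR (- T1).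
    rewrite /m nuE mxE -/(d p) expRN; have := expR_gt0 T1 => H; rewrite expRN; field.
    by rewrite h9 !gt_eqF // expR_gt0.
  have FE : F0 (y p) = m p *: Xh p.
    rewrite mE XE scalerA /F0 /st /stab -/(pt (y p)); congr (_ *: _).
    by rewrite -!expRD; congr expR; ring.
  split=> //.
  - rewrite -[LHS](subrK (em n (Xh p))) -/(nu (P p)) nuE addrC mE -mulrA -[expR (- T1) * _]expRD addNr expR0 mulr1 //.
  - by move=> E; rewrite E ltxx in p0.
  move=> _; split; first by rewrite mE mulr_gt0 // expR_gt0.
    rewrite /zeta row_mxKl row_mxKr mxE eqxx mulr1n -FE h8 scalerA eE; congr (ph h Phi v (_ *: _)).
    rewrite mE -expRD -expRN -expRD -[LHS]lnK ?posrE //; congr expR; rewrite /t; ring.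
  by exists (ln mu); rewrite lnK ?posrE.
have m0 : m 0 = 0.
  by have [_ _ /(_ (mxE _ _ _ _))[]] := nbhs_singleton main corner0.
exists T', y, m, Xh, P; split=> //.
  by split=> //; exact: pm_smooth.
apply: filterS2 n1 n4 => p [h1 h2 h3] h4; split=> //; last exact: (box_inb h2).
by rewrite /P coordK // (gfKN gf).
Qed.

Lemma corner_near : \forall p \near (0 : 'rV[R]_q.+1), 0 <= (p : 'rV[R]_q.+1) 0 0 -> corner 1 a p.
Proof.
have a0 : 0 < a by case: CC => -[].
apply: filterS (nbhsx_ballx (0 : 'rV[R]_q.+1) a a0) => p; rewrite -ball_normE /= sub0r normrN => pa p0.
split=> [j|j j1]; first exact: (le_lt_trans (normrV_coef p j) pa).
by have -> : j = 0 by apply/val_inj; move: j1; rewrite ltnS leqn0 => /eqP.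
Qed.

Section Collared.
Variables (T' : R) (y : 'rV[R]_q.+1 -> 'rV[R]_q.+1) (m : 'rV[R]_q.+1 -> R)
    (Xh : 'rV[R]_q.+1 -> 'rV[R]_q) (P : 'rV[R]_q.+1 -> 'rV[R]_n).
Hypotheses (sm : smooth_at m 0) (m0 : m 0 = 0) (sX : smooth_at Xh 0) (sP : smooth_at P 0).
Hypotheses (sy : smooth_at y 0) (y0 : y 0 = x1).
Hypothesis nA : \forall p \near (0 : 'rV[R]_q.+1), [/\ e p = Phi T' (param (cc h Phi w) (P p)),
  inb (rr h Phi w) (P p) & sg (F0 (y p)) = y p].
Hypothesis nB : \forall p \near (0 : 'rV[R]_q.+1), corner 1 a p -> collared T' y m Xh P p.

Definition zc (p : 'rV[R]_q.+1) : 'rV[R]_(1 + q) := row_mx (m p)%:M (Xh p).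

Let sz : smooth_at zc 0.
Proof. by apply: smooth_row_mx => //; exact: smooth_scalar. Qed.

Let Jzc : 'J zc 0 = row_mx ('J (fun p => (m p)%:M : 'rV[R]_1) 0) ('J Xh 0).
Proof. by apply: jac_row_mx => //; exact: smooth_scalar. Qed.

Let nH : \forall p \near (0 : 'rV[R]_q.+1), 0 <= (p : 'rV[R]_q.+1) 0 0 -> corner 1 a p /\ collared T' y m Xh P p.
Proof. by apply: filterS2 corner_near nB => p h1 h2 p0; have cp := h1 p0; split=> //; exact: h2. Qed.

Section Degenerate.
Variable u : 'rV[R]_q.+1.
Hypothesis uz : u *m 'J zc 0 = 0.

Let um : 'D_u m 0 = 0.
Proof.
move: uz; rewrite Jzc mul_mx_row -[0 in RHS](row_mx0) => /eq_row_mx[H _].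
have ss := smooth_scalar sm; have E := deriveEjacobian u (smooth_diff ss).
have E2 := derive_rV u 0 ss; rewrite E H mxE in E2; rewrite E2; congr ('D_u _ 0).
by apply/funext => p; rewrite mxE eqxx mulr1n.
Qed.

Let uX : 'D_u Xh 0 = 0.
Proof.
move: uz; rewrite Jzc mul_mx_row -[0 in RHS](row_mx0) => /eq_row_mx[_ H].
by have E := deriveEjacobian u (smooth_diff sX); rewrite E.
Qed.

Let ue : u *m jac e 0 = 0.
Proof.
pose P' p := em n (Xh p) + (m p * expR T1) *: nu (pt (y p)).
have spy : smooth_at (fun p => nu (pt (y p))) 0.
  have sp : smooth_at (fun p => pt (y p)) 0.
    apply: (@smooth_comp _ _ _ _ y pt); [exact: findim_rV|exact: findim_rV|exact: sy|].
    by rewrite y0; exact: pt_smooth.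
  apply: smooth_add; first exact: sp.
  under eq_fun do rewrite -scaleN1r.
  by apply: scale_smooth; apply: em_smooth; apply: pm_smooth; exact: sp.
have sme : smooth_at (fun p => m p * expR T1) 0 by apply: smooth_mul => //; exact: smooth_cst.
have s1 : smooth_at (fun p => em n (Xh p)) 0 by exact: em_smooth.
have s2 : smooth_at (fun p => (m p * expR T1) *: nu (pt (y p))) 0.
  by apply: smooth_scale; [exact: findim_rV|exact: sme|exact: spy].
have sP' : smooth_at P' 0 by exact: smooth_add.
have JP : 'J P 0 = 'J P' 0.
  by apply: (halfspace_derive sP sP'); apply: filterS nH => p H /H[_ []].
have uP : u *m 'J P 0 = 0.
  rewrite JP; have E := deriveEjacobian u (smooth_diff sP'); apply: (etrans (esym E)).
  apply: (etrans (smooth_deriveD u s1 s2)); rewrite (derive_scaleV u sme spy) m0 mul0r scale0r addr0.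
  have -> : 'D_u (fun p => m p * expR T1) 0 = 0.
    have dm : derivable m 0 u by apply: diff_derivable; exact: smooth_diff.
    have dc : derivable (cst (expR T1) : 'rV[R]_q.+1 -> R) 0 u by exact: derivable_cst.
    apply: (etrans (deriveM dm dc)); rewrite um derive_cst !scaler0 addr0 //.
  rewrite scale0r addr0; apply: (etrans (derive_mulmxr _ u (smooth_diff sX))).
  by rewrite uX mul0mx.
have iP0 : inb (rr h Phi w) (P 0) by case: (nbhs_singleton nA).
have sL : smooth_into (fun p => Phi T' (param (cc h Phi w) p)) (P 0).
  apply: (gf_smooth gf); apply: smooth_into_param; first exact: hc_smooth hw.
  exact/(hc_img hw).
have -> : jac e 0 = jac ((fun p => Phi T' (param (cc h Phi w) p)) \o P) 0.
  apply: jac_near_eq; first by apply: filterS nA => p [].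
  exact: (smooth_into_comp (findim_rV R n) sP sL).
by rewrite (jac_comp_into sP sL) mulmxA uP mul0mx.
Qed.

Let uy : u *m 'J y 0 = 0.
Proof.
have sF : smooth_at F0 (y 0) by rewrite y0; exact: F0_smooth.
have sxi : smooth_at (F0 \o y) 0 by apply: (smooth_comp (f := y) (g := F0)); [exact: findim_rV|exact: findim_rV|exact: sy|exact: sF].
have smX : smooth_at (fun p => m p *: Xh p) 0 by apply: smooth_scale; [exact: findim_rV|exact: sm|exact: sX].
have Jxi : 'J (F0 \o y) 0 = 'J (fun p => m p *: Xh p) 0.
  by apply: (halfspace_derive sxi smX); apply: filterS nH => p H /H[_ []].
have uxi : u *m 'J (F0 \o y) 0 = 0.
  rewrite Jxi; have E := deriveEjacobian u (smooth_diff smX); apply: (etrans (esym E)).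
  by apply: (etrans (derive_scaleV u sm sX)); rewrite um uX m0 !scale0r addr0.
have xi0 : (F0 \o y) 0 = 0 by rewrite /= y0; exact: F0_x1.
have ssg : smooth_at sg ((F0 \o y) 0) by rewrite xi0; case: (nbhs_singleton sgP).
have -> : 'J y 0 = 'J (sg \o (F0 \o y)) 0.
  apply: near_eq_jac; last exact: smooth_diff.
  by apply: filterS nA => p [_ _ /= ->].
by rewrite (jac_comp (smooth_diff sxi) (smooth_diff ssg)) mulmxA uxi mul0mx.
Qed.

(** On the half space [f] is the point at level [c] on the orbit of [g]. Such a point is unique, so
    [f] agrees there with the level map obtained from [g], and a direction killed by [g] is killed
    by [f]. *)
Let same_orbit_jac (f g : 'rV[R]_q.+1 -> M) c : smooth_into f 0 -> smooth_into g 0 ->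
  (forall x, crit h x -> h x != c) ->
  (\forall p \near (0 : 'rV[R]_q.+1), 0 <= (p : 'rV[R]_q.+1) 0 0 -> (exists t, f p = Phi t (g p)) /\ h (f p) = c) ->
  u *m jac g 0 = 0 -> u *m jac f 0 = 0.
Proof.
move=> sf sg_ nc nE ug; have le00 : 0 <= (0 : 'rV[R]_q.+1) 0 0 by rewrite mxE.
have [[t0 f0E] h0] := nbhs_singleton nE le00.
have ncr z : h z = c -> ~ crit h z by move=> hz cz; move: (nc z cz); rewrite hz eqxx.
have nc0 : ~ crit h (Phi t0 (g 0)) by apply: ncr; rewrite -f0E.
have [k [tau [sk _ nk uk]]] := level_map_ex hMS sg_ nc0.
rewrite (halfspace_jac sf sk); first exact: uk.
apply: filterS2 nE nk => p H1 [kE hk] p0; have [[t fE] hp] := H1 p0.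
have ncg : ~ crit h (g p).
  move=> cg; apply: (ncr _ hp); rewrite fE (crit_flow hMS) //.
rewrite kE fE; apply: (same_level_orbit hMS ncg).
by rewrite -fE -kE hp hk -f0E.
Qed.

(** A direction that leaves [(m, Xh)] stationary also leaves [e] and [y] stationary. A level map
    above [h w] is determined by the orbit of [y], one below [h w] by the orbit of [e]; so [u]
    violates the immersion clause of [corner_chart] unless it is zero. *)
Lemma degenerate_zero : u = 0.
Proof.
apply: contrapT => /eqP u0; case: CC => _ _ _ _ /(_ _ corner0)[_ /(_ u u0)].
move=> [ue0|]; first by move: ue0; rewrite ue => /eqP; apply.
move=> [c [f [[/andP[rc1 rc2] rc3] [sf nf] uf]]].
move/negP: uf; apply; apply/eqP.
have cw0 : h w != c by apply: rc3; case: cw.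
have tr p : corner 1 a p -> track Phi (F p) (f p) ->
    (0 < p 0 0 -> exists t, f p = Phi t (e p)) /\
    (p 0 0 = 0 -> gam (f p) \/ exists2 t, t <= 0 & f p = Phi t (e p)).
  move=> cp H; split=> p0.
    have [We FE] := chart_int cp p0; move: H; rewrite FE /track /= => -[t _ <-]; by exists t.
  have [We FE] := chart_bdry cp p0; move: H; rewrite FE /track /= => -[H|[t t0 <-]]; [by left|right; by exists t].
move: cw0; rewrite neq_lt => /orP[cw0|cw0].
  apply: (@same_orbit_jac f (ph h Phi v (m := q.+1) \o y) c).
  - exact: sf.
  - exact: (smooth_into_comp (findim_rV R q.+1) sy (ph_smooth hMS cv _)).
  - exact: rc3.
  - apply: filterS2 nH nf => p H1 H2 p0; have [cp [_ _ b1 b2]] := H1 p0; have [tp hp] := H2 cp.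
    split=> //; have [t1 t2] := tr p cp tp; move: p0; rewrite le_eqVlt => /predU1P[p0|p0].
      have [_ yE _] := b1 (esym p0); rewrite /= yE.
      have [[t _ <-]|[t t0 fE]] := t2 (esym p0); first by exists t.
      have [We _] := chart_bdry cp (esym p0).
      by have := Wminus_h_le t We; rewrite -fE hp leNgt cw0.
    have [_ _ [mu eE]] := b2 p0; have [t fE] := t1 p0; exists (t + mu).
    have H : Phi mu (ph h Phi v (y p)) = e p by rewrite eE /ph (phi_flow gf mn hv).
    by rewrite fE -H -(gfD gf).
  - by rewrite (jac_comp_into sy (ph_smooth hMS cv _)) mulmxA uy mul0mx.
apply: (@same_orbit_jac f e c); [exact: sf|exact: e_smooth|exact: rc3| |exact: ue].
apply: filterS2 nH nf => p H1 H2 p0; have [cp _] := H1 p0; have [tp hp] := H2 cp.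
split=> //; have [t1 t2] := tr p cp tp; move: p0; rewrite le_eqVlt => /predU1P[p0|/t1//].
have [/gam_h|[t _ fE]] := t2 (esym p0); last by exists t.
by rewrite hp => H; have := lt_trans H cw0; rewrite ltxx.
Qed.
End Degenerate.

Lemma zc_nondegenerate : \det ('J zc 0) != 0.
Proof. by apply/negP => /det0P[u u0 /degenerate_zero uE]; move: u0; rewrite uE eqxx. Qed.
Lemma mul_row01 k (z : 'rV[R]_k) : z *m (row_mx 0 1%:M : 'M[R]_(k, 1 + k)) = row_mx 0 z.
Proof. by rewrite mul_mx_row mulmx0 mulmx1. Qed.

Lemma lsubmx00 k (z : 'rV[R]_(1 + k)) : lsubmx z 0 0 = z 0 0.
Proof. by rewrite mxE; congr (z _ _); exact/val_inj. Qed.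

Lemma row01K k (z : 'rV[R]_(1 + k)) : z 0 0 = 0 -> rsubmx z *m (row_mx 0 1%:M : 'M[R]_(k, 1 + k)) = z.
Proof.
move=> z0; rewrite mul_row01 -[RHS]hsubmxK; congr (row_mx _ _).
by rewrite [RHS]mx11_scalar lsubmx00 z0 raddf0.
Qed.

Lemma mul01_row' k l (B : 'M[R]_(1 + k, l)) :
  (row_mx 0 1%:M : 'M[R]_(k, 1 + k)) *m B = row' 0 (B : 'M[R]_(k.+1, l)).
Proof.
apply/matrixP => i j; rewrite -[B in LHS]vsubmxK mul_row_col mul0mx mul1mx add0r !mxE.
congr (B _ j); exact/val_inj.
Qed.

Let near_prop (p : 'rV[R]_q.+1) : Prop := 0 <= p 0 0 -> corner 1 a p /\ collared T' y m Xh P p.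

Let A := adet x1 (Jw h Phi v w q x1).
Let D : R := \det ('J zc 0).
Let Z (p : 'rV[R]_q.+1) := expR T' *: zeta sg (zc p).
Let incl : 'M[R]_(q, q.+1) := (row_mx 0 1%:M : 'M[R]_(q, 1 + q)).
Let D' : R := \det (incl *m 'J Xh 0).

Let A0 : A != 0.
Proof.
have JE := JwE hMS cv cw g1 Wx1.
by apply: adet_neq0; [rewrite JE; exact: (Jst_full hMS cv cw g1 Wx1)|exact: x10|rewrite JE; exact: (Jst_ray hMS cv cw g1 Wx1)].
Qed.

Let nD : \forall p \near (0 : 'rV[R]_q.+1), 0 < \det ('J zc p) * D.
Proof.
apply: (smooth_pos (f := fun p => \det ('J zc p) * D)).
  apply: smooth_mul; last exact: smooth_cst.
  by apply: smooth_det => i j; exact: smooth_jac.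
by rewrite -expr2 exprn_even_gt0 // zc_nondegenerate.
Qed.

Let smX : smooth_at (fun p => m p *: Xh p) 0.
Proof. by apply: smooth_scale; [exact: findim_rV|exact: sm|exact: sX]. Qed.

Let mX0 : m 0 *: Xh 0 = 0.
Proof. by rewrite m0 scale0r. Qed.

Let nsg : \forall p \near (0 : 'rV[R]_q.+1),
  \forall xi \near (m p *: Xh p), [/\ smooth_at sg xi, sg xi *m x1^T = 1%:M & F0 (sg xi) = xi].
Proof.
have cm := smooth_cont smX.
apply: (near_cont (P := fun x : 'rV[R]_q => \forall xi \near x, [/\ smooth_at sg xi, sg xi *m x1^T = 1%:M & F0 (sg xi) = xi]) cm).
by rewrite mX0; exact: nbhs_interior.
Qed.

Let ssg : smooth_at (fun p => sg (m p *: Xh p)) 0.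
Proof.
apply: (@smooth_comp _ _ _ _ (fun p => m p *: Xh p) sg); [exact: findim_rV|exact: findim_rV|exact: smX|].
by rewrite mX0; case: (nbhs_singleton sgP).
Qed.

Let nF : \forall p \near (0 : 'rV[R]_q.+1), smooth_at F0 (sg (m p *: Xh p)).
Proof.
have cm := smooth_cont ssg; apply: (near_cont (P := fun x : 'rV[R]_q.+1 => smooth_at F0 x) cm).
by rewrite mX0 sg0; apply: smooth_near; exact: F0_smooth.
Qed.

Let nAp : \forall p \near (0 : 'rV[R]_q.+1), 0 < adet x1 ('J F0 (sg (m p *: Xh p))) * A.
Proof.
have cm := smooth_cont ssg.
have sF := F0_smooth.
have H := near_cont (P := fun x : 'rV[R]_q.+1 => 0 < adet x1 ('J F0 x) * A) cm.
apply: H; rewrite mX0 sg0; apply: (smooth_pos (f := fun x => adet x1 ('J F0 x) * A)).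
  apply: smooth_mul; last exact: smooth_cst.
  apply: adet_smooth => [|i j]; first exact: smooth_cst.
  exact: smooth_jac.
have -> : 'J F0 x1 = Jw h Phi v w q x1 by apply: esym; exact: (JwE hMS cv cw g1 Wx1).
by rewrite -expr2 exprn_even_gt0.
Qed.

Let nint : \forall p \near (0 : 'rV[R]_q.+1), 0 < (p : 'rV[R]_q.+1) 0 0 -> \forall p' \near p, e p' = ph h Phi v (Z p').
Proof.
have H := nbhs_interior nH; apply: filterS H => p Hp p0.
have np : \forall p' \near p, 0 < (p' : 'rV[R]_q.+1) 0 0.
  by apply: (smooth_pos (f := fun p : 'rV[R]_q.+1 => p 0 0)) => //; apply: smooth_coef; exact: smooth_id.
by apply: filterS2 np Hp => p' p'0 /(_ (ltW p'0))[_ [_ _ _ /(_ p'0)[]]].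
Qed.

(** Near the boundary [e] is [ph v] composed with a positive multiple of [zeta] in the coordinates
    [zc]. The minus sign of the outward normal and that of [zeta_jac_det] cancel, which leaves the
    sign of [D * A]. *)
Lemma interior_sign (o : M -> 'M[R]_(q.+1, n) -> bool) : is_orientation (Wminus Phi v) o ->
  \forall p \near (0 : 'rV[R]_q.+1), 0 < (p : 'rV[R]_q.+1) 0 0 ->
    o (e p) (outward_first (jac e p)) = osign h Phi v o (+) (D * A < 0).
Proof.
move=> oP; apply: filterS3 (near_and nint nH) (near_and nD nsg) (near_and (near_and nF nAp) (smooth_near sz)).
move=> p [Hi HB] [pD pS] [[pF pA] szp] p0.
have {HB}[_ [_ _ _ /(_ p0)[mp _ _]]] := HB (ltW p0); have {Hi}eE := Hi p0.
have l1 : lsubmx (zc p) 0 0 = m p by rewrite /zc row_mxKl mxE eqxx mulr1n.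
have l2 : rsubmx (zc p) = Xh p by rewrite /zc row_mxKr.
have H := @zeta_jac_det R q x1 F0 sg (zc p); rewrite /= l1 l2 in H.
have {}H := H (lt0r_neq0 mp) pF pS.
have sze : smooth_at (zeta sg) (zc p).
  by apply: zeta_smooth; rewrite l1 ?l2; [exact: lt0r_neq0|case: (nbhs_singleton pS)].
have szz : smooth_at (fun p => zeta sg (zc p)) p.
  by apply: (@smooth_comp _ _ _ _ zc (zeta sg)); [exact: findim_rV|exact: findim_rV|exact: szp|exact: sze].
have sZ : smooth_at Z p.
  by apply: smooth_scale; [exact: findim_rV|exact: smooth_cst|exact: szz].
have JZ : 'J Z p = expR T' *: ('J zc p *m 'J (zeta sg) (zc p)).
  have -> : Z = fun p => zeta sg (zc p) *m (expR T')%:M by apply/funext => x; rewrite mul_mx_scalar.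
  rewrite jac_mulmxr; last exact: smooth_diff.
  have JC := jac_comp (smooth_diff szp) (smooth_diff sze).
  apply: (etrans (mul_mx_scalar _ _)); exact: (congr1 (fun B => expR T' *: B) JC).
pose N : 'M[R]_q.+1 := diag_mx (\row_j (if j == 0 then -1 else 1)).
have dN : \det N = -1.
  rewrite det_diag big_ord_recl mxE eqxx big1 ?mulr1 // => i _; rewrite mxE //.
have -> : outward_first (jac e p) = (N *m 'J Z p) *m jac (ph h Phi v (m := q.+1)) (Z p).
  have sph := ph_smooth hMS cv (Z p).
  have E2 := jac_near_eq eE (smooth_into_comp (findim_rV R q.+1) sZ sph).
  have E1 := jac_comp_into sZ sph.
  rewrite -mulmxA -E1 -E2 /N mul_diag_mx; apply/matrixP => i j; rewrite !mxE.
  by case: ifP => _; rewrite ?mulN1r ?mul1r.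
rewrite (nbhs_singleton eE) oP.1; first last.
- rewrite unitmxE unitfE det_mulmx dN JZ detZ det_mulmx mulN1r oppr_eq0.
  apply: mulf_neq0; first by rewrite expf_neq0 // gt_eqF // expR_gt0.
  apply: mulf_neq0.
    by apply: contraTneq pD => ->; rewrite mul0r ltxx.
  by apply: contra_eq_neq H => ->; rewrite mul0r eq_sym oppr_eq0 invr_eq0 expf_neq0 // gt_eqF.
- move=> i; apply: tangent_jac; [exact: (ph_smooth hMS cv)|by apply: filterE => x; exact: (ph_Wminus hMS cv)].
- exact: (jac_ph_free hMS cv).
- exact: (ph_Wminus hMS cv).
rewrite (osignE hMS cv oP); congr (_ (+) _); rewrite det_mulmx dN JZ detZ det_mulmx mulN1r oppr_lt0.
rewrite pmulr_rgt0 ?exprn_gt0 ?expR_gt0 //.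
have H2 : \det ('J (zeta sg) (zc p)) * adet x1 ('J F0 (sg (m p *: Xh p))) = - m p ^- 2 := H.
apply: (sign_transfer pD pA); by rewrite H2 oppr_lt0 invr_gt0 exprn_gt0.
Qed.

(** Since [m] vanishes on the boundary, the Jacobian of [zc] is triangular there. Its corner entry
    [d] is the normal derivative of [m], which is nonzero by nondegeneracy and not negative because
    [m > 0] inside. *)
Let J0 : exists2 d : R, 0 < d & D = d * D'.
Proof.
pose b (x : 'rV[R]_q) : 'rV[R]_q.+1 := x *m incl.
have sb x : smooth_at b x by apply: smooth_mulmxr; exact: smooth_id.
have Jb x : 'J b x = incl.
  by rewrite /b (@jac_mulmxr _ _ _ _ id) ?jac_id ?mul1mx //; apply: smooth_diff; exact: smooth_id.
have b0 : b 0 = 0 by rewrite /b mul0mx.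
have b00 x : b x 0 0 = 0.
  have -> : b x = (row_mx 0 x : 'rV[R]_(1 + q)) by exact: mul_row01.
  by rewrite -(lsubmx00 (row_mx 0 x : 'rV[R]_(1 + q))) row_mxKl mxE.
have Jzc' := Jzc; set Jm := 'J (fun p => (m p)%:M : 'rV[R]_1) 0 in Jzc'.
have ssm := smooth_scalar sm.
have iJm : incl *m Jm = 0.
  have E := @jac_comp R _ _ _ b (fun p => (m p)%:M : 'rV[R]_1) 0; rewrite b0 Jb in E.
  rewrite /Jm -E; [|exact: (smooth_diff (sb 0))|exact: smooth_diff].
  rewrite -(jac_cst (0 : 'rV[R]_1) (0 : 'rV[R]_q)); apply: esym; apply: near_eq_jac; last by apply: smooth_diff; exact: smooth_cst.
  have cb := smooth_cont (sb 0).
  have H := near_cont (P := near_prop) cb; rewrite b0 in H.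
  apply: filterS (H nH) => x; rewrite /near_prop /collared b00 lexx => /(_ isT)[_ [_ _ /(_ erefl)[mE _ _] _]].
  by rewrite /= mE raddf0.
pose d := Jm 0 0; have DE : D = d * D'.
  by rewrite /D Jzc'; exact: (det_row_mx_kernel _ iJm).
exists d => //; rewrite lt_neqAle; apply/andP; split.
  by apply: contraNneq zc_nondegenerate => d0; rewrite -/D DE -d0 mul0r.
rewrite leNgt; apply/negP => dN; pose c (t : R) : 'rV[R]_q.+1 := t *: delta_mx 0 0.
have sc t : smooth_at c t by apply: smooth_scale; [exact: findim_rV|exact: smooth_id|exact: smooth_cst].
have c0 : c 0 = 0 by rewrite /c scale0r.
have Dc : 'D_1 c 0 = delta_mx 0 0.
  rewrite (@derive_scale _ _ id (cst (delta_mx 0 0))); [|exact: smooth_id|exact: smooth_cst].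
  by rewrite derive_id derive_cst scaler0 addr0 scale1r.
pose F1 (p : 'rV[R]_q.+1) : 'rV[R]_1 := (m p)%:M.
have sF1 : smooth_at F1 (c 0) by rewrite c0.
have sFc : smooth_at (F1 \o c) 0 by apply: (smooth_comp (f := c) (g := F1)); [exact: findim_rV|exact: findim_rV|exact: sc|exact: sF1].
have E1 := derive_curve (sc 0) sF1; rewrite Dc c0 -rowE -/Jm in E1.
have E2 := derive_rV (1 : R) 0 sFc; rewrite E1 mxE -/d in E2.
have E3 : (fun t => (F1 \o c) t 0 0) = m \o c by apply/funext => t; rewrite /= mxE eqxx mulr1n.
rewrite E3 in E2; have smc : smooth_at (m \o c) 0 by rewrite -E3; exact: smooth_coef.
have dm : derivable (- (m \o c)) 0 1 by apply: derivableN; apply: diff_derivable; exact: smooth_diff.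
have DN : 0 < 'D_1 (- (m \o c)) 0.
  by rewrite deriveN ?oppr_gt0 -?E2 //; apply: diff_derivable; exact: smooth_diff.
have n1 := derive_pos_mono dm DN.
have cc0 := smooth_cont (sc 0).
have n2 := near_cont (P := near_prop) cc0; rewrite c0 in n2.
have [r r0 Hr] := near_ball (near_and n1 (n2 nH)).
have [|h1 h2] := Hr (r / 2); first by rewrite -ball_normE /= sub0r normrN gtr0_norm ?divr_gt0 //; lra.
have cr : c (r / 2) 0 0 = r / 2 by rewrite /c !mxE eqxx mulr1.
have r20 : 0 < r / 2 by rewrite divr_gt0.
have := h2; rewrite /near_prop /collared cr => /(_ (ltW r20))[_ [_ _ _ /(_ r20)[mp _ _]]].
have Em : m (c 0) = 0 by rewrite c0.
by move: h1; rewrite !fctE /= Em oppr0 oppr_lt0 mp ltNge ltW.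
Qed.

Let DD : (D < 0) = (D' < 0).
Proof. by have [d d0 ->] := J0; rewrite pmulr_rlt0. Qed.
Let D0 : D' != 0.
Proof. by have [d d0 E] := J0; have := zc_nondegenerate; rewrite -/D E mulf_eq0 gt_eqF. Qed.

Lemma boundary_sign (o : M -> 'M[R]_(q, n) -> bool) : is_orientation (Wminus Phi w) o ->
  \forall p \near (0 : 'rV[R]_q.+1), (p : 'rV[R]_q.+1) 0 0 = 0 ->
    o (e p) (row' 0 (jac e p)) = osign h Phi w o (+) (D < 0).
Proof.
move=> oP.
have n1 : \forall p \near (0 : 'rV[R]_q.+1), 0 < \det (incl *m 'J Xh p) * D'.
  apply: (smooth_pos (f := fun p => \det (incl *m 'J Xh p) * D')).
    apply: smooth_mul; last exact: smooth_cst.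
    apply: smooth_det; apply: smooth_mulmx => i j; first exact: smooth_cst.
    exact: smooth_jac.
  by rewrite -expr2 exprn_even_gt0.
apply: filterS3 (nbhs_interior nH) n1 (near_and (smooth_near sX) corner_near) => p Hp pD [sXp cp] p0.
pose b (x : 'rV[R]_q) : 'rV[R]_q.+1 := x *m incl.
have sb x : smooth_at b x by apply: smooth_mulmxr; exact: smooth_id.
have Jb x : 'J b x = incl.
  by rewrite /b (@jac_mulmxr _ _ _ _ id) ?jac_id ?mul1mx //; apply: smooth_diff; exact: smooth_id.
have bE x : b x = (row_mx 0 x : 'rV[R]_(1 + q)) by exact: mul_row01.
have b00 x : b x 0 0 = 0.
  by rewrite bE -(lsubmx00 (row_mx 0 x : 'rV[R]_(1 + q))) row_mxKl mxE.
pose x0 : 'rV[R]_q := rsubmx (p : 'rV[R]_(1 + q)).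
have bx0 : b x0 = p.
  exact: row01K.
have se : smooth_into e (b x0).
  by rewrite bx0; case: CC => _ _ _ /(_ p)C4 _; apply: (C4 _).1; apply: cp; rewrite p0.
have JE : jac (e \o b) x0 = row' 0 (jac e p).
  rewrite (jac_comp_into (sb x0) se) Jb bx0; exact: mul01_row'.
have EE : \forall x \near x0, (e \o b) x = ph h Phi w (expR T' *: Xh (b x)).
  have cb := smooth_cont (sb x0).
  have H := near_cont (P := near_prop) cb; rewrite bx0 in H.
  apply: filterS (H Hp) => x; rewrite /near_prop /collared b00 lexx => /(_ isT)[_ [_ _ /(_ erefl)[_ _ eE] _]].
  exact: eE.
have sXb : smooth_at Xh (b x0) by rewrite bx0.
have sXc : smooth_at (Xh \o b) x0 by apply: (smooth_comp (f := b) (g := Xh)); [exact: findim_rV|exact: findim_rV|exact: sb|exact: sXb].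
have szx : smooth_at (fun x => expR T' *: Xh (b x)) x0.
  by apply: smooth_scale; [exact: findim_rV|exact: smooth_cst|exact: sXc].
have Jz : 'J (fun x => expR T' *: Xh (b x)) x0 = expR T' *: (incl *m 'J Xh p).
  have -> : (fun x => expR T' *: Xh (b x)) = fun x => (Xh \o b) x *m (expR T')%:M by apply/funext => x; rewrite mul_mx_scalar.
  rewrite jac_mulmxr; last exact: smooth_diff.
  have JC := jac_comp (smooth_diff (sb x0)) (smooth_diff sXb).
  rewrite Jb bx0 in JC.
  apply: (etrans (mul_mx_scalar _ _)); exact: (congr1 (fun B => expR T' *: B) JC).
have dz : \det ('J (fun x => expR T' *: Xh (b x)) x0) = expR T' ^+ q * \det (incl *m 'J Xh p) by rewrite Jz detZ.
have k0 : 0 < expR T' ^+ q by rewrite exprn_gt0 // expR_gt0.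
have uz : 'J (fun x => expR T' *: Xh (b x)) x0 \in unitmx.
  rewrite unitmxE unitfE dz; apply: mulf_neq0; first by rewrite gt_eqF.
  by apply: contraTneq pD => ->; rewrite mul0r ltxx.
have := orient_ph hMS cw oP szx uz EE; rewrite JE /= bx0 dz pmulr_rlt0 // => ->.
congr (_ (+) _); rewrite DD; move: pD; move: (\det _) D' => d1 d2 pD; apply/idP/idP => h0; nra.
Qed.

(** The orientation [D] of the chart contributes to the interior and to the boundary sign alike and
    drops out; only the sign of [A], which does not depend on the chart, remains. *)
Lemma chart_agrees (ov : M -> 'M[R]_(q.+1, n) -> bool) (ow : M -> 'M[R]_(q, n) -> bool) :
  is_orientation (Wminus Phi v) ov -> is_orientation (Wminus Phi w) ow ->
  exists2 r : R, 0 < r & forall p p' : 'rV[R]_q.+1, ball (0 : 'rV[R]_q.+1) r p -> ball (0 : 'rV[R]_q.+1) r p' ->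
    0 < p 0 0 -> p' 0 0 = 0 ->
    (ov (e p) (outward_first (jac e p)) == ow (e p') (row' 0 (jac e p'))) =
    ((osign h Phi v ov == osign h Phi w ow) == (0 < A)).
Proof.
move=> oPv oPw; have [r r0 Hr] := near_ball (near_and (interior_sign oPv) (boundary_sign oPw)).
exists r => // p p' /Hr[Hp _] /Hr[_ Hp'] p0 p'0; rewrite Hp // Hp' //.
have Dn0 := zc_nondegenerate; rewrite -/D in Dn0.
have [Ap|An|E] := ltrgtP 0 A; last by move: A0; rewrite -E eqxx.
  by rewrite pmulr_llt0 //; case: (osign _ _ _ _); case: (osign _ _ _ _); case: (D < 0).
have -> : (D * A < 0) = ~~ (D < 0) by rewrite nmulr_llt0 // -leNgt le_eqVlt eq_sym (negbTE Dn0).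
by case: (osign _ _ _ _); case: (osign _ _ _ _); case: (D < 0).
Qed.
End Collared.
End WithSection.

Lemma corner_chart_sign (ov : M -> 'M[R]_(q.+1, n) -> bool) (ow : M -> 'M[R]_(q, n) -> bool) :
  is_orientation (Wminus Phi v) ov -> is_orientation (Wminus Phi w) ow ->
  exists2 r : R, 0 < r & forall p p' : 'rV[R]_q.+1, ball (0 : 'rV[R]_q.+1) r p -> ball (0 : 'rV[R]_q.+1) r p' ->
    0 < p 0 0 -> p' 0 0 = 0 ->
    (ov (e p) (outward_first (jac e p)) == ow (e p') (row' 0 (jac e p'))) =
    ((osign h Phi v ov == osign h Phi w ow) == (0 < adet x1 (Jw h Phi v w q x1))).
Proof.
move=> oPv oPw; have [sg [sg0 sgP sgK]] := F0_section.
have [T' [y [m [Xh [P [[sm m0] [sX sP] [sy y0] nA nB]]]]]] := collar sgK.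
eapply chart_agrees; eassumption.
Qed.

End OneChart.

Lemma row_split_eq k (z z' : 'rV[R]_(1 + k)) : z 0 0 = z' 0 0 -> rsubmx z = rsubmx z' -> z = z'.
Proof.
move=> E rE; rewrite -[z]hsubmxK -[z']hsubmxK rE; congr (row_mx _ _).
by rewrite [LHS]mx11_scalar [RHS]mx11_scalar !lsubmx00 E.
Qed.

Lemma h_flow_continuous z : continuous (fun t => h (Phi t z)).
Proof.
move=> t; apply: differentiable_continuous; apply/derivable1_diffP; exact: (h_flow_derive hMS z t).1.
Qed.

Lemma h_flow_reach z (t1 t2 c : R) : h (Phi t2 z) < c -> c < h (Phi t1 z) -> exists2 t, t1 < t < t2 & h (Phi t z) = c.
Proof.
move=> c2 c1; have t12 : t1 <= t2.
  by rewrite leNgt; apply/negP => /ltW tt; have := gf_h_mono gf z tt; rewrite leNgt (lt_trans c2 c1).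
have cc0 : {within `[t1, t2], continuous (fun t => h (Phi t z))}.
  by apply: continuous_subspaceT => t; exact: h_flow_continuous.
have [|t /itvP ti tE] := IVT t12 cc0 (v := c).
  by rewrite ge_min le_max (ltW c2) (ltW c1) orbT.
exists t => //; rewrite !lt_neqAle !ti !andbT; apply/andP; split.
  by apply/eqP => E; move: c1; rewrite E tE ltxx.
by apply/eqP => E; move: c2; rewrite -E tE ltxx.
Qed.

Lemma Wminus_reach v' z (c : R) : Wminus Phi v' z -> h z < c -> c < h v' -> exists2 t, t < 0 & h (Phi t z) = c.
Proof.
move=> Wz zc cv'; have chv : {for v', continuous h} by exact: (gf_h gf).
have n1 : \forall x \near v', c < h x by exact: (cvgr_gt (h v') chv).
have n2 : \forall t \near -oo%R, c < h (Phi t z) by exact: (Wz _ n1).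
have [t1 ct] := filter_ex n2.
by have [|t /andP[_ t0] tE] := @h_flow_reach z t1 0 c _ ct; [rewrite (gf0 gf)|exists t].
Qed.

(** * Existence of a boundary chart *)

Section StandardChart.
Variable sg : 'rV[R]_q -> 'rV[R]_q.+1.
Hypothesis sg0 : sg 0 = x1.
Hypothesis sgP : \forall xi \near (0 : 'rV[R]_q), [/\ smooth_at sg xi, sg xi *m x1^T = 1%:M & F0 (sg xi) = xi].
Let rs (p : 'rV[R]_q.+1) : 'rV[R]_q := rsubmx (p : 'rV[R]_(1 + q)).
Let yy (p : 'rV[R]_q.+1) := sg (p 0 0 *: rs p).
(** The coordinates are [(s, x)]: for [s > 0] the image is the exit point near [w] of the orbit in
    direction [sg (s *: x)], for [s = 0] the point [x] of the unstable manifold of [w], preceded by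
    the orbit [gam]. *)
Let Ep (p : 'rV[R]_q.+1) := exitpt T1 (p 0 0) (rs p) (pt (yy p)).
Let e (p : 'rV[R]_q.+1) : M := param (cc h Phi w) (Ep p).
Let F (p : 'rV[R]_q.+1) : seq (set M) * M := (if p 0 0 == 0 then [:: gam] else [::], e p).

Let srs p : smooth_at rs p. Proof.
have H : smooth_at (fun z : 'rV[R]_(1 + q) => rsubmx z) (p : 'rV[R]_(1 + q)).
  by apply: smooth_rsubmx; exact: smooth_id.
exact: H.
Qed.
Let sp0 p : smooth_at (fun p : 'rV[R]_q.+1 => p 0 0) p. Proof. by apply: smooth_coef; exact: smooth_id. Qed.
Let sxi p : smooth_at (fun p : 'rV[R]_q.+1 => p 0 0 *: rs p) p.
Proof. by apply: smooth_scale; [exact: findim_rV|exact: sp0|exact: srs]. Qed.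
Let xi0 : (0 : 'rV[R]_q.+1) 0 0 *: rs 0 = 0. Proof. by rewrite mxE scale0r. Qed.
Let yy0 : yy 0 = x1. Proof. by rewrite /yy xi0. Qed.

Let syy : smooth_at yy 0.
Proof.
apply: (@smooth_comp _ _ _ _ (fun p : 'rV[R]_q.+1 => p 0 0 *: rs p) sg); [exact: findim_rV|exact: findim_rV|exact: sxi|].
by rewrite xi0; case: (nbhs_singleton sgP).
Qed.

Let spy : smooth_at (fun p => pt (yy p)) 0.
Proof. by apply: (@smooth_comp _ _ _ _ yy pt); [exact: findim_rV|exact: findim_rV|exact: syy|rewrite yy0; exact: pt_smooth]. Qed.

Let fp p := pt (yy p) - em n (pm q (pt (yy p))).
Let kp (p : 'rV[R]_q.+1) := p 0 0 * expR T1.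

Let sfp : smooth_at fp 0.
Proof.
apply: smooth_add; first exact: spy.
by under eq_fun do rewrite -scaleN1r; apply: scale_smooth; apply: em_smooth; apply: pm_smooth; exact: spy.
Qed.

Let skp : smooth_at kp 0. Proof. by apply: smooth_mul; [exact: sp0|exact: smooth_cst]. Qed.
Let sem : smooth_at (fun p => em n (rs p)) 0. Proof. by apply: em_smooth; exact: srs. Qed.
Let skf : smooth_at (fun p => kp p *: fp p) 0. Proof. by apply: smooth_scale; [exact: findim_rV|exact: skp|exact: sfp]. Qed.
Let sEp : smooth_at Ep 0. Proof. by apply: smooth_add; [exact: sem|exact: skf]. Qed.

Let pmE' p : pm q (Ep p) = rs p.
Proof.
have H (z : 'rV[R]_n) : pm q (z - em n (pm q z)) = 0 by rewrite /pm mulmxBl -/(pm q z) -/(pm q _) (emK wn) subrr.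
by rewrite /Ep /exitpt {1}/pm mulmxDl -scalemxAl -/(pm q (em n _)) -/(pm q (_ - _)) H (emK wn) scaler0 addr0.
Qed.

Let Ep0 (p : 'rV[R]_q.+1) : p 0 0 = 0 -> Ep p = em n (rs p).
Proof. by move=> p0; rewrite /Ep /exitpt p0 mul0r scale0r addr0. Qed.

(** The expanding part of [Ep] is [x] itself. In the direction of [s] the contracting part moves
    with velocity [expR T1 *: pt x1], nonzero because the orbit of [x1] does not consist of the
    critical point [w]. *)
Let row_free_Ep : row_free ('J Ep 0).
Proof.
rewrite -kermx_eq0; apply/eqP/row_matrixP => i; rewrite row0; set u := row i _.
have uJ : u *m 'J Ep 0 = 0 by rewrite -row_mul mulmx_ker row0.
have E1 := deriveEjacobian u (smooth_diff sEp); rewrite uJ in E1.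
have Drs : 'D_u rs 0 = rsubmx (u : 'rV[R]_(1 + q)) by exact: (@derive_rsub R 1 q 0 u).
have ur : rsubmx (u : 'rV[R]_(1 + q)) = 0.
  rewrite -Drs; have -> : rs = fun p => Ep p *m (pid_mx q : 'M[R]_(n, q)) by apply/funext => p; rewrite -pmE'.
  by apply: etrans (derive_mulmxr _ u (smooth_diff sEp)) _; rewrite E1 mul0mx.
have E2 := etrans (esym (smooth_deriveD u sem skf)) E1.
have E3 : 'D_u (fun p => em n (rs p)) 0 = 0.
  by apply: etrans (derive_mulmxr _ u (smooth_diff (srs 0))) _; rewrite Drs ur mul0mx.
rewrite E3 add0r (derive_scaleV u skp sfp) in E2.
have k0 : kp 0 = 0 by rewrite /kp mxE mul0r.
have Dk : 'D_u kp 0 = expR T1 * u 0 0.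
  have dm : derivable (fun p : 'rV[R]_q.+1 => p 0 0) 0 u by apply: diff_derivable; apply: smooth_diff; exact: sp0.
  have dc : derivable (cst (expR T1) : 'rV[R]_q.+1 -> R) 0 u by exact: derivable_cst.
  apply: (etrans (deriveM dm dc)); rewrite derive_cst scaler0 add0r; congr (_ * _).
  by rewrite -(@derive_rV _ _ _ id) ?derive_id //; exact: smooth_id.
have f0 : fp 0 = pt x1.
  rewrite /fp yy0; have -> : pm q (pt x1) = 0 by apply: nsq_eq0; rewrite -(sqn_pm wn); exact: pt_x1.1.
  by rewrite /em mul0mx subr0.
rewrite k0 scale0r addr0 Dk f0 in E2.
have u0 : u 0 0 = 0.
  move/eqP: E2; rewrite scaler_eq0 mulf_eq0 gt_eqF ?expR_gt0 //= (negbTE pt_x1_neq0) orbF => /eqP//.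
by rewrite -[LHS](row01K u0) ur mul0mx.
Qed.

Lemma near_row_free m1 (f : 'rV[R]_m1 -> 'rV[R]_n) : smooth_at f 0 -> row_free ('J f 0) ->
  \forall p \near (0 : 'rV[R]_m1), forall u : 'rV[R]_m1, u *m 'J f p = 0 -> u = 0.
Proof.
move=> sf /row_freeP[B JB].
have sd : smooth_at (fun p => \det ('J f p *m B)) 0.
  by apply: smooth_det; apply: smooth_mulmx => i j; [exact: smooth_jac|exact: smooth_cst].
have d0 : \det ('J f 0 *m B) != 0 by rewrite JB det1 oner_neq0.
have H := near_neq0 (smooth_cont sd) d0.
apply: filterS H => p dp u uJ.
have uu : 'J f p *m B \in unitmx by rewrite unitmxE unitfE.
by rewrite -(mulmxK uu u) mulmxA uJ !mul0mx.
Qed.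

Let good (p : 'rV[R]_q.+1) := [/\ smooth_at Ep p, inb (rr h Phi w) (Ep p), forall u : 'rV[R]_q.+1, u *m 'J Ep p = 0 -> u = 0,
  smooth_at yy p /\ F0 (yy p) = p 0 0 *: rs p /\ yy p *m x1^T = 1%:M & dom (cc h Phi w) (Phi T1 (ph h Phi v (yy p)))].

Let near_good : \forall p \near (0 : 'rV[R]_q.+1), good p.
Proof.
have E0 : Ep 0 = 0 by rewrite Ep0 ?mxE // /rs linear0 /em mul0mx.
have n1 := near_cont (P := inb (rr h Phi w)) (smooth_cont sEp).
have ib : inb (rr h Phi w) (Ep 0) by rewrite E0 /inb big1 ?exprn_gt0 ?(hc_r hw) // => j _; rewrite mxE expr0n.
have n2 := near_cont (P := fun xi : 'rV[R]_q => [/\ smooth_at sg xi, sg xi *m x1^T = 1%:M & F0 (sg xi) = xi]) (smooth_cont (sxi 0)).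
rewrite xi0 in n2.
have n3 := near_cont (P := fun y => gd h Phi w q T1 (ph h Phi v y)) (smooth_cont syy); rewrite yy0 in n3.
have n3' := n3 (near_ph hMS (P := gd h Phi w q T1) cv (near_gd hMS g1)).
have nrf := near_row_free sEp row_free_Ep.
apply: filterS3 (near_and (smooth_near sEp) (n1 (inb_near ib))) (near_and (n2 sgP) n3') (near_and nrf (smooth_near syy)).
move=> p [h1 h2] [[_ h3 h4] h5] [h6 h7].
split; [exact: h1|exact: h2|exact: h6|split; [exact: h7|by split]|exact: h5.1].
Qed.

Let e_bdry (p : 'rV[R]_q.+1) : good p -> p 0 0 = 0 -> e p = ph h Phi w (rs p).
Proof.
move=> [_ ib _ _ _] p0; rewrite /e Ep0 // in ib *; rewrite /ph (phi_small gf wn hw) //.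
by move: ib; rewrite /inb (sqn_split (idx_pred q)) (sqn_em wn) (sqnC_em n) addr0.
Qed.

Let e_flow (p : 'rV[R]_q.+1) : good p -> 0 < p 0 0 -> e p = Phi (- ln (p 0 0)) (ph h Phi v (yy p)).
Proof.
move=> [_ ib _ [_ [FE _]] dT] p0; rewrite /e; apply: esym; exact: (exit_flow hMS cw p0 dT FE ib).
Qed.

Let e_int (p : 'rV[R]_q.+1) : good p -> 0 < p 0 0 -> e p = ph h Phi v ((p 0 0)^-1 *: yy p).
Proof.
move=> gp p0; have E : expR (- ln (p 0 0)) = (p 0 0)^-1 by rewrite expRN lnK ?posrE.
by rewrite (e_flow gp p0) /ph (phi_flow gf mn hv) E.
Qed.

Lemma standard_chart : exists2 a, 0 < a & corner_chart h Phi v 1 a F e.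
Proof.
have sE0 : {for 0, continuous e}.
  have : smooth_into e 0; last by case.
  apply: (@smooth_into_comp _ _ _ _ _ Ep (param (cc h Phi w))); [exact: findim_rV|exact: sEp|].
  by apply: smooth_into_param; [exact: hc_smooth hw|apply/(hc_img hw); case: (nbhs_singleton near_good)].
have [r r0 Hr] := near_ball near_good; exists (r / 2); first by rewrite divr_gt0.
have gP (p : 'rV[R]_q.+1) : corner 1 (r / 2) p -> good p.
  move=> [cp _]; apply: Hr; rewrite -ball_normE /= sub0r normrN.
  have rr2 : r / 2 < r by lra.
  apply: le_lt_trans rr2; apply: normrV_le => [|j]; [by rewrite ltW // divr_gt0|exact: ltW].
have pP (p : 'rV[R]_q.+1) : corner 1 (r / 2) p -> 0 <= p 0 0 by case=> _ /(_ 0 isT).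
have se (p : 'rV[R]_q.+1) : good p -> smooth_into e p.
  move=> [sp ip _ _ _]; apply: (@smooth_into_comp _ _ _ _ _ Ep (param (cc h Phi w))); [exact: findim_rV|exact: sp|].
  by apply: smooth_into_param; [exact: hc_smooth hw|apply/(hc_img hw)].
split.
- split; [by case: cv|by rewrite divr_gt0].
- move=> p cp; have gp := gP p cp; have := pP p cp; rewrite le_eqVlt => /predU1P[p0|p0].
    rewrite /F -p0 eqxx; split.
      exists w; split; [by case: cw| |by rewrite (e_bdry gp (esym p0)); exact: (ph_Wminus hMS cw)].
      exists w; split=> //; first by case: cw.
        by split; [case: cv => _ ->; case: cw => _ ->|exact: hwv].
      exists (ph h Phi v x1) => //; split; [exact: (ph_Wminus hMS cv)|exact: Wx1].
    rewrite (_ : [set j : 'I_q.+1 | _ & _] = [set 0]%SET) ?cards1 //; apply/setP => j; rewrite !inE.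
    by apply/andP/eqP => [[j1 _]|->]; [apply/val_inj; move: j1; rewrite ltnS leqn0 => /eqP|rewrite -p0].
  rewrite /F gt_eqF //; split.
    exists v; split; [by case: cv| |by rewrite (e_int gp p0); exact: (ph_Wminus hMS cv)] => //.
  apply: esym; apply/eqP; rewrite cards_eq0; apply/eqP/setP => j; rewrite !inE; apply/negP => /andP[j1 pj].
  have j0 : j = 0 by apply/val_inj; move: j1; rewrite ltnS leqn0 => /eqP.
  by move: pj; rewrite j0 gt_eqF.
- move=> p p' cp cp'; have gp := gP p cp; have gp' := gP p' cp'; move=> [E1 E2].
  have iE : Ep p = Ep p'.
    have [_ i1 _ _ _] := gp; have [_ i2 _ _ _] := gp'.
    by move: (congr1 (cc h Phi w) E2); rewrite /e !(inb_K hw).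
  have rE : rs p = rs p' by rewrite -!pmE' iE.
  suff p0E : p 0 0 = p' 0 0.
    exact: (row_split_eq p0E rE).
  move: E1; have := pP p cp; have := pP p' cp'; rewrite !le_eqVlt => /predU1P[p'0|p'0] /predU1P[p0|p0].
  + by rewrite -p0 -p'0.
  + by rewrite -p'0 eqxx gt_eqF.
  + by rewrite -p0 eqxx (gt_eqF p'0).
  + move=> _; move: E2; rewrite (e_int gp p0) (e_int gp' p'0) => /(phi_inj gf mn hv) E.
    have [_ _ _ [_ [_ y1]] _] := gp; have [_ _ _ [_ [_ y2]] _] := gp'.
    move: (congr1 (fun z => (z *m x1^T) 0 0) E); rewrite -!scalemxAl y1 y2 !mxE eqxx !mulr1; exact: invr_inj.
- by move=> p cp; split; [exact: se (gP p cp)|].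
move=> p0 cp0; have gp0 := gP p0 cp0; split; last first.
  move=> u u0; left; apply: contraNneq u0 => uj; have [sp ip rf _ _] := gp0; apply/eqP; apply: rf.
  have ge := se p0 gp0.
  have dc : dom (cc h Phi w) (e p0) by apply: dom_param; exact/(hc_img hw).
  have sc : sfun (cc h Phi w) (e p0) by apply: sfun_chart => //; exact: hc_smooth hw.
  have J1 := jac_sfun_comp ge sc.
  have -> : 'J Ep p0 = 'J (cc h Phi w \o e) p0.
    apply: near_eq_jac; last exact: smooth_diff.
    have ni := near_cont (P := inb (rr h Phi w)) (smooth_cont sp) (inb_near ip).
    by apply: filterS ni => p ip'; rewrite /= /e (inb_K hw).
  by apply: etrans (congr1 (mulmx u) J1) _; rewrite mulmxA uj mul0mx.
move=> c [/andP[c1 c2] c3]; have ncr z : h z = c -> ~ crit h z by move=> hz cz; move: (c3 z cz); rewrite hz eqxx.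
(* The case in which the level is met on the half orbit that ends at [e p0]; the hitting time stays
   negative nearby, so the point remains on the track. *)
have lower t0 : t0 < 0 -> h (Phi t0 (e p0)) = c -> exists f, level_map h Phi (corner 1 (r / 2)) F c p0 f.
  move=> t00 tE; have nc : ~ crit h (Phi t0 (e p0)) by exact: ncr.
  have [f [tau [sf [ctau tau0] nf _]]] := level_map_ex hMS (se p0 gp0) nc.
  exists f; split; first exact: sf.
  have nt : \forall p \near p0, tau p < 0 by apply: (cvgr_lt (tau p0) ctau); rewrite tau0.
  apply: filterS2 nf nt => p [fE hf] tp cp; split; last by rewrite hf.
  rewrite /track /F /=; have H : [set Phi t (e p) | t in [set t : R | t <= 0]] (f p).
    by exists (tau p); [exact: ltW|rewrite fE].
  by case: ifP => _ //=; right.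
have := pP p0 cp0; rewrite le_eqVlt => /predU1P[p00|p00]; last first.
  have We : Wminus Phi v (e p0) by rewrite (e_int gp0 p00); exact: (ph_Wminus hMS cv).
  by have [t0 t00 tE] := Wminus_reach We c1 c2; exact: (lower t0).
have We : Wminus Phi w (e p0) by rewrite (e_bdry gp0 (esym p00)); exact: (ph_Wminus hMS cw).
have hwc : h w != c by apply: c3; case: cw.
move: hwc; rewrite neq_lt => /orP[hwc|hwc]; last by have [t0 t00 tE] := Wminus_reach We c1 hwc; exact: (lower t0).
have y0E : yy p0 = x1 by rewrite /yy -p00 scale0r.
(* For a level above [h w] at a boundary point, the level map must be taken along [gam] and
   therefore through the direction [yy]. *)
have [t0 tE] : exists t0, h (Phi t0 (ph h Phi v x1)) = c.
  have chw : {for w, continuous h} by exact: (gf_h gf).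
  have chv : {for v, continuous h} by exact: (gf_h gf).
  have n1 : \forall x \near w, h x < c by exact: (cvgr_lt (h w) chw).
  have n2 : \forall t \near +oo%R, h (Phi t (ph h Phi v x1)) < c by exact: (Wx1 n1).
  have n3 : \forall x \near v, c < h x by exact: (cvgr_gt (h v) chv).
  have n4 : \forall t \near -oo%R, c < h (Phi t (ph h Phi v x1)) by exact: (ph_Wminus hMS cv x1 n3).
  have [t2 ct2] := filter_ex n2; have [t1 ct1] := filter_ex n4.
  by have [t _ E] := h_flow_reach ct2 ct1; exists t.
have sgx : smooth_into (ph h Phi v (m := q.+1) \o yy) p0.
  by have [_ _ _ [syp _] _] := gp0; exact: (smooth_into_comp (findim_rV R q.+1) syp (ph_smooth hMS cv _)).
have nc : ~ crit h (Phi t0 ((ph h Phi v (m := q.+1) \o yy) p0)) by apply: ncr; rewrite /= y0E.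
have [f [tau [sf _ nf _]]] := level_map_ex hMS sgx nc.
exists f; split; first exact: sf.
have hE : h (e p0) < c by move: c1.
have nhe : \forall p \near p0, h (e p) < c.
  have ch : {for p0, continuous (h \o e)} by apply: (continuous_comp (se p0 gp0).1); exact: (gf_h gf).
  exact: (cvgr_lt (h (e p0)) ch).
apply: filterS2 nf nhe => p [fE hf] hep cp; have gp := gP p cp; rewrite /= y0E tE in hf.
split; last exact: hf.
rewrite /track /F /=; have := pP p cp; rewrite le_eqVlt => /predU1P[p'0|p'0].
  by rewrite -p'0 eqxx /=; left; exists (tau p) => //; rewrite fE /= /yy -p'0 scale0r sg0.
rewrite gt_eqF //=; have fE' : f p = Phi (tau p + ln (p 0 0)) (e p).
  by rewrite (e_flow gp p'0) -(gfD gf) addrK fE.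
exists (tau p + ln (p 0 0)); last by rewrite -fE'.
(* A point at level [c], which is above the level of [e p], comes before [e p] on the orbit and so
   lies on the track. *)
rewrite /= leNgt; apply/negP => /ltW tt; have := gf_h_mono gf (e p) tt.
by rewrite -fE' hf (gf0 gf) leNgt hep.
Qed.

Lemma standard_chart_boundary (p : 'rV[R]_q.+1) : p 0 0 = 0 -> (F p).1 = [:: gam].
Proof. by move=> p0; rewrite /F /= p0 eqxx. Qed.
End StandardChart.

Lemma corner_chart_shrink a a' F e : corner_chart h Phi v 1 a F e -> 0 < a' -> a' <= a ->
  @corner_chart R n M h Phi v q.+1 1 a' F e.
Proof.
move=> [[C0 a0] C2 C3 C4 C5] a'0 aa.
have cS p : corner 1 a' p -> @corner R 1 q.+1 a p.
  by move=> [c1 c2]; split=> // j; exact: lt_le_trans (c1 j) aa.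
split; first by split.
- by move=> p /cS; exact: C2.
- by move=> p p' /cS cp /cS cp'; exact: C3.
- by move=> p /cS; exact: C4.
move=> p /cS cp; have [L1 L2] := C5 p cp.
have LS c f : level_map h Phi (corner 1 a) F c p f -> level_map h Phi (corner 1 a') F c p f.
  by move=> [sf nf]; split; [exact: sf|apply: filterS nf => p' H /cS; exact: H].
split=> [c rc|u u0]; first by have [f lf] := L1 c rc; exists f; exact: LS.
by have [H|[c [f [rc lf uf]]]] := L2 u u0; [left|right; exists c, f; split=> //; exact: LS].
Qed.

(** Any chart has the sign given by [corner_chart_sign], which proves one direction. The other needs
    a chart, and the standard one is shrunk until that sign holds on all of it. *)
Lemma orientation_agreement (ov : M -> 'M[R]_(q.+1, n) -> bool) (ow : M -> 'M[R]_(q, n) -> bool) :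
  is_orientation (Wminus Phi v) ov -> is_orientation (Wminus Phi w) ow ->
  (exists (a : R) (F : 'rV[R]_q.+1 -> seq (set M) * M) (e : 'rV[R]_q.+1 -> M),
    [/\ corner_chart h Phi v 1 a F e,
        (forall p, corner 1 a p -> p 0 0 = 0 -> (F p).1 = [:: gam]) &
        (forall p p', corner 1 a p -> 0 < p 0 0 -> corner 1 a p' -> p' 0 0 = 0 ->
           ov (e p) (outward_first (jac e p)) = ow (e p') (row' 0 (jac e p')))]) <->
  (osign h Phi v ov == osign h Phi w ow) = (0 < adet x1 (Jw h Phi v w q x1)).
Proof.
move=> oPv oPw; split.
  move=> [a [F [e [CC FB H]]]]; have [r r0 Hr] := corner_chart_sign CC FB oPv oPw.
  have a0 : 0 < a by case: CC => -[].
  pose t := Num.min a r / 2; have m0 : 0 < Num.min a r by rewrite lt_min a0.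
  have t0 : 0 < t by rewrite divr_gt0.
  have : t < Num.min a r by rewrite /t; lra.
  rewrite lt_min => /andP[ta tr].
  pose p : 'rV[R]_q.+1 := \row_j t; have nt : `|t| = t by rewrite gtr0_norm.
  have cp : corner 1 a p by split=> j; rewrite mxE ?nt // ltW.
  have c0 : corner 1 a (0 : 'rV[R]_q.+1) by split=> j; rewrite mxE ?normr0.
  have bp : ball (0 : 'rV[R]_q.+1) r p.
    rewrite -ball_normE /= sub0r normrN; apply: le_lt_trans tr.
    by apply: normrV_le => [|j]; rewrite ?mxE ?nt // ltW.
  have p0 : 0 < p 0 0 by rewrite mxE.
  have := Hr p 0 bp (ballxx _ r0) p0 (mxE _ _ _ _).
  by rewrite (H _ _ cp p0 c0 (mxE _ _ _ _)) eqxx => /esym/eqP.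
move=> agree; have [sg [sg0 sgP _]] := F0_section.
have [a a0 CC] := standard_chart sg0 sgP.
have FB := fun p (_ : corner 1 a p) => standard_chart_boundary sg (p := p).
have [r r0 Hr] := corner_chart_sign CC FB oPv oPw.
have m0 : 0 < Num.min a (r / 2) by rewrite lt_min a0 divr_gt0.
(* A corner of size [r / 2] lies in the open ball of radius [r] for the sup norm. *)
exists (Num.min a (r / 2)); eexists; eexists; split.
- by apply: (corner_chart_shrink CC) => //; rewrite ge_min lexx.
- by move=> p _; exact: standard_chart_boundary.
move=> p p' cp p0 cp' p'0.
have bS z : corner 1 (Num.min a (r / 2)) z -> ball (0 : 'rV[R]_q.+1) r z.
  move=> [cz _]; rewrite -ball_normE /= sub0r normrN.
  have h2 : r / 2 < r by lra.
  apply: le_lt_trans h2; apply: normrV_le => [|j]; first by rewrite ltW // divr_gt0.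
  by apply: ltW; apply: lt_le_trans (cz j) _; rewrite ge_min lexx orbT.
apply/eqP; rewrite (Hr _ _ (bS _ cp) (bS _ cp') p0 p'0); exact/eqP.
Qed.
End CornerCharts.

(** * The value of [epsilon] *)

Section Epsilon.
Variables (R : realType) (n : nat) (M : manifold R n).
Variables (h : M -> R) (X : vector_field M) (Phi : R -> M -> M).
Hypothesis hMS : morse_smale h X Phi.
Hypothesis cM : closed_manifold M.
Variable O : forall v : M, M -> 'M[R]_(morse_index h v, n) -> bool.
Hypothesis OP : unstable_orientations Phi O.
Let gf := ms_gflow hMS.

Definition pm1 (b : bool) : int := if b then 1 else -1.

Lemma pm1_eq a b : pm1 (a == b) = pm1 a * pm1 b. Proof. by case: a b => -[]. Qed.

Lemma pm1_sqr b : pm1 b * pm1 b = 1. Proof. by case: b. Qed.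

Definition csign (v : M) : bool := osign h Phi v (@O v).

Lemma osign_cast v r m (E : m = r) (o : M -> 'M[R]_(r, n) -> bool) :
  osign h Phi v (fun x (B : 'M[R]_(m, n)) => o x (castmx (E, erefl n) B)) = osign h Phi v o.
Proof. by case: r / E o => o; rewrite /osign castmx_id. Qed.

(** The prescribed orientations enter only through one sign per critical point. For the intermediate
    point of a broken orbit this factor will occur twice and cancel. *)
Lemma epsilon_sign v w q (x1 : 'rV[R]_q.+1) : cip h v q.+1 -> cip h w q -> nsq x1 = 1 ->
  Wplus Phi w (ph h Phi v x1) ->
  epsilon Phi O v w (flow_orbit Phi (ph h Phi v x1)) =
  pm1 (csign v) * pm1 (csign w) * pm1 (0 < adet x1 (Jw h Phi v w q x1)).
Proof.
move=> cv [cw wE]; move: wE cv x1 => <- cv x1 nx1 Wx1.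
have cw' : cip h w (morse_index h w) by [].
rewrite -!pm1_eq /epsilon; have E : (morse_index h w).+1 = morse_index h v by case: cv.
have oPv := is_orientation_cast E (OP cv.1).
have agree := orientation_agreement hMS cM cv cw' nx1 Wx1 oPv (OP cw).
rewrite osign_cast -/(csign v) -/(csign w) in agree.
have -> : `[< boundary_agrees Phi O v w (flow_orbit Phi (ph h Phi v x1)) >] =
    ((csign v == csign w) == (0 < adet x1 (Jw h Phi v w (morse_index h w) x1))).
  apply/asboolP/eqP.
    by move=> [E' [a [F [e [H1 H2 H3]]]]]; rewrite (eq_irrelevance E' E) in H3; apply/agree; exists a, F, e.
  by move/agree => [a [F [e [H1 H2 H3]]]]; exists E, a, F, e.
by [].
Qed.

(** The flow scales both the parameter space and the values of [st] by the same exponential, so it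
    does not change the Jacobian. *)
Lemma Jw_scale v w m k (x : 'rV[R]_m) t : cip h v m -> cip h w k -> Wplus Phi w (ph h Phi v x) ->
  Jw h Phi v w k (expR t *: x) = Jw h Phi v w k x.
Proof.
move=> cv cw Wx; have hv := cip_hyp hMS cv; have mn := cip_le cv.
have k0 : expR t != 0 by exact: (lt0r_neq0 (expR_gt0 t)).
have phE (y : 'rV[R]_m) : ph h Phi v (expR t *: y) = Phi t (ph h Phi v y) by rewrite /ph (phi_flow gf mn hv).
have Wtx : Wplus Phi w (ph h Phi v (expR t *: x)) by rewrite phE; exact: (Wplus_flow gf).
set T := gT h Phi w k (ph h Phi v x); have gT1 := gTP hMS cw Wx; rewrite -/T in gT1.
have gT2 : gd h Phi w k (T - t) (ph h Phi v (expR t *: x)).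
  by move: gT1; rewrite /gd /Defs.dom phE /= /good -!(gfD gf) subrK.
rewrite (JwE hMS cv cw gT2 Wtx) /Jw -/T /Jst.
set f := st h Phi w k (T - t) \o ph h Phi v (m := m); set g := st h Phi w k T \o ph h Phi v (m := m).
have sf : smooth_at f (expR t *: x) by apply: (st_ph_smooth hMS cv cw); case: gT2.
have sg : smooth_at g x by apply: (st_ph_smooth hMS cv cw); case: gT1.
have fE : f \o (fun y => y *m (expR t)%:M) = fun y => g y *m (expR t)%:M.
  apply/funext => y; rewrite /f /g /= !mul_mx_scalar phE; exact: (stab_flow gf).
have sm : smooth_at (fun y : 'rV[R]_m => y *m (expR t)%:M) x by apply: smooth_mulmxr; exact: smooth_id.
have sf' : smooth_at f (x *m (expR t)%:M) by rewrite mul_mx_scalar.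
have J1 := jac_comp (smooth_diff sm) (smooth_diff sf').
have J2 := jac_mulmxr (expR t)%:M (smooth_diff sg).
rewrite fE J2 (@jac_mulmxr _ _ _ _ id) ?jac_id ?mul1mx in J1; last by apply: smooth_diff; exact: smooth_id.
rewrite !mul_mx_scalar mul_scalar_mx in J1.
move: J1; move: ('J g x) ('J f _) => B1 B2 J1.
by rewrite -[B2]scale1r -(mulVf k0) -scalerA -J1 scalerA mulVf // scale1r.
Qed.

Lemma adet_scale k (a : R) (x : 'rV[R]_k.+1) (J : 'M[R]_(k.+1, k)) : adet (a *: x) J = a * adet x J.
Proof.
have E : (row_mx (a *: x)^T J : 'M[R]_(1 + k)) = row_mx x^T J *m block_mx a%:M 0 0 1%:M.
  by rewrite mul_row_block mulmx0 mulmx0 mulmx1 addr0 add0r linearZ /= mul_mx_scalar.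
by rewrite /adet E det_mulmx det_ublock det_scalar1 det1 mulr1 mulrC.
Qed.
End Epsilon.

(** * The covering: lifted flow, lifted unstable manifolds and end points of lifts *)

Section SmoothMaps.
Variables (R : realType) (m n : nat) (N : manifold R m) (M : manifold R n) (f : N -> M).
Hypothesis sf : smooth_map f.

Lemma smooth_map_continuous : continuous f.
Proof.
move=> x; have [cf _] := sf x; have dx := chart_at_dom x.
have cc0 := Defs.coord_continuous dx.
apply: (near_eq_continuous (f := (f \o param (chart_at x)) \o chart_at x)).
  by apply: filterS (near_dom dx) => y dy; rewrite /= coordK.
exact: (continuous_comp cc0 cf).
Qed.

Lemma sfun_smooth_map x : sfun (chart_at (f x) \o f) x.
Proof. by have [_] := sf x; rewrite /= coordK //; exact: chart_at_dom. Qed.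

Lemma smooth_into_map (V : normedModType R) (c : V -> N) t : smooth_into c t -> smooth_into (f \o c) t.
Proof.
move=> sc; split.
  by case: sc => cc0 _; apply: continuous_comp; [exact: cc0|exact: smooth_map_continuous].
have H := sfun_comp (findim_rV R n) sc (sfun_smooth_map (c t)); exact: H.
Qed.

Lemma velocity_map (c : R -> N) t : smooth_into c t -> velocity (f \o c) t = velocity c t *m tangent_mx f (c t).
Proof.
by move=> sc; have H := velocity_sfun sc (sfun_smooth_map (c t)); rewrite {1}/velocity derive1E; exact: H.
Qed.
End SmoothMaps.

Section Covering.
Variables (R : realType) (n : nat) (Mt M : manifold R n) (G : groupType) (pi : covering G Mt M).

Lemma proj_continuous : continuous pi.
Proof. exact: (smooth_map_continuous (proj_local_diffeo pi).1). Qed.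

Lemma deck_continuous g : continuous (deck pi g).
Proof. exact: (smooth_map_continuous (deck_smooth pi g)). Qed.

Lemma proj_deck g x : pi (deck pi g x) = pi x.
Proof. by apply: esym; apply/(proj_fiber pi); exists g. Qed.

Lemma tangent_proj_unit x : tangent_mx pi x \in unitmx.
Proof.
have [sp loc] := proj_local_diffeo pi; have [U [s [oU Ux oV sK ss]]] := loc x.
have Vx : (pi @` U) (pi x) by exists x.
have ssx := ss _ Vx; have sx := sK x Ux.
have sg : sfun (chart_at x \o s) (pi x).
  by move: ssx => [_]; rewrite /= coordK ?sx //; exact: chart_at_dom.
have sf := sp x; set p := chart_at x x in sf; have fp : (pi \o param (chart_at x)) p = pi x by rewrite /= coordK //; exact: chart_at_dom.
have sg' : sfun (chart_at x \o s) ((pi \o param (chart_at x)) p) by rewrite fp.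
have J1 := jac_sfun_comp sf sg'; rewrite fp in J1.
have J2 : jac (pi \o param (chart_at x)) p = tangent_mx pi x by rewrite /jac fp.
have J3 : 'J ((chart_at x \o s) \o (pi \o param (chart_at x))) p = 1%:M.
  rewrite -(jac_id p); apply: esym; apply: near_eq_jac; last by apply: smooth_diff; exact: smooth_id.
  have dp : (chart_at x @` dom (chart_at x)) p by exact: (ex_intro2 _ _ x (chart_at_dom x) erefl).
  have cp := param_continuous dp.
  have n1 := near_cont (P := U) cp; rewrite coordK in n1; last exact: chart_at_dom.
  have n2 := near_img (chart_at_dom x).
  apply: filterS2 (n1 (open_nbhs_nbhs (conj oU Ux))) n2 => y Uy iy.
  have E : s (pi (param (chart_at x) y)) = param (chart_at x) y := sK _ Uy.
  by apply: esym; apply: etrans (congr1 (chart_at x) E) _; exact: paramK.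
have J4 := etrans (esym J1) J3.
exact: (mulmx1_unit (etrans (congr1 (mulmx^~ _) (esym J2)) J4)).1.
Qed.

Lemma sheet x : exists (U : set Mt) (s : M -> Mt), [/\ open U, U x, open (pi @` U),
  (forall y, U y -> s (pi y) = y) & (forall z, (pi @` U) z -> {for z, continuous s})].
Proof.
have [_ loc] := proj_local_diffeo pi; have [U [s [oU Ux oV sK ss]]] := loc x.
exists U, s; split=> // z Vz; have [cs _] := ss z Vz; have dz := chart_at_dom z.
apply: (near_eq_continuous (f := (s \o param (chart_at z)) \o chart_at z)).
  by apply: filterS (near_dom dz) => y dy; rewrite /= coordK.
exact: (continuous_comp (Defs.coord_continuous dz) cs).
Qed.

Lemma unique_lift (a b : R -> Mt) t0 : continuous a -> continuous b ->
  (forall t, pi (a t) = pi (b t)) -> a t0 = b t0 -> forall t, a t = b t.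
Proof.
move=> ca cb E E0; apply: (real_clopen (S := [set t | a t = b t]) E0); last exact: closed_eq_fun.
rewrite openE => t /= Et; have [U [s [oU Ux _ sK _]]] := sheet (a t).
have n1 : \forall u \near t, U (a u) by apply: (near_cont (ca t)); exact: open_nbhs_nbhs.
have n2 : \forall u \near t, U (b u) by apply: (near_cont (cb t)); apply: open_nbhs_nbhs; rewrite -Et.
apply: filterS2 n1 n2 => u Ua Ub /=; by rewrite -(sK _ Ua) -(sK _ Ub) E.
Qed.

Variables (h : M -> R) (X : vector_field M) (Phi : R -> M -> M) (Phit : R -> Mt -> Mt).
Hypothesis hMS : morse_smale h X Phi.
Hypothesis ft : is_flow (lift_vector_field pi X) Phit.
Let gf := ms_gflow hMS.

Lemma proj_flow t x : pi (Phit t x) = Phi t (pi x).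
Proof.
have sp := (proj_local_diffeo pi).1.
suff E : (fun t => pi (Phit t x)) = (Phi^~ (pi x)) by exact: (congr1 (fun f => f t) E).
apply: (integral_curve_unique (ms_smooth hMS) (t0 := 0)).
- move=> u; have [sc vc] := flow_integral_curve ft x u; split; first exact: (smooth_into_map sp sc).
  apply: (etrans (velocity_map sp sc)); rewrite vc /lift_vector_field mulmxKV //; exact: tangent_proj_unit.
- exact: (flow_integral_curve (ms_flow hMS)).
by rewrite (flow0 ft) (gf0 gf).
Qed.

Lemma lift_flow_continuous x : continuous (Phit^~ x).
Proof.
move=> t; apply: (@continuous_comp _ _ _ (fun t : R => (t, x)) (fun p : R * Mt => Phit p.1 p.2)).
  by apply: pair_continuous; [exact: cvg_id|exact: cst_continuous].
exact: (flow_continuous ft).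
Qed.

Lemma lift_flow_continuous2 t : continuous (Phit t).
Proof.
move=> x; apply: (@continuous_comp _ _ _ (fun x : Mt => (t, x)) (fun p : R * Mt => Phit p.1 p.2)).
  by apply: pair_continuous; [exact: cst_continuous|exact: cvg_id].
exact: (flow_continuous ft).
Qed.

Lemma continuous_shift (f : R -> Mt) s : continuous f -> continuous (fun t => f (t + s)).
Proof.
move=> cf t; apply: (@continuous_comp _ _ _ (fun t : R => t + s) f); last exact: cf.
by apply: smooth_cont; apply: smooth_add; [exact: smooth_id|exact: smooth_cst].
Qed.

(** The group law is inherited from [M]: both sides are lifts of one orbit and agree at [s = 0]. *)
Lemma lift_flowD s t x : Phit (s + t) x = Phit s (Phit t x).
Proof.
apply: (unique_lift (a := fun s => Phit (s + t) x) (b := Phit^~ (Phit t x)) (t0 := 0)).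
- by apply: (continuous_shift (f := Phit^~ x)); exact: lift_flow_continuous.
- exact: lift_flow_continuous.
- by move=> u; rewrite !proj_flow (gfD gf).
by rewrite add0r (flow0 ft).
Qed.

Lemma lift_flowK t x : Phit (- t) (Phit t x) = x.
Proof. by rewrite -lift_flowD addNr (flow0 ft). Qed.

Lemma deck_flow g t x : Phit t (deck pi g x) = deck pi g (Phit t x).
Proof.
apply: (unique_lift (a := Phit^~ (deck pi g x)) (b := fun t => deck pi g (Phit t x)) (t0 := 0)).
- exact: lift_flow_continuous.
- move=> u; apply: (@continuous_comp _ _ _ (Phit^~ x) (deck pi g)); [exact: lift_flow_continuous|exact: deck_continuous].
- by move=> u; rewrite !(proj_flow, proj_deck).
by rewrite !(flow0 ft).
Qed.

Lemma fiber_deck x y : pi x = pi y -> exists g, x = deck pi g y.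
Proof. by move=> /esym/(proj_fiber pi). Qed.

Lemma deck_cvg g (f : R -> Mt) (F : set_system R) (FF : Filter F) x :
  f @ F --> x -> (fun t => deck pi g (f t)) @ F --> deck pi g x.
Proof. by move=> fx; exact: (cvg_comp _ _ fx (deck_continuous (x := x))). Qed.

Lemma lift_Wplus_deck g x y : Wplus Phit x y -> Wplus Phit (deck pi g x) (deck pi g y).
Proof.
move=> Wy; rewrite /Wplus /=; under eq_fun do rewrite deck_flow; exact: deck_cvg.
Qed.

Lemma lift_Wminus_deck g x y : Wminus Phit x y -> Wminus Phit (deck pi g x) (deck pi g y).
Proof.
move=> Wy; rewrite /Wminus /=; under eq_fun do rewrite deck_flow; exact: deck_cvg.
Qed.

Lemma proj_Wplus x y : Wplus Phit x y -> Wplus Phi (pi x) (pi y).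
Proof.
move=> Wy; rewrite /Wplus /=; under eq_fun do rewrite -proj_flow.
exact: (cvg_comp _ _ Wy (proj_continuous (x := x))).
Qed.

Lemma proj_Wminus x y : Wminus Phit x y -> Wminus Phi (pi x) (pi y).
Proof.
move=> Wy; rewrite /Wminus /=; under eq_fun do rewrite -proj_flow.
exact: (cvg_comp _ _ Wy (proj_continuous (x := x))).
Qed.

Lemma lift_Wplus_unique x x' y : Wplus Phit x y -> Wplus Phit x' y -> x = x'.
Proof. exact: (cvg_unique (@manifold_hausdorff _ _ Mt)). Qed.

Lemma lift_Wplus_flow x y t : Wplus Phit x (Phit t y) <-> Wplus Phit x y.
Proof.
have key s z : Wplus Phit x z -> Wplus Phit x (Phit s z).
  move=> Wz; rewrite /Wplus /=; under eq_fun do rewrite -lift_flowD.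
  apply: (@cvg_comp _ _ _ (fun u : R => u + s) (Phit^~ z) _ +oo%R); last exact: Wz.
  by apply: cvg_addrr.
split=> [/(key (- t))|]; last exact: key.
by rewrite lift_flowK.
Qed.

Section Lift.
Variables (vt : Mt) (m : nat).
Hypothesis cv : cip h (pi vt) m.
Let hv := cip_hyp hMS cv.
Let mn := cip_le cv.

(** Near the origin a local section of the projection lifts [ph]. An arbitrary [x] is first
    contracted into that neighbourhood by the scalar [k x], lifted there, and carried back by the
    lifted flow for the time [ln (k x)]. *)
Lemma lift_ex : exists f : 'rV[R]_m -> Mt, [/\ f 0 = vt, continuous f & forall x, pi (f x) = ph h Phi (pi vt) x].
Proof.
have [U [s [oU Ux oV sK cs]]] := sheet vt.
have p0 : ph h Phi (pi vt) (0 : 'rV[R]_m) = pi vt by exact: (phi0 gf mn hv).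
have cph : {for (0 : 'rV[R]_m), continuous (ph h Phi (pi vt) (m := m))} by exact: (phc hMS cv).
have nV := near_cont (P := pi @` U) cph; rewrite p0 in nV.
have [rho rho0 Hrho] := near_ball (nV (open_nbhs_nbhs (conj oV (ex_intro2 _ _ vt Ux erefl)))).
(* Then [|x| / k x < rho], while [k 0 = 1] leaves the origin in place. *)
pose k (x : 'rV[R]_m) : R := 1 + `|x| / rho.
have k0 x : 0 < k x by rewrite ltr_pwDl // divr_ge0 // ltW.
have kb x : (pi @` U) (ph h Phi (pi vt) ((k x)^-1 *: x)).
  apply: Hrho; rewrite -ball_normE /= sub0r normrN normrZ gtr0_norm ?invr_gt0 //.
  by rewrite mulrC ltr_pdivrMr // /k mulrDr mulr1 mulrCA divff ?mulr1 ?ltrDr // gt_eqF.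
have ck : continuous k.
  move=> x; apply: (@continuous_comp _ _ _ (@Num.norm _ 'rV[R]_m) (fun u : R => 1 + u / rho)); first exact: norm_continuous.
  apply: smooth_cont; apply: smooth_add; first exact: smooth_cst.
  by apply: smooth_mul; [exact: smooth_id|exact: smooth_cst].
exists (fun x => Phit (ln (k x)) (s (ph h Phi (pi vt) ((k x)^-1 *: x)))); split.
- by rewrite /k normr0 mul0r addr0 ln1 invr1 scale1r (flow0 ft) p0 sK.
- move=> x; pose a x := s (ph h Phi (pi vt) ((k x)^-1 *: x)).
  apply: (@continuous_comp _ _ _ (fun x => (ln (k x), a x)) (fun p : R * Mt => Phit p.1 p.2)); last exact: (flow_continuous ft).
  apply: pair_continuous.
    by apply: (@continuous_comp _ _ _ k (@ln R)); [exact: ck|exact: continuous_ln].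
  apply: (@continuous_comp _ _ _ (fun x => ph h Phi (pi vt) ((k x)^-1 *: x)) s); last exact: cs (kb x).
  apply: (@continuous_comp _ _ _ (fun x => (k x)^-1 *: x) (ph h Phi (pi vt) (m := m))); last exact: (phc hMS cv).
  have ckv : {for x, continuous (fun x => (k x)^-1)}.
    apply: (@continuous_comp _ _ _ k (fun u : R => u^-1)); first exact: ck.
    by apply: smooth_cont; apply: smooth_inv; [rewrite gt_eqF|exact: smooth_id].
  exact: (cvgZ ckv cvg_id).
move=> x; rewrite proj_flow; have [y Uy yE] := kb x; rewrite -yE sK // yE.
by rewrite /ph (phi_flow gf mn hv) lnK ?posrE // scalerA divff ?scale1r // gt_eqF.
Qed.

Definition lift : 'rV[R]_m -> Mt := sval (cid lift_ex).

Lemma lift0 : lift 0 = vt. Proof. by case: (svalP (cid lift_ex)). Qed.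
Lemma lift_continuous : continuous lift. Proof. by case: (svalP (cid lift_ex)). Qed.
Lemma liftE x : pi (lift x) = ph h Phi (pi vt) x. Proof. by case: (svalP (cid lift_ex)). Qed.

Let cexp (x : 'rV[R]_m) : continuous (fun t : R => expR t *: x).
Proof. by move=> t; apply: cvgZr_tmp; exact: continuous_expR. Qed.

Lemma lift_flow t x : Phit t (lift x) = lift (expR t *: x).
Proof.
apply: (unique_lift (a := Phit^~ (lift x)) (b := fun t => lift (expR t *: x)) (t0 := 0)).
- exact: lift_flow_continuous.
- by move=> u; apply: (@continuous_comp _ _ _ (fun t : R => expR t *: x) lift); [exact: cexp|exact: lift_continuous].
- by move=> u; rewrite proj_flow !liftE /ph (phi_flow gf mn hv).
by rewrite (flow0 ft) expR0 scale1r.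
Qed.

Lemma lift_Wminus x : Wminus Phit vt (lift x).
Proof.
rewrite /Wminus /=; under eq_fun do rewrite lift_flow.
have H : (fun t : R => expR t *: x) @ -oo%R --> (0 : 'rV[R]_m).
  rewrite -(scale0r x); apply: cvgZr_tmp; apply/cvgNy_compNP; exact: cvgr_expR.
by have := cvg_comp _ _ H (lift_continuous (x := 0)); rewrite lift0.
Qed.

(** The projection of [z] has a parameter [x], so [z] is a translate of [lift x] by some [g]. Its
    backward limit is both [vt] and the translate of [vt], hence [g = 1] by freeness. *)
Lemma lift_surj z : Wminus Phit vt z -> exists x, z = lift x.
Proof.
move=> Wz; have [x zE] := Wminus_range gf mn hv (proj_Wminus Wz); exists x.
have [g gE] : exists g, z = deck pi g (lift x) by apply: fiber_deck; rewrite liftE zE.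
have Wg : Wminus Phit (deck pi g vt) (deck pi g (lift x)) by apply: lift_Wminus_deck; exact: lift_Wminus.
rewrite -gE in Wg.
have E : deck pi g vt = vt by exact: (cvg_unique (@manifold_hausdorff _ _ Mt) Wg Wz).
by rewrite gE (deck_free E) deck1.
Qed.

Lemma lift_inj : injective lift.
Proof. by move=> x y /(congr1 pi); rewrite !liftE => /(phi_inj gf mn hv). Qed.

Lemma lift_unique (f : R -> 'rV[R]_m) (b : R -> Mt) t0 : continuous f -> continuous b ->
  (forall t, pi (b t) = ph h Phi (pi vt) (f t)) -> b t0 = lift (f t0) -> forall t, b t = lift (f t).
Proof.
move=> cf cb E E0; apply: (unique_lift (b := fun t => lift (f t)) cb _ _ E0).
  by move=> t; apply: (@continuous_comp _ _ _ f lift); [exact: cf|exact: lift_continuous].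
by move=> t; rewrite liftE.
Qed.
End Lift.

Section Stable.
Variables (ut : Mt) (k : nat).
Hypothesis cu : cip h (pi ut) k.
Let hu := cip_hyp hMS cu.
Let c := cc h Phi (pi ut).
Let r := rr h Phi (pi ut).
Let s := @idx_pred n k.

(* The chart of [pi ut] is evenly covered near its centre, and the orbits of the local stable
   manifold stay there. *)
Lemma stable_sheet : exists (V : set M) (sg : M -> Mt), [/\ open V, V (pi ut), sg (pi ut) = ut,
  (forall z, V z -> {for z, continuous sg} /\ pi (sg z) = z) &
  (forall z, V z -> Wplus Phi (pi ut) z -> Wplus Phit ut (sg z))] /\
  exists2 d : R, 0 < d & forall p, inb d p -> inb r p /\ V (param c p).
Proof.
have [U [sg [oU Ux oV sK cs]]] := sheet ut; set V0 := pi @` U.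
have V0u : V0 (pi ut) by exists ut.
have c0 : {for (0 : 'rV[R]_n), continuous (param c)}.
  by apply: Defs.param_continuous; apply/(hc_img hu); rewrite /inb big1 ?exprn_gt0 ?(hc_r hu) // => j _; rewrite mxE expr0n.
have nV := near_cont (P := V0) c0; rewrite (param0 hu) in nV.
have [e e0 He] := near_ball (nV (open_nbhs_nbhs (conj oV V0u))).
pose d := Num.min (e / 2) (r / 2).
have d0 : 0 < d by rewrite lt_min !divr_gt0 // (hc_r hu).
have de : d < e by apply: (@le_lt_trans _ _ (e / 2)); [rewrite ge_min lexx|lra].
have dr : d < r by have := hc_r hu; rewrite -/r => r0; apply: (@le_lt_trans _ _ (r / 2)); [rewrite ge_min lexx orbT|lra].
have db p : inb d p -> inb r p /\ V0 (param c p).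
  rewrite /inb => pd; split; first by apply: lt_trans pd _; rewrite ltr_pXn2r ?nnegrE ?ltW //; apply: lt_trans dr.
  apply: He; rewrite -ball_normE /= sub0r normrN; apply: le_lt_trans de.
  apply: normrV_le => [|j]; first exact: ltW.
  have : p 0 j ^+ 2 <= d ^+ 2.
    apply: le_trans (ltW pd); rewrite (bigD1 j) //= lerDl; apply: sumr_ge0 => i _; exact: sqr_ge0.
  by rewrite -real_normK ?num_real // ler_pXn2r ?nnegrE ?normr_ge0 // ltW.
pose V := [set z | [/\ dom c z, inb (d / 2) (c z) & V0 z]].
have inbS (p : 'rV[R]_n) : inb (d / 2) p -> inb d p.
  by rewrite /inb => pd; apply: lt_trans pd _; rewrite ltr_pXn2r ?nnegrE ?ltW ?divr_gt0 //; lra.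
have d20 : 0 < d / 2 by rewrite divr_gt0.
have piK z : V0 z -> pi (sg z) = z by move=> [y Uy <-]; rewrite sK.
exists V, sg; split; last first.
  exists (d / 2) => // p pd; have [h1 h2] := db p (inbS p pd); split; first exact: h1.
  split; [exact: (inb_dom hu h1)|by rewrite (inb_K hu h1)|exact: h2].
split.
- rewrite openE => z [dz iz Vz]; have cz := Defs.coord_continuous dz.
  have n1 := near_cont (P := inb (d / 2)) cz (inb_near iz).
  have n2 : \forall z' \near z, V0 z' by apply: open_nbhs_nbhs.
  by apply: filterS3 (near_dom dz) n1 n2 => z'.
- split; [exact: hc_dom hu|by rewrite (hc_0 hu) /inb big1 ?exprn_gt0 // => j _; rewrite mxE expr0n|exact: V0u].
- exact: sK.
- by move=> z [_ _ Vz]; split; [exact: cs|exact: piK].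
move=> z [dz iz Vz] Wz.
have bz : box s r (c z).
  have sq p : sqn s p + sqn (predC s) p < (d / 2) ^+ 2 -> box s r p.
    have h1 := sqn_ge0 s p; have h2 := sqn_ge0 (predC s) p => h3.
    have dd : (d / 2) ^+ 2 <= r ^+ 2 / 2.
      have H : d / 2 <= r / 2 by lra.
      have H2 : (d / 2) ^+ 2 <= (r / 2) ^+ 2 by rewrite ler_pXn2r ?nnegrE ?divr_ge0 // ltW // (hc_r hu).
      have H3 : (r / 2) ^+ 2 = r ^+ 2 / 4 by field.
      have := sqr_ge0 r => H4; rewrite H3 in H2; lra.
    split; lra.
  by apply: sq; rewrite -sqn_split.
have s0 : sqn s (c z) = 0 by apply/(stable_boxP gf hu bz); rewrite coordK.
(* The absolute value extends the forward orbit to the whole line, as [unique_lift] requires,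
   without leaving the evenly covered set. *)
pose p (t : R) := linflow s `|t| (c z).
have ip t : inb (d / 2) (p t).
  rewrite /inb (sqn_split s) sqn_linflow sqn_linflowC s0 mulr0 add0r.
  have h2 := sqn_ge0 (predC s) (c z).
  apply: le_lt_trans iz; rewrite (sqn_split s) s0 add0r ler_piMl // exprn_ile1 ?expR_ge0 //.
have fE t : Phi `|t| z = param c (p t).
  rewrite -{1}(coordK (c := c) dz) (hc_flow hu) //; [exact: (box_inb bz)|].
  exact: (db _ (inbS _ (ip t))).1.
have Vt (t : R) : V0 (Phi `|t| z) by rewrite fE; exact: (db _ (inbS _ (ip t))).2.
have cPhi : continuous (fun t : R => Phi `|t| z).
  move=> t; apply: (@continuous_comp _ _ _ (fun t : R => (`|t|, z)) (fun p : R * M => Phi p.1 p.2)); last exact: (gf_cont gf).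
  by apply: pair_continuous; [exact: norm_continuous|exact: cst_continuous].
have E := unique_lift (a := fun t => Phit `|t| (sg z)) (b := fun t => sg (Phi `|t| z)) (t0 := 0).
have {}E (t : R) : Phit `|t| (sg z) = sg (Phi `|t| z).
  apply: E.
  - move=> u; apply: (@continuous_comp _ _ _ (@Num.norm _ R) (Phit^~ (sg z))); [exact: norm_continuous|exact: lift_flow_continuous].
  - by move=> u; apply: (@continuous_comp _ _ _ (fun t : R => Phi `|t| z) sg); [exact: cPhi|exact: (cs _ (Vt u))].
  - by move=> u; rewrite proj_flow piK // piK.
  by rewrite normr0 (flow0 ft) (gf0 gf).
have H : (fun t => sg (Phi t z)) @ +oo%R --> sg (pi ut) by exact: (cvg_comp _ _ Wz (cs _ V0u)).
rewrite sK // in H.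
apply: cvg_trans H; apply: near_eq_cvg.
near=> t; have t0 : 0 <= t by near: t; exact: nbhs_pinfty_ge.
by rewrite -(ger0_norm t0) E.
Unshelve. all: by end_near.
Qed.

Lemma stable_open : exists W : set Mt, [/\ open W, W ut & forall z, W z -> Wplus Phi (pi ut) (pi z) -> Wplus Phit ut z].
Proof.
have [V [sg [[oV Vu sgu Vs VW] _]]] := stable_sheet.
have [U [s' [oU Ux _ sK' _]]] := sheet ut.
pose W : set Mt := [set z : Mt | \forall z' \near z, [/\ U (z' : Mt), V (pi z') & U (sg (pi z'))]].
have cp : {for ut, continuous pi} by exact: proj_continuous.
have nW : W ut.
  have cs : {for ut, continuous (sg \o pi)} by apply: continuous_comp; [exact: proj_continuous|exact: (Vs _ Vu).1].
  have n2 := near_cont (P := V) cp (open_nbhs_nbhs (conj oV Vu)).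
  have n3 := near_cont (P := U) cs; rewrite /= sgu in n3.
  by apply: filterS3 (open_nbhs_nbhs (conj oU Ux)) n2 (n3 (open_nbhs_nbhs (conj oU Ux))) => z'.
exists W; split=> //.
  by rewrite openE => z /nbhs_interior; apply: filterS.
move=> z /nbhs_singleton[Uz Vz Usz] Wz.
have -> : z = sg (pi z) by rewrite -[LHS](sK' _ Uz) -[RHS](sK' _ Usz) (Vs _ Vz).2.
exact: VW.
Qed.

(** The projected orbit eventually enters the evenly covered set; there the lifted orbit is a deck
    translate of the section, and so it converges to the same translate of [ut]. *)
Lemma stable_end z : Wplus Phi (pi ut) (pi z) -> exists2 u', pi u' = pi ut & Wplus Phit u' z.
Proof.
move=> Wz; have [V [sg [[oV Vu sgu Vs VW] _]]] := stable_sheet.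
have nV : \forall t \near +oo%R, V (Phi t (pi z)) by apply: Wz; exact: open_nbhs_nbhs.
have [T VT] := filter_ex nV.
have [g gE] : exists g, Phit T z = deck pi g (sg (Phi T (pi z))).
  by apply: fiber_deck; rewrite proj_flow (Vs _ VT).2.
exists (deck pi g ut); first exact: proj_deck.
apply/(lift_Wplus_flow _ _ T); rewrite gE; apply: lift_Wplus_deck; apply: VW => //.
exact: (Wplus_flow gf).
Qed.
End Stable.

(** At a late time the orbit of [z0] lies in an open set around its limit [u'], and so do the nearby
    orbits; each of them whose projection is stable converges to [u']. *)
Lemma stable_locally_constant ut k z0 : cip h (pi ut) k -> Wplus Phi (pi ut) (pi z0) ->
  \forall z \near z0, Wplus Phi (pi ut) (pi z) -> (Wplus Phit ut z <-> Wplus Phit ut z0).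
Proof.
move=> cu Wz0; have [u' u'E Wu'] := stable_end cu Wz0.
have cu' : cip h (pi u') k by rewrite u'E.
have [W [oW Wu HW]] := stable_open cu'.
have nW : \forall t \near +oo%R, W (Phit t z0) by apply: Wu'; exact: open_nbhs_nbhs.
have [T WT] := filter_ex nW.
have cT : {for z0, continuous (Phit T)} by exact: lift_flow_continuous2.
have n1 := near_cont (P := W) cT (open_nbhs_nbhs (conj oW WT)).
apply: filterS n1 => z Wz pz.
have Wz' : Wplus Phit u' z.
  apply/(lift_Wplus_flow _ _ T); apply: (HW _ Wz).
  by rewrite proj_flow u'E; exact: (Wplus_flow gf).
split=> H; first by rewrite (lift_Wplus_unique H Wz').
by rewrite (lift_Wplus_unique H Wu').
Qed.
End Covering.

(** * Constancy of the lifted end point across a broken orbit *)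

Section EndLabels.
Variables (R : realType) (n : nat) (Mt M : manifold R n) (G : groupType) (pi : covering G Mt M).
Variables (h : M -> R) (X : vector_field M) (Phi : R -> M -> M) (Phit : R -> Mt -> Mt).
Hypothesis hMS : morse_smale h X Phi.
Hypothesis ft : is_flow (lift_vector_field pi X) Phit.
Let gf := ms_gflow hMS.

Lemma local_lift_eq (T : topologicalType) (a b : T -> Mt) x : {for x, continuous a} -> {for x, continuous b} ->
  (\forall y \near x, pi (a y) = pi (b y)) -> a x = b x -> \forall y \near x, a y = b y.
Proof.
move=> ca cb E Ex; have [U [s [oU Ux _ sK _]]] := sheet pi (a x).
have n1 := near_cont (P := U) ca (open_nbhs_nbhs (conj oU Ux)).
have n2 : \forall y \near x, U (b y) by apply: (near_cont cb); apply: open_nbhs_nbhs; rewrite -Ex.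
by apply: filterS3 E n1 n2 => y Ey Ua Ub; rewrite -(sK _ Ua) -(sK _ Ub) Ey.
Qed.

(* [sg] is a section over the ball of radius [d] of the chart around [w], with value [wt] at [w]. *)
Definition chart_section (w : M) (wt : Mt) (d : R) (sg : M -> Mt) : Prop := sg w = wt /\
  forall p, inb d p -> [/\ inb (rr h Phi w) p, {for param (cc h Phi w) p, continuous sg} &
    pi (sg (param (cc h Phi w) p)) = param (cc h Phi w) p].

(** The radius depends on [w] only: sections with other values at [w] are deck translates of one
    section. It can thus be fixed before the intermediate lift is known. *)
Lemma chart_section_ex w k : cip h w k ->
  exists2 d : R, 0 < d & forall wt, pi wt = w -> exists sg, chart_section w wt d sg.
Proof.
move=> cw; have [w0 w0E] := proj_surj pi w.
have cw0 : cip h (pi w0) k by rewrite w0E.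
have [V [sg [[_ _ sg0 Vs _] [d d0 Hd]]]] := stable_sheet hMS ft cw0.
rewrite w0E in sg0 Hd; exists d => // wt wtE.
have [g gE] : exists g, wt = deck pi g w0 by apply: fiber_deck; rewrite wtE.
exists (fun z => deck pi g (sg z)); split; first by rewrite sg0 gE.
move=> p /Hd[ip Vp]; have [cs ps] := Vs _ Vp; split=> //.
  by apply: continuous_comp; [exact: cs|exact: deck_continuous].
by rewrite proj_deck.
Qed.

Variables (vt wt ut : Mt) (m k j : nat).
Hypotheses (cv : cip h (pi vt) m) (cw : cip h (pi wt) k) (cu : cip h (pi ut) j).
Let hv := cip_hyp hMS cv.
Let hw := cip_hyp hMS cw.
Let mn := cip_le cv.
Let kn := cip_le cw.
Let v := pi vt.
Let w := pi wt.
Let u := pi ut.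
Let lv := lift hMS ft cv.
Let lw := lift hMS ft cw.
Let c := cc h Phi w.
Let s := @idx_pred n k.
Variables (d : R) (sg : M -> Mt).
Hypotheses (d0 : 0 < d) (sgP : chart_section w wt d sg).
Variables (x1 : 'rV[R]_m) (y1 : 'rV[R]_k).
Hypotheses (Wx1 : Wplus Phit wt (lv x1)) (Wy1 : Wplus Phi u (ph h Phi w y1)) (y1s : 4 * nsq y1 <= d ^+ 2).

Let Wx1' : Wplus Phi w (ph h Phi v x1).
Proof. by rewrite -(liftE hMS ft cv); exact: (proj_Wplus hMS ft). Qed.

Let inb_small p : sqn s p <= d ^+ 2 / 2 -> sqn (predC s) p < d ^+ 2 / 2 -> inb d p.
Proof. by move=> h1 h2; rewrite /inb (sqn_split s); lra. Qed.

Let cphi p : inb d p -> {for p, continuous (param c)}.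
Proof. by move=> /(sgP.2)[ip _ _]; apply: Defs.param_continuous; exact/(hc_img hw). Qed.

Let csg p : inb d p -> {for p, continuous (fun p => sg (param c p))}.
Proof. by move=> ip; apply: continuous_comp; [exact: cphi|case: (sgP.2 p ip)]. Qed.

(* Late on the orbit of [x1] the lift follows the section [sg]. *)
Lemma late_time : exists T : R, [/\ gd h Phi w k T (ph h Phi v x1), inb (d / 2) (c (Phi T (ph h Phi v x1))) &
  Phit T (lv x1) = sg (Phi T (ph h Phi v x1))].
Proof.
have W1 : Wplus Phi w (ph h Phi v x1) := Wx1'.
have n1 : \forall T \near +oo%R, gd h Phi w k T (ph h Phi v x1) := good_ex hw W1.
have cw0 : {for w, continuous c} by apply: Defs.coord_continuous; exact: hc_dom hw.
have iz : inb (d / 2) (c w) by rewrite (hc_0 hw) /inb big1 ?exprn_gt0 ?divr_gt0 // => i _; rewrite mxE expr0n.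
have n2 := near_cont (P := inb (d / 2)) cw0 (inb_near iz).
have n2' : \forall T \near +oo%R, inb (d / 2) (c (Phi T (ph h Phi v x1))) by exact: (W1 _ n2).
have [U [s' [oU Ux _ sK' _]]] := sheet pi wt.
have n3 : \forall T \near +oo%R, U (Phit T (lv x1)) by apply: Wx1; exact: open_nbhs_nbhs.
have i0 : inb d (0 : 'rV[R]_n) by rewrite /inb big1 ?exprn_gt0 // => i _; rewrite mxE expr0n.
have csw : {for w, continuous sg} by have [_ H _] := sgP.2 _ i0; rewrite (param0 hw) in H.
have n4 := near_cont (P := U) csw; rewrite sgP.1 in n4.
have n4' : \forall T \near +oo%R, U (sg (Phi T (ph h Phi v x1))).
  by exact: (W1 _ (n4 (open_nbhs_nbhs (conj oU Ux)))).
have [T [[gT1 iT] [UT UsT]]] := filter_ex (filterI (filterI n1 n2') (filterI n3 n4')).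
exists T; split=> //; rewrite -(sK' _ UT) -[RHS](sK' _ UsT); congr s'.
rewrite (proj_flow hMS ft) (liftE hMS ft cv) -(coordK (c := c) gT1.1).
have iT' : inb d (c (Phi T (ph h Phi v x1))).
  by move: iT; rewrite /inb => H; apply: lt_trans H _; rewrite ltr_pXn2r ?nnegrE ?ltW ?divr_gt0 //; have := d0; lra.
by have [_ _ ->] := sgP.2 _ iT'.
Qed.

Lemma section_lift : sg (param c (em n y1)) = lw y1.
Proof.
(* A path from 0 to [y1] inside the chart, parametrized by the whole line in order to apply
   [lift_unique]. *)
pose kap (t : R) := Num.min `|t| 1.
have ck : continuous kap.
  move=> t; apply: continuous_min; [exact: norm_continuous|exact: cst_continuous].
have k01 t : 0 <= kap t <= 1 by rewrite le_min normr_ge0 ler01 /= ge_min lexx orbT.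
have ns t : nsq (kap t *: y1) <= nsq y1.
  rewrite nsqZ ler_piMl ?nsq_ge0 // exprn_ile1 //; by case/andP: (k01 t).
have ib t : inb d (em n (kap t *: y1)).
  apply: inb_small; rewrite ?(sqn_em kn) ?(sqnC_em n) ?divr_gt0 ?exprn_gt0 //.
  by have := ns t; have := y1s; have := nsq_ge0 y1; lra.
have pE t : ph h Phi w (kap t *: y1) = param c (em n (kap t *: y1)).
  have [ip _ _] := sgP.2 _ (ib t); rewrite /ph (phi_small gf kn hw) //.
  by move: ip; rewrite /inb (sqn_split s) (sqn_em kn) (sqnC_em n) addr0.
have cf : continuous (fun t => kap t *: y1) by move=> t; apply: cvgZr_tmp; exact: ck.
have E := @lift_unique R n Mt M G pi h X Phi Phit hMS ft wt k cw (fun t => kap t *: y1) (fun t => sg (param c (em n (kap t *: y1)))) 0 cf.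
have k1 : kap 1 = 1 by rewrite /kap normr1 minxx.
have k0 : kap 0 = 0 by rewrite /kap normr0 min_l.
have := E _ _ _ 1; rewrite k1 scale1r; apply.
- move=> t; apply: (@continuous_comp _ _ _ (fun t => em n (kap t *: y1)) (fun p => sg (param c p))); last exact: csg.
  apply: (@continuous_comp _ _ _ (fun t => kap t *: y1) (fun x : 'rV[R]_k => em n x)); first exact: cf.
  by apply: smooth_cont; apply: em_smooth; exact: smooth_id.
- by move=> t; have [_ _ ->] := sgP.2 _ (ib t); rewrite -pE.
by rewrite k0 scale0r /em mul0mx (param0 hw) sgP.1 lift0.
Qed.

(** A lifted orbit that starts near [x1] follows the section [sg] during its passage and leaves near
    the lift of [y1]. Since it is stable for [u], local constancy gives it the same end point as the
    second half of the broken orbit. *)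
Lemma end_label : exists2 e : R, 0 < e & forall (y : 'rV[R]_m) (t : R) (x : 'rV[R]_k),
  Wplus Phi u (ph h Phi v y) -> `|y - x1| < e -> 0 < t < e -> `|x - y1| < e ->
  st h Phi w k (gT h Phi w k (ph h Phi v x1)) (ph h Phi v y) = t *: x ->
  (Wplus Phit ut (lv y) <-> Wplus Phit ut (lw y1)).
Proof.
have [T [gT1 iT TE]] := late_time.
pose pt (y : 'rV[R]_m) := c (Phi T (ph h Phi v y)).
have cpt : {for x1, continuous pt}.
  apply: (@continuous_comp _ _ _ (fun y => Phi T (ph h Phi v y)) c).
    apply: (@continuous_comp _ _ _ (ph h Phi v (m := m)) (Phi T)); [exact: (phc hMS cv)|exact: (gf_contt gf)].
  by apply: Defs.coord_continuous; exact: gT1.1.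
have id2 (p : 'rV[R]_n) : inb (d / 2) p -> inb d p.
  by move=> H; apply: lt_trans H _; rewrite ltr_pXn2r ?nnegrE ?ltW ?divr_gt0 //; have := d0; lra.
have m1 : \forall y \near x1, gd h Phi w k T (ph h Phi v y) by exact: (near_ph hMS (P := gd h Phi w k T) cv (near_gd hMS gT1)).
have m2 : \forall y \near x1, inb (d / 2) (pt y) by exact: (near_cont cpt (inb_near iT)).
have m3 : \forall y \near x1, st h Phi w k (gT h Phi w k (ph h Phi v x1)) (ph h Phi v y) = st h Phi w k T (ph h Phi v y).
  have H := stab_indep gf kn hw Wx1' (gTP hMS cw Wx1') gT1.
  exact: (near_ph hMS (P := fun z => st h Phi w k (gT h Phi w k (ph h Phi v x1)) z = st h Phi w k T z) cv H).
have m4 : \forall y \near x1, Phit T (lv y) = sg (Phi T (ph h Phi v y)).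
  apply: local_lift_eq; [| | |exact: TE].
  - by apply: (@continuous_comp _ _ _ lv (Phit T)); [exact: lift_continuous|exact: (lift_flow_continuous2 ft)].
  - apply: (@continuous_comp _ _ _ (fun y => Phi T (ph h Phi v y)) sg).
      apply: (@continuous_comp _ _ _ (ph h Phi v (m := m)) (Phi T)); [exact: (phc hMS cv)|exact: (gf_contt gf)].
    by have [_ H _] := sgP.2 _ (id2 _ iT); rewrite coordK in H; [exact: H|exact: gT1.1].
  apply: filterS2 m1 m2 => y gy iy; rewrite (proj_flow hMS ft) (liftE hMS ft cv) -/v.
  by rewrite -(coordK (c := c) gy.1); have [_ _ ->] := sgP.2 _ (id2 _ iy).
have ns1 : nsq y1 < 2 * (d ^+ 2 / 4).
  have := exprn_gt0 2 d0 => dd; have := y1s; lra.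
have m5 : \forall x \near y1, nsq x < 2 * (d ^+ 2 / 4).
  exact: (cvgr_lt (nsq y1) (@nsq_continuous R k y1) _ ns1).
have LC : \forall z \near lw y1, Wplus Phi u (pi z) -> (Wplus Phit ut z <-> Wplus Phit ut (lw y1)).
  by apply: (stable_locally_constant hMS ft cu); rewrite (liftE hMS ft cw).
pose ex (z : R * 'rV[R]_k * 'rV[R]_m) := exitpt T z.1.1 z.1.2 (pt z.2).
have exE : ex (0, y1, x1) = em n y1 by rewrite /ex /exitpt /= mul0r scale0r addr0.
have cex : {for (0, y1, x1), continuous ex}.
  have c1 : {for ((0, y1, x1) : R * 'rV[R]_k * 'rV[R]_m), continuous (fun z : R * 'rV[R]_k * 'rV[R]_m => em n z.1.2)}.
    apply: (@continuous_comp _ _ _ (fun z : R * 'rV[R]_k * 'rV[R]_m => z.1.2) (fun x : 'rV[R]_k => em n x)).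
      by apply: (@continuous_comp _ _ _ fst snd); [exact: cvg_fst|exact: cvg_snd].
    by apply: smooth_cont; apply: em_smooth; exact: smooth_id.
  have c2 : {for ((0, y1, x1) : R * 'rV[R]_k * 'rV[R]_m), continuous (fun z : R * 'rV[R]_k * 'rV[R]_m => z.1.1 * expR T)}.
    apply: (@continuous_comp _ _ _ (fun z : R * 'rV[R]_k * 'rV[R]_m => z.1.1) (fun r : R => r * expR T)).
      by apply: (@continuous_comp _ _ _ fst fst); exact: cvg_fst.
    by apply: smooth_cont; apply: smooth_mul; [exact: smooth_id|exact: smooth_cst].
  have c3 : {for ((0, y1, x1) : R * 'rV[R]_k * 'rV[R]_m), continuous (fun z : R * 'rV[R]_k * 'rV[R]_m => pt z.2 - em n (pm k (pt z.2)))}.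
    apply: (@continuous_comp _ _ _ (fun z : R * 'rV[R]_k * 'rV[R]_m => pt z.2) (fun p => p - em n (pm k p))).
      by apply: (@continuous_comp _ _ _ snd pt); [exact: cvg_snd|exact: cpt].
    apply: smooth_cont; apply: smooth_add; first exact: smooth_id.
    by under eq_fun do rewrite -scaleN1r; apply: scale_smooth; apply: em_smooth; apply: pm_smooth; exact: smooth_id.
  exact: (cvgD c1 (cvgZ c2 c3)).
have iy1 : inb d (em n y1).
  apply: inb_small; rewrite ?(sqn_em kn) ?(sqnC_em n) ?divr_gt0 ?exprn_gt0 //; have := nsq_ge0 y1; have := y1s; lra.
have cH : {for (0, y1, x1), continuous (fun z => sg (param c (ex z)))}.
  by apply: (@continuous_comp _ _ _ ex (fun p => sg (param c p))); [exact: cex|rewrite exE; exact: csg].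
have mH := near_cont (P := fun z => Wplus Phi u (pi z) -> (Wplus Phit ut z <-> Wplus Phit ut (lw y1))) cH.
rewrite exE section_lift in mH.
have [e1 e10 H1] := near_ball (near_and (near_and m1 m2) (near_and m3 m4)).
have [e2 e20 H2] := near_ball m5; have [e3 e30 H3] := near_ball (mH LC).
have eT : 0 < expR (- T) by exact: expR_gt0.
exists (Num.min (Num.min e1 e2) (Num.min e3 (expR (- T)))); first by rewrite !lt_min e10 e20 e30.
move=> y t x Wy; rewrite !lt_min => /andP[/andP[y1_ _] /andP[y3 _]] /andP[t0 /andP[_ /andP[t3 tT]]].
move=> /andP[/andP[_ x2] /andP[x3 _]] stE.
have [|[gy iy] [sy Ey]] := H1 y; first by rewrite -ball_normE /= distrC.
have nx := H2 x (_ : ball y1 e2 x); rewrite -ball_normE /= distrC in nx; have {}nx := nx x2.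
rewrite {}sy in stE.
(* The time from the entrance at [T] to the exit at [- ln t]; it is nonnegative because
   [t < expR (- T)]. *)
pose tau := - ln t - T.
have tau0 : 0 <= tau.
  rewrite /tau subr_ge0 -(expRK T) -lnV ?posrE //; rewrite -ler_expR !lnK ?posrE ?invr_gt0 ?expR_gt0 //.
  rewrite -[expR T]invrK -expRN lef_pV2 ?posrE //; exact: ltW.
have pmE : pm k (pt y) = (t * expR T) *: x.
  rewrite mulrC -scalerA -stE /st /stab scalerA -expRD subrr expR0 scale1r //.
have et : expR tau * (t * expR T) = 1.
  by rewrite /tau expRD expRN lnK ?posrE // expRN mulrACA mulVf ?mulVf ?mul1r ?gt_eqF ?expR_gt0.
have eN : expR (- tau) = t * expR T.
  by rewrite expRN -[LHS]mulr1 -et mulKf // gt_eqF // expR_gt0.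
have linE : linflow s tau (pt y) = exitpt T t x (pt y).
  by rewrite (linflow_split cw) /exitpt pmE scalerA et scale1r eN.
have lin0 : linflow s 0 (pt y) = pt y by rewrite (linflow_split cw) oppr0 expR0 !scale1r addrC subrK.
pose kap (r : R) := Num.min `|r| tau.
have ck : continuous kap by move=> r; apply: continuous_min; [exact: norm_continuous|exact: cst_continuous].
have kr r : 0 <= kap r <= tau by rewrite le_min normr_ge0 tau0 /= ge_min lexx orbT.
have k0 : kap 0 = 0 by rewrite /kap normr0 min_l.
have k1 : kap tau = tau by rewrite /kap ger0_norm // minxx.
have ilin r : inb d (linflow s (kap r) (pt y)).
  have /andP[r0 r1] := kr r; apply: inb_small.
    rewrite sqn_linflow (sqn_pm kn).
    apply: (@le_trans _ _ (expR tau ^+ 2 * nsq (pm k (pt y)))).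
      by rewrite ler_wpM2r ?nsq_ge0 // ler_pXn2r ?nnegrE ?expR_ge0 // ler_expR.
    by rewrite -nsqZ pmE scalerA et scale1r; lra.
  rewrite sqn_linflowC.
  have h2 := sqn_ge0 (predC s) (pt y); have h3 := sqn_ge0 s (pt y).
  have h4 : sqn (predC s) (pt y) < d ^+ 2 / 2.
    move: iy; rewrite /inb (sqn_split s); have dd := exprn_gt0 2 d0.
    have -> : (d / 2) ^+ 2 = d ^+ 2 / 4 by field.
    lra.
  apply: le_lt_trans h4; rewrite ler_piMl // exprn_ile1 ?expR_ge0 //.
  by rewrite expR_le1 oppr_le0.
have flE r : Phi (kap r) (Phi T (ph h Phi v y)) = param c (linflow s (kap r) (pt y)).
  rewrite -(coordK (c := c) gy.1) -/(pt y) (hc_flow hw) //; first by case: (sgP.2 _ (id2 _ iy)).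
  by case: (sgP.2 _ (ilin r)).
have HE : Phit tau (Phit T (lv y)) = sg (param c (ex (t, x, y))).
  have E := unique_lift (pi := pi) (a := fun r => Phit (kap r) (Phit T (lv y)))
    (b := fun r => sg (param c (linflow s (kap r) (pt y)))) (t0 := 0).
  have := E _ _ _ _ tau; rewrite k1 linE; apply.
  - by move=> r; apply: (@continuous_comp _ _ _ kap (Phit^~ (Phit T (lv y)))); [exact: ck|exact: (lift_flow_continuous ft)].
  - move=> r; apply: (@continuous_comp _ _ _ (fun r => linflow s (kap r) (pt y)) (fun p => sg (param c p))); last exact: csg (ilin r).
    apply: (@continuous_comp _ _ _ kap (fun r => linflow s r (pt y))); first exact: ck.
    have -> : (fun r => linflow s r (pt y)) = fun r => em n (expR r *: pm k (pt y)) + expR (- r) *: (pt y - em n (pm k (pt y))).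
      by apply/funext => r'; exact: (linflow_split cw).
    apply: smooth_cont; apply: smooth_add.
      apply: em_smooth; apply: smooth_scale; [exact: findim_rV|exact: smooth_expR|exact: smooth_cst].
    apply: smooth_scale; [exact: findim_rV| |exact: smooth_cst].
    by under eq_fun do rewrite expRN; apply: smooth_inv; [rewrite gt_eqF // expR_gt0|exact: smooth_expR].
  - move=> r; rewrite !(proj_flow hMS ft) (liftE hMS ft cv) flE; by have [_ _ ->] := sgP.2 _ (ilin r).
  by rewrite k0 (flow0 ft) Ey lin0 /pt coordK //; exact: gy.1.
have B3 : ball ((0, y1, x1) : R * 'rV[R]_k * 'rV[R]_m) e3 (t, x, y).
  by split; [split|]; rewrite -ball_normE /= ?sub0r ?normrN ?gtr0_norm // distrC.
have Wp : Wplus Phi u (pi (sg (param c (ex (t, x, y))))).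
  rewrite -HE !(proj_flow hMS ft) (liftE hMS ft cv); do 2 apply: (Wplus_flow gf); exact: Wy.
have K := H3 _ B3 Wp; rewrite -HE in K.
have K1 := lift_Wplus_flow hMS ft ut (Phit T (lv y)) tau; have K2 := lift_Wplus_flow hMS ft ut (lv y) T.
by split=> [/K2/K1/K|/K/K1/K2].
Qed.
End EndLabels.

From mathcomp Require Import finmap.

Lemma mul_shuffle (a b c d e : int) : a * b * c * (b * d * e) = b * b * (a * d * (c * e)).
Proof. ring. Qed.

(** * Incidence numbers on the covering and their quadratic relation *)

Section Incidence.
Variables (R : realType) (n : nat) (Mt M : manifold R n) (G : groupType) (pi : covering G Mt M).
Variables (h : M -> R) (X : vector_field M) (Phi : R -> M -> M) (Phit : R -> Mt -> Mt).
Hypothesis hMS : morse_smale h X Phi.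
Hypothesis cM : closed_manifold M.
Hypothesis ft : is_flow (lift_vector_field pi X) Phit.
Variable O : forall v : M, M -> 'M[R]_(morse_index h v, n) -> bool.
Hypothesis OP : unstable_orientations Phi O.
Let gf := ms_gflow hMS.

(** A version of [lift] without a proof argument, so that it can be applied to a varying
    intermediate point; the default value is irrelevant for critical points of index [m]. *)
Definition liftc (vt : Mt) (m : nat) : 'rV[R]_m -> Mt :=
  if pselect (cip h (pi vt) m) is left cv then lift hMS ft cv else fun=> vt.

Lemma liftcE vt m (cv : cip h (pi vt) m) : @liftc vt m = lift hMS ft cv.
Proof. by rewrite /liftc; case: pselect => // cv'; rewrite (Prop_irrelevance cv' cv). Qed.

Lemma nsq_pos k (x : 'rV[R]_k) : x != 0 -> 0 < nsq x.
Proof. by move=> x0; rewrite lt_neqAle nsq_ge0 andbT eq_sym; apply: contraNneq x0 => /nsq_eq0 ->. Qed.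

(* The unique rescaling by the flow to the sphere of radius [rho]. *)
Lemma rescale k (x : 'rV[R]_k) (rho : R) : 0 < rho -> x != 0 -> exists t, nsq (expR t *: x) = rho ^+ 2.
Proof.
move=> r0 x0; have s0 : 0 < Num.sqrt (nsq x) by rewrite sqrtr_gt0 nsq_pos.
exists (ln (rho / Num.sqrt (nsq x))); rewrite nsqZ lnK ?posrE ?divr_gt0 // expr_div_n sqr_sqrtr ?nsq_ge0 //.
by rewrite divfK // gt_eqF // nsq_pos.
Qed.

Lemma epsilon_nonunit v w q (x : 'rV[R]_q.+1) : cip h v q.+1 -> cip h w q -> x != 0 ->
  Wplus Phi w (ph h Phi v x) ->
  epsilon Phi O v w (flow_orbit Phi (ph h Phi v x)) =
  pm1 (csign Phi O v) * pm1 (csign Phi O w) * pm1 (0 < adet x (Jw h Phi v w q x)).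
Proof.
move=> cv cw x0 Wx; have [t nt] := rescale ltr01 x0; rewrite expr1n in nt.
have E : ph h Phi v (expR t *: x) = Phi t (ph h Phi v x) by rewrite /ph (phi_flow gf (cip_le cv) (cip_hyp hMS cv)).
have Wt : Wplus Phi w (ph h Phi v (expR t *: x)) by rewrite E; exact: (Wplus_flow gf).
have -> : flow_orbit Phi (ph h Phi v x) = flow_orbit Phi (ph h Phi v (expR t *: x)).
  apply/seteqP; split=> z [s _ <-]; [exists (s - t) => //|exists (s + t) => //].
    by rewrite E -(gfD gf) subrK.
  by rewrite E -(gfD gf).
by rewrite (epsilon_sign hMS cM OP cv cw nt Wt) (Jw_scale hMS t cv cw Wx) adet_scale pmulr_rgt0 // expR_gt0.
Qed.

Section Pair.
Variables (vt wt : Mt) (m : nat).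
Hypotheses (cv : cip h (pi vt) m.+1) (cw : cip h (pi wt) m).
Let lv := @liftc vt m.+1.

(** Each lifted orbit crosses the sphere of radius [rho] in the parameter space exactly once, so
    these points enumerate the trajectories. The radius is free because the two halves of a broken
    orbit use different ones. *)
Definition ends (rho : R) : set 'rV[R]_m.+1 := [set x | nsq x = rho ^+ 2 /\ Wplus Phit wt (lv x)].

Lemma ends_Wplus x : Wplus Phit wt (lv x) -> Wplus Phi (pi wt) (ph h Phi (pi vt) x).
Proof. by rewrite /lv liftcE => /(proj_Wplus hMS ft); rewrite liftE. Qed.

Lemma ends_neq0 (rho : R) x : 0 < rho -> ends rho x -> x != 0.
Proof.
move=> r0 [nx _]; apply: contraTneq (exprn_gt0 2 r0) => x0.
by rewrite -nx x0 /nsq big1 ?ltxx // => i _; rewrite mxE expr0n.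
Qed.

Lemma lv_flow t x : Phit t (lv x) = lv (expR t *: x).
Proof. by rewrite /lv liftcE lift_flow. Qed.

Lemma orbit_flow t z : flow_orbit Phit (Phit t z) = flow_orbit Phit z.
Proof.
apply/seteqP; split=> y [s _ <-]; [exists (s + t) => //|exists (s - t) => //].
  by rewrite (lift_flowD hMS ft).
by rewrite -(lift_flowD hMS ft) subrK.
Qed.

Lemma ends_bij (rho : R) : 0 < rho ->
  set_bij (ends rho) (trajectories Phit vt wt) (fun x => flow_orbit Phit (lv x)).
Proof.
move=> r0; split.
- move=> x [nx Wx]; exists (lv x) => //; split=> //; rewrite /lv liftcE; exact: lift_Wminus.
- move=> x y /set_mem[nx Wx] /set_mem[ny Wy] E.
  have : flow_orbit Phit (lv y) (lv x) by rewrite -E; exists 0 => //; exact: (flow0 ft).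
  move=> [t _]; rewrite lv_flow /lv liftcE => /(@lift_inj _ _ _ _ _ _ _ _ _ _ hMS ft _ _ cv) xE.
  have e1 : expR t ^+ 2 = 1.
    have r2 := exprn_gt0 2 r0; have := nx; rewrite -xE nsqZ ny => /eqP.
    by rewrite -[X in _ == X]mul1r => /eqP/mulIf; apply; rewrite gt_eqF.
  have e2 : expR t = 1.
    by apply/eqP; rewrite -(@eqrXn2 _ 2) ?expR_ge0 // e1 expr1n.
  by rewrite -xE e2 scale1r.
move=> g [z [Wz Wz'] <-]; have [y zE] := lift_surj hMS ft cv Wz.
have y0 : y != 0.
  apply/eqP => y0; move: Wz'; rewrite zE y0 lift0 => Wv.
  have E : vt = wt.
    apply: (lift_Wplus_unique (y := vt)) Wv; rewrite /Wplus /=.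
    have F t : Phit t vt = vt by rewrite -{1}(lift0 hMS ft cv) lift_flow scaler0 lift0.
    under eq_fun do rewrite F; exact: cvg_cst.
  have [_ i1] := cv; have [_ i2] := cw; rewrite E i2 in i1.
  by move/eqP: i1; rewrite ltn_eqF.
have [t nt] := rescale r0 y0; exists (expR t *: y).
  by split=> //; rewrite -lv_flow; apply/(lift_Wplus_flow hMS ft); rewrite /lv liftcE -zE.
by rewrite -lv_flow orbit_flow /lv liftcE -zE.
Qed.

Lemma proj_orbit x : pi @` flow_orbit Phit (lv x) = flow_orbit Phi (ph h Phi (pi vt) x).
Proof.
have E t : pi (Phit t (lv x)) = Phi t (ph h Phi (pi vt) x) by rewrite (proj_flow hMS ft) /lv liftcE liftE.
apply/seteqP; split=> z.
  by move=> [y [t _ <-] <-]; rewrite E; exists t.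
by move=> [t _ <-]; rewrite -E; exists (Phit t (lv x)) => //; exists t.
Qed.

Lemma incidence_ends (rho : R) : 0 < rho ->
  incidence pi Phi Phit O vt wt = \sum_(x \in ends rho)
    pm1 (csign Phi O (pi vt)) * pm1 (csign Phi O (pi wt)) *
    pm1 (0 < adet x (Jw h Phi (pi vt) (pi wt) m x)).
Proof.
move=> r0; rewrite /incidence (reindex_fsbig _ _ _ _ (ends_bij r0)).
apply: eq_fsbigr => x /set_mem ex; rewrite proj_orbit (epsilon_nonunit cv cw (ends_neq0 r0 ex)) //.
by apply: ends_Wplus; case: ex.
Qed.

Lemma ends_finite (rho : R) : 0 < rho -> finite_set (ends rho).
Proof.
move=> r0; apply: sub_finite_set (finite_image ( *:%R rho) (traj_finite hMS cM cv cw)).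
move=> x ex; exists (rho^-1 *: x); last by rewrite scalerA divff ?scale1r // gt_eqF.
have [nx Wx] := ex; split.
  by rewrite nsqZ nx exprVn mulVf // expf_neq0 // gt_eqF.
have E : rho^-1 = expR (- ln rho) by rewrite expRN lnK ?posrE.
by rewrite E; apply: ends_Wplus; rewrite -lv_flow; apply/(lift_Wplus_flow hMS ft).
Qed.

Lemma incidence_neq0 : incidence pi Phi Phit O vt wt != 0 -> exists x, ends 1 x.
Proof.
rewrite (incidence_ends ltr01); apply: contraNP => N; apply/eqP; apply: fsbig1 => x ex.
by exfalso; apply: N; exists x.
Qed.
End Pair.

(** Directions of orbits to some point of index [m] are finite in number already on [M], and a
    direction determines the end point of its lift. *)
Lemma endpoints_finite (vt : Mt) m : cip h (pi vt) m.+1 ->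
  finite_set [set wt : cov_crit pi h m | exists x : 'rV[R]_m.+1, ends vt (val wt) 1 x].
Proof.
move=> cv; set W := [set wt | _].
have [[w0 W0]|N] := pselect (exists w0, W w0); last first.
  by rewrite (_ : W = set0); [exact: finite_set0|apply/seteqP; split=> // w Ww; apply: N; exists w].
pose A : set 'rV[R]_m.+1 := \bigcup_(w in crit_index h m) [set x | nsq x = 1 /\ Wplus Phi w (ph h Phi (pi vt) x)].
have fA : finite_set A.
  apply: bigcup_finite; first by apply: sub_finite_set (crit_finite hMS cM) => w [].
  by move=> w cw; exact: (traj_finite hMS cM cv cw).
pose e (x : 'rV[R]_m.+1) : cov_crit pi h m := xget w0 [set wt | Wplus Phit (val wt) (@liftc vt m.+1 x)].
apply: sub_finite_set (finite_image e fA) => wt [x [nx Wx]]; exists x.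
  exists (pi (val wt)); first exact: (set_mem (valP wt)).
  by rewrite expr1n in nx; split=> //; exact: ends_Wplus.
rewrite /e; case: xgetP => [wt' -> /= Wx'|/(_ wt)//].
by apply: val_inj; exact: (lift_Wplus_unique Wx' Wx).
Qed.

Section Square.
Variables (vt ut : Mt) (q : nat).
Hypotheses (cv : cip h (pi vt) q.+2) (cu : cip h (pi ut) q).
Let C := cov_crit pi h q.+1.
Let cC (w : C) : cip h (pi (val w)) q.+1. Proof. exact: (set_mem (valP w)). Qed.

Let radius_data (w : M) : exists d : R, cip h w q.+1 -> 0 < d /\
  forall wt, pi wt = w -> exists sg, chart_section pi h Phi w wt d sg.
Proof.
have [cw|N] := pselect (cip h w q.+1); last by exists 0.
by have [d d0 H] := chart_section_ex hMS ft cw; exists d.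
Qed.

Let dw w := sval (cid (radius_data w)).
Let dwP w : cip h w q.+1 -> 0 < dw w /\ forall wt, pi wt = w -> exists sg, chart_section pi h Phi w wt (dw w) sg.
Proof. exact: (svalP (cid (radius_data w))). Qed.
(** The first bound keeps the sphere in the chart, as the gluing requires; the second keeps it in
    the domain of the local section, as the labels require. *)
Let rho w : R := Num.min (rr h Phi w / 2) (dw w / 2).

Let rho0 w : cip h w q.+1 -> 0 < rho w.
Proof.
by move=> cw; rewrite /rho lt_min !divr_gt0 //; [case: (dwP cw)|exact: hc_r (cip_hyp hMS cw)].
Qed.

Let rhoP w : cip h w q.+1 -> 0 < rho w /\ rho w ^+ 2 <= rr h Phi w ^+ 2 / 4.
Proof.
move=> cw; have r0 := rho0 cw; split=> //.
have -> : rr h Phi w ^+ 2 / 4 = (rr h Phi w / 2) ^+ 2 by field.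
have rr0 := hc_r (cip_hyp hMS cw).
by rewrite ler_pXn2r ?nnegrE ?(ltW r0) ?divr_ge0 ?(ltW rr0) // ge_min lexx.
Qed.

Let rhod w : cip h w q.+1 -> 4 * rho w ^+ 2 <= dw w ^+ 2.
Proof.
move=> cw; have r0 := rho0 cw; have [d0 _] := dwP cw.
have H : rho w <= dw w / 2 by rewrite ge_min lexx orbT.
have H2 : rho w ^+ 2 <= (dw w / 2) ^+ 2 by rewrite ler_pXn2r ?nnegrE ?(ltW r0) ?divr_ge0 ?(ltW d0).
have E : (dw w / 2) ^+ 2 = dw w ^+ 2 / 4 by field.
by rewrite E in H2; lra.
Qed.

Let lab x := Wplus Phit ut (@liftc vt q.+2 x).
(** The intermediate lift is determined by the first half and is shared by both halves; this is the
    continuity of the broken orbit in the covering. *)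
Let Lend w x y := exists wt : Mt, [/\ pi wt = w, Wplus Phit wt (@liftc vt q.+2 x) & Wplus Phit ut (@liftc wt q.+1 y)].

Let labP x : N0 h Phi (pi vt) (pi ut) x ->
  \forall y \near x, N0 h Phi (pi vt) (pi ut) y -> (lab y <-> lab x).
Proof.
move=> [_ Wx]; rewrite /lab liftcE; set l := lift hMS ft cv.
have cl : {for x, continuous l} by exact: lift_continuous.
have W' : Wplus Phi (pi ut) (pi (l x)) by rewrite liftE.
have H := near_cont (P := fun z => Wplus Phi (pi ut) (pi z) -> (Wplus Phit ut z <-> Wplus Phit ut (l x))) cl
  (stable_locally_constant hMS ft cu W').
by apply: filterS H => y Hy [_ Wy]; apply: Hy; rewrite liftE.
Qed.

Let labE w x1 y1 : is_end h Phi (pi vt) (pi ut) rho w x1 y1 -> exists2 d : R, 0 < d & forall y (s : R) x,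
  N0 h Phi (pi vt) (pi ut) y -> `|y - x1| < d -> 0 < s < d -> `|x - y1| < d -> st1 h Phi (pi vt) w x1 y = s *: x ->
  (lab y <-> Lend w x1 y1).
Proof.
move=> [cw [nx Wx] [ny Wy]]; have [w0 w0E] := proj_surj pi w.
have cw0 : cip h (pi w0) q.+1 by rewrite w0E.
have [wt wtE Wt] : exists2 wt, pi wt = w & Wplus Phit wt (@liftc vt q.+2 x1).
  have H : Wplus Phi (pi w0) (pi (@liftc vt q.+2 x1)) by rewrite liftcE liftE w0E.
  by have [wt wtE Wt] := stable_end hMS ft cw0 H; exists wt => //; rewrite wtE.
have [d0 Hd] := dwP cw; have [sg sgP] := Hd wt wtE; have rd := rhod cw.
rewrite -{}ny in rd; move: wtE cw sgP Wx Wy d0 rd => <- cw sgP Wx Wy d0 rd.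
have Wt' := Wt; rewrite liftcE in Wt'.
have [e e0 He] := @end_label R n Mt M G pi h X Phi Phit hMS ft vt wt ut q.+2 q.+1 q cv cw cu (dw (pi wt)) sg d0 sgP x1 y1 Wt' Wy rd; exists e => // y s x [_ N0y] h1 h2 h3 h4.
have := He y s x N0y h1 h2 h3 h4; rewrite /lab liftcE => ->; split=> [H|[wt' [_ W1 W2]]].
  by exists wt; split=> //; rewrite liftcE.
by move: W2; rewrite (lift_Wplus_unique W1 Wt) liftcE.
Qed.

Let Ends : set (C * 'rV[R]_q.+2 * 'rV[R]_q.+1) :=
  [set z | ends vt (val z.1.1) 1 z.1.2 /\ ends (val z.1.1) ut (rho (pi (val z.1.1))) z.2].
Let Wf : set C := [set wt : C | exists x : 'rV[R]_q.+2, ends vt (val wt) 1 x].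
Let fWf : finite_set Wf. Proof. exact: (endpoints_finite cv). Qed.
Let Xf : set 'rV[R]_q.+2 := \bigcup_(wt in Wf) ends vt (val wt) 1.
Let Yf : set 'rV[R]_q.+1 := \bigcup_(wt in Wf) ends (val wt) ut (rho (pi (val wt))).
Let fXf : finite_set Xf. Proof. by apply: bigcup_finite => // wt _; exact: (ends_finite cv (cC wt) ltr01). Qed.
Let fYf : finite_set Yf. Proof. by apply: bigcup_finite => // wt _; exact: (ends_finite (cC wt) cu (rho0 (cC wt))). Qed.

Let EndsS : Ends `<=` (Wf `*` Xf) `*` Yf.
Proof.
move=> [[wt x] y] [/= e1 e2]; have Wwt : Wf wt by exists x.
by split=> /=; [split=> //=; exists wt|exists wt].
Qed.

Let fEnds : finite_set Ends.
Proof. by apply: sub_finite_set EndsS _; apply: finite_setX => //; exact: finite_setX. Qed.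

Let a1 (z : C * 'rV[R]_q.+2 * 'rV[R]_q.+1) := adet z.1.2 (Jw h Phi (pi vt) (pi (val z.1.1)) q.+1 z.1.2).
Let a2 (z : C * 'rV[R]_q.+2 * 'rV[R]_q.+1) := adet z.2 (Jw h Phi (pi (val z.1.1)) (pi ut) q z.2).

Let b1 z : bool := 0 < a1 z.
Let b2 z : bool := 0 < a2 z.

Let adet_ends vt' wt' m (x : 'rV[R]_m.+1) (r : R) (cv' : cip h (pi vt') m.+1) (cw' : cip h (pi wt') m) : 0 < r ->
  ends vt' wt' r x -> adet x (Jw h Phi (pi vt') (pi wt') m x) != 0.
Proof.
move=> r0 ex; have Wx := ends_Wplus cv' ex.2; have g1 := gTP hMS cw' Wx; have JE := JwE hMS cv' cw' g1 Wx.
apply: adet_neq0; [rewrite JE; exact: (Jst_full hMS cv' cw' g1 Wx)|exact: (ends_neq0 r0 ex)|rewrite JE; exact: (Jst_ray hMS cv' cw' g1 Wx)].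
Qed.

(** Each term is the sign of an end, and by [glue_ends] there are as many positive as negative ends,
    the sign never being zero. *)
Let cancel : \sum_(z \in Ends) pm1 (b1 z) * pm1 (b2 z) = 0.
Proof.
rewrite fsbig_finite // big_seq_fsetE /=; set E := fset_set Ends.
have EP (i : E) : Ends (val i) by have := valP i; rewrite in_fset_set // => /set_mem.
pose ew (i : E) := pi (val (val i).1.1); pose ex (i : E) := (val i).1.2; pose ey (i : E) := (val i).2.
have H1 (i : E) : is_end h Phi (pi vt) (pi ut) rho (ew i) (ex i) (ey i) /\ Lend (ew i) (ex i) (ey i).
  have [[n1 W1] [n2 W2]] := EP i; rewrite expr1n in n1; split.
    split; [exact: cC|split; [exact: n1|exact: (ends_Wplus cv)]|split; [exact: n2|exact: (ends_Wplus (cC _))]].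
  by exists (val (val i).1.1).
have H2 (i j : E) : ew i = ew j -> ex i = ex j -> ey i = ey j -> i = j.
  move=> _ xE yE; have [[_ W1] _] := EP i; have [[_ W2] _] := EP j; apply: val_inj.
  have W2' : Wplus Phit (val (val j).1.1) (@liftc vt q.+2 (val i).1.2) by have := xE; rewrite /ex => ->.
  have wE := val_inj (lift_Wplus_unique W1 W2').
  move: wE xE yE; rewrite /ex /ey; case: (val i) => [[? ?] ?]; case: (val j) => [[? ?] ?] /=.
  by move=> -> -> ->.
have H3 w x y : is_end h Phi (pi vt) (pi ut) rho w x y -> Lend w x y -> exists i : E, [/\ ew i = w, ex i = x & ey i = y].
  move=> [cw [nx Wx] [ny Wy]] [wt [wtE W1 W2]].
  have wC : wt \in cov_crit pi h q.+1 by apply/mem_set; rewrite /cov_crit /= wtE.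
  pose z : C * 'rV[R]_q.+2 * 'rV[R]_q.+1 := (exist _ wt wC, x, y).
  have zE : z \in E.
    have Ez : Ends z.
      split; [split; [by rewrite expr1n|exact: W1]|split; [rewrite /= wtE; exact: ny|exact: W2]].
    by rewrite in_fset_set //; exact: mem_set.
  by exists [` zE]%fset; split=> //=; rewrite /ew /=.
have GE := glue_ends hMS cM cv cu rhoP labP labE H1 H2 H3.
pose sg (i : E) : R := end_sign h Phi (pi vt) (pi ut) ew ex ey i.
have sgE i : sg i = a1 (val i) * a2 (val i) by [].
have sg0 i : sg i != 0.
  have [e1 e2] := EP i; rewrite sgE mulf_neq0 //; [exact: (adet_ends cv (cC _) ltr01 e1)|exact: (adet_ends (cC _) cu (rho0 (cC _)) e2)].
have S i : pm1 (b1 (val i)) * pm1 (b2 (val i)) = pm1 (0 < sg i).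
  have [e1 e2] := EP i; have d1 := adet_ends cv (cC _) ltr01 e1; have d2 := adet_ends (cC _) cu (rho0 (cC _)) e2.
  rewrite sgE -pm1_eq /b1 /b2; congr pm1.
  have [p1|p1|/esym/eqP] := ltrgtP 0 (a1 (val i)); last by rewrite (negbTE d1).
    by rewrite pmulr_rgt0 //; case: (0 < _).
  by rewrite nmulr_rgt0 // ltNge le_eqVlt eq_sym (negbTE d2) /=; case: (_ < 0).
rewrite (eq_bigr _ (fun i _ => S i)) (bigID (fun i => 0 < sg i)) /=.
rewrite (eq_bigr (fun=> 1)) => [|i ->//]; rewrite [X in _ + X](eq_bigr (fun=> -1)) => [|i /negbTE ->//].
have c1 (Q : pred E) : \sum_(i | Q i) (1 : int) = #|[pred i | Q i]|%:R by rewrite -sum1_card natr_sum.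
rewrite sumrN !c1 (_ : #|[pred i | ~~ (0 < sg i)]| = #|[pred i | sg i < 0]|).
  by rewrite -GE subrr.
by apply: eq_card => i; rewrite !inE -leNgt le_eqVlt (negbTE (sg0 i)).
Qed.

(** The products of incidence numbers expand into a sum over [Ends], in which the sign of the
    intermediate orientation occurs twice. The signs at [vt] and [ut] factor out and [cancel]
    applies. *)
Lemma incidence_square (W : set C) : finite_set W -> Wf `<=` W ->
  \sum_(wt \in W) incidence pi Phi Phit O (val wt) ut * incidence pi Phi Phit O vt (val wt) = 0.
Proof.
move=> fW WfW.
pose s0 := pm1 (csign Phi O (pi vt)) * pm1 (csign Phi O (pi ut)).
pose F z := s0 * (pm1 (b1 z) * pm1 (b2 z)).
(* Extension by zero replaces the dependent sums, whose ranges vary with the intermediate point, by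
   sums over a product of finite sets. *)
pose F' z : int := if pselect (Ends z) then F z else 0.
have F'0 z : ~ Ends z -> F' z = 0 by rewrite /F'; case: pselect.
have F'1 z : Ends z -> F' z = F z by rewrite /F'; case: pselect.
have step wt : Wf wt -> incidence pi Phi Phit O (val wt) ut * incidence pi Phi Phit O vt (val wt) =
    \sum_(x \in Xf) \sum_(y \in Yf) F' (wt, x, y).
  move=> Wwt; rewrite (incidence_ends cv (cC wt) ltr01) (incidence_ends (cC wt) cu (rho0 (cC wt))).
  have f1 := ends_finite cv (cC wt) ltr01; have f2 := ends_finite (cC wt) cu (rho0 (cC wt)).
  rewrite mulrC [X in X * _]fsbig_finite // [X in _ * X]fsbig_finite // big_distrlr /= -fsbig_finite //.
  rewrite -[RHS](@fsbig_widen _ _ _ _ (ends vt (val wt) 1) Xf) /=; first last.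
  - move=> x [Xx Nx] /=; apply: fsbig1 => y _; apply: F'0 => -[e1 _]; apply: Nx; exact: e1.
  - by move=> x ex; exists wt.
  apply: eq_fsbigr => x /set_mem ex; rewrite -fsbig_finite //.
  rewrite -[RHS](@fsbig_widen _ _ _ _ (ends (val wt) ut (rho (pi (val wt)))) Yf) /=; first last.
  - move=> y [Yy Ny] /=; apply: F'0 => -[_ e2]; apply: Ny; exact: e2.
  - by move=> y ey; exists wt.
  apply: eq_fsbigr => y /set_mem ey; rewrite F'1; last by split.
  rewrite /F /s0 -[RHS]mul1r -(pm1_sqr (csign Phi O (pi (val wt)))) /b1 /b2 /a1 /a2 /=.
  exact: mul_shuffle.
rewrite -(@fsbig_widen _ _ _ _ Wf W) //; last first.
  move=> wt [_ NW] /=; have [->|I0] := eqVneq (incidence pi Phi Phit O vt (val wt)) 0; first by rewrite mulr0.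
  by case: NW; exact: (incidence_neq0 cv (cC wt) I0).
transitivity (\sum_(wt \in Wf) \sum_(x \in Xf) \sum_(y \in Yf) F' (wt, x, y)).
  by apply: eq_fsbigr => wt /set_mem; exact: step.
transitivity (\sum_(wt \in Wf) \sum_(p \in Xf `*` Yf) F' (wt, p.1, p.2)).
  by apply: eq_fsbigr => wt _; exact: (@pair_fsbig _ _ _ _ _ Xf Yf (fun x y => F' (wt, x, y)) fXf fYf).
rewrite (@pair_fsbig _ _ _ _ _ Wf (Xf `*` Yf) (fun wt p => F' (wt, p.1, p.2)) fWf (finite_setX fXf fYf)).
pose assoc (z : C * 'rV[R]_q.+2 * 'rV[R]_q.+1) := (z.1.1, (z.1.2, z.2)).
have bij : set_bij ((Wf `*` Xf) `*` Yf) (Wf `*` (Xf `*` Yf)) assoc.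
  split=> [[[w x] y] [[/= h1 h2] h3]|[[w x] y] [[w' x'] y'] _ _ [-> -> ->]|[w [x y]] [/= h1 [h2 h3]]] //.
  by exists (w, x, y).
rewrite (reindex_fsbig _ _ _ _ bij) -(@fsbig_widen _ _ _ _ Ends) //; last first.
  by move=> [[w x] y] [_ NE] /=; rewrite /assoc /=; exact: F'0.
transitivity (\sum_(z \in Ends) F z).
  by apply: eq_fsbigr => -[[w x] y] /set_mem Ez; rewrite /assoc /=; exact: F'1.
have := cancel; rewrite !fsbig_finite // => E; rewrite /F -mulr_sumr E mulr0 //.
Qed.
End Square.
End Incidence.

(** * The cochain complex and its invariant subcomplex *)

Section Complex.
Variables (R : realType) (n : nat) (M Mt : manifold R n) (G : groupType) (pi : covering G Mt M).
Variables (h : M -> R) (X : vector_field M) (Phi : R -> M -> M) (Phit : R -> Mt -> Mt).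
Variable O : forall v : M, M -> 'M[R]_(morse_index h v, n) -> bool.
Variables (K : fieldType) (E : vectType K) (rho : representation G E).
Hypothesis cM : closed_manifold M.
Hypothesis hMS : morse_smale h X Phi.
Hypothesis ft : is_flow (lift_vector_field pi X) Phit.
Hypothesis OP : unstable_orientations Phi O.

Let C (q : nat) : Type := cov_crit pi h q.
Let cC q (v : C q) : cip h (pi (val v)) q. Proof. exact: (set_mem (valP v)). Qed.
Let I (v w : Mt) : int := incidence pi Phi Phit O v w.
Let delta q (f : cochain pi h E q) : cochain pi h E q.+1 := coboundary Phi Phit O f.

Definition neighbours q (v : cov_crit pi h q.+1) : set (cov_crit pi h q) :=
  [set w : cov_crit pi h q | exists x : 'rV[R]_q.+1, ends hMS ft (val v) (val w) 1 x].

Lemma neighbours_finite q (v : cov_crit pi h q.+1) : finite_set (neighbours v).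
Proof. exact: (endpoints_finite hMS cM ft (cC v)). Qed.

Lemma incidence_far q (v : cov_crit pi h q.+1) (w : cov_crit pi h q) : ~ neighbours v w -> I (val v) (val w) = 0.
Proof.
move=> N; apply/eqP; apply: contrapT => /negP H; apply: N.
exact: (incidence_neq0 hMS cM ft OP (cC v) (cC w) H).
Qed.

(** The sum over all critical points has its support in [neighbours v]. Freedom in [W] allows one
    finite set to serve all intermediate points when two coboundaries are composed. *)
Lemma coboundaryE q (f : cochain pi h E q) (v : cov_crit pi h q.+1) (W : set (cov_crit pi h q)) :
  finite_set W -> neighbours v `<=` W ->
  delta f v = \sum_(w <- fset_set W) f w *~ I (val v) (val w).
Proof.
move=> fW nW; rewrite -fsbig_finite //; apply: esym; apply: (@fsbig_widen _ _ _ _ W setT) => //.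
move=> w [_ Nw] /=; have -> : I (val v) (val w) = 0 by apply: incidence_far => /nW.
by rewrite mulr0z.
Qed.

Lemma coboundary_linear q : linear (@delta q).
Proof.
move=> a f f'; apply/funext => v.
have fN := neighbours_finite v.
rewrite [LHS](coboundaryE _ fN) //.
transitivity (a *: delta f v + delta f' v); last by [].
rewrite !(coboundaryE _ fN) // scaler_sumr -big_split /=; apply: eq_bigr => w _.
have -> : (a *: f + f') w = a *: f w + f' w by [].
by rewrite mulrzDl; congr (_ + _); exact: esym (raddfMz ( *:%R a) _ _).
Qed.

Lemma coboundary_square q (f : cochain pi h E q) : delta (delta f) = 0.
Proof.
apply/funext => v; have fN := neighbours_finite v.
rewrite (coboundaryE _ fN) //; set W := neighbours v in fN *.
pose Y : set (cov_crit pi h q) := \bigcup_(w in W) neighbours w.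
have fY : finite_set Y by apply: bigcup_finite => // w _; exact: neighbours_finite.
rewrite (eq_big_seq (fun w => \sum_(u <- fset_set Y) f u *~ (I (val w) (val u) * I (val v) (val w)))); last first.
  move=> w; rewrite in_fset_set // => /set_mem Ww; rewrite (coboundaryE f fY); last by move=> u Nu; exists w.
  by rewrite mulrz_suml; apply: eq_bigr => u _; rewrite mulrzA.
rewrite exchange_big /=; rewrite big1 // => u _.
rewrite -mulrz_sumr -fsbig_finite // (_ : \sum_(w \in W) _ = 0) ?mulr0z //.
exact: (incidence_square cM OP (cC v) (cC u) fN (@subset_refl _ W)).
Qed.

(** A deck transformation commutes with the lifted flow, so it maps trajectories bijectively to
    trajectories with the same projection, and [epsilon] sees only the projection. *)
Lemma incidence_deck g v w : I (deck pi g v) (deck pi g w) = I v w.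
Proof.
have orb z : deck pi g @` flow_orbit Phit z = flow_orbit Phit (deck pi g z).
  apply/seteqP; split=> y; first by move=> [x [t _ <-] <-]; exists t => //; rewrite (deck_flow hMS ft).
  by move=> [t _ <-]; exists (Phit t z); [exists t|rewrite (deck_flow hMS ft)].
have BIJ : set_bij (trajectories Phit v w) (trajectories Phit (deck pi g v) (deck pi g w)) (fun c => deck pi g @` c); last first.
  apply: (etrans (reindex_fsbig _ _ _ _ BIJ)); apply: eq_fsbigr => c _; rewrite !proj_deck; congr (epsilon _ _ _ _ _).
  by rewrite image_comp; apply: eq_imagel => x _ /=; rewrite proj_deck.
have dK x : deck pi g^-1%g (deck pi g x) = x by rewrite -deckM mulVg deck1.
have dKV x : deck pi g (deck pi g^-1%g x) = x by rewrite -deckM mulgV deck1.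
split.
- move=> c [z [Wz Wz'] <-]; rewrite orb; exists (deck pi g z) => //; split.
    exact: (lift_Wminus_deck hMS ft).
  exact: (lift_Wplus_deck hMS ft).
- move=> c c' _ _ E'; have inj (A : set Mt) : deck pi g^-1%g @` (deck pi g @` A) = A.
    by rewrite image_comp (_ : _ \o _ = id) ?image_id //; apply/funext => x /=.
  by rewrite -(inj c) E' inj.
move=> c [z [Wz Wz'] <-]; exists (flow_orbit Phit (deck pi g^-1%g z)); last by rewrite orb dKV.
exists (deck pi g^-1%g z) => //; split.
  by rewrite -(dK v); exact: (lift_Wminus_deck hMS ft).
by rewrite -(dK w); exact: (lift_Wplus_deck hMS ft).
Qed.

Lemma end_mulz (a : 'End(E)) x (z : int) : a (x *~ z) = a x *~ z.
Proof. exact: raddfMz. Qed.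

Let act q g (f : cochain pi h E q) : cochain pi h E q := cochain_act rho g f.

Lemma act_linear q g : linear (@act q g).
Proof. move=> a f f'; apply/funext => v.
exact: (linearP (rho g) a (f (deck_crit g^-1%g v)) (f' (deck_crit g^-1%g v))). Qed.

Lemma act1 q f : @act q 1%g f = f.
Proof.
apply/funext => v; rewrite /act /cochain_act rep1 id_lfunE; congr f.
by apply: val_inj; rewrite /= invg1 deck1.
Qed.

Lemma actM q g g' f : @act q (g * g')%g f = act g (act g' f).
Proof.
apply/funext => v; rewrite /act /cochain_act repM comp_lfunE; congr (rho g (rho g' (f _))).
by apply: val_inj; rewrite /= invgM deckM.
Qed.

Lemma deck_crit_bij q g : bijective (fun w : cov_crit pi h q => deck_crit g w).
Proof.
exists (fun w => deck_crit g^-1%g w) => w; apply: val_inj => /=; rewrite -deckM.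
  by rewrite mulVg deck1.
by rewrite mulgV deck1.
Qed.

Lemma coboundary_act q g f : delta (@act q g f) = act g (delta f).
Proof.
apply/funext => v; rewrite {2}/act /cochain_act; set v' := deck_crit g^-1%g v.
have RE : act g (delta f) v = \sum_(w \in neighbours v') rho g (f w *~ I (val v') (val w)).
  rewrite fsbig_finite; last exact: neighbours_finite.
  by rewrite /act /cochain_act -/v' (coboundaryE f (neighbours_finite v')) // linear_sum.
rewrite -/v' in RE; apply: etrans _ (esym RE).
rewrite (@fsbig_widen _ _ _ _ (neighbours v') setT) //; last first.
  move=> w [_ Nw] /=; have E0 : I (val v') (val w) = 0 by apply: incidence_far; exact: Nw.
  by rewrite E0 mulr0z linear0.
rewrite (reindex_fsbig (fun w => deck_crit g^-1%g w) setT); last first.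
  have [k K1 K2] := deck_crit_bij q g^-1%g; split=> //; first by move=> x y _ _ /(can_inj K1).
  by move=> w _; exists (k w).
apply: eq_fsbigr => w _.
have -> : I (val v') (val (deck_crit g^-1%g w)) = I (val v) (val w) by exact: incidence_deck.
exact: esym (end_mulz _ _ _).
Qed.

Let Inv q : set (cochain pi h E q) := @invariant_cochain G R n Mt M pi h K E rho q.

(** An invariant cochain is determined by its values on one chosen lift of each critical point of
    [M], of which there are finitely many. The generator for a critical point and a basis vector of
    [E] is the equivariant extension of that vector along the fibre. *)
Lemma invariant_basis q : exists (d : nat) (b : 'I_d -> cochain pi h E q), (forall i, Inv (b i)) /\
  forall f, Inv f -> exists a : 'I_d -> K, f = \sum_(i < d) a i *: b i.
Proof.
have fF : finite_set (crit_index h q) by apply: sub_finite_set (crit_finite hMS cM) => w [].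
set F := fset_set (crit_index h q).
have inF (v : cov_crit pi h q) : pi (val v) \in F by rewrite in_fset_set //; apply/mem_set; exact: (set_mem (valP v)).
pose rep (w : M) : Mt := sval (cid (proj_surj pi w)).
have repE w : pi (rep w) = w by exact: svalP (cid (proj_surj pi w)).
have gex (v : Mt) : exists g, v = deck pi g (rep (pi v)) by apply: fiber_deck; rewrite repE.
pose gv v := sval (cid (gex v)); have gvE v : v = deck pi (gv v) (rep (pi v)) := svalP (cid (gex v)).
(* Freeness makes the element that moves the chosen lift to [v] unique, hence equivariant in [v];
   this is what makes the generators invariant. *)
have gvM g v : gv (deck pi g v) = (g * gv v)%g.
  have H := gvE (deck pi g v); rewrite proj_deck {1}(gvE v) -deckM in H.
  have H2 : deck pi ((gv (deck pi g v))^-1 * (g * gv v))%g (rep (pi v)) = rep (pi v).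
    by rewrite deckM H -deckM mulVg deck1.
  by rewrite -[LHS]mulg1 -(deck_free H2) mulgA mulgV mul1g.
pose m := \dim {:E}; pose B := vbasis {:E}.
pose b' (z : F * 'I_m) : cochain pi h E q := fun v => if pi (val v) == val z.1 then rho (gv (val v)) B`_z.2 else 0.
exists #|{: F * 'I_m}|, (fun i => b' (enum_val i)); split.
  move=> i g; apply/funext => v; rewrite /cochain_act /b' /= proj_deck; case: ifP => _; last by rewrite linear0.
  by rewrite gvM -comp_lfunE -repM mulgA mulgV mul1g.
move=> f If.
have rC (z : F * 'I_m) : rep (val z.1) \in cov_crit pi h q.
  by apply/mem_set; rewrite /cov_crit /= repE; have := valP z.1; rewrite in_fset_set // => /set_mem.
pose a' (z : F * 'I_m) : K := coord B z.2 (f (exist _ (rep (val z.1)) (rC z))).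
exists (fun i => a' (enum_val i)); apply/funext => v.
have -> : (\sum_(i < #|{: F * 'I_m}|) a' (enum_val i) *: b' (enum_val i)) = \sum_(z : F * 'I_m) a' z *: b' z.
  by rewrite (reindex (@enum_val (F * 'I_m)%type predT)) //; exact: (onW_bij _ (enum_val_bij (F * 'I_m)%type)).
have ev (s : seq (F * 'I_m)) : (\sum_(z <- s) a' z *: b' z) v = \sum_(z <- s) a' z *: b' z v.
  by elim: s => [|z s IH]; rewrite ?big_nil // !big_cons -IH.
rewrite ev; transitivity (\sum_(x : F) \sum_(j : 'I_m) a' (x, j) *: b' (x, j) v); last first.
  by rewrite pair_bigA /=; apply: eq_bigr => -[x j] _.
rewrite (bigD1 [` inF v]%fset) //= [X in _ + X]big1 ?addr0; last first.
  move=> x xv; apply: big1 => j _; rewrite /b' /= ifN ?scaler0 //.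
  by apply: contraNneq xv => E'; apply/eqP/val_inj.
set r0 := deck_crit (gv (val v))^-1%g v.
have r0E : rep (pi (val v)) = val r0.
  apply: esym; rewrite /r0 /=; apply: (etrans (congr1 (deck pi (gv (val v))^-1%g) (gvE (val v)))).
  by rewrite -deckM mulVg deck1.
have aE j : a' ([` inF v]%fset, j) = coord B j (f r0).
  by rewrite /a'; congr (coord B j (f _)); apply: val_inj; exact: r0E.
have fE : f v = rho (gv (val v)) (f r0).
  by have := congr1 (fun k => k v) (If (gv (val v))) => /= <-.
rewrite fE {1}(coord_vbasis (memvf (f r0))) linear_sum; apply: eq_bigr => j _.
by rewrite aE /b' /= eqxx linearZ.
Qed.
End Complex.

Theorem proposition5p6 (R : realType) (n : nat) (M Mt : manifold R n)
    (G : groupType) (pi : covering G Mt M)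
    (h : M -> R) (X : vector_field M)
    (Phi : R -> M -> M) (Phit : R -> Mt -> Mt)
    (O : forall v : M, M -> 'M[R]_(morse_index h v, n) -> bool)
    (k : scalars) (E : vectType (base_field R k)) (rho : representation G E)
    (M_closed : closed_manifold M)
    (G_countable : countable [set: G]%classic)
    (hX_morse_smale : morse_smale h X Phi)
    (Phit_flow : is_flow (lift_vector_field pi X) Phit)
    (O_orientations : unstable_orientations Phi O) :
  cochain_complex_of_reps
    (fun q => @cochain_act G R n Mt M pi h _ E rho q)
    (fun q => @coboundary G R n Mt M pi h Phi Phit O _ E q) /\
  finite_dim_subcomplex
    (fun q => @coboundary G R n Mt M pi h Phi Phit O _ E q)
    (fun q => @invariant_cochain G R n Mt M pi h _ E rho q).
Proof.
split.
  split.
  - by move=> q; eapply coboundary_linear; eassumption.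
  - by move=> q f; eapply coboundary_square; eassumption.
  - exact: act_linear.
  - by move=> q; split; [exact: act1|exact: actM].
  exact: (coboundary_act rho M_closed hX_morse_smale Phit_flow O_orientations).
move=> q; split.
- by move=> g; apply/funext => v; rewrite /cochain_act linear0.
- by move=> a f f' If If' g; rewrite act_linear If If'.
- move=> f If g.
  by rewrite -(coboundary_act rho M_closed hX_morse_smale Phit_flow O_orientations) If.
exact: (invariant_basis pi rho M_closed hX_morse_smale q).
Qed.
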